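(* For any $\xi\in(0,1/2)$ there is a constant $C=C(\xi)$ such that the following holds. Let $E:[-\ell,\ell]\times\mathbb{R}\to\mathbb{R}$ be a $C^{0,\alpha}$ function supported on the strip $[-\ell,\ell]\times[-2\pi,2\pi]$ with $\|E\|_{0,\alpha}\le\beta$ and satisfying the orthogonality conditions $$\int_{-\ell}^{\ell}E(s,z)\cosh^{-1}(s)\,ds=\int_{-\ell}^{\ell}E(s,z)\tanh(s)\,ds=0\qquad\text{for all }z\in\mathbb{R}.$$ Then there is a unique locally $C^{2,\alpha}$ function $u:[-\ell,\ell]\times\mathbb{R}\to\mathbb{R}$ that solves $$u_{ss}+u_{zz}+2\cosh^{-2}(s)\,u=E,$$ satisfies the same orthogonality conditions $$\int_{-\ell}^{\ell}u(s,z)\cosh^{-1}(s)\,ds=\int_{-\ell}^{\ell}u(s,z)\tanh(s)\,ds=0\qquad\text{for all }z\in\mathbb{R},$$ and is such that: (1) the odd part $u^-(s,z):=\frac12(u(s,z)-u(-s,z))$ satisfies $\partial_su^-(\ell,z)\tanh(\ell)-u^-(\ell,z)\tanh'(\ell)=0$ for all $z\in\mathbb{R}$; (2) the even part $u^+(s,z):=\frac12(u(s,z)+u(-s,z))$ satisfies $\partial_su^+(\ell,z)\cosh^{-1}(\ell)-u^+(\ell,z)\left(\cosh^{-1}\right)'(\ell)=0$ for all $z\in\mathbb{R}$. Moreover, $u$ satisfies the weighted estimate $$\|u\|_{2,\alpha}\le C\,\ell^{5/2}\,\beta\left(\frac{1}{1+|z|}\right)^{\xi}.$$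
   Context: Coordinates on $\mathbb{R}^2$ are $(s,z)$; $\alpha\in(0,1)$ is a Hölder exponent; $\cosh^{-1}(s)$ means $1/\cosh(s)$ and $\cosh^{-2}(s)$ means $1/\cosh^2(s)$. For a function $u:\Lambda\to\mathbb{R}$ with $\Lambda\subset\mathbb{R}^2$, $\|u\|_{k,\alpha}$ is the localized Hölder norm, a function of the point $p$: $\|u\|_{k,\alpha}(p):=\|u:C^{k,\alpha}(\Lambda\cap D_p)\|$, where $D_p$ is the unit disk in $\mathbb{R}^2$ centered at $p$. Thus $\|E\|_{0,\alpha}\le\beta$ is meant at every point, and the weighted estimate is meant at every point $p=(s,z)$ of $[-\ell,\ell]\times\mathbb{R}$.
   Formalization: The estimate is proved for all ℓ ≥ ℓ₀ with C depending on ξ, α and an arbitrary ℓ₀ > 0 (a C uniform as ℓ→0 is impossible), and uniqueness is among solutions bounded on the strip (without a growth condition, f(s)cosh(νz) is a counterexample). *)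

(* Defs.v *)
From Stdlib Require Import Reals List.
From Coquelicot Require Import Coquelicot.
Open Scope R_scope.

Definition strip (l : R) (p : R * R) : Prop := - l <= fst p <= l.

Definition dist2 (p q : R * R) : R :=
  sqrt ((fst p - fst q) ^ 2 + (snd p - snd q) ^ 2).

Definition sech (s : R) : R := / cosh s.

(** Directional derivative relative to the domain [L]: the increments [h] are
    restricted to those keeping the point in [L], so that at a boundary point
    of a closed strip the derivative across the boundary is one-sided.  All the
    notions below depend only on the values of [f] on [L]. *)
Definition is_pd (L : R * R -> Prop) (e : R * R) (f : R * R -> R)
    (p : R * R) (d : R) : Prop :=
  let shift h := (fst p + h * fst e, snd p + h * snd e) in
  filterlim (fun h => (f (shift h) - f p) / h)
    (within (fun h => L (shift h)) (locally' 0)) (locally d).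

(** Total version, meaningful only where the derivative exists. *)
Definition pd (L : R * R -> Prop) (e : R * R) (f : R * R -> R) (p : R * R) : R :=
  iota (fun d : R => is_pd L e f p d).

Definition e_s : R * R := (1, 0).
Definition e_z : R * R := (0, 1).

Definition pd_multi (L : R * R -> Prop) (g : nat * nat) (f : R * R -> R) :
    R * R -> R :=
  Nat.iter (fst g) (pd L e_s) (Nat.iter (snd g) (pd L e_z) f).

Fixpoint Ck_on (L : R * R -> Prop) (k : nat) (f : R * R -> R) : Prop :=
  continuous_on L f /\
  match k with
  | O => True
  | S k' =>
      forall e, e = e_s \/ e = e_z ->
        (forall p, L p -> exists d, is_pd L e f p d) /\ Ck_on L k' (pd L e f)
  end.

Definition sup_abs (W : R * R -> Prop) (f : R * R -> R) : Rbar :=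
  Lub_Rbar (fun x => exists p, W p /\ x = Rabs (f p)).

Definition holder_seminorm (W : R * R -> Prop) (a : R) (f : R * R -> R) : Rbar :=
  Lub_Rbar (fun x => exists p q, W p /\ W q /\ p <> q /\
                       x = Rabs (f p - f q) / Rpower (dist2 p q) a).

Definition Rbar_sum (r : list Rbar) : Rbar := fold_right Rbar_plus (Finite 0) r.

Definition multi_indices (m : nat) : list (nat * nat) :=
  map (fun j => ((m - j)%nat, j)) (seq 0 (S m)).

(** [|| f : C^{k,a}(L /\ D_p) ||], normalised as the sum of the suprema of all
    derivatives of order at most [k] and of the [a]-Hoelder seminorms of those
    of order [k].  The value is [p_infty] when one of them is infinite. *)
Definition holder_norm_at (L : R * R -> Prop) (k : nat) (a : R)
    (f : R * R -> R) (p : R * R) : Rbar :=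
  let W q := L q /\ dist2 p q < 1 in
  Rbar_plus
    (Rbar_sum (map (fun g => sup_abs W (pd_multi L g f))
                 (flat_map multi_indices (seq 0 (S k)))))
    (Rbar_sum (map (fun g => holder_seminorm W a (pd_multi L g f))
                 (multi_indices k))).

Definition locally_Cka (L : R * R -> Prop) (k : nat) (a : R)
    (f : R * R -> R) : Prop :=
  Ck_on L k f /\ forall p, L p -> is_finite (holder_norm_at L k a f p).

Definition orthogonality (l : R) (f : R * R -> R) : Prop :=
  forall z,
    is_RInt (fun s => f (s, z) * sech s) (- l) l 0 /\
    is_RInt (fun s => f (s, z) * tanh s) (- l) l 0.

Definition odd_part (u : R * R -> R) (p : R * R) : R :=
  / 2 * (u p - u (- fst p, snd p)).

Definition even_part (u : R * R -> R) (p : R * R) : R :=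
  / 2 * (u p + u (- fst p, snd p)).

Definition boundary_odd (l : R) (u : R * R -> R) : Prop :=
  forall z,
    pd (strip l) e_s (odd_part u) (l, z) * tanh l
    - odd_part u (l, z) * Derive tanh l = 0.

Definition boundary_even (l : R) (u : R * R -> R) : Prop :=
  forall z,
    pd (strip l) e_s (even_part u) (l, z) * sech l
    - even_part u (l, z) * Derive sech l = 0.

Definition solves_pde (l : R) (E u : R * R -> R) : Prop :=
  forall p, strip l p ->
    pd_multi (strip l) (2, 0)%nat u p + pd_multi (strip l) (0, 2)%nat u p
    + 2 * sech (fst p) ^ 2 * u p = E p.

Definition is_solution (l a : R) (E u : R * R -> R) : Prop :=
  locally_Cka (strip l) 2 a u /\ solves_pde l E u /\ orthogonality l u /\
  boundary_odd l u /\ boundary_even l u.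

Definition bounded_on (L : R * R -> Prop) (f : R * R -> R) : Prop :=
  exists M, forall p, L p -> Rabs (f p) <= M.

(* Main.v *)
Require Import Defs.
From Stdlib Require Import Reals List Lra Lia Psatz ClassicalEpsilon.
From Coquelicot Require Import Coquelicot.
Open Scope R_scope.

(** Split [E] and [u] into even and odd parts in [s]; on [0 <= s <= l] each part
    is orthogonal to [om] ([sech], resp. [tanh]), the Jacobi field that generates
    its Robin condition [w_s = kap w].

    - Energy.  On functions of [s] with these conditions the operator
      [- L = - d^2/ds^2 - 2 sech^2] is coercive with constant [1/(4 l^2)].  Hence
      [h z = int_0^l w(s,z)^2 ds] satisfies [h'' >= k^2 h - k^-2 int E^2] with
      [k = 1/(2 l)], and comparison with [exp (- k sqrt (1 + z^2))] yields
      [h <= C l^4 beta^2 exp (- |z|/(2 l))].  Since [(1 + |z|) exp (- |z|/(2 l)) <= 1 + 2 l],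
      [sqrt h <= C l^(5/2) beta (1 + |z|)^(-1/2)], whence every [xi < 1/2].  With [E = 0]
      and [w] bounded the same inequality forces [w = 0], which is uniqueness.

    - Regularity.  Averages of [w] against [t^-2 bump ((x - p)/t)] have [t]-derivatives
      that are averages of [lap w] against derivatives of [Psi], where
      [grad Psi = - (a, b) bump]; integrating in [t] gives the sup, gradient and
      Schauder estimates.  A Robin reflection makes them hold up to the boundary, on
      disks of radius independent of [l].

    - Existence.  Convolving [E] in [z] with trigonometric polynomials
      reduces the problem to ODEs in [s], solved by the substitution
      [psi = phi' - tanh phi], which turns [L - eta^2] into [d^2/ds^2 - eta^2].
      The approximate solutions converge locally by the two previous estimates. *)

(** * Continuity, derivatives and parametric integrals *)

(** Two bounded homogeneous solutions have to be excluded, [tanh s] and [sech s * cos z]: with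
    [L = d^2/ds^2 + 2 sech^2], one has [L tanh = 0] and [L sech = sech]. The Robin conditions are
    those of [tanh] and [sech] themselves, so both are exact eigenfunctions of a self-adjoint
    problem on [[0, l]], and orthogonality on each slice removes precisely them. The rest of the
    spectrum of [L] is negative but approaches 0 like [- l^-2]; decay in [z] therefore has a rate of
    order [1/l] only, and a fixed polynomial weight costs a power of [l]. Homogeneous solutions
    growing exponentially in [z] satisfy all the other conditions, whence the boundedness in the
    uniqueness claim. The constants depend on [l0] because for small [l] the odd Robin coefficient
    [sech^2 l / tanh l] blows up and the disks at the boundary run out of room. The approximate
    sources are periodic in [z], hence wrong for large [|z|]; near a fixed height their error is
    damped by [cosh (k z) / cosh (k n)], so the approximations are Cauchy there and no compactness
    argument is called for. *)

Definition cont1 (f : R -> R) := forall x, continuous f x.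
Definition cont2 (f : R -> R -> R) :=
  forall p : R * R, continuous (fun q : R * R => f (fst q) (snd q)) p.

Section Continuity.
Context {T : UniformSpace}.
Implicit Types (f g : T -> R) (x : T).

Lemma ct_plus f g x :
  continuous f x -> continuous g x -> continuous (fun x => f x + g x) x.
Proof. exact (continuous_plus f g x). Qed.

Lemma ct_opp f x : continuous f x -> continuous (fun x => - f x) x.
Proof. exact (continuous_opp f x). Qed.

Lemma ct_minus f g x :
  continuous f x -> continuous g x -> continuous (fun x => f x - g x) x.
Proof. exact (continuous_minus f g x). Qed.

Lemma ct_mult f g x :
  continuous f x -> continuous g x -> continuous (fun x => f x * g x) x.
Proof. exact (continuous_mult f g x). Qed.

Lemma ct_pow f n x : continuous f x -> continuous (fun x => f x ^ n) x.
Proof.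
  intros H; induction n as [|n IH]; simpl.
  - apply continuous_const.
  - apply ct_mult; assumption.
Qed.

Lemma ct_comp1 (h : R -> R) f x :
  continuous f x -> continuous h (f x) -> continuous (fun x => h (f x)) x.
Proof. intros; apply (continuous_comp f h); assumption. Qed.

Lemma ct_comp2 (h : R -> R -> R) f g x :
  cont2 h -> continuous f x -> continuous g x ->
  continuous (fun x => h (f x) (g x)) x.
Proof.
  intros H Hf Hg.
  apply (continuous_comp_2 f g h x Hf Hg (H (f x, g x))).
Qed.

Lemma ct_inv f x : f x <> 0 -> continuous f x -> continuous (fun x => / f x) x.
Proof.
  intros H Hf; apply (ct_comp1 Rinv); auto.
  apply continuity_pt_filterlim, continuity_pt_inv; auto.
  apply derivable_continuous_pt, derivable_pt_id.
Qed.

Lemma ct_fst {U V : UniformSpace} (f : T -> U * V) x :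
  continuous f x -> continuous (fun x => fst (f x)) x.
Proof. intros H; apply (continuous_comp f fst); auto; apply continuous_fst. Qed.

Lemma ct_snd {U V : UniformSpace} (f : T -> U * V) x :
  continuous f x -> continuous (fun x => snd (f x)) x.
Proof. intros H; apply (continuous_comp f snd); auto; apply continuous_snd. Qed.
End Continuity.

Section DerivativeRules.
Implicit Types (f g : R -> R) (x a b c : R).

Lemma dr_eq f x a b : is_derive f x a -> a = b -> is_derive f x b.
Proof. intros H <-; exact H. Qed.

Lemma dr_const c x : is_derive (fun _ : R => c) x 0.
Proof. exact (is_derive_const (V := R_NormedModule) c x). Qed.

Lemma dr_id x : is_derive (fun x : R => x) x 1.
Proof. exact (is_derive_id x). Qed.

Lemma dr_plus f g x a b :
  is_derive f x a -> is_derive g x b -> is_derive (fun x => f x + g x) x (a + b).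
Proof. exact (is_derive_plus f g x a b). Qed.

Lemma dr_minus f g x a b :
  is_derive f x a -> is_derive g x b -> is_derive (fun x => f x - g x) x (a - b).
Proof. exact (is_derive_minus f g x a b). Qed.

Lemma dr_mult f g x a b :
  is_derive f x a -> is_derive g x b ->
  is_derive (fun x => f x * g x) x (a * g x + f x * b).
Proof. intros Hf Hg; apply (is_derive_mult f g x a b Hf Hg Rmult_comm). Qed.

Lemma dr_scal c f x a : is_derive f x a -> is_derive (fun x => c * f x) x (c * a).
Proof.
  intros H; eapply dr_eq; [apply (dr_mult (fun _ => c) f); [apply dr_const | exact H] | ring].
Qed.

Lemma dr_opp f x a : is_derive f x a -> is_derive (fun x => - f x) x (- a).
Proof. exact (is_derive_opp f x a). Qed.

Lemma dr_comp f g x a b :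
  is_derive f (g x) a -> is_derive g x b -> is_derive (fun x => f (g x)) x (b * a).
Proof. exact (is_derive_comp f g x a b). Qed.
End DerivativeRules.

Lemma ct_der (f : R -> R) x l : is_derive f x l -> continuous f x.
Proof. intros H; apply (ex_derive_continuous (V := R_NormedModule) f x); exists l; exact H. Qed.

Lemma cont1_exp : cont1 exp.
Proof. intros x; apply (ct_der _ _ _ (is_derive_exp x)). Qed.
Lemma cont1_sin : cont1 sin.
Proof. intros x; apply (ct_der _ _ _ (is_derive_sin x)). Qed.
Lemma cont1_cos : cont1 cos.
Proof. intros x; apply (ct_der _ _ _ (is_derive_cos x)). Qed.

Lemma is_derive_cosh' x : is_derive cosh x (sinh x).
Proof. unfold cosh, sinh; auto_derive; auto; unfold sinh; lra. Qed.
Lemma is_derive_sinh' x : is_derive sinh x (cosh x).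
Proof. unfold cosh, sinh; auto_derive; auto; unfold cosh; lra. Qed.
Lemma cosh_pos x : 0 < cosh x.
Proof. unfold cosh; generalize (exp_pos x) (exp_pos (-x)); lra. Qed.

Lemma sech_pos x : 0 < sech x.
Proof. apply Rinv_0_lt_compat, cosh_pos. Qed.

Lemma cosh2_sinh2 x : cosh x * cosh x - sinh x * sinh x = 1.
Proof.
  unfold cosh, sinh.
  assert (H : exp x * exp (- x) = 1)
    by (rewrite <- exp_plus, Rplus_opp_r; apply exp_0).
  nra.
Qed.

Lemma tanh_def x : tanh x = sinh x * sech x.
Proof. reflexivity. Qed.

Lemma cosh_sech x : cosh x * sech x = 1.
Proof. unfold sech; apply Rinv_r; generalize (cosh_pos x); lra. Qed.

Lemma sech2_tanh2 x : sech x * sech x = 1 - tanh x * tanh x.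
Proof.
  rewrite tanh_def.
  generalize (cosh2_sinh2 x) (cosh_sech x); intros H1 H2.
  replace (1 - sinh x * sech x * (sinh x * sech x))
    with ((cosh x * sech x) * (cosh x * sech x)
          - sinh x * sinh x * (sech x * sech x)) by (rewrite H2; ring).
  replace (sinh x * sinh x) with (cosh x * cosh x - 1) by lra. ring.
Qed.

Lemma is_derive_sech x : is_derive sech x (- tanh x * sech x).
Proof.
  unfold sech.
  evar_last. apply is_derive_inv. apply is_derive_cosh'.
  generalize (cosh_pos x); lra.
  rewrite tanh_def; unfold sech; field; generalize (cosh_pos x); lra.
Qed.

Lemma is_derive_tanh x : is_derive tanh x (sech x * sech x).
Proof.
  apply (is_derive_ext (fun t => sinh t * sech t)). reflexivity.
  evar_last.
  apply (is_derive_mult sinh sech x _ _ (is_derive_sinh' x) (is_derive_sech x)).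
  intros; apply Rmult_comm.
  unfold plus, mult; simpl.
  rewrite sech2_tanh2, cosh_sech, tanh_def. ring.
Qed.

Lemma cont1_cosh : cont1 cosh.
Proof. intros x; apply (ct_der _ _ _ (is_derive_cosh' x)). Qed.
Lemma cont1_sinh : cont1 sinh.
Proof. intros x; apply (ct_der _ _ _ (is_derive_sinh' x)). Qed.
Lemma cont1_sech : cont1 sech.
Proof. intros x; apply (ct_der _ _ _ (is_derive_sech x)). Qed.
Lemma cont1_tanh : cont1 tanh.
Proof. intros x; apply (ct_der _ _ _ (is_derive_tanh x)). Qed.

Lemma cont1_Rabs : cont1 Rabs.
Proof. intros x; apply continuous_Rabs. Qed.

Ltac ct1 :=
  match goal with
  | |- cont2 _ => intros ?; cbv beta
  | |- cont1 _ => intros ?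
  | |- continuous (fun _ => ?c) _ => apply continuous_const
  | |- continuous (fun x => x) _ => apply continuous_id
  | H : cont1 ?g |- continuous ?g _ => apply H
  | H : forall x, continuous ?g x |- continuous ?g _ => apply H
  | H : cont2 ?g |- continuous (?g _) _ => apply (ct_comp2 g _ _ _ H)
  | |- continuous (fun x => @?f x + @?g x) _ => apply (ct_plus f g)
  | |- continuous (fun x => @?f x - @?g x) _ => apply (ct_minus f g)
  | |- continuous (fun x => @?f x * @?g x) _ => apply (ct_mult f g)
  | |- continuous (fun x => - @?f x) _ => apply (ct_opp f)
  | |- continuous (fun x => @?f x ^ ?n) _ => apply (ct_pow f n)
  | |- continuous (fun x => fst (@?f x)) _ => apply (ct_fst f)
  | |- continuous (fun x => snd (@?f x)) _ => apply (ct_snd f)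
  | |- continuous (fun x => Rabs (@?f x)) _ =>
      apply (ct_comp1 Rabs f); [|apply continuous_Rabs]
  | |- continuous (fun x => exp (@?f x)) _ =>
      apply (ct_comp1 exp f); [|apply cont1_exp]
  | |- continuous (fun x => cos (@?f x)) _ =>
      apply (ct_comp1 cos f); [|apply cont1_cos]
  | |- continuous (fun x => sin (@?f x)) _ =>
      apply (ct_comp1 sin f); [|apply cont1_sin]
  | |- continuous (fun x => tanh (@?f x)) _ =>
      apply (ct_comp1 tanh f); [|apply cont1_tanh]
  | |- continuous (fun x => sech (@?f x)) _ =>
      apply (ct_comp1 sech f); [|apply cont1_sech]
  | |- continuous (fun x => cosh (@?f x)) _ =>
      apply (ct_comp1 cosh f); [|apply cont1_cosh]
  | |- continuous (fun x => sinh (@?f x)) _ =>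
      apply (ct_comp1 sinh f); [|apply cont1_sinh]
  | H : cont2 ?h |- continuous (fun x => ?h (@?f x) (@?g x)) _ =>
      apply (ct_comp2 h f g _ H)
  | H : cont1 ?h |- continuous (fun x => ?h (@?f x)) _ =>
      apply (ct_comp1 h f); [|apply H]
  | H : forall x, continuous ?h x |- continuous (fun x => ?h (@?f x)) _ =>
      apply (ct_comp1 h f); [|apply H]
  | |- continuous sech _ => apply cont1_sech
  | |- continuous tanh _ => apply cont1_tanh
  | |- continuous cosh _ => apply cont1_cosh
  | |- continuous sinh _ => apply cont1_sinh
  | |- continuous exp _ => apply cont1_exp
  | |- continuous cos _ => apply cont1_cos
  | |- continuous sin _ => apply cont1_sin
  | |- continuous Rabs _ => apply cont1_Rabs
  end.
Ltac ct := repeat ct1; auto.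

Lemma ex_RInt_cont1 f a b : cont1 f -> ex_RInt f a b.
Proof. intros H; apply (@ex_RInt_continuous R_CompleteNormedModule); intros; apply H. Qed.

Lemma RInt_bound (f : R -> R) a b M :
  a <= b -> cont1 f -> (forall t, a <= t <= b -> Rabs (f t) <= M) ->
  Rabs (RInt f a b) <= (b - a) * M.
Proof.
  intros Hab Hf HM.
  eapply Rle_trans; [apply abs_RInt_le; auto; apply ex_RInt_cont1; auto|].
  eapply Rle_trans.
  - apply (RInt_le (fun t => Rabs (f t)) (fun _ => M)); auto.
    + apply ex_RInt_cont1; ct.
    + apply ex_RInt_cont1; ct.
    + intros; apply HM; lra.
  - rewrite RInt_const; apply Req_le; reflexivity.
Qed.

(** Tube lemma: the neighbourhoods given by joint continuity at the points [(u0, t)] have a common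
    radius, since [t] runs in a compact segment. *)
Lemma unif_near {U : UniformSpace} (f : U -> R -> R) (a b : R) (u0 : U) :
  (forall t, continuous (fun q : U * R => f (fst q) (snd q)) (u0, t)) ->
  forall eps : posreal,
  locally u0 (fun u => forall t, a <= t <= b -> Rabs (f u t - f u0 t) < eps).
Proof.
  intros Hc eps.
  assert (He : 0 < eps / 2) by (destruct eps; simpl; lra).
  assert (H : forall t, exists d : posreal, forall u s, ball u0 d u -> Rabs (s - t) < d ->
             Rabs (f u s - f u0 t) < eps / 2).
  { intros t. specialize (Hc t).
    destruct (proj1 (filterlim_locally _ _) Hc (mkposreal _ He)) as [d Hd].
    exists d; intros u s Hu Hs.
    apply (Hd (u, s)). split; auto. }
  assert (H' : forall t, {d : posreal | forall u s, ball u0 d u -> Rabs (s - t) < d ->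
             Rabs (f u s - f u0 t) < eps / 2}).
  { intros t; apply constructive_indefinite_description, H. }
  destruct (compactness_value_1d a b (fun t => proj1_sig (H' t))) as [d Hd].
  exists d; intros u Hu t Ht.
  destruct (NNPP _ (Hd t Ht)) as [s [Hs [Hs1 Hs2]]].
  destruct (H' s) as [ds Hds]; simpl in *.
  assert (A1 := Hds u t (ball_le _ _ _ Hs2 _ Hu) Hs1).
  assert (A2 := Hds u0 t (ball_center _ _) Hs1).
  replace (f u t - f u0 t) with ((f u t - f u0 s) - (f u0 t - f u0 s)) by ring.
  eapply Rle_lt_trans; [apply Rabs_triang|]. rewrite Rabs_Ropp. lra.
Qed.

Lemma ct_RInt {U : UniformSpace} (f : U -> R -> R) (a b : R) (u0 : U) :
  (forall q : U * R, continuous (fun q => f (fst q) (snd q)) q) ->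
  continuous (fun u => RInt (f u) a b) u0.
Proof.
  intros Hc.
  assert (Hf : forall u, cont1 (f u)).
  { intros u t.
    apply (continuous_comp_2 (fun _ : R => u) (fun t : R => t) f t).
    apply continuous_const. apply continuous_id. apply (Hc (u, t)). }
  assert (W : forall a b, a <= b -> continuous (fun u => RInt (f u) a b) u0).
  { clear a b; intros a b Hab.
    apply filterlim_locally; intros eps.
    assert (He : 0 < eps / (b - a + 1)) by (apply Rdiv_lt_0_compat; [apply eps | lra]).
    apply (filter_imp _ _ ) with (2 := unif_near f a b u0 (fun t => Hc (u0, t)) (mkposreal _ He)).
    intros u Hu. simpl in Hu.
    change (Rabs (RInt (f u) a b - RInt (f u0) a b) < eps).
    rewrite <- (RInt_minus (V := R_CompleteNormedModule)); try (apply ex_RInt_cont1, Hf).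
    eapply Rle_lt_trans.
    - apply (RInt_bound _ a b (eps / (b - a + 1))); auto.
      + intros t. apply @continuous_minus; apply Hf.
      + intros t Ht. left. apply (Hu t Ht).
    - assert (0 < eps) by apply eps.
      apply Rmult_lt_reg_r with (b - a + 1); [lra|].
      replace ((b - a) * (eps / (b - a + 1)) * (b - a + 1)) with ((b - a) * eps) by (field; lra).
      nra. }
  destruct (Rle_dec a b) as [H|H]; [apply W; auto|].
  apply continuous_ext with (fun u => - RInt (f u) b a).
  - intros u. apply (opp_RInt_swap (V := R_CompleteNormedModule)). apply ex_RInt_cont1, Hf.
  - apply ct_opp, W; lra.
Qed.

Lemma cont2_pt f x y : cont2 f -> continuity_2d_pt f x y.
Proof. intros H; apply continuity_2d_pt_filterlim, (H (x, y)). Qed.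

Lemma is_derive_RInt_par (f f' : R -> R -> R) a b x :
  (forall x t, is_derive (fun x => f x t) x (f' x t)) ->
  (forall x, cont1 (f x)) -> cont2 f' ->
  is_derive (fun x => RInt (f x) a b) x (RInt (f' x) a b).
Proof.
  intros Hd Hc Hc'.
  assert (E : forall x t, Derive (fun z => f z t) x = f' x t)
    by (intros; apply is_derive_unique, Hd).
  evar_last.
  - apply (is_derive_RInt_param f a b x).
    + apply filter_forall; intros y t _; exists (f' y t); apply Hd.
    + intros t _.
      apply (continuity_2d_pt_ext f'); [intros; symmetry; apply E | apply cont2_pt, Hc'].
    + apply filter_forall; intros y; apply ex_RInt_cont1, Hc.
  - apply RInt_ext; intros t _; apply E.
Qed.

Lemma is_derive_RInt1 f a x : cont1 f -> is_derive (fun x => RInt f a x) x (f x).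
Proof.
  intros H. apply (is_derive_RInt f _ a).
  apply filter_forall; intros; apply (RInt_correct (V := R_CompleteNormedModule)), ex_RInt_cont1, H.
  apply H.
Qed.

(* The derivative is only assumed inside, so that one-sided data at the ends suffice. *)
Lemma RInt_FTC (F G : R -> R) a b :
  a <= b -> (forall x, a < x < b -> is_derive F x (G x)) ->
  cont1 F -> cont1 G -> RInt G a b = F b - F a.
Proof.
  intros Hab HD HF HG.
  destruct (Req_dec a b) as [->|Hn]; [rewrite RInt_point; unfold zero; simpl; lra|].
  assert (W : forall x, a < x < b -> is_derive (fun x => F x - RInt G a x) x 0).
  { intros x Hx. evar_last.
    apply (is_derive_minus F _ x _ _ (HD x Hx) (is_derive_RInt1 G a x HG)).
    unfold minus, plus, opp; simpl; ring. }
  assert (E : F b - RInt G a b = F a - RInt G a a).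
  { destruct (MVT_gen (fun x => F x - RInt G a x) a b (fun _ => 0)) as [c [_ Hc]].
    - intros x Hx; rewrite Rmin_left, Rmax_right in Hx by lra. apply W; lra.
    - intros x _. apply continuity_pt_filterlim.
      apply (ct_minus F); [apply HF | apply (ct_der _ _ _ (is_derive_RInt1 G a x HG))].
    - lra. }
  rewrite RInt_point in E. unfold zero in E; simpl in E. lra.
Qed.

(** As functions of the upper limit [b] both sides vanish at [a] and have the same derivative. *)
Lemma RInt_Fubini (f : R -> R -> R) a b c d :
  cont2 f -> a <= b ->
  RInt (fun s => RInt (fun z => f s z) c d) a b
  = RInt (fun z => RInt (fun s => f s z) a b) c d.
Proof.
  intros Hf Hab.
  assert (HG : cont1 (fun s => RInt (fun z => f s z) c d)).
  { intros s; apply (ct_RInt (fun s z => f s z)). intros; ct. }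
  pose (F := fun x => RInt (fun z => RInt (fun s => f s z) a x) c d).
  assert (HD : forall x, is_derive F x (RInt (fun z => f x z) c d)).
  { intros x; unfold F.
    apply (is_derive_RInt_par (fun x z => RInt (fun s => f s z) a x) f); auto.
    - intros y t; apply (is_derive_RInt1 (fun s => f s t)); ct.
    - intros y t. apply (ct_RInt (fun z s => f s z)). intros; ct. }
  rewrite (RInt_FTC F _ a b Hab); auto.
  - unfold F at 2. rewrite (RInt_ext (V:=R_CompleteNormedModule) _ (fun _ => 0)).
    rewrite RInt_const. unfold F, scal; simpl; unfold mult; simpl. lra.
    intros; apply (RInt_point (V:=R_CompleteNormedModule)).
  - intros x. apply (ct_der _ _ _ (HD x)).
Qed.

(** The mean value theorem for [G - phi] and [G + phi] replaces the integration of [phi'], so that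
    no integrability of [G'] has to be checked when it is a singular power of a scale. *)
Lemma MVT_bound (phi phi' G G' : R -> R) a b :
  a <= b ->
  (forall x, a <= x <= b -> is_derive phi x (phi' x)) ->
  (forall x, a <= x <= b -> is_derive G x (G' x)) ->
  (forall x, a <= x <= b -> Rabs (phi' x) <= G' x) ->
  Rabs (phi b - phi a) <= G b - G a.
Proof.
  intros Hab Hp HG Hb.
  assert (W : forall s, (s = 1 \/ s = -1) -> s * (phi b - phi a) <= G b - G a).
  { intros s Hs.
    destruct (MVT_gen (fun x => G x - s * phi x) a b (fun x => G' x - s * phi' x)) as [c [Hc Hc']].
    - intros x Hx; rewrite Rmin_left, Rmax_right in Hx by lra.
      evar_last. apply (is_derive_minus G (fun x => s * phi x) x).
      apply HG; lra. apply (is_derive_scal phi x s). apply Hp; lra.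
      reflexivity.
    - intros x Hx; rewrite Rmin_left, Rmax_right in Hx by lra.
      apply continuity_pt_filterlim. apply (ct_minus G (fun x => s * phi x)).
      apply (ct_der G _ _ (HG x Hx)). apply (ct_mult (fun _ => s) phi). apply continuous_const.
      apply (ct_der phi _ _ (Hp x Hx)).
    - rewrite Rmin_left, Rmax_right in Hc by lra.
      specialize (Hb c Hc). apply Rabs_le_between in Hb.
      assert (0 <= G' c - s * phi' c) by (destruct Hs; subst; lra).
      nra. }
  apply Rabs_le; split.
  - generalize (W (-1) (or_intror eq_refl)); lra.
  - generalize (W 1 (or_introl eq_refl)); lra.
Qed.

(** * The averaging kernels *)

Definition ppow (n : nat) (x : R) : R := Rmax 0 x ^ n.

Lemma cont1_Rmax0 : cont1 (Rmax 0).
Proof.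
  intros x. apply continuous_ext with (fun x => (x + Rabs x) * / 2).
  - intros y; unfold Rmax, Rabs; destruct (Rle_dec 0 y), (Rcase_abs y); simpl; lra.
  - ct.
Qed.

Lemma is_derive_ppow n x :
  is_derive (ppow (S (S n))) x (INR (S (S n)) * ppow (S n) x).
Proof.
  destruct (Rlt_le_dec 0 x) as [H|H]; [|destruct (Req_dec x 0) as [->|Hx]].
  - apply (is_derive_ext_loc (fun x => x ^ (S (S n)))).
    + exists (mkposreal x H); intros y Hy. unfold ppow. rewrite Rmax_right; auto.
      unfold ball, AbsRing_ball, abs, minus, plus, opp in Hy; simpl in Hy.
      unfold AbsRing_ball, abs, minus, plus, opp in Hy; simpl in Hy.
      apply Rabs_lt_between in Hy; lra.
    + evar_last. apply is_derive_pow. apply is_derive_id.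
      unfold ppow; rewrite Rmax_right by lra. simpl pred. unfold one; simpl. ring.
  - unfold ppow at 2. rewrite Rmax_left by lra. rewrite pow_i by lia. rewrite Rmult_0_r.
    apply is_derive_Reals. intros eps He.
    assert (Hd : 0 < Rmin eps 1) by (apply Rmin_glb_lt; lra).
    exists (mkposreal _ Hd); intros h Hh Hhd; simpl in Hhd.
    unfold ppow. rewrite Rplus_0_l, (Rmax_left 0 0) by lra.
    rewrite (pow_i (S (S n))) by lia.
    replace ((Rmax 0 h ^ S (S n) - 0) / h - 0) with (Rmax 0 h ^ S (S n) / h) by (field; auto).
    assert (Hm : 0 <= Rmax 0 h <= Rabs h).
    { unfold Rmax, Rabs; destruct (Rle_dec 0 h), (Rcase_abs h); lra. }
    assert (Hd1 : Rabs h < eps) by (eapply Rlt_le_trans; [exact Hhd | apply Rmin_l]).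
    assert (Hd2 : Rabs h < 1) by (eapply Rlt_le_trans; [exact Hhd | apply Rmin_r]).
    assert (Hp : 0 < Rabs h) by (apply Rabs_pos_lt; auto).
    unfold Rdiv. rewrite Rabs_mult, Rabs_inv, (Rabs_pos_eq (_ ^ _)) by (apply pow_le; lra).
    apply Rmult_lt_reg_r with (Rabs h); auto.
    rewrite Rmult_assoc, Rinv_l, Rmult_1_r by lra.
    simpl. assert (Rmax 0 h ^ n <= 1).
    { rewrite <- (pow1 n); apply pow_incr; lra. }
    assert (0 <= Rmax 0 h ^ n) by (apply pow_le; lra).
    assert (Rmax 0 h * Rmax 0 h <= Rabs h * Rabs h) by nra.
    assert (Rmax 0 h * (Rmax 0 h * Rmax 0 h ^ n) <= Rabs h * Rabs h) by nra.
    nra.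
  - apply (is_derive_ext_loc (fun _ => 0)).
    + assert (H' : 0 < - x) by lra.
      exists (mkposreal _ H'); intros y Hy. unfold ppow. rewrite Rmax_left; [rewrite pow_i by lia; auto|].
      unfold ball, AbsRing_ball, abs, minus, plus, opp in Hy; simpl in Hy.
      unfold AbsRing_ball, abs, minus, plus, opp in Hy; simpl in Hy.
      apply Rabs_lt_between in Hy; lra.
    + unfold ppow; rewrite Rmax_left by lra. rewrite pow_i by lia. rewrite Rmult_0_r.
      apply (is_derive_const (V := R_NormedModule)).
Qed.

(* [(c, (i, j, n))] stands for [c a^i b^j max(0, 1 - a^2 - b^2)^n]. *)
Definition mono := (R * (nat * nat * nat))%type.

Definition ev1 (m : mono) (a b : R) : R :=
  let '(c, (i, j, n)) := m in c * a ^ i * b ^ j * ppow n (1 - a ^ 2 - b ^ 2).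
Definition ev (l : list mono) (a b : R) : R :=
  fold_right (fun m r => ev1 m a b + r) 0 l.

(** Differentiation acts on the syntax, so that identities between kernels become finitely many
    polynomial computations. The value of [pred] at 0 is harmless: the coefficient contains the
    exponent as a factor and vanishes there. *)
Definition Da (l : list mono) : list mono :=
  flat_map (fun m : mono => let '(c, (i, j, n)) := m in
    (c * INR i, (pred i, j, n)) :: (- 2 * INR n * c, (S i, j, pred n)) :: nil) l.
Definition Db (l : list mono) : list mono :=
  flat_map (fun m : mono => let '(c, (i, j, n)) := m in
    (c * INR j, (i, pred j, n)) :: (- 2 * INR n * c, (i, S j, pred n)) :: nil) l.

(** Power at least 2 of the truncated factor makes the expression differentiable across the unit
    circle; power at least 1 makes it vanish on and outside the circle. *)
Definition min_pow (k : nat) (l : list mono) :=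
  List.Forall (fun m : mono => (k <= snd (snd m))%nat) l.

Lemma min_pow_Da k l : min_pow (S k) l -> min_pow k (Da l).
Proof.
  intros H; induction H as [|[c [[i j] n]] l Hm H IH]; simpl; constructor; simpl in *; try lia.
  constructor; simpl; auto; lia.
Qed.
Lemma min_pow_Db k l : min_pow (S k) l -> min_pow k (Db l).
Proof.
  intros H; induction H as [|[c [[i j] n]] l Hm H IH]; simpl; constructor; simpl in *; try lia.
  constructor; simpl; auto; lia.
Qed.

Lemma cont2_ev l : cont2 (ev l).
Proof.
  assert (H : forall n, cont1 (ppow n)).
  { intros n x. unfold ppow. apply ct_pow, cont1_Rmax0. }
  induction l as [|[c [[i j] n]] l IH].
  - intros p; apply continuous_const.
  - intros p; simpl. apply ct_plus; [|apply IH].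
    specialize (H n); ct.
Qed.

Lemma is_derive_ev_a l a b : min_pow 2 l -> is_derive (fun a => ev l a b) a (ev (Da l) a b).
Proof.
  intros H; induction H as [|[c [[i j] n]] l Hm H IH]; simpl.
  - apply (is_derive_const (V := R_NormedModule)).
  - rewrite <- Rplus_assoc. apply (is_derive_plus (V := R_NormedModule)); auto. simpl in Hm.
    destruct n as [|[|n]]; try lia.
    assert (D1 : is_derive (fun a => c * a ^ i * b ^ j) a (INR i * a ^ pred i * (c * b ^ j)))
      by (auto_derive; auto; ring).
    assert (D2 : is_derive (fun a => 1 - a ^ 2 - b ^ 2) a (- 2 * a))
      by (auto_derive; auto; ring).
    eapply dr_eq.
    + apply (dr_mult _ _ _ _ _ D1 (dr_comp (ppow (S (S n))) _ _ _ _ (is_derive_ppow n _) D2)).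
    + change (pred (S (S n))) with (S n); change (a * (a * 1)) with (a ^ 2); change (b * (b * 1)) with (b ^ 2).
      generalize (ppow (S (S n)) (1 - a ^ 2 - b ^ 2)) (ppow (S n) (1 - a ^ 2 - b ^ 2)).
      generalize (a ^ i) (b ^ j) (a ^ pred i) (b ^ pred j) (INR (S (S n))) (INR i) (INR j).
      intros; ring.
Qed.

Lemma is_derive_ev_b l a b : min_pow 2 l -> is_derive (fun b => ev l a b) b (ev (Db l) a b).
Proof.
  intros H; induction H as [|[c [[i j] n]] l Hm H IH]; simpl.
  - apply (is_derive_const (V := R_NormedModule)).
  - rewrite <- Rplus_assoc. apply (is_derive_plus (V := R_NormedModule)); auto. simpl in Hm.
    destruct n as [|[|n]]; try lia.
    assert (D1 : is_derive (fun b => c * a ^ i * b ^ j) b (INR j * b ^ pred j * (c * a ^ i)))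
      by (auto_derive; auto; ring).
    assert (D2 : is_derive (fun b => 1 - a ^ 2 - b ^ 2) b (- 2 * b))
      by (auto_derive; auto; ring).
    eapply dr_eq.
    + apply (dr_mult _ _ _ _ _ D1 (dr_comp (ppow (S (S n))) _ _ _ _ (is_derive_ppow n _) D2)).
    + change (pred (S (S n))) with (S n); change (a * (a * 1)) with (a ^ 2); change (b * (b * 1)) with (b ^ 2).
      generalize (ppow (S (S n)) (1 - a ^ 2 - b ^ 2)) (ppow (S n) (1 - a ^ 2 - b ^ 2)).
      generalize (a ^ i) (b ^ j) (a ^ pred i) (b ^ pred j) (INR (S (S n))) (INR i) (INR j).
      intros; ring.
Qed.

Lemma ev_boundary l a b : min_pow 1 l -> 1 <= a ^ 2 + b ^ 2 -> ev l a b = 0.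
Proof.
  intros H Hab; induction H as [|[c [[i j] n]] l Hm H IH]; simpl; auto.
  simpl in Hm. unfold ppow at 1. rewrite Rmax_left by (simpl in *; lra).
  rewrite pow_i by lia. rewrite IH; ring.
Qed.

Lemma ev_bounded l :
  exists C, 0 <= C /\ forall a b, -1 <= a <= 1 -> -1 <= b <= 1 -> Rabs (ev l a b) <= C.
Proof.
  induction l as [|[c [[i j] n]] l [C [HC IH]]]; simpl.
  - exists 0; split; [lra|]; intros; rewrite Rabs_R0; lra.
  - exists (Rabs c + C); split; [generalize (Rabs_pos c); lra|].
    intros a b Ha Hb. eapply Rle_trans; [apply Rabs_triang|].
    apply Rplus_le_compat; [|auto].
    assert (P1 : forall x k, -1 <= x <= 1 -> Rabs (x ^ k) <= 1).
    { intros x k Hx. rewrite <- RPow_abs, <- (pow1 k). apply pow_incr; split.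
      apply Rabs_pos. apply Rabs_le; lra. }
    rewrite !Rabs_mult.
    assert (Rabs (ppow n (1 - a ^ 2 - b ^ 2)) <= 1).
    { unfold ppow. apply P1. split.
      - eapply Rle_trans; [|apply Rmax_l]; lra.
      - apply Rmax_lub; simpl; nra. }
    generalize (P1 a i Ha) (P1 b j Hb) (Rabs_pos c) (Rabs_pos (a ^ i)) (Rabs_pos (b ^ j)).
    intros. assert (Rabs c * Rabs (a ^ i) <= Rabs c) by nra.
    assert (0 <= Rabs c * Rabs (a ^ i)) by nra.
    assert (Rabs c * Rabs (a ^ i) * Rabs (b ^ j) <= Rabs c) by nra.
    assert (0 <= Rabs c * Rabs (a ^ i) * Rabs (b ^ j)) by nra.
    generalize (Rabs_pos (ppow n (1 - a ^ 2 - b ^ 2))). simpl (_ ^ 2) in *. nra.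
Qed.

(** The exponent 6 leaves enough smoothness at the circle for three derivatives of [bump] and the
    integrations by parts. In [Pl] the exponent is one higher, and [1/14] cancels the factor [7 * 2]
    of the gradient. *)
Definition Kl (i j : nat) : list mono :=
  Nat.iter i Da (Nat.iter j Db ((1, (0, 0, 6)%nat) :: nil)).
Definition Pl (i j : nat) : list mono :=
  Nat.iter i Da (Nat.iter j Db ((/ 14, (0, 0, 7)%nat) :: nil)).

Definition bump (i j : nat) := ev (Kl i j).
Definition Psi (i j : nat) := ev (Pl i j).

Lemma min_pow_iter l i j k : min_pow (i + j + k) l ->
  min_pow k (Nat.iter i Da (Nat.iter j Db l)).
Proof.
  revert k; induction i as [|i IH]; intros k H; simpl.
  - revert k H; induction j as [|j IH]; intros k H; simpl in *; auto.
    apply min_pow_Db, IH. replace (j + S k)%nat with (S (j + k)) by lia; auto.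
  - apply min_pow_Da, IH. replace (i + j + S k)%nat with (S i + j + k)%nat by lia; auto.
Qed.

Lemma min_pow_Kl i j k : (i + j + k <= 6)%nat -> min_pow k (Kl i j).
Proof. intros H; apply min_pow_iter; constructor; auto. Qed.
Lemma min_pow_Pl i j k : (i + j + k <= 7)%nat -> min_pow k (Pl i j).
Proof. intros H; apply min_pow_iter; constructor; auto. Qed.

Lemma K_da i j a b : (i + j <= 3)%nat ->
  is_derive (fun a => bump i j a b) a (bump (S i) j a b).
Proof. intros H; apply is_derive_ev_a, min_pow_Kl; lia. Qed.

Lemma Psi_da i j a b : (i + j <= 3)%nat ->
  is_derive (fun a => Psi i j a b) a (Psi (S i) j a b).
Proof. intros H; apply is_derive_ev_a, min_pow_Pl; lia. Qed.

Ltac small_cases i j :=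
  destruct i as [|[|[|[|i]]]]; try lia; destruct j as [|[|[|[|j]]]]; try lia.

(** Mixed derivatives commute. [Kl] applies every [Db] before any [Da], so the extra [Db] has to be
    moved outwards; the few multi-indices in range are settled by computation. *)
Lemma K_Sb i j a b : (i + j <= 3)%nat ->
  bump i (S j) a b = ev (Db (Kl i j)) a b.
Proof. intros H. unfold bump, Kl. small_cases i j; cbn; ring. Qed.
Lemma Psi_Sb i j a b : (i + j <= 3)%nat ->
  Psi i (S j) a b = ev (Db (Pl i j)) a b.
Proof. intros H. unfold Psi, Pl. small_cases i j; cbn; ring. Qed.

Lemma K_db i j a b : (i + j <= 3)%nat ->
  is_derive (fun b => bump i j a b) b (bump i (S j) a b).
Proof. intros H; rewrite K_Sb; auto. apply is_derive_ev_b, min_pow_Kl; lia. Qed.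
Lemma Psi_db i j a b : (i + j <= 3)%nat ->
  is_derive (fun b => Psi i j a b) b (Psi i (S j) a b).
Proof. intros H; rewrite Psi_Sb; auto. apply is_derive_ev_b, min_pow_Pl; lia. Qed.

(* Both follow from grad Psi = - (a, b) bump by the Leibniz rule. *)
Lemma Psi_a i j a b : (i + j <= 3)%nat ->
  Psi (S i) j a b = - (a * bump i j a b + INR i * bump (pred i) j a b).
Proof. intros H. unfold bump, Kl, Psi, Pl. small_cases i j; cbn; field. Qed.
Lemma Psi_b i j a b : (i + j <= 3)%nat ->
  Psi i (S j) a b = - (b * bump i j a b + INR j * bump i (pred j) a b).
Proof. intros H. unfold bump, Kl, Psi, Pl. small_cases i j; cbn; field. Qed.

Lemma K_boundary i j a b : (i + j <= 5)%nat -> 1 <= a ^ 2 + b ^ 2 -> bump i j a b = 0.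
Proof. intros H; apply ev_boundary, min_pow_Kl; lia. Qed.
Lemma Psi_boundary i j a b : (i + j <= 6)%nat -> 1 <= a ^ 2 + b ^ 2 -> Psi i j a b = 0.
Proof. intros H; apply ev_boundary, min_pow_Pl; lia. Qed.

Lemma K_pos a b : 0 <= bump 0 0 a b.
Proof. unfold bump; cbn; unfold ppow. generalize (pow_le (Rmax 0 (1 - a * (a * 1) - b * (b * 1))) 6 (Rmax_l _ _)); simpl; lra. Qed.

Lemma kernels_bounded : exists C, 1 <= C /\ forall i j a b, (i + j <= 3)%nat ->
  -1 <= a <= 1 -> -1 <= b <= 1 -> Rabs (bump i j a b) <= C /\ Rabs (Psi i j a b) <= C.
Proof.
  assert (W : forall L : list (nat * nat), exists C, 1 <= C /\ forall i j a b, In (i, j) L ->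
    -1 <= a <= 1 -> -1 <= b <= 1 -> Rabs (bump i j a b) <= C /\ Rabs (Psi i j a b) <= C).
  { induction L as [|[i j] L [C [HC IH]]].
    - exists 1; split; [lra|]; intros i j a b [].
    - destruct (ev_bounded (Kl i j)) as [C1 [HC1 H1]], (ev_bounded (Pl i j)) as [C2 [HC2 H2]].
      exists (C + C1 + C2); split; [lra|]. intros i' j' a b [E|Hin] Ha Hb.
      + inversion E; subst. specialize (H1 a b Ha Hb); specialize (H2 a b Ha Hb).
        unfold bump, Psi; lra.
      + destruct (IH i' j' a b Hin Ha Hb); lra. }
  destruct (W (list_prod (seq 0 4) (seq 0 4))) as [C [HC H]].
  exists C; split; auto. intros i j a b Hij. apply H, in_prod; apply in_seq; lia.
Qed.

Lemma cont2_dcont1 f x : cont2 f -> cont1 (f x).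
Proof. intros H; ct. Qed.

Lemma RInt_plus' f g a b : cont1 f -> cont1 g ->
  RInt (fun x => f x + g x) a b = RInt f a b + RInt g a b.
Proof. intros; apply (RInt_plus (V := R_CompleteNormedModule)); apply ex_RInt_cont1; auto. Qed.
Lemma RInt_minus' f g a b : cont1 f -> cont1 g ->
  RInt (fun x => f x - g x) a b = RInt f a b - RInt g a b.
Proof. intros; apply (RInt_minus (V := R_CompleteNormedModule)); apply ex_RInt_cont1; auto. Qed.
Lemma RInt_scal' c f a b : cont1 f -> RInt (fun x => c * f x) a b = c * RInt f a b.
Proof. intros; apply (RInt_scal (V := R_CompleteNormedModule)); apply ex_RInt_cont1; auto. Qed.
Lemma RInt_ext' (f g : R -> R) a b : (forall x, f x = g x) -> RInt f a b = RInt g a b.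
Proof. intros H; apply RInt_ext; intros; apply H. Qed.

(** * Scaled averages and their derivatives *)

Record grad (g g1 g2 : R -> R -> R) : Prop := {
  gr_c : cont2 g; gr_c1 : cont2 g1; gr_c2 : cont2 g2;
  gr_d1 : forall s z, is_derive (fun s => g s z) s (g1 s z);
  gr_d2 : forall s z, is_derive (fun z => g s z) z (g2 s z) }.

Lemma grad_comp g g1 g2 (f h : R -> R) t a b :
  grad g g1 g2 -> is_derive f t a -> is_derive h t b ->
  is_derive (fun t => g (f t) (h t)) t (a * g1 (f t) (h t) + b * g2 (f t) (h t)).
Proof.
  intros G Hf Hh. apply is_derive_Reals.
  rewrite (Rmult_comm a), (Rmult_comm b). apply derivable_pt_lim_comp_2d; try (apply is_derive_Reals; assumption).
  apply filterdiff_differentiable_pt_lim.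
  apply (filterdiff_ext_lin _ (fun u : R * R => plus (scal (fst u) (g1 (f t) (h t))) (scal (snd u) (g2 (f t) (h t))))).
  - apply (is_derive_filterdiff g (f t) (h t) g1 (g2 (f t) (h t))).
    + apply filter_forall; intros; apply (gr_d1 _ _ _ G).
    + apply (gr_d2 _ _ _ G).
    + apply (gr_c1 _ _ _ G (f t, h t)).
  - reflexivity.
Qed.

(** For [k] supported in the unit disk this is [t^-2] times the integral of [g] against [k] scaled
    to radius [t] around [(x, y)]. In these coordinates the domain of integration is fixed, and
    [t = 0] is allowed. *)
Definition DI (k g : R -> R -> R) (x y t : R) : R :=
  RInt (fun b => RInt (fun a => k a b * g (x + t * a) (y + t * b)) (-1) 1) (-1) 1.

Section DI.
Context (k : R -> R -> R) (Hk : cont2 k).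

Lemma DI_inner_ct (F : R -> R -> R -> R) :
  (forall q : (R * R) * R, continuous (fun q => F (fst (fst q)) (snd (fst q)) (snd q)) q) ->
  cont2 (fun t b => RInt (fun a => F t b a) (-1) 1).
Proof. intros H p. apply (ct_RInt (fun (q : R * R) a => F (fst q) (snd q) a)). exact H. Qed.

Lemma DI_plus g h x y t : cont2 g -> cont2 h ->
  DI k (fun s z => g s z + h s z) x y t = DI k g x y t + DI k h x y t.
Proof.
  intros Hg Hh; unfold DI. rewrite <- RInt_plus'.
  - apply RInt_ext'; intros b. rewrite <- RInt_plus'; try ct.
    apply RInt_ext'; intros a; ring.
  - apply (cont2_dcont1 (fun t b => RInt (fun a => k a b * g (x + t * a) (y + t * b)) (-1) 1)).
    apply DI_inner_ct; intros; ct.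
  - apply (cont2_dcont1 (fun t b => RInt (fun a => k a b * h (x + t * a) (y + t * b)) (-1) 1)).
    apply DI_inner_ct; intros; ct.
Qed.

Lemma DI_scal c g x y t : cont2 g -> DI k (fun s z => c * g s z) x y t = c * DI k g x y t.
Proof.
  intros Hg; unfold DI. rewrite <- RInt_scal'.
  - apply RInt_ext'; intros b. rewrite <- RInt_scal'; try ct.
    apply RInt_ext'; intros a; ring.
  - apply (cont2_dcont1 (fun t b => RInt (fun a => k a b * g (x + t * a) (y + t * b)) (-1) 1)).
    apply DI_inner_ct; intros; ct.
Qed.

Lemma DI_kext k' g x y t : (forall a b, k a b = k' a b) -> DI k g x y t = DI k' g x y t.
Proof. intros H; unfold DI. apply RInt_ext'; intros; apply RInt_ext'; intros; rewrite H; auto. Qed.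

Lemma DI_gext g h x y t : (forall s z, g s z = h s z) -> DI k g x y t = DI k h x y t.
Proof. intros H; unfold DI. apply RInt_ext'; intros; apply RInt_ext'; intros; rewrite H; auto. Qed.

Lemma DI_kplus k' g x y t : cont2 k' -> cont2 g ->
  DI (fun a b => k a b + k' a b) g x y t = DI k g x y t + DI k' g x y t.
Proof.
  intros Hk' Hg; unfold DI. rewrite <- RInt_plus'.
  - apply RInt_ext'; intros b. rewrite <- RInt_plus'; try ct.
    apply RInt_ext'; intros a; ring.
  - apply (cont2_dcont1 (fun t b => RInt (fun a => k a b * g (x + t * a) (y + t * b)) (-1) 1)).
    apply DI_inner_ct; intros; ct.
  - apply (cont2_dcont1 (fun t b => RInt (fun a => k' a b * g (x + t * a) (y + t * b)) (-1) 1)).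
    apply DI_inner_ct; intros; ct.
Qed.

Lemma DI_kscal c g x y t : cont2 g -> DI (fun a b => c * k a b) g x y t = c * DI k g x y t.
Proof.
  intros Hg; rewrite <- DI_scal by auto. unfold DI.
  apply RInt_ext'; intros; apply RInt_ext'; intros; ring.
Qed.

Lemma DI_bound g x y t C M :
  (forall a b, -1 <= a <= 1 -> -1 <= b <= 1 -> Rabs (k a b) <= C) ->
  cont2 g ->
  (forall a b, -1 <= a <= 1 -> -1 <= b <= 1 -> Rabs (g (x + t * a) (y + t * b)) <= M) ->
  Rabs (DI k g x y t) <= 4 * C * M.
Proof.
  intros HC Hg HM.
  replace (4 * C * M) with ((1 - (-1)) * ((1 - (-1)) * (C * M))) by ring.
  apply RInt_bound; [lra| |].
  - apply (cont2_dcont1 (fun t b => RInt (fun a => k a b * g (x + t * a) (y + t * b)) (-1) 1)).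
    apply DI_inner_ct; intros; ct.
  - intros b Hb. apply RInt_bound; [lra|ct|].
    intros a Ha. rewrite Rabs_mult. apply Rmult_le_compat; auto using Rabs_pos.
Qed.

Lemma DI_ct g x y : cont2 g -> cont1 (fun t => DI k g x y t).
Proof.
  intros Hg t. unfold DI. apply ct_RInt.
  apply (DI_inner_ct (fun t b a => k a b * g (x + t * a) (y + t * b))). intros; ct.
Qed.

Lemma DI_dt g g1 g2 x y t : grad g g1 g2 ->
  is_derive (fun t => DI k g x y t) t
    (DI (fun a b => a * k a b) g1 x y t + DI (fun a b => b * k a b) g2 x y t).
Proof.
  intros G. assert (Hg := gr_c _ _ _ G); assert (Hg1 := gr_c1 _ _ _ G); assert (Hg2 := gr_c2 _ _ _ G).
  unfold DI. rewrite <- RInt_plus'.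
  - apply (is_derive_RInt_par (fun t b => RInt (fun a => k a b * g (x + t * a) (y + t * b)) (-1) 1)
      (fun t b => RInt (fun a => a * k a b * g1 (x + t * a) (y + t * b)) (-1) 1
        + RInt (fun a => b * k a b * g2 (x + t * a) (y + t * b)) (-1) 1)).
    + intros t' b. rewrite <- RInt_plus'; try ct.
      apply (is_derive_RInt_par (fun t a => k a b * g (x + t * a) (y + t * b))
        (fun t a => a * k a b * g1 (x + t * a) (y + t * b) + b * k a b * g2 (x + t * a) (y + t * b))).
      * intros t'' a. eapply dr_eq.
        { apply (dr_scal (k a b) (fun t => g (x + t * a) (y + t * b))).
          apply (grad_comp g g1 g2 (fun t => x + t * a) (fun t => y + t * b) t'' a b G);
            auto_derive; auto; ring. }
        ring.
      * intros; ct.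
      * ct.
    + intros t'. apply (cont2_dcont1 (fun t b => RInt (fun a => k a b * g (x + t * a) (y + t * b)) (-1) 1)).
      apply DI_inner_ct; intros; ct.
    + intros p; apply ct_plus.
      * apply (DI_inner_ct (fun t b a => a * k a b * g1 (x + t * a) (y + t * b))). intros; ct.
      * apply (DI_inner_ct (fun t b a => b * k a b * g2 (x + t * a) (y + t * b))). intros; ct.
  - apply (cont2_dcont1 (fun t b => RInt (fun a => a * k a b * g1 (x + t * a) (y + t * b)) (-1) 1)).
    apply DI_inner_ct; intros; ct.
  - apply (cont2_dcont1 (fun t b => RInt (fun a => b * k a b * g2 (x + t * a) (y + t * b)) (-1) 1)).
    apply DI_inner_ct; intros; ct.
Qed.

Lemma DI_dx g g1 g2 x y t : grad g g1 g2 ->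
  is_derive (fun x => DI k g x y t) x (DI k g1 x y t).
Proof.
  intros G. assert (Hg := gr_c _ _ _ G); assert (Hg1 := gr_c1 _ _ _ G).
  apply (is_derive_RInt_par (fun x b => RInt (fun a => k a b * g (x + t * a) (y + t * b)) (-1) 1)
      (fun x b => RInt (fun a => k a b * g1 (x + t * a) (y + t * b)) (-1) 1)).
  - intros x' b. apply (is_derive_RInt_par (fun x a => k a b * g (x + t * a) (y + t * b))
        (fun x a => k a b * g1 (x + t * a) (y + t * b))); try (intros; ct).
    eapply dr_eq; [apply (dr_scal (k t0 b) (fun x => g (x + t * t0) (y + t * b)))|].
    + apply (grad_comp g g1 g2 (fun x => x + t * t0) (fun _ => y + t * b) x0 1 0 G);
        auto_derive; auto; ring.
    + ring.
  - intros x'. apply (cont2_dcont1 (fun t0 b => RInt (fun a => k a b * g (x' + t * a) (y + t * b)) (-1) 1) 0).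
    apply DI_inner_ct; intros; ct.
  - apply (DI_inner_ct (fun x b a => k a b * g1 (x + t * a) (y + t * b))). intros; ct.
Qed.

Lemma DI_dy g g1 g2 x y t : grad g g1 g2 ->
  is_derive (fun y => DI k g x y t) y (DI k g2 x y t).
Proof.
  intros G. assert (Hg := gr_c _ _ _ G); assert (Hg2 := gr_c2 _ _ _ G).
  apply (is_derive_RInt_par (fun y b => RInt (fun a => k a b * g (x + t * a) (y + t * b)) (-1) 1)
      (fun y b => RInt (fun a => k a b * g2 (x + t * a) (y + t * b)) (-1) 1)).
  - intros y' b. apply (is_derive_RInt_par (fun y a => k a b * g (x + t * a) (y + t * b))
        (fun y a => k a b * g2 (x + t * a) (y + t * b))); try (intros; ct).
    eapply dr_eq; [apply (dr_scal (k t0 b) (fun y => g (x + t * t0) (y + t * b)))|].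
    + apply (grad_comp g g1 g2 (fun _ => x + t * t0) (fun y => y + t * b) x0 0 1 G);
        auto_derive; auto; ring.
    + ring.
  - intros y'. apply (cont2_dcont1 (fun t0 b => RInt (fun a => k a b * g (x + t * a) (y' + t * b)) (-1) 1) 0).
    apply DI_inner_ct; intros; ct.
  - apply (DI_inner_ct (fun y b a => k a b * g2 (x + t * a) (y + t * b))). intros; ct.
Qed.

Lemma DI_parts_a ka g g1 g2 x y t : cont2 ka -> grad g g1 g2 ->
  (forall a b, is_derive (fun a => k a b) a (ka a b)) ->
  (forall b, k 1 b = 0) -> (forall b, k (-1) b = 0) ->
  DI ka g x y t = - t * DI k g1 x y t.
Proof.
  intros Hka G Hd H1 H2. assert (Hg := gr_c _ _ _ G); assert (Hg1 := gr_c1 _ _ _ G).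
  rewrite <- DI_scal by auto. unfold DI. apply RInt_ext'; intros b.
  cut (RInt (fun a => ka a b * g (x + t * a) (y + t * b)
        - k a b * (- t * g1 (x + t * a) (y + t * b))) (-1) 1 = 0).
  { rewrite RInt_minus'; try ct. intros; lra. }
  set (F := fun a => k a b * g (x + t * a) (y + t * b)).
  transitivity (F 1 - F (-1)); [|unfold F; rewrite H1, H2; lra].
  apply RInt_FTC; [lra| |unfold F; ct|ct].
  - intros a _. eapply dr_eq; [apply (dr_mult (fun a => k a b) (fun a => g (x + t * a) (y + t * b))); [apply Hd|]|].
    + apply (grad_comp g g1 g2 (fun a => x + t * a) (fun _ => y + t * b) a t 0 G);
        auto_derive; auto; ring.
    + ring.
Qed.

Lemma DI_parts_b kb g g1 g2 x y t : cont2 kb -> grad g g1 g2 ->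
  (forall a b, is_derive (fun b => k a b) b (kb a b)) ->
  (forall a, k a 1 = 0) -> (forall a, k a (-1) = 0) ->
  DI kb g x y t = - t * DI k g2 x y t.
Proof.
  intros Hkb G Hd H1 H2. assert (Hg := gr_c _ _ _ G); assert (Hg2 := gr_c2 _ _ _ G).
  rewrite <- DI_scal by auto. unfold DI.
  set (J := fun b => RInt (fun a => k a b * g (x + t * a) (y + t * b)) (-1) 1).
  assert (C1 : cont1 (fun b => RInt (fun a => kb a b * g (x + t * a) (y + t * b)) (-1) 1)).
  { apply (cont2_dcont1 (fun t0 b => RInt (fun a => kb a b * g (x + t * a) (y + t * b)) (-1) 1) 0).
    apply DI_inner_ct; intros; ct. }
  assert (C2 : cont1 (fun b => RInt (fun a => k a b * (- t * g2 (x + t * a) (y + t * b))) (-1) 1)).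
  { apply (cont2_dcont1 (fun t0 b => RInt (fun a => k a b * (- t * g2 (x + t * a) (y + t * b))) (-1) 1) 0).
    apply DI_inner_ct; intros; ct. }
  assert (HJ : forall b, is_derive J b (RInt (fun a => kb a b * g (x + t * a) (y + t * b)) (-1) 1
     - RInt (fun a => k a b * (- t * g2 (x + t * a) (y + t * b))) (-1) 1)).
  { intros b. unfold J. rewrite <- RInt_minus'; try ct.
    apply (is_derive_RInt_par (fun b a => k a b * g (x + t * a) (y + t * b))
      (fun b a => kb a b * g (x + t * a) (y + t * b) - k a b * (- t * g2 (x + t * a) (y + t * b))));
      try (intros; ct).
    eapply dr_eq; [apply (dr_mult (fun b => k t0 b) (fun b => g (x + t * t0) (y + t * b))); [apply Hd|]|].
    + apply (grad_comp g g1 g2 (fun _ => x + t * t0) (fun b => y + t * b) x0 0 t G);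
        auto_derive; auto; ring.
    + ring. }
  assert (E := RInt_FTC J _ (-1) 1 ltac:(lra) (fun b _ => HJ b)).
  rewrite RInt_minus' in E; auto.
  assert (J1 : J 1 = 0).
  { unfold J; rewrite (RInt_ext' _ (fun _ => 0)). rewrite RInt_const. unfold scal; simpl; unfold mult; simpl; ring.
    intros; rewrite H1; ring. }
  assert (J2 : J (-1) = 0).
  { unfold J; rewrite (RInt_ext' _ (fun _ => 0)). rewrite RInt_const. unfold scal; simpl; unfold mult; simpl; ring.
    intros; rewrite H2; ring. }
  rewrite J1, J2 in E.
  enough (E' : RInt (fun b => RInt (fun a => kb a b * g (x + t * a) (y + t * b)) (-1) 1) (-1) 1
    - RInt (fun b => RInt (fun a => k a b * (- t * g2 (x + t * a) (y + t * b))) (-1) 1) (-1) 1 = 0 - 0) by lra.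
  apply E.
  - intros b; apply (ct_der _ _ _ (HJ b)).
  - intros b; apply ct_minus; auto.
Qed.
End DI.

Record jet := Jet { j0 : R -> R -> R; j1 : R -> R -> R; j2 : R -> R -> R;
                    j11 : R -> R -> R; j12 : R -> R -> R; j22 : R -> R -> R }.

Record is_C2 (J : jet) : Prop := {
  C2_0 : grad (j0 J) (j1 J) (j2 J);
  C2_1 : grad (j1 J) (j11 J) (j12 J);
  C2_2 : grad (j2 J) (j12 J) (j22 J) }.

Definition lap (J : jet) (s z : R) := j11 J s z + j22 J s z.

(** Orders up to 2 are meant; the default [j0 J] keeps every [jD J i j] continuous, whatever the
    indices. *)
Definition jD (J : jet) (i j : nat) : R -> R -> R :=
  match i, j with
  | 1%nat, 0%nat => j1 J | 0%nat, 1%nat => j2 J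
  | 2%nat, 0%nat => j11 J | 1%nat, 1%nat => j12 J | 0%nat, 2%nat => j22 J
  | _, _ => j0 J
  end.

Lemma cont2_jD J i j : is_C2 J -> cont2 (jD J i j).
Proof.
  intros [[] [] []]. destruct i as [|[|[|i]]], j as [|[|[|j]]]; simpl; auto.
Qed.

Lemma cont2_lap J : is_C2 J -> cont2 (lap J).
Proof. intros HJ p. apply ct_plus; [apply (cont2_jD J 2 0 HJ) | apply (cont2_jD J 0 2 HJ)]. Qed.

Lemma cont2_K i j : cont2 (bump i j).
Proof. apply cont2_ev. Qed.
Lemma cont2_Psi i j : cont2 (Psi i j).
Proof. apply cont2_ev. Qed.

Lemma DI_K_a i j g g1 g2 x y t : (i + j <= 2)%nat -> grad g g1 g2 ->
  DI (bump (S i) j) g x y t = - t * DI (bump i j) g1 x y t.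
Proof.
  intros H G. apply (DI_parts_a (bump i j) (cont2_K i j) _ g g1 g2 x y t (cont2_K _ _) G).
  - intros; apply K_da; lia.
  - intros; apply K_boundary; try lia. nra.
  - intros; apply K_boundary; try lia. nra.
Qed.
Lemma DI_K_b i j g g1 g2 x y t : (i + j <= 2)%nat -> grad g g1 g2 ->
  DI (bump i (S j)) g x y t = - t * DI (bump i j) g2 x y t.
Proof.
  intros H G. apply (DI_parts_b (bump i j) (cont2_K i j) _ g g1 g2 x y t (cont2_K _ _) G).
  - intros; apply K_db; lia.
  - intros; apply K_boundary; try lia. nra.
  - intros; apply K_boundary; try lia. nra.
Qed.
Lemma DI_Psi_a i j g g1 g2 x y t : (i + j <= 3)%nat -> grad g g1 g2 ->
  DI (Psi (S i) j) g x y t = - t * DI (Psi i j) g1 x y t.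
Proof.
  intros H G. apply (DI_parts_a (Psi i j) (cont2_Psi i j) _ g g1 g2 x y t (cont2_Psi _ _) G).
  - intros; apply Psi_da; lia.
  - intros; apply Psi_boundary; try lia. nra.
  - intros; apply Psi_boundary; try lia. nra.
Qed.
Lemma DI_Psi_b i j g g1 g2 x y t : (i + j <= 3)%nat -> grad g g1 g2 ->
  DI (Psi i (S j)) g x y t = - t * DI (Psi i j) g2 x y t.
Proof.
  intros H G. apply (DI_parts_b (Psi i j) (cont2_Psi i j) _ g g1 g2 x y t (cont2_Psi _ _) G).
  - intros; apply Psi_db; lia.
  - intros; apply Psi_boundary; try lia. nra.
  - intros; apply Psi_boundary; try lia. nra.
Qed.

Lemma cont2_aK i j : cont2 (fun a b => a * bump i j a b).
Proof. generalize (cont2_K i j); intros; ct. Qed.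
Lemma cont2_bK i j : cont2 (fun a b => b * bump i j a b).
Proof. generalize (cont2_K i j); intros; ct. Qed.

(** Integration by parts moves one derivative of each term of [lap] onto [Psi], whose gradient is
    expressed by [bump]. The Leibniz terms [INR i * bump (pred i) j] are integrated by parts once
    more, in the opposite direction, and add up to the term with [INR (i + j)]. *)
Lemma DI_K_lap J i j x y t : is_C2 J -> (i + j <= 3)%nat ->
  t * t * DI (Psi i j) (lap J) x y t
  = t * (DI (fun a b => a * bump i j a b) (j1 J) x y t + DI (fun a b => b * bump i j a b) (j2 J) x y t)
    - INR (i + j) * DI (bump i j) (j0 J) x y t.
Proof.
  intros HJ Hij. destruct HJ as [G0 G1 G2].
  assert (C1 := gr_c _ _ _ G1); assert (C2 := gr_c _ _ _ G2).
  assert (C11 := gr_c1 _ _ _ G1); assert (C22 := gr_c2 _ _ _ G2).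
  unfold lap. rewrite DI_plus; auto using cont2_Psi.
  assert (E1 := DI_Psi_a i j _ _ _ x y t Hij G1).
  assert (E2 := DI_Psi_b i j _ _ _ x y t Hij G2).
  rewrite (DI_kext (Psi (S i) j) (fun a b => (-1) * (a * bump i j a b + INR i * bump (pred i) j a b))) in E1
    by (intros; rewrite Psi_a by lia; ring).
  rewrite (DI_kext (Psi i (S j)) (fun a b => (-1) * (b * bump i j a b + INR j * bump i (pred j) a b))) in E2
    by (intros; rewrite Psi_b by lia; ring).
  assert (CK1 := cont2_K (pred i) j). assert (CK2 := cont2_K i (pred j)).
  rewrite (DI_kscal (fun a b => a * bump i j a b + INR i * bump (pred i) j a b)) in E1;
    [|generalize (cont2_K i j); intros; ct|auto].
  rewrite (DI_kscal (fun a b => b * bump i j a b + INR j * bump i (pred j) a b)) in E2;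
    [|generalize (cont2_K i j); intros; ct|auto].
  rewrite (DI_kplus (fun a b => a * bump i j a b) (cont2_aK i j) (fun a b => INR i * bump (pred i) j a b)) in E1;
    [|ct|auto].
  rewrite (DI_kplus (fun a b => b * bump i j a b) (cont2_bK i j) (fun a b => INR j * bump i (pred j) a b)) in E2;
    [|ct|auto].
  rewrite (DI_kscal (bump (pred i) j)) in E1 by auto.
  rewrite (DI_kscal (bump i (pred j))) in E2 by auto.
  assert (F1 : t * (INR i * DI (bump (pred i) j) (j1 J) x y t) = - INR i * DI (bump i j) (j0 J) x y t).
  { destruct i as [|i]; simpl pred; [simpl; ring|]. rewrite (DI_K_a i j _ _ _ x y t ltac:(lia) G0). ring. }
  assert (F2 : t * (INR j * DI (bump i (pred j)) (j2 J) x y t) = - INR j * DI (bump i j) (j0 J) x y t).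
  { destruct j as [|j]; simpl pred; [simpl; ring|]. rewrite (DI_K_b i j _ _ _ x y t ltac:(lia) G0). ring. }
  rewrite plus_INR.
  replace (t * t * (DI (Psi i j) (j11 J) x y t + DI (Psi i j) (j22 J) x y t))
    with (- t * (- t * DI (Psi i j) (j11 J) x y t) - t * (- t * DI (Psi i j) (j22 J) x y t)) by ring.
  rewrite <- E1, <- E2. lra.
Qed.

(** Differentiating [t^-(i + j)] produces exactly the term with [INR (i + j)] in [DI_K_lap], so that
    only the Laplacian is left on the right. *)
Lemma DI_K_derive J i j x y t : is_C2 J -> (i + j <= 3)%nat -> 0 < t ->
  is_derive (fun t => DI (bump i j) (j0 J) x y t / t ^ (i + j)) t
    (t * DI (Psi i j) (lap J) x y t / t ^ (i + j)).
Proof.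
  intros HJ Hij Ht.
  assert (Hn : forall n, t ^ n <> 0) by (intros; apply pow_nonzero; lra).
  eapply dr_eq.
  - apply (dr_mult (fun t => DI (bump i j) (j0 J) x y t) (fun t => / t ^ (i + j))).
    + apply (DI_dt _ (cont2_K i j) _ _ _ x y t (C2_0 J HJ)).
    + apply (is_derive_inv (fun t => t ^ (i + j)) t (INR (i + j) * t ^ pred (i + j))); [|apply Hn].
      eapply dr_eq; [apply (is_derive_pow (fun t => t) (i + j) t 1), dr_id | ring].
  - assert (E := DI_K_lap J i j x y t HJ Hij).
    apply (Rmult_eq_reg_l t); [|lra].
    set (D := DI _ (j1 J) x y t + DI _ (j2 J) x y t) in *.
    replace (t * (t * DI (Psi i j) (lap J) x y t / t ^ (i + j)))
      with ((t * D - INR (i + j) * DI (bump i j) (j0 J) x y t) / t ^ (i + j))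
      by (rewrite <- E; field; apply Hn).
    destruct (i + j)%nat as [|n]; simpl pred.
    + simpl; field.
    + simpl pow. field. repeat split; try apply (Hn n); lra.
Qed.

Lemma DI_K_parts J i j x y t : is_C2 J -> (i + j <= 2)%nat ->
  DI (bump i j) (j0 J) x y t = (- t) ^ (i + j) * DI (bump 0 0) (jD J i j) x y t.
Proof.
  intros [G0 G1 G2] Hij.
  destruct i as [|[|[|i]]], j as [|[|[|j]]]; try lia; simpl plus; simpl jD.
  - simpl; ring.
  - rewrite (DI_K_b 0 0 _ _ _ x y t ltac:(lia) G0). simpl; ring.
  - rewrite (DI_K_b 0 1 _ _ _ x y t ltac:(lia) G0), (DI_K_b 0 0 _ _ _ x y t ltac:(lia) G2). simpl; ring.
  - rewrite (DI_K_a 0 0 _ _ _ x y t ltac:(lia) G0). simpl; ring.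
  - rewrite (DI_K_a 0 1 _ _ _ x y t ltac:(lia) G0), (DI_K_b 0 0 _ _ _ x y t ltac:(lia) G1). simpl; ring.
  - rewrite (DI_K_a 1 0 _ _ _ x y t ltac:(lia) G0), (DI_K_a 0 0 _ _ _ x y t ltac:(lia) G1). simpl; ring.
Qed.

Lemma RInt_pos_mid f : cont1 f -> (forall x, -1 <= x <= 1 -> 0 <= f x) ->
  (forall x, -1/2 <= x <= 1/2 -> 0 < f x) -> 0 < RInt f (-1) 1.
Proof.
  intros Hc H0 H1.
  rewrite <- (RInt_Chasles f (-1) (-1/2) 1), <- (RInt_Chasles f (-1/2) (1/2) 1);
    try (apply ex_RInt_cont1; auto).
  unfold plus; simpl.
  assert (0 <= RInt f (-1) (-1/2)) by (apply RInt_ge_0; [lra|apply ex_RInt_cont1; auto|intros; apply H0; lra]).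
  assert (0 <= RInt f (1/2) 1) by (apply RInt_ge_0; [lra|apply ex_RInt_cont1; auto|intros; apply H0; lra]).
  assert (0 < RInt f (-1/2) (1/2)) by (apply RInt_gt_0; [lra|intros; apply H1; lra|intros; apply Hc]).
  lra.
Qed.

Definition Kmass : R := RInt (fun b => RInt (fun a => bump 0 0 a b) (-1) 1) (-1) 1.

Lemma Kmass_pos : 0 < Kmass.
Proof.
  assert (CK := cont2_K 0 0).
  assert (P : forall a b, -1/2 <= a <= 1/2 -> -1/2 <= b <= 1/2 -> 0 < bump 0 0 a b).
  { intros a b Ha Hb. unfold bump; cbn; unfold ppow. rewrite Rmax_right by nra.
    assert (0 < (1 - a * (a * 1) - b * (b * 1)) ^ 6) by (apply pow_lt; nra). simpl in *; lra. }
  assert (C1 : forall c d, cont1 (fun b => RInt (fun a => bump 0 0 a b) c d)).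
  { intros c d b. apply (ct_RInt (fun b a => bump 0 0 a b)). intros; ct. }
  apply RInt_pos_mid; auto.
  - intros b _. apply RInt_ge_0; [lra|apply ex_RInt_cont1; ct|]. intros; apply K_pos.
  - intros b Hb. apply RInt_pos_mid; [ct| |].
    + intros; apply K_pos.
    + intros; apply P; auto.
Qed.

Lemma DI_K_0 g x y : cont2 g -> DI (bump 0 0) g x y 0 = Kmass * g x y.
Proof.
  intros Hg. rewrite Rmult_comm. unfold DI, Kmass.
  assert (CK := cont2_K 0 0).
  rewrite <- RInt_scal'.
  - apply RInt_ext'; intros b. rewrite <- RInt_scal' by ct. apply RInt_ext'; intros a.
    rewrite !Rmult_0_l, !Rplus_0_r; ring.
  - intros b. apply (ct_RInt (fun b a => bump 0 0 a b)). intros; ct.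
Qed.

Lemma lim_bound f r B : 0 < r -> cont1 f ->
  (forall e, 0 < e <= r -> Rabs (f e) <= B) -> Rabs (f 0) <= B.
Proof.
  intros Hr Hc H. destruct (Rle_lt_dec (Rabs (f 0)) B) as [|Hlt]; auto. exfalso.
  assert (Hc' : continuous (fun x => Rabs (f x)) 0) by ct.
  assert (He : 0 < Rabs (f 0) - B) by lra.
  destruct (proj1 (filterlim_locally _ _) Hc' (mkposreal _ He)) as [d Hd].
  set (e := Rmin r (d / 2)).
  assert (0 < e <= r) by (unfold e; split; [apply Rmin_glb_lt; [auto|destruct d; simpl; lra] | apply Rmin_l]).
  assert (e < d) by (eapply Rle_lt_trans; [apply Rmin_r|destruct d; simpl; lra]).
  assert (Hb : Rabs (Rabs (f e) - Rabs (f 0)) < Rabs (f 0) - B).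
  { apply (Hd e). unfold ball; simpl; unfold AbsRing_ball, abs, minus, plus, opp; simpl.
    rewrite Ropp_0, Rplus_0_r, Rabs_pos_eq; lra. }
  apply Rabs_lt_between in Hb. specialize (H e ltac:(lra)). lra.
Qed.

(** * Interior estimates for the Laplacian *)

Section Estimates.
Context (CK : R) (HCK : 1 <= CK).
Context (HK : forall i j a b, (i + j <= 3)%nat -> -1 <= a <= 1 -> -1 <= b <= 1 ->
  Rabs (bump i j a b) <= CK /\ Rabs (Psi i j a b) <= CK).

Definition box (x y r s z : R) := x - r <= s <= x + r /\ y - r <= z <= y + r.

Lemma box_in x y r t a b : 0 <= t <= r -> -1 <= a <= 1 -> -1 <= b <= 1 ->
  box x y r (x + t * a) (y + t * b).
Proof. intros; split; nra. Qed.

Lemma DI_K_growth J i j x y G G' e t :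
  is_C2 J -> (i + j <= 3)%nat -> 0 < e <= t ->
  (forall u, e <= u <= t -> is_derive G u (G' u)) ->
  (forall u, e <= u <= t -> Rabs (u * DI (Psi i j) (lap J) x y u / u ^ (i + j)) <= G' u) ->
  Rabs (DI (bump i j) (j0 J) x y t / t ^ (i + j) - DI (bump i j) (j0 J) x y e / e ^ (i + j))
  <= G t - G e.
Proof.
  intros HJ Hij He HG Hb.
  apply (MVT_bound (fun t => DI (bump i j) (j0 J) x y t / t ^ (i + j))
    (fun u => u * DI (Psi i j) (lap J) x y u / u ^ (i + j)) G G'); auto; try lra.
  intros u Hu. apply DI_K_derive; auto; lra.
Qed.

(** A derivative of a kernel that vanishes at the border has integral zero. Owing to this
    cancellation only the oscillation of [lap] enters the second order estimates, and the
    singularity in the scale becomes integrable. *)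
Lemma DI_Psi_const i j c x y t : (1 <= i + j <= 4)%nat -> DI (Psi i j) (fun _ _ => c) x y t = 0.
Proof.
  intros Hij.
  assert (G : grad (fun _ _ => c) (fun _ _ => 0) (fun _ _ => 0)).
  { split; try (intros p; apply continuous_const); intros; apply dr_const. }
  assert (Z : forall k, cont2 k -> DI k (fun _ _ => 0) x y t = 0).
  { intros k Hk. rewrite (DI_gext k _ (fun _ _ => 0 * 1)) by (intros; ring).
    rewrite DI_scal; auto; [ring | intros p; apply continuous_const]. }
  destruct i as [|i]; [destruct j as [|j]; [lia|]|].
  - rewrite (DI_Psi_b 0 j _ _ _ x y t ltac:(lia) G), Z; [ring | apply cont2_Psi].
  - rewrite (DI_Psi_a i j _ _ _ x y t ltac:(lia) G), Z; [ring | apply cont2_Psi].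
Qed.

Lemma DI_Psi_osc i j f x y t H : (1 <= i + j <= 3)%nat -> cont2 f ->
  (forall s z, box x y t s z -> Rabs (f s z - f x y) <= H) -> 0 <= t ->
  Rabs (DI (Psi i j) f x y t) <= 4 * CK * H.
Proof.
  intros Hij Hf Hosc Ht.
  replace (DI (Psi i j) f x y t) with (DI (Psi i j) (fun s z => f s z - f x y) x y t).
  - apply DI_bound; auto using cont2_Psi.
    + intros; apply HK; auto; lia.
    + intros p; ct.
    + intros a b Ha Hb. apply Hosc, box_in; auto; lra.
  - rewrite (DI_gext _ _ (fun s z => f s z + - f x y)) by (intros; ring).
    rewrite DI_plus; auto using cont2_Psi; [|intros p; apply continuous_const].
    rewrite DI_Psi_const by lia. ring.
Qed.

Lemma DI_Psi_sup i j f x y t M : (i + j <= 3)%nat -> cont2 f ->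
  (forall s z, box x y t s z -> Rabs (f s z) <= M) -> 0 <= t ->
  Rabs (DI (Psi i j) f x y t) <= 4 * CK * M.
Proof.
  intros Hij Hf HM Ht. apply DI_bound; auto using cont2_Psi.
  - intros; apply HK; auto; lia.
  - intros a b Ha Hb. apply HM, box_in; auto; lra.
Qed.

Lemma DI_K_sup i j f x y t M : (i + j <= 3)%nat -> cont2 f ->
  (forall s z, box x y t s z -> Rabs (f s z) <= M) -> 0 <= t ->
  Rabs (DI (bump i j) f x y t) <= 4 * CK * M.
Proof.
  intros Hij Hf HM Ht. apply DI_bound; auto using cont2_K.
  - intros; apply HK; auto; lia.
  - intros a b Ha Hb. apply HM, box_in; auto; lra.
Qed.

Lemma DI_K_quot J i j x y t : is_C2 J -> (i + j <= 2)%nat -> 0 < t ->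
  DI (bump i j) (j0 J) x y t / t ^ (i + j) = (-1) ^ (i + j) * DI (bump 0 0) (jD J i j) x y t.
Proof.
  intros HJ Hij Ht. rewrite DI_K_parts by auto.
  replace (- t) with ((-1) * t) by ring. rewrite Rpow_mult_distr. field. apply pow_nonzero; lra.
Qed.

(* [A(t) = t^-n DI (bump i j) w] tends to [+- Kmass] times the derivative of [w] as [t -> 0]. *)
Lemma jD_near J i j x y t B :
  is_C2 J -> (i + j <= 2)%nat -> 0 < t ->
  (forall e, 0 < e <= t ->
     Rabs (DI (bump i j) (j0 J) x y t / t ^ (i + j) - DI (bump i j) (j0 J) x y e / e ^ (i + j)) <= B) ->
  Rabs (DI (bump i j) (j0 J) x y t / t ^ (i + j) - (-1) ^ (i + j) * (Kmass * jD J i j x y)) <= B.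
Proof.
  intros HJ Hij Ht Hb.
  rewrite <- DI_K_0 by (apply cont2_jD; auto).
  apply (lim_bound (fun e => DI (bump i j) (j0 J) x y t / t ^ (i + j)
    - (-1) ^ (i + j) * DI (bump 0 0) (jD J i j) x y e) t B Ht).
  - intros e. apply ct_minus; [apply continuous_const|]. apply ct_mult; [apply continuous_const|].
    apply (DI_ct (bump 0 0) (cont2_K 0 0) _ x y (cont2_jD J i j HJ)).
  - intros e He. rewrite <- (DI_K_quot J i j x y e) by (auto; lra). apply Hb; auto.
Qed.

Lemma jD_from_quot J i j x y B Q :
  is_C2 J -> (i + j <= 2)%nat ->
  Rabs (Q - (-1) ^ (i + j) * (Kmass * jD J i j x y)) <= B ->
  Kmass * Rabs (jD J i j x y) <= Rabs Q + B.
Proof.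
  intros HJ Hij Hb.
  assert (E : Kmass * Rabs (jD J i j x y) = Rabs ((-1) ^ (i + j) * (Kmass * jD J i j x y))).
  { rewrite !Rabs_mult, pow_1_abs, (Rabs_pos_eq Kmass); [ring | left; apply Kmass_pos]. }
  rewrite E. set (P := _ * (Kmass * _)) in *.
  replace P with (Q - (Q - P)) by ring.
  eapply Rle_trans; [apply Rabs_triang|]. rewrite Rabs_Ropp. lra.
Qed.

(** The hypothesis bounds [u] times the average because the Laplacian is at first controlled by
    square integrals over slices only, and its averages at scale [u] may grow like [1 / sqrt u]. *)
Lemma sup_est J x y r B : is_C2 J -> 0 < r ->
  (forall u, 0 < u <= r -> Rabs (u * DI (Psi 0 0) (lap J) x y u) <= B) ->
  Kmass * Rabs (j0 J x y) <= Rabs (DI (bump 0 0) (j0 J) x y r) + B * r.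
Proof.
  intros HJ Hr HB.
  assert (B0 : 0 <= B) by (eapply Rle_trans; [apply Rabs_pos | apply (HB r); lra]).
  assert (N := jD_near J 0 0 x y r (B * r) HJ ltac:(lia) Hr).
  apply jD_from_quot in N; auto.
  - simpl in N. unfold Rdiv in N. rewrite Rinv_1, Rmult_1_r in N. exact N.
  - intros e He. apply Rle_trans with (B * r - B * e); [|nra].
    apply (DI_K_growth J 0 0 x y (fun u => B * u) (fun _ => B)); auto; try lra.
    + intros u _. eapply dr_eq; [apply (dr_scal B (fun u => u)); apply dr_id | ring].
    + intros u Hu. simpl. unfold Rdiv; rewrite Rinv_1, Rmult_1_r. apply HB; lra.
Qed.

Lemma grad_est J i j x y r W M : is_C2 J -> (i + j = 1)%nat -> 0 < r ->
  (forall s z, box x y r s z -> Rabs (j0 J s z) <= W) ->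
  (forall s z, box x y r s z -> Rabs (lap J s z) <= M) ->
  Kmass * Rabs (jD J i j x y) <= 4 * CK * W / r + 4 * CK * M * r.
Proof.
  intros HJ Hij Hr HW HM.
  assert (M0 : 0 <= M) by (eapply Rle_trans; [apply Rabs_pos | apply (HM x y); split; lra]).
  assert (N := jD_near J i j x y r (4 * CK * M * r) HJ ltac:(lia) Hr).
  apply jD_from_quot in N; auto; try lia.
  - eapply Rle_trans; [exact N|]. apply Rplus_le_compat_r.
    rewrite Hij, pow_1. unfold Rdiv. rewrite Rabs_mult, Rabs_inv, (Rabs_pos_eq r) by lra.
    apply Rmult_le_compat_r; [left; apply Rinv_0_lt_compat; auto|].
    apply DI_K_sup; auto; try lia; try lra. apply (C2_0 J HJ).
  - intros e He. assert (0 <= 4 * CK * M) by nra. apply Rle_trans with (4 * CK * M * r - 4 * CK * M * e); [|nra].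
    apply (DI_K_growth J i j x y (fun u => 4 * CK * M * u) (fun _ => 4 * CK * M)); auto; try lia; try lra.
    + intros u _. eapply dr_eq; [apply (dr_scal (4 * CK * M) (fun u => u)); apply dr_id | ring].
    + intros u Hu. rewrite Hij, pow_1.
      replace (u * DI (Psi i j) (lap J) x y u / u) with (DI (Psi i j) (lap J) x y u) by (field; lra).
      apply DI_Psi_sup; auto using cont2_lap; try lia; try lra.
      intros s z [Hs Hz]; apply HM; split; lra.
Qed.
End Estimates.

Lemma is_derive_Rpower a u : 0 < u ->
  is_derive (fun u => Rpower u a) u (a * Rpower u (a - 1)).
Proof.
  intros Hu. apply is_derive_Reals. apply derivable_pt_lim_power; auto.
Qed.

Lemma Rpower_pos x a : 0 < Rpower x a.
Proof. apply exp_pos. Qed.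

Lemma Rpower_mult_1 d a : 0 < d -> d * Rpower d (a - 1) = Rpower d a.
Proof.
  intros Hd. rewrite <- (Rpower_1 d Hd) at 1. rewrite <- Rpower_plus. f_equal; ring.
Qed.

Lemma Rpower_le_base x y a : 0 < x <= y -> 0 <= a -> Rpower x a <= Rpower y a.
Proof. intros; apply Rle_Rpower_l; lra. Qed.

Lemma Rpower_le_1 x a : 0 < x <= 1 -> 0 <= a -> Rpower x a <= 1.
Proof.
  intros Hx Ha. replace 1 with (Rpower 1 a); [apply Rpower_le_base; lra|].
  unfold Rpower; rewrite ln_1, Rmult_0_r; apply exp_0.
Qed.

Lemma Rpower_ge_id x a : 0 < x <= 1 -> 0 <= a <= 1 -> x <= Rpower x a.
Proof.
  intros Hx Ha. rewrite <- (Rpower_mult_1 x a) by lra.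
  assert (1 <= Rpower x (a - 1)); [|nra].
  assert (ln x <= 0).
  { rewrite <- ln_1. destruct (Req_dec x 1) as [->|]; [lra|]. left; apply ln_increasing; lra. }
  assert (P : 0 <= (a - 1) * ln x) by nra.
  assert (exp 0 <= exp ((a - 1) * ln x)); [|rewrite exp_0 in *; auto].
  destruct P as [P|P]; [left; apply exp_increasing; auto | right; f_equal; auto].
Qed.

Lemma lipschitz_MVT (f f' : R -> R) a b L :
  (forall x, Rmin a b <= x <= Rmax a b -> is_derive f x (f' x)) ->
  (forall x, Rmin a b <= x <= Rmax a b -> Rabs (f' x) <= L) ->
  Rabs (f b - f a) <= L * Rabs (b - a).
Proof.
  intros Hd HL.
  destruct (MVT_gen f a b f') as [c [Hc E]].
  - intros x Hx; apply Hd; lra.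
  - intros x Hx; apply continuity_pt_filterlim, (ct_der f _ _ (Hd x Hx)).
  - rewrite E, Rabs_mult. apply Rmult_le_compat_r; [apply Rabs_pos | auto].
Qed.

(** * Schauder estimates for second derivatives *)

Section Second.
Context (CK : R) (HCK : 1 <= CK).
Context (HK : forall i j a b, (i + j <= 3)%nat -> -1 <= a <= 1 -> -1 <= b <= 1 ->
  Rabs (bump i j a b) <= CK /\ Rabs (Psi i j a b) <= CK).
Context (al : R) (Hal : 0 < al < 1).

Definition holder_at (f : R -> R -> R) x y r H :=
  forall u s z, 0 < u <= r -> box x y u s z -> Rabs (f s z - f x y) <= H * Rpower u al.

Lemma DI_Psi_holder J i j x y r H u : is_C2 J -> (1 <= i + j <= 3)%nat ->
  holder_at (lap J) x y r H -> 0 < u <= r ->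
  Rabs (DI (Psi i j) (lap J) x y u) <= 4 * CK * (H * Rpower u al).
Proof.
  intros HJ Hij HH Hu. apply DI_Psi_osc; auto using cont2_lap; try lra.
Qed.

Lemma holder_at_pos f x y r H : 0 < r -> holder_at f x y r H -> 0 <= H.
Proof.
  intros Hr HH. assert (A := HH r x y ltac:(lra) ltac:(split; lra)).
  assert (P := Rpower_pos r al). generalize (Rabs_pos (f x y - f x y)). intros. nra.
Qed.

(** For [i + j = 2] the growth rate is [DI (Psi i j) (lap J) / u], of size [H u^(al - 1)] by
    cancellation; its integral from 0 to [t] is [H t^al / al]. *)
Lemma D2_near J i j x y r H t : is_C2 J -> (i + j = 2)%nat -> 0 < t <= r ->
  holder_at (lap J) x y r H ->
  Rabs (DI (bump i j) (j0 J) x y t / t ^ 2 - Kmass * jD J i j x y) <= 4 * CK * H / al * Rpower t al.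
Proof.
  intros HJ Hij Ht HH.
  assert (H0 : 0 <= H) by (eapply holder_at_pos; [|exact HH]; lra).
  assert (N := jD_near J i j x y t (4 * CK * H / al * Rpower t al) HJ ltac:(lia) ltac:(lra)).
  rewrite Hij in N. replace ((-1) ^ 2) with 1 in N by ring. rewrite Rmult_1_l in N.
  apply N. intros e He. rewrite <- Hij.
  assert (P0 : 0 <= 4 * CK * H / al).
  { apply Rmult_le_pos; [nra | left; apply Rinv_0_lt_compat; lra]. }
  eapply Rle_trans.
  - apply (DI_K_growth J i j x y (fun u => 4 * CK * H / al * Rpower u al)
      (fun u => 4 * CK * H * Rpower u (al - 1))); auto; try lia; try lra.
    + intros u Hu. eapply dr_eq; [apply dr_scal, is_derive_Rpower; lra | field; lra].
    + intros u Hu. rewrite Hij.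
      replace (u * DI (Psi i j) (lap J) x y u / u ^ 2) with (DI (Psi i j) (lap J) x y u * / u) by (field; lra).
      rewrite Rabs_mult, (Rabs_pos_eq (/ u)) by (left; apply Rinv_0_lt_compat; lra).
      apply Rmult_le_reg_r with u; [lra|]. rewrite Rmult_assoc, Rinv_l, Rmult_1_r by lra.
      rewrite Rmult_assoc, (Rmult_comm _ u), Rpower_mult_1 by lra.
      rewrite Rmult_assoc. apply (DI_Psi_holder J i j x y r); auto; try lia; lra.
  - generalize (Rpower_pos e al). intros. nra.
Qed.

Lemma D2_est J i j x y r W H : is_C2 J -> (i + j = 2)%nat -> 0 < r <= 1 ->
  (forall s z, box x y r s z -> Rabs (j0 J s z) <= W) ->
  holder_at (lap J) x y r H ->
  Kmass * Rabs (jD J i j x y) <= 4 * CK * W / r ^ 2 + 4 * CK * H / al.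
Proof.
  intros HJ Hij Hr HW HH.
  assert (H0 : 0 <= H) by (eapply holder_at_pos; [|exact HH]; lra).
  assert (N := D2_near J i j x y r H r HJ Hij ltac:(lra) HH).
  assert (S : Rabs (DI (bump i j) (j0 J) x y r / r ^ 2) <= 4 * CK * W / r ^ 2).
  { assert (0 < r ^ 2) by (apply pow_lt; lra).
    unfold Rdiv. rewrite Rabs_mult, Rabs_inv, (Rabs_pos_eq (r ^ 2)) by lra.
    apply Rmult_le_compat_r; [left; apply Rinv_0_lt_compat; auto|].
    apply DI_K_sup; auto; try lia; try lra. apply (C2_0 J HJ). }
  assert (P : 4 * CK * H / al * Rpower r al <= 4 * CK * H / al).
  { generalize (Rpower_le_1 r al ltac:(lra) ltac:(lra)).
    assert (0 <= 4 * CK * H / al).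
    { apply Rmult_le_pos; [nra | left; apply Rinv_0_lt_compat; lra]. }
    nra. }
  rewrite <- (Rabs_pos_eq Kmass) by (left; apply Kmass_pos). rewrite <- Rabs_mult.
  set (Q := DI (bump i j) (j0 J) x y r / r ^ 2) in *.
  replace (Kmass * jD J i j x y) with (Q - (Q - Kmass * jD J i j x y)) by ring.
  eapply Rle_trans; [apply Rabs_triang|]. rewrite Rabs_Ropp. lra.
Qed.

(** Now the rate is of size [H u^(al - 2)], which is not integrable at 0: the third derivative need
    not exist, but its approximation at scale [d] is reached by integrating downwards from [r] and
    blows up like [d^(al - 1)] only. *)
Lemma D3_quot_est J i j x y r W H d : is_C2 J -> (i + j = 3)%nat -> 0 < d <= r ->
  (forall s z, box x y r s z -> Rabs (j0 J s z) <= W) ->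
  holder_at (lap J) x y r H ->
  Rabs (DI (bump i j) (j0 J) x y d / d ^ 3)
  <= 4 * CK * W / r ^ 3 + 4 * CK * H / (1 - al) * Rpower d (al - 1).
Proof.
  intros HJ Hij Hd HW HH.
  assert (H0 : 0 <= H) by (eapply holder_at_pos; [|exact HH]; lra).
  assert (P0 : 0 <= 4 * CK * H / (1 - al)).
  { apply Rmult_le_pos; [nra | left; apply Rinv_0_lt_compat; lra]. }
  assert (S : Rabs (DI (bump i j) (j0 J) x y r / r ^ 3) <= 4 * CK * W / r ^ 3).
  { assert (0 < r ^ 3) by (apply pow_lt; lra).
    unfold Rdiv. rewrite Rabs_mult, Rabs_inv, (Rabs_pos_eq (r ^ 3)) by lra.
    apply Rmult_le_compat_r; [left; apply Rinv_0_lt_compat; auto|].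
    apply DI_K_sup; auto; try lia; try lra. apply (C2_0 J HJ). }
  assert (Gr : Rabs (DI (bump i j) (j0 J) x y r / r ^ (i + j) - DI (bump i j) (j0 J) x y d / d ^ (i + j))
     <= - (4 * CK * H / (1 - al)) * Rpower r (al - 1) - - (4 * CK * H / (1 - al)) * Rpower d (al - 1)).
  { apply (DI_K_growth J i j x y (fun u => - (4 * CK * H / (1 - al)) * Rpower u (al - 1))
      (fun u => 4 * CK * H * Rpower u (al - 1 - 1))); auto; try lia; try lra.
    + intros u Hu. eapply dr_eq; [apply dr_scal, is_derive_Rpower; lra | field; lra].
    + intros u Hu. rewrite Hij.
      replace (u * DI (Psi i j) (lap J) x y u / u ^ 3) with (DI (Psi i j) (lap J) x y u * / (u * u)) by (field; lra).
      assert (0 < u * u) by nra.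
      rewrite Rabs_mult, (Rabs_pos_eq (/ (u * u))) by (left; apply Rinv_0_lt_compat; lra).
      apply Rmult_le_reg_r with (u * u); [lra|]. rewrite Rmult_assoc, Rinv_l, Rmult_1_r by lra.
      replace (4 * CK * H * Rpower u (al - 1 - 1) * (u * u))
        with (4 * CK * (H * (u * (u * Rpower u (al - 1 - 1))))) by ring.
      rewrite !Rpower_mult_1 by lra.
      apply (DI_Psi_holder J i j x y r); auto; try lia; lra. }
  rewrite Hij in Gr. generalize (Rpower_pos r (al - 1)); intros.
  set (Q := DI (bump i j) (j0 J) x y r / r ^ 3) in *.
  set (Q' := DI (bump i j) (j0 J) x y d / d ^ 3) in *.
  replace Q' with (Q - (Q - Q')) by ring.
  eapply Rle_trans; [apply Rabs_triang|]. rewrite Rabs_Ropp. nra.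
Qed.

(** Both second derivatives are replaced by their quotients at scale [d], with errors given by
    [D2_near]. The derivatives of these quotients in [x] and [y] are third order quotients, so a
    displacement by [d] changes them by about [d * d^(al - 1)]. *)
Lemma D2_holder J i j x y x' y' r W H d : is_C2 J -> (i + j = 2)%nat -> 0 < d <= r -> r <= 1 ->
  Rabs (x' - x) <= d -> Rabs (y' - y) <= d ->
  (forall s z, box x y (2 * r) s z -> Rabs (j0 J s z) <= W) ->
  (forall s z, box x y r s z -> holder_at (lap J) s z r H) ->
  Kmass * Rabs (jD J i j x' y' - jD J i j x y)
  <= 8 * CK * (/ al + / (1 - al) + 1) * (H + W / r ^ 3) * Rpower d al.
Proof.
  intros HJ Hij Hd Hr Hx Hy HW HH.
  apply Rabs_le_between in Hx; apply Rabs_le_between in Hy.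
  assert (H0 : 0 <= H) by (eapply holder_at_pos; [|apply (HH x y)]; [lra|split; lra]).
  assert (W0 : 0 <= W) by (eapply Rle_trans; [apply Rabs_pos | apply (HW x y); split; lra]).
  assert (Hn2 : d ^ 2 <> 0) by (apply pow_nonzero; lra).
  set (Q3 := 4 * CK * W / r ^ 3 + 4 * CK * H / (1 - al) * Rpower d (al - 1)).
  assert (B3 : forall a b s z, (a + b = 3)%nat -> box x y d s z ->
    Rabs (DI (bump a b) (j0 J) s z d / d ^ 3) <= Q3).
  { intros a b s z Hab [Hs Hz]. apply (D3_quot_est J a b s z r W H d); auto.
    - intros s' z' [Hs' Hz']. apply HW; split; lra.
    - apply HH; split; lra. }
  assert (X : Rabs (DI (bump i j) (j0 J) x' y d / d ^ 2 - DI (bump i j) (j0 J) x y d / d ^ 2) <= Q3 * Rabs (x' - x)).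
  { apply (lipschitz_MVT (fun x => DI (bump i j) (j0 J) x y d / d ^ 2)
      (fun x => DI (bump i j) (j1 J) x y d / d ^ 2)).
    - intros s _. apply (is_derive_ext (fun x => / d ^ 2 * DI (bump i j) (j0 J) x y d)); [intros; unfold Rdiv; apply Rmult_comm|].
      eapply dr_eq; [apply dr_scal, (DI_dx _ (cont2_K i j) _ _ _ s y d (C2_0 J HJ)) | unfold Rdiv; ring].
    - intros s Hs.
      assert (E := DI_K_a i j _ _ _ s y d ltac:(lia) (C2_0 J HJ)).
      replace (DI (bump i j) (j1 J) s y d / d ^ 2) with (- (DI (bump (S i) j) (j0 J) s y d / d ^ 3))
        by (rewrite E; field; lra).
      rewrite Rabs_Ropp. apply B3; [lia|].
      unfold Rmin, Rmax in Hs; destruct (Rle_dec x x'); split; lra. }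
  assert (Y : Rabs (DI (bump i j) (j0 J) x' y' d / d ^ 2 - DI (bump i j) (j0 J) x' y d / d ^ 2) <= Q3 * Rabs (y' - y)).
  { apply (lipschitz_MVT (fun y => DI (bump i j) (j0 J) x' y d / d ^ 2)
      (fun y => DI (bump i j) (j2 J) x' y d / d ^ 2)).
    - intros s _. apply (is_derive_ext (fun y => / d ^ 2 * DI (bump i j) (j0 J) x' y d)); [intros; unfold Rdiv; apply Rmult_comm|].
      eapply dr_eq; [apply dr_scal, (DI_dy _ (cont2_K i j) _ _ _ x' s d (C2_0 J HJ)) | unfold Rdiv; ring].
    - intros s Hs.
      assert (E := DI_K_b i j _ _ _ x' s d ltac:(lia) (C2_0 J HJ)).
      replace (DI (bump i j) (j2 J) x' s d / d ^ 2) with (- (DI (bump i (S j)) (j0 J) x' s d / d ^ 3))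
        by (rewrite E; field; lra).
      rewrite Rabs_Ropp. apply B3; [lia|].
      unfold Rmin, Rmax in Hs; destruct (Rle_dec y y'); split; lra. }
  assert (N := D2_near J i j x y r H d HJ Hij Hd (HH x y ltac:(split; lra))).
  assert (N' := D2_near J i j x' y' r H d HJ Hij Hd (HH x' y' ltac:(split; lra))).
  assert (R3 : 0 < r ^ 3) by (apply pow_lt; lra).
  assert (D0 : d <= Rpower d al) by (apply Rpower_ge_id; lra).
  assert (Wr : 0 <= W / r ^ 3) by (apply Rmult_le_pos; [lra | left; apply Rinv_0_lt_compat; auto]).
  assert (Pd := Rpower_pos d al).
  assert (Ia : 0 < / al) by (apply Rinv_0_lt_compat; lra).
  assert (Ib : 0 < / (1 - al)) by (apply Rinv_0_lt_compat; lra).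
  assert (Q30 : 0 <= Q3).
  { unfold Q3, Rdiv in *. generalize (Rpower_pos d (al - 1)); intros.
    apply Rplus_le_le_0_compat; [nra|]. repeat apply Rmult_le_pos; lra. }
  assert (XX : Rabs (x' - x) <= d) by (apply Rabs_le; lra).
  assert (YY : Rabs (y' - y) <= d) by (apply Rabs_le; lra).
  (* The singular part uses [d * d^(al - 1) = d^al], the regular part [d <= d^al] for [d <= 1]. *)
  assert (Qd : Q3 * d <= 4 * CK * (W / r ^ 3) * Rpower d al + 4 * CK * H * / (1 - al) * Rpower d al).
  { unfold Q3. rewrite Rmult_plus_distr_r. apply Rplus_le_compat.
    - unfold Rdiv in *. rewrite !(Rmult_assoc (4 * CK)). apply Rmult_le_compat_l; [lra|].
      apply Rmult_le_compat_l; auto.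
    - rewrite <- (Rpower_mult_1 d al) by lra. right; field; lra. }
  rewrite <- (Rabs_pos_eq Kmass) by (left; apply Kmass_pos). rewrite <- Rabs_mult.
  apply Rabs_le_between in X; apply Rabs_le_between in Y;
  apply Rabs_le_between in N; apply Rabs_le_between in N'.
  unfold Rdiv in *.
  assert (F : 8 * CK * (/ al + / (1 - al) + 1) * (H + W * / r ^ 3) * Rpower d al >=
     2 * (4 * CK * H * / al * Rpower d al) + 2 * (Q3 * d)).
  { assert (0 <= CK * (/ al) * (W * / r ^ 3) * Rpower d al) by (apply Rmult_le_pos; [apply Rmult_le_pos; [apply Rmult_le_pos|]|]; lra).
    assert (0 <= CK * (/ (1 - al)) * (W * / r ^ 3) * Rpower d al) by (apply Rmult_le_pos; [apply Rmult_le_pos; [apply Rmult_le_pos|]|]; lra).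
    assert (0 <= CK * H * Rpower d al) by (apply Rmult_le_pos; [apply Rmult_le_pos|]; lra).
    lra. }
  assert (Q3 * Rabs (x' - x) <= Q3 * d) by (apply Rmult_le_compat_l; auto).
  assert (Q3 * Rabs (y' - y) <= Q3 * d) by (apply Rmult_le_compat_l; auto).
  apply Rabs_le; lra.
Qed.
End Second.

(** * Reflection across a Robin boundary *)

Definition glue (c : R) (f h : R -> R) (x : R) : R := if Rle_dec x c then f x else h x.

Lemma glue_le c f h x : x <= c -> glue c f h x = f x.
Proof. unfold glue; destruct Rle_dec; lra. Qed.
Lemma glue_ge c f h x : f c = h c -> c <= x -> glue c f h x = h x.
Proof. unfold glue; destruct Rle_dec; auto; intros. replace x with c by lra; auto. Qed.

Lemma ball_R (x e y : R) : ball x e y -> Rabs (y - x) < e.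
Proof. exact (fun H => H). Qed.

Lemma glue_derive c f h f' h' x : f c = h c -> f' c = h' c ->
  (forall x, is_derive f x (f' x)) -> (forall x, is_derive h x (h' x)) ->
  is_derive (glue c f h) x (glue c f' h' x).
Proof.
  intros E E' Hf Hh.
  destruct (Rtotal_order x c) as [H|[->|H]].
  - rewrite glue_le by lra. apply (is_derive_ext_loc f); auto.
    assert (P : 0 < c - x) by lra. exists (mkposreal _ P). intros y Hy.
    apply ball_R, Rabs_lt_between in Hy; simpl in Hy. rewrite glue_le; auto; lra.
  - rewrite glue_le by lra. apply is_derive_Reals.
    assert (A := proj1 (is_derive_Reals _ _ _) (Hf c)).
    assert (B := proj1 (is_derive_Reals _ _ _) (Hh c)).
    intros eps He. destruct (A eps He) as [d1 H1], (B eps He) as [d2 H2].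
    exists (mkposreal _ (Rmin_pos _ _ (cond_pos d1) (cond_pos d2))); simpl.
    intros k Hk Hkd.
    rewrite (glue_le c f h c) by lra.
    destruct (Rle_dec (c + k) c) as [L|L].
    + rewrite glue_le by auto. apply H1; auto. eapply Rlt_le_trans; [exact Hkd | apply Rmin_l].
    + rewrite glue_ge by (auto; lra). rewrite E, E'. apply H2; auto.
      eapply Rlt_le_trans; [exact Hkd | apply Rmin_r].
  - rewrite glue_ge by (auto; lra). apply (is_derive_ext_loc h); auto.
    assert (P : 0 < x - c) by lra. exists (mkposreal _ P). intros y Hy.
    apply ball_R, Rabs_lt_between in Hy; simpl in Hy. rewrite glue_ge; auto; lra.
Qed.

Lemma glue_cont c f h : f c = h c -> cont1 f -> cont1 h -> cont1 (glue c f h).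
Proof.
  intros E Hf Hh x.
  (* A formula without case distinction: [f] is evaluated at the minimum of [x] and [c], [h] at
     their maximum. *)
  apply continuous_ext with (fun x => f (x - Rmax 0 (x - c)) + (h (c + Rmax 0 (x - c)) - h c)).
  - assert (W : forall y : R, f (y - Rmax 0 (y - c)) + (h (c + Rmax 0 (y - c)) - h c) = glue c f h y);
      [|exact W].
    intros y. unfold glue; destruct (Rle_dec y c).
    + rewrite Rmax_left by lra. rewrite Rminus_0_r, Rplus_0_r. ring.
    + rewrite Rmax_right by lra. replace (y - (y - c)) with c by ring.
      replace (c + (y - c)) with y by ring. rewrite E. ring.
  - assert (M := cont1_Rmax0). ct.
Qed.

Section Reflection.
Context (kap l : R).

(** The solution of [V' = kap V + g (l - t)] with [V 0 = 0], by variation of constants. *)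
Definition rV (g : R -> R) (t : R) : R :=
  exp (kap * t) * RInt (fun tau => exp (- kap * tau) * g (l - tau)) 0 t.

(* With [g' l = kap * g l] this continues [g] across [l] as a C^2 function:
   it makes [g' - kap g] odd about [l]. *)
Definition refl (g : R -> R) (t : R) : R := g (l - t) + 2 * kap * rV g t.

Definition refl1 (g g1 : R -> R) (t : R) : R :=
  - g1 (l - t) + 2 * kap * (kap * rV g t + g (l - t)).

Lemma rV_0 g : rV g 0 = 0.
Proof. unfold rV. rewrite RInt_point. unfold zero; simpl. ring. Qed.

Lemma is_derive_rV g t : cont1 g -> is_derive (rV g) t (kap * rV g t + g (l - t)).
Proof.
  intros Hg. unfold rV.
  assert (D1 : is_derive (fun t => exp (kap * t)) t (kap * exp (kap * t)))
    by (auto_derive; auto; ring).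
  eapply dr_eq; [apply (dr_mult (fun t => exp (kap * t))
    (fun t => RInt (fun tau => exp (- kap * tau) * g (l - tau)) 0 t) t _ (exp (- kap * t) * g (l - t)) D1);
    apply (is_derive_RInt1 (fun tau => exp (- kap * tau) * g (l - tau))); ct|].
  assert (X : exp (kap * t) * exp (- kap * t) = 1).
  { rewrite <- exp_plus. replace (kap * t + - kap * t) with 0 by ring. apply exp_0. }
  simpl. set (I := RInt _ _ _).
  replace (exp (kap * t) * (exp (- kap * t) * g (l - t))) with (g (l - t) * (exp (kap * t) * exp (- kap * t))) by ring.
  rewrite X. ring.
Qed.

Lemma is_derive_flip (g g1 : R -> R) t : (forall s, is_derive g s (g1 s)) ->
  is_derive (fun t => g (l - t)) t (- g1 (l - t)).
Proof.
  intros H. eapply dr_eq; [apply (dr_comp g (fun t => l - t) t _ (-1) (H _))|ring].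
  auto_derive; auto; ring.
Qed.

Lemma is_derive_refl (g g1 : R -> R) t : (forall s, is_derive g s (g1 s)) ->
  is_derive (refl g) t (refl1 g g1 t).
Proof.
  intros H. apply dr_plus.
  - apply is_derive_flip; auto.
  - apply dr_scal, is_derive_rV. intros s; apply (ct_der _ _ _ (H s)).
Qed.

(** [refl] commutes with the second derivative. The value of [rV g2] comes from an explicit
    primitive whose boundary term at [t = 0] is [kap * g l - g1 l], zero by the Robin condition.
    Consequently the Laplacian of a reflected function is the reflection of its Laplacian. *)
Lemma is_derive_refl1 (g g1 g2 : R -> R) t :
  (forall s, is_derive g s (g1 s)) -> (forall s, is_derive g1 s (g2 s)) -> cont1 g2 ->
  g1 l = kap * g l -> 0 <= t ->
  is_derive (refl1 g g1) t (refl g2 t).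
Proof.
  intros H H1 H2 BC Ht.
  assert (C0 : cont1 g) by (intros s; apply (ct_der _ _ _ (H s))).
  assert (C1 : cont1 g1) by (intros s; apply (ct_der _ _ _ (H1 s))).
  assert (CV : cont1 (rV g)) by (intros s; apply (ct_der _ _ _ (is_derive_rV g s C0))).
  unfold refl1, refl.
  assert (EV : rV g2 t = kap * (kap * rV g t + g (l - t)) - g1 (l - t)).
  { unfold rV at 1.
    rewrite (RInt_FTC (fun s => exp (- kap * s) * (kap * (kap * rV g s + g (l - s)) - g1 (l - s)))); auto.
    - rewrite rV_0, Rmult_0_r, exp_0, Rminus_0_r, BC.
      replace (exp (kap * t) * (exp (- kap * t) * (kap * (kap * rV g t + g (l - t)) - g1 (l - t)) -
         1 * (kap * (kap * 0 + g l) - kap * g l)))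
       with ((exp (kap * t) * exp (- kap * t)) * (kap * (kap * rV g t + g (l - t)) - g1 (l - t))) by ring.
      rewrite <- exp_plus. replace (kap * t + - kap * t) with 0 by ring. rewrite exp_0. ring.
    - intros s _.
      assert (D1 : is_derive (fun t => exp (- kap * t)) s (- kap * exp (- kap * s)))
        by (auto_derive; auto; ring).
      eapply dr_eq.
      + eapply (dr_mult (fun t => exp (- kap * t))
          (fun s => kap * (kap * rV g s + g (l - s)) - g1 (l - s)) s _ _ D1).
        apply (dr_minus (fun s => kap * (kap * rV g s + g (l - s)))); [apply dr_scal, dr_plus|].
        * apply dr_scal, is_derive_rV; auto.
        * apply is_derive_flip, H.
        * apply is_derive_flip, H1.
      + simpl. ring.
    - ct.
    - ct. }
  rewrite EV.
  eapply dr_eq.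
  - apply dr_plus; [apply dr_opp, is_derive_flip, H1|]. apply dr_scal, dr_plus.
    + apply dr_scal, is_derive_rV; auto.
    + apply is_derive_flip, H.
  - simpl. ring.
Qed.

Lemma rV_ext g h t : 0 <= t -> (forall s, l - t <= s <= l -> g s = h s) -> rV g t = rV h t.
Proof.
  intros Ht H. unfold rV. f_equal. apply RInt_ext. intros s Hs.
  rewrite Rmin_left, Rmax_right in Hs by lra. rewrite H; auto; lra.
Qed.

Lemma refl_ext g h t : 0 <= t -> (forall s, l - t <= s <= l -> g s = h s) -> refl g t = refl h t.
Proof. intros Ht H. unfold refl. rewrite (rV_ext g h t), H; auto; lra. Qed.

Lemma rV_scal c g t : cont1 g -> rV (fun s => c * g s) t = c * rV g t.
Proof.
  intros Hg. unfold rV.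
  rewrite (RInt_ext' _ (fun tau => c * (exp (- kap * tau) * g (l - tau)))) by (intros; ring).
  rewrite RInt_scal'; [ring|ct].
Qed.

Lemma rV_plus g h t : cont1 g -> cont1 h -> rV (fun s => g s + h s) t = rV g t + rV h t.
Proof.
  intros Hg Hh. unfold rV.
  rewrite (RInt_ext' _ (fun tau => exp (- kap * tau) * g (l - tau) + exp (- kap * tau) * h (l - tau)))
    by (intros; ring).
  rewrite RInt_plus'; [ring|ct|ct].
Qed.

Lemma refl_scal c g t : cont1 g -> refl (fun s => c * g s) t = c * refl g t.
Proof. intros; unfold refl; rewrite rV_scal; auto; ring. Qed.

Lemma refl_plus g h t : cont1 g -> cont1 h -> refl (fun s => g s + h s) t = refl g t + refl h t.
Proof. intros; unfold refl; rewrite rV_plus; auto; ring. Qed.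

Context (sig : R) (Hsig : sig * sig = 1) (Hl : 0 < l).

Definition ext3 (left mid right : R -> R) : R -> R := glue l (glue (- l) left mid) right.

Definition ext (g : R -> R) : R -> R :=
  ext3 (fun s => sig * refl g (- s - l)) g (fun s => refl g (s - l)).

Definition ext' (g g1 : R -> R) : R -> R :=
  ext3 (fun s => - sig * refl1 g g1 (- s - l)) g1 (fun s => refl1 g g1 (s - l)).

Lemma refl_0 g : refl g 0 = g l.
Proof. unfold refl. rewrite rV_0, Rminus_0_r. ring. Qed.
Lemma refl1_0 g g1 : g1 l = kap * g l -> refl1 g g1 0 = g1 l.
Proof. intros H; unfold refl1. rewrite rV_0, Rminus_0_r. lra. Qed.

Definition parity (s0 : R) (g : R -> R) := forall s, g (- s) = s0 * g s.

Lemma parity_derive s0 (g g1 : R -> R) : (forall s, is_derive g s (g1 s)) -> parity s0 g -> parity (- s0) g1.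
Proof.
  intros H P s.
  assert (D : is_derive (fun s => g (- s)) s (- g1 (- s))).
  { eapply dr_eq; [apply (dr_comp g (fun t => - t) s _ (-1) (H _))|ring]. auto_derive; auto; ring. }
  apply (is_derive_ext _ (fun s => s0 * g s)) in D; [|intros; apply P].
  assert (E := is_derive_unique _ _ _ D).
  assert (E' := is_derive_unique _ _ _ (dr_scal s0 g s _ (H s))).
  assert (- g1 (- s) = s0 * g1 s) by (transitivity (Derive (fun s => s0 * g s) s); auto).
  lra.
Qed.

Lemma ext3_in lf mid rt s : lf (- l) = mid (- l) -> - l <= s <= l -> ext3 lf mid rt s = mid s.
Proof. intros E Hs. unfold ext3. rewrite glue_le by lra. apply glue_ge; auto; lra. Qed.

Lemma ext3_out lf mid rt s : mid l = rt l -> l <= s -> ext3 lf mid rt s = rt s.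
Proof.
  intros E Hs. unfold ext3. apply glue_ge; auto. rewrite <- E.
  unfold glue; destruct Rle_dec; auto; lra.
Qed.

Lemma ext3_derive lf mid rt lf' mid' rt' s :
  lf (- l) = mid (- l) -> mid l = rt l -> lf' (- l) = mid' (- l) -> mid' l = rt' l ->
  (forall x, is_derive lf x (lf' x)) -> (forall x, is_derive mid x (mid' x)) ->
  (forall x, is_derive rt x (rt' x)) ->
  is_derive (ext3 lf mid rt) s (ext3 lf' mid' rt' s).
Proof.
  intros E1 E2 E3 E4 D1 D2 D3. apply glue_derive; auto.
  - rewrite <- E2. unfold glue; destruct Rle_dec; auto; lra.
  - rewrite <- E4. unfold glue; destruct Rle_dec; auto; lra.
  - intros x. apply glue_derive; auto.
Qed.

Section Ext.
Context (g g1 g2 : R -> R) (P : parity sig g)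
  (D : forall s, is_derive g s (g1 s)) (D1 : forall s, is_derive g1 s (g2 s))
  (C2 : cont1 g2) (BC : g1 l = kap * g l).

Lemma ext_derive s : is_derive (ext g) s (ext' g g1 s).
Proof.
  assert (P1 := parity_derive sig g g1 D P).
  apply ext3_derive; auto.
  - replace (- - l - l) with 0 by ring. rewrite refl_0, P; auto.
  - replace (l - l) with 0 by ring. rewrite refl_0; auto.
  - replace (- - l - l) with 0 by ring. rewrite refl1_0, P1; auto.
  - replace (l - l) with 0 by ring. rewrite refl1_0; auto.
  - intros x. eapply dr_eq.
    + apply dr_scal. eapply (dr_comp (refl g) (fun s => - s - l) x).
      * apply is_derive_refl, D.
      * instantiate (1 := -1). auto_derive; auto; ring.
    + ring.
  - intros x. eapply dr_eq.
    + eapply (dr_comp (refl g) (fun s => s - l) x).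
      * apply is_derive_refl, D.
      * instantiate (1 := 1). auto_derive; auto; ring.
    + ring.
Qed.

Lemma ext2_cont h : cont1 h -> parity sig h -> cont1 (ext h).
Proof.
  intros Ch Ph.
  assert (CV : cont1 (rV h)) by (intros s; apply (ct_der _ _ _ (is_derive_rV h s Ch))).
  unfold ext, ext3. apply glue_cont; [|apply glue_cont|]; auto; unfold refl; ct.
  - rewrite Rminus_diag, rV_0, Rminus_0_r. unfold glue; destruct Rle_dec; lra.
  - replace (- - l - l) with 0 by ring. rewrite rV_0, Ph, Rminus_0_r. ring.
Qed.

(* [is_derive_refl1] holds for [t >= 0] only: clamp [t] before gluing. *)
Lemma ext1_derive s : is_derive (ext' g g1) s (ext g2 s).
Proof.
  assert (P1 := parity_derive sig g g1 D P).
  assert (P2 := parity_derive _ g1 g2 D1 P1).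
  set (rt := fun t => glue 0 (fun t => g1 l + t * g2 l) (refl1 g g1) t).
  set (rt' := fun t => glue 0 (fun t => g2 l) (refl g2) t).
  assert (Drt : forall t, is_derive rt t (rt' t)).
  { intros t. destruct (Rle_dec 0 t) as [Ht|Ht].
    - destruct (Req_dec t 0) as [->|Hn].
      + assert (A := is_derive_refl1 g g1 g2 0 D D1 C2 BC ltac:(lra)).
        assert (B : is_derive (fun t => g1 l + t * g2 l) 0 (g2 l)) by (auto_derive; auto; ring).
        unfold rt'. rewrite glue_le by lra.
        rewrite refl_0 in A.
        apply is_derive_Reals. apply is_derive_Reals in A; apply is_derive_Reals in B.
        intros eps He. destruct (A eps He) as [d1 H1], (B eps He) as [d2 H2].
        exists (mkposreal _ (Rmin_pos _ _ (cond_pos d1) (cond_pos d2))); simpl.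
        intros k Hk Hkd. unfold rt. rewrite (glue_le 0 _ _ 0) by lra.
        destruct (Rle_dec (0 + k) 0) as [L|L].
        * rewrite glue_le by auto. apply H2; auto. eapply Rlt_le_trans; [exact Hkd | apply Rmin_r].
        * rewrite glue_ge by (try (rewrite refl1_0; auto; ring); lra).
          rewrite Rmult_0_l, Rplus_0_r. rewrite <- (refl1_0 g g1 BC) at 1.
          apply H1; auto. eapply Rlt_le_trans; [exact Hkd | apply Rmin_l].
      + unfold rt', rt. rewrite glue_ge by (try (rewrite refl_0; auto); lra).
        apply (is_derive_ext_loc (refl1 g g1)).
        * assert (Q : 0 < t) by lra. exists (mkposreal _ Q). intros y Hy.
          apply ball_R, Rabs_lt_between in Hy; simpl in Hy.
          rewrite glue_ge; auto; [rewrite refl1_0; auto; ring | lra].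
        * apply is_derive_refl1; auto.
    - unfold rt', rt. rewrite glue_le by lra.
      apply (is_derive_ext_loc (fun t => g1 l + t * g2 l)).
      + assert (Q : 0 < - t) by lra. exists (mkposreal _ Q). intros y Hy.
        apply ball_R, Rabs_lt_between in Hy; simpl in Hy.
        rewrite glue_le; auto; lra.
      + auto_derive; auto; ring. }
  assert (R0 : rt 0 = g1 l) by (unfold rt; rewrite glue_le by lra; ring).
  assert (R0' : rt' 0 = g2 l) by (unfold rt'; rewrite glue_le by lra; ring).
  assert (RP : forall t, 0 <= t -> rt t = refl1 g g1 t)
    by (intros t Ht; unfold rt; rewrite glue_ge; auto; rewrite refl1_0; auto; ring).
  assert (RP' : forall t, 0 <= t -> rt' t = refl g2 t)
    by (intros t Ht; unfold rt'; rewrite glue_ge; auto; rewrite refl_0; auto).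
  apply (is_derive_ext (ext3 (fun s => - sig * rt (- s - l)) g1 (fun s => rt (s - l)))).
  { intros t. unfold ext', ext3, glue.
    destruct (Rle_dec t l); [destruct (Rle_dec t (- l))|]; auto; rewrite RP; auto; lra. }
  replace (ext g2 s) with (ext3 (fun s => sig * rt' (- s - l)) g2 (fun s => rt' (s - l)) s).
  2:{ unfold ext, ext3, glue.
      destruct (Rle_dec s l); [destruct (Rle_dec s (- l))|]; auto; rewrite RP'; auto; lra. }
  apply ext3_derive; auto.
  - replace (- - l - l) with 0 by ring. rewrite R0, P1; auto.
  - replace (l - l) with 0 by ring. auto.
  - replace (- - l - l) with 0 by ring. rewrite R0', P2. lra.
  - replace (l - l) with 0 by ring. auto.
  - intros x. eapply dr_eq.
    + apply dr_scal. eapply (dr_comp (rt) (fun s => - s - l) x).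
      * apply Drt.
      * instantiate (1 := -1). auto_derive; auto; ring.
    + ring.
  - intros x. eapply dr_eq.
    + eapply (dr_comp (rt) (fun s => s - l) x).
      * apply Drt.
      * instantiate (1 := 1). auto_derive; auto; ring.
    + ring.
Qed.
End Ext.

Lemma ext_in g s : parity sig g -> - l <= s <= l -> ext g s = g s.
Proof.
  intros P Hs. apply ext3_in; auto.
  replace (- - l - l) with 0 by ring. rewrite refl_0, P; auto.
Qed.

Lemma ext_out g s : l <= s -> ext g s = refl g (s - l).
Proof. intros Hs. unfold ext. rewrite ext3_out; auto. rewrite Rminus_diag, refl_0; auto. Qed.

Lemma ext_parity g : parity sig g -> parity sig (ext g).
Proof.
  intros P s.
  destruct (Rle_dec (- l) s) as [L1|L1]; [destruct (Rle_dec s l) as [L2|L2]|].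
  - rewrite !ext_in by (auto; lra). apply P.
  - rewrite (ext_out g s) by lra. unfold ext, ext3.
    rewrite glue_le, glue_le by lra. f_equal; f_equal; ring.
  - rewrite (ext_out g (- s)) by lra. unfold ext, ext3.
    rewrite glue_le, glue_le by lra. rewrite <- Rmult_assoc, Hsig. ring.
Qed.

(** On this range the reflection reads its argument only on [[0, l]], where extension and original
    agree. The law can thus be stated for the extended function alone, in the form that is stable
    under linear combinations. *)
Lemma ext_self g s : parity sig g -> l <= s <= 2 * l ->
  ext g s = refl (ext g) (s - l).
Proof.
  intros P Hs. rewrite ext_out by lra. apply refl_ext; [lra|].
  intros t Ht. rewrite ext_in; auto; lra.
Qed.
End Reflection.

(** * From square integrals over slices to averages *)

Lemma RInt_flip f c a b : cont1 f -> RInt (fun t => f (c - t)) a b = RInt f (c - b) (c - a).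
Proof.
  intros Hf.
  assert (E := RInt_comp (V := R_CompleteNormedModule) f (fun t => c - t) (fun _ => -1) a b
    (fun x _ => Hf _)).
  assert (S := opp_RInt_swap (V := R_CompleteNormedModule) f (c - a) (c - b)
    ltac:(apply ex_RInt_cont1; auto)).
  rewrite <- S, <- E.
  - change (RInt (fun t => f (c - t)) a b = - RInt (fun t => -1 * f (c - t)) a b).
    rewrite (RInt_scal' (-1) (fun t => f (c - t))) by ct. lra.
  - intros x _; split; [auto_derive; auto; ring | apply continuous_const].
Qed.

Lemma RInt_affine f x t : cont1 f ->
  t * RInt (fun a => f (x + t * a)) (-1) 1 = RInt f (x - t) (x + t).
Proof.
  intros Hf.
  assert (E := RInt_comp (V := R_CompleteNormedModule) f (fun a => x + t * a) (fun _ => t) (-1) 1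
    (fun y _ => Hf _)).
  transitivity (RInt f (x + t * -1) (x + t * 1)); [|f_equal; ring].
  rewrite <- E.
  - rewrite <- RInt_scal' by ct. reflexivity.
  - intros y _; split; [auto_derive; auto; ring | apply continuous_const].
Qed.

Lemma RInt_mono f g a b : a <= b -> cont1 f -> cont1 g ->
  (forall x, a <= x <= b -> f x <= g x) -> RInt f a b <= RInt g a b.
Proof. intros; apply RInt_le; auto; try (apply ex_RInt_cont1; auto). intros; apply H2; lra. Qed.

Lemma RInt_nonneg f a b : a <= b -> cont1 f -> (forall x, 0 <= f x) -> 0 <= RInt f a b.
Proof. intros; apply RInt_ge_0; auto; apply ex_RInt_cont1; auto. Qed.

Lemma RInt_sub f a b c d : a <= c -> c <= d -> d <= b -> cont1 f -> (forall x, 0 <= f x) ->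
  RInt f c d <= RInt f a b.
Proof.
  intros H1 H2 H3 Hf H0.
  rewrite <- (RInt_Chasles f a c b), <- (RInt_Chasles f c d b) by (apply ex_RInt_cont1; auto).
  unfold plus; simpl.
  generalize (RInt_nonneg f a c H1 Hf H0) (RInt_nonneg f d b H3 Hf H0). lra.
Qed.

Lemma RInt_const' c a b : RInt (fun _ => c) a b = (b - a) * c.
Proof. rewrite RInt_const. reflexivity. Qed.

Lemma amgm x lam : 0 < lam -> Rabs x <= lam / 2 + / (2 * lam) * (x * x).
Proof.
  intros Hl. apply Rmult_le_reg_l with (2 * lam); [lra|].
  replace (2 * lam * (lam / 2 + / (2 * lam) * (x * x))) with (lam * lam + x * x) by (field; lra).
  assert (E : x * x = Rabs x * Rabs x) by (unfold Rabs; destruct Rcase_abs; ring).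
  rewrite E. generalize (Rle_0_sqr (lam - Rabs x)); unfold Rsqr; lra.
Qed.

(** Folds [[- 2 l, 2 l]] onto [[0, l]] by the reflections in 0 and in the two boundary points; each
    value is taken by four arcs, whence the factor 4 in [fold_L2]. *)
Definition fold (l s : R) : R := l - Rabs (l - Rabs s).

Lemma fold_in l s : 0 <= l -> - l <= s <= l -> fold l s = Rabs s.
Proof.
  intros Hl Hs. unfold fold. rewrite (Rabs_pos_eq (l - Rabs s)); [ring|].
  assert (Rabs s <= l) by (apply Rabs_le; lra). lra.
Qed.
Lemma fold_out l s : 0 <= l -> l <= s -> fold l s = 2 * l - s.
Proof.
  intros Hl Hs. unfold fold. rewrite (Rabs_pos_eq s), (Rabs_left1 (l - s)) by lra. ring.
Qed.
Lemma fold_opp l s : fold l (- s) = fold l s.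
Proof. unfold fold; rewrite Rabs_Ropp; auto. Qed.
Lemma cont1_fold l : cont1 (fold l).
Proof. unfold fold; ct. Qed.

Lemma fold_L2 w l : 0 < l -> cont1 w ->
  RInt (fun s => w (fold l s) * w (fold l s)) (- (2 * l)) (2 * l)
  = 4 * RInt (fun s => w s * w s) 0 l.
Proof.
  intros Hl Hw. assert (Cf := cont1_fold l).
  set (U := fun s => w (fold l s) * w (fold l s)).
  assert (CU : cont1 U) by (unfold U; ct).
  assert (E1 : RInt U 0 l = RInt (fun s => w s * w s) 0 l).
  { apply RInt_ext. intros s Hs. rewrite Rmin_left, Rmax_right in Hs by lra. unfold U.
    rewrite fold_in, Rabs_pos_eq by lra. auto. }
  assert (E2 : RInt U l (2 * l) = RInt (fun s => w s * w s) 0 l).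
  { transitivity (RInt (fun t => (fun s => w s * w s) (2 * l - t)) l (2 * l)).
    - apply RInt_ext. intros s Hs. rewrite Rmin_left, Rmax_right in Hs by lra. unfold U.
      rewrite fold_out by lra. auto.
    - rewrite (RInt_flip (fun s => w s * w s)) by ct. f_equal; ring. }
  assert (E3 : RInt U (- (2 * l)) 0 = RInt U 0 (2 * l)).
  { transitivity (RInt (fun t => U (0 - t)) (- (2 * l)) 0).
    - apply RInt_ext'. intros s. unfold U. replace (0 - s) with (- s) by ring. rewrite fold_opp; auto.
    - rewrite RInt_flip by auto. f_equal; ring. }
  rewrite <- (RInt_Chasles U (- (2 * l)) 0 (2 * l)), E3 by (apply ex_RInt_cont1; auto).
  rewrite <- (RInt_Chasles U 0 l (2 * l)), E1, E2 by (apply ex_RInt_cont1; auto).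
  unfold plus; simpl; ring.
Qed.

(** The AM-GM inequality at the level [lam = Q / sqrt t] plays the part of Cauchy-Schwarz on a
    window of length [2 t]. The constant 3 is 1 from the constant term plus 2 from the square. *)
Lemma fold_L1 w l x t Q : 0 < l -> cont1 w -> 0 < Q -> RInt (fun s => w s * w s) 0 l <= Q * Q ->
  - l <= x <= l -> 0 < t <= l ->
  RInt (fun a => Rabs (w (fold l (x + t * a)))) (-1) 1 <= 3 * Q / sqrt t.
Proof.
  intros Hl Hw HQ HI Hx Ht. assert (Cf := cont1_fold l).
  assert (St : 0 < sqrt t) by (apply sqrt_lt_R0; lra).
  assert (Sq : sqrt t * sqrt t = t) by (apply sqrt_sqrt; lra).
  set (lam := Q / sqrt t).
  assert (Hlam : 0 < lam) by (apply Rdiv_lt_0_compat; auto).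
  set (U := fun s => w (fold l s) * w (fold l s)).
  assert (CU : cont1 U) by (unfold U; ct).
  eapply Rle_trans.
  - apply (RInt_mono _ (fun a => lam / 2 + / (2 * lam) * U (x + t * a))); [lra|ct|ct|].
    intros a _. apply amgm; auto.
  - rewrite RInt_plus', RInt_const', RInt_scal' by ct.
    assert (B : t * RInt (fun a => U (x + t * a)) (-1) 1 <= 4 * (Q * Q)).
    { rewrite RInt_affine by auto.
      apply Rle_trans with (RInt U (- (2 * l)) (2 * l)).
      - apply RInt_sub; auto; try lra. intros s; unfold U; nra.
      - unfold U; rewrite fold_L2 by auto. lra. }
    set (I := RInt (fun a => U (x + t * a)) (-1) 1) in *.
    assert (I <= 4 * (lam * lam)).
    { apply Rmult_le_reg_l with t; [lra|]. eapply Rle_trans; [exact B|]. right.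
      unfold lam. rewrite <- Sq at 1. field. lra. }
    replace (3 * Q / sqrt t) with (3 * lam) by (unfold lam; field; lra).
    assert (/ (2 * lam) * I <= 2 * lam).
    { apply Rmult_le_reg_l with (2 * lam); [lra|].
      rewrite <- Rmult_assoc, Rinv_r, Rmult_1_l by lra. nra. }
    lra.
Qed.

Lemma DI_bound_L1 k g x y t C N : cont2 k -> cont2 g -> 0 <= C ->
  (forall a b, -1 <= a <= 1 -> -1 <= b <= 1 -> Rabs (k a b) <= C) ->
  (forall b, -1 <= b <= 1 -> RInt (fun a => Rabs (g (x + t * a) (y + t * b))) (-1) 1 <= N) ->
  Rabs (DI k g x y t) <= 2 * (C * N).
Proof.
  intros Hk Hg HC Hb HN. unfold DI.
  replace (2 * (C * N)) with ((1 - -1) * (C * N)) by ring.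
  apply RInt_bound; [lra| |].
  - apply (cont2_dcont1 (fun t b => RInt (fun a => k a b * g (x + t * a) (y + t * b)) (-1) 1)).
    apply DI_inner_ct; intros; ct.
  - intros b Hb'. eapply Rle_trans; [apply abs_RInt_le; [lra|apply ex_RInt_cont1; ct]|].
    eapply Rle_trans.
    + apply (RInt_mono _ (fun a => C * Rabs (g (x + t * a) (y + t * b)))); [lra|ct|ct|].
      intros a Ha. rewrite Rabs_mult. apply Rmult_le_compat_r; [apply Rabs_pos | auto].
    + rewrite RInt_scal' by ct. apply Rmult_le_compat_l; auto.
Qed.

(** * Local estimates up to the boundary *)

(** The jet lives on the whole plane while the equation holds on the strip only; outside, up to
    [2 l], the reflection laws for the function and its Laplacian take its place, so that interior
    estimates apply at boundary points. Every field is linear in the pair of source and jet or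
    stable under linear combinations, so differences of solutions fall under the same estimates. *)
Record Sol (l kap sig : R) (om : R -> R) (E : R -> R -> R) (J : jet) : Prop := {
  so_C2 : is_C2 J;
  so_par0 : forall z, parity sig (fun s => j0 J s z);
  so_parL : forall z, parity sig (fun s => lap J s z);
  so_refl0 : forall s z, l <= s <= 2 * l -> j0 J s z = refl kap l (fun s => j0 J s z) (s - l);
  so_reflL : forall s z, l <= s <= 2 * l -> lap J s z = refl kap l (fun s => lap J s z) (s - l);
  so_eq : forall s z, - l <= s <= l -> lap J s z + 2 * (sech s * sech s) * j0 J s z = E s z;
  so_bc : forall z, j1 J l z = kap * j0 J l z;
  so_orth : forall z, RInt (fun s => j0 J s z * om s) 0 l = 0;
  so_bdd : exists B, forall s z, - l <= s <= l -> Rabs (j0 J s z) <= B }.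

Section ReflBounds.
Context (l kap k0 : R) (Hl : 0 < l) (Hk : Rabs kap <= k0).

Definition Xk := exp k0 * exp k0.

Lemma k0_pos : 0 <= k0.
Proof. eapply Rle_trans; [apply Rabs_pos | exact Hk]. Qed.

Lemma Xk_ge1 : 1 <= Xk.
Proof.
  assert (1 <= exp k0); [|unfold Xk; nra].
  generalize (exp_ineq1_le k0) k0_pos; lra.
Qed.

Lemma exp_le x y : x <= y -> exp x <= exp y.
Proof. intros [H| ->]; [left; apply exp_increasing; auto | lra]. Qed.

Lemma rV_L1 g t : cont1 g -> 0 <= t <= 1 ->
  Rabs (rV kap l g t) <= Xk * RInt (fun tau => Rabs (g (l - tau))) 0 t.
Proof.
  intros Hg Ht. assert (bump := Hk). apply Rabs_le_between in bump.
  unfold rV, Xk. rewrite Rabs_mult, (Rabs_pos_eq (exp _)) by (left; apply exp_pos).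
  rewrite Rmult_assoc. apply Rmult_le_compat.
  - left; apply exp_pos.
  - apply Rabs_pos.
  - apply exp_le; nra.
  - eapply Rle_trans; [apply abs_RInt_le; [lra|apply ex_RInt_cont1; ct]|].
    rewrite <- RInt_scal' by ct.
    apply RInt_mono; [lra|ct|ct|]. intros x Hx.
    rewrite Rabs_mult, (Rabs_pos_eq (exp _)) by (left; apply exp_pos).
    apply Rmult_le_compat_r; [apply Rabs_pos|]. apply exp_le; nra.
Qed.

Lemma rV_sup g t G : cont1 g -> 0 <= t <= 1 ->
  (forall s, l - t <= s <= l -> Rabs (g s) <= G) -> Rabs (rV kap l g t) <= Xk * G.
Proof.
  intros Hg Ht HG.
  assert (G0 : 0 <= G) by (eapply Rle_trans; [apply Rabs_pos | apply (HG l); lra]).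
  eapply Rle_trans; [apply rV_L1; auto|]. generalize Xk_ge1; intros.
  apply Rmult_le_compat_l; [lra|].
  eapply Rle_trans.
  - apply (RInt_mono _ (fun _ => G)); [lra|ct|ct|]. intros x Hx. apply HG; lra.
  - rewrite RInt_const'. nra.
Qed.

Lemma rV_L2 g t Q M : cont1 g -> 0 <= t <= 1 -> t <= l -> 0 < Q -> 0 <= M ->
  RInt (fun s => g s * g s) 0 l <= Q * Q ->
  forall h, cont1 h -> (forall s, 0 <= s <= l -> Rabs (h s) <= M + 2 * Rabs (g s)) ->
  Rabs (rV kap l h t) <= Xk * (M + 2 * Q).
Proof.
  intros Hg Ht Htl HQ HM HI h Hh Hb.
  eapply Rle_trans; [apply rV_L1; auto|]. generalize Xk_ge1; intros.
  apply Rmult_le_compat_l; [lra|].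
  eapply Rle_trans.
  - apply (RInt_mono _ (fun tau => (M + Q) + / Q * (g (l - tau) * g (l - tau)))); [lra|ct|ct|].
    intros x Hx. eapply Rle_trans; [apply Hb; lra|].
    generalize (amgm (g (l - x)) Q HQ). replace (/ (2 * Q)) with (/ Q / 2) by (field; lra). lra.
  - rewrite RInt_plus', RInt_const', RInt_scal' by ct.
    rewrite (RInt_flip (fun s => g s * g s)) by ct.
    assert (RInt (fun s => g s * g s) (l - t) (l - 0) <= Q * Q).
    { eapply Rle_trans; [apply (RInt_sub _ 0 l)|exact HI]; try lra; [ct|intros; nra]. }
    assert (/ Q * RInt (fun s => g s * g s) (l - t) (l - 0) <= Q).
    { apply Rmult_le_reg_l with Q; auto. rewrite <- Rmult_assoc, Rinv_r, Rmult_1_l by lra. auto. }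
    nra.
Qed.

Lemma refl_sup g t G : cont1 g -> 0 <= t <= 1 ->
  (forall s, l - t <= s <= l -> Rabs (g s) <= G) -> Rabs (refl kap l g t) <= (1 + 2 * k0 * Xk) * G.
Proof.
  intros Hg Ht HG.
  assert (G0 : 0 <= G) by (eapply Rle_trans; [apply Rabs_pos | apply (HG l); lra]).
  unfold refl. eapply Rle_trans; [apply Rabs_triang|].
  rewrite !Rabs_mult, (Rabs_pos_eq 2) by lra.
  assert (A := rV_sup g t G Hg Ht HG). assert (B := HG (l - t) ltac:(lra)).
  assert (2 * Rabs kap * Rabs (rV kap l g t) <= 2 * k0 * (Xk * G)).
  { apply Rmult_le_compat; auto using Rabs_pos; generalize (Rabs_pos kap); lra. }
  lra.
Qed.

Lemma rV_lip g t t' G : cont1 g -> 0 <= t <= 1 -> 0 <= t' <= 1 ->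
  (forall s, l - 1 <= s <= l -> l - Rmax t t' <= s -> Rabs (g s) <= G) ->
  Rabs (rV kap l g t' - rV kap l g t) <= (k0 * Xk + 1) * G * Rabs (t' - t).
Proof.
  intros Hg Ht Ht' HG.
  apply (lipschitz_MVT (rV kap l g) (fun t => kap * rV kap l g t + g (l - t))).
  - intros x _. apply is_derive_rV; auto.
  - intros x Hx.
    assert (Hx' : 0 <= x <= 1 /\ x <= Rmax t t').
    { split; [|lra]. split; [eapply Rle_trans; [|apply Hx]; apply Rmin_glb; lra
                            |eapply Rle_trans; [apply Hx|]; apply Rmax_lub; lra]. }
    assert (A : Rabs (rV kap l g x) <= Xk * G).
    { apply rV_sup; auto; try lra. intros s Hs. apply HG; lra. }
    assert (B : Rabs (g (l - x)) <= G) by (apply HG; lra).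
    eapply Rle_trans; [apply Rabs_triang|]. rewrite Rabs_mult.
    assert (Rabs kap * Rabs (rV kap l g x) <= k0 * (Xk * G)).
    { apply Rmult_le_compat; auto using Rabs_pos. }
    lra.
Qed.
End ReflBounds.

Lemma sech_le1 s : 0 < sech s * sech s <= 1.
Proof.
  split; [apply Rmult_lt_0_compat; apply sech_pos|].
  rewrite sech2_tanh2. nra.
Qed.

Lemma tanh_le1 s : Rabs (tanh s) <= 1.
Proof.
  generalize (sech_le1 s); rewrite sech2_tanh2; intros.
  apply Rabs_le; nra.
Qed.

Lemma sech2_lip s s' : Rabs (sech s' * sech s' - sech s * sech s) <= 2 * Rabs (s' - s).
Proof.
  apply (lipschitz_MVT (fun s => sech s * sech s) (fun s => -2 * tanh s * (sech s * sech s))).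
  - intros x _. eapply dr_eq; [apply (dr_mult sech sech); apply is_derive_sech | ring].
  - intros x _. rewrite !Rabs_mult. generalize (tanh_le1 x) (sech_le1 x); intros.
    replace (Rabs (-2)) with 2 by (unfold Rabs; destruct Rcase_abs; lra).
    rewrite <- Rabs_mult, (Rabs_pos_eq (sech x * sech x)) by lra.
    generalize (Rabs_pos (tanh x)); nra.
Qed.

Lemma Rabs_sig sig x : sig * sig = 1 -> Rabs (sig * x) = Rabs x.
Proof.
  intros H. rewrite Rabs_mult. replace (Rabs sig) with 1; [ring|].
  assert (sig = 1 \/ sig = -1) as [-> | ->].
  { assert ((sig - 1) * (sig + 1) = 0) by lra.
    destruct (Rmult_integral _ _ H0); [left | right]; lra. }
  rewrite Rabs_R1; auto. unfold Rabs; destruct Rcase_abs; lra.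
Qed.

Lemma parity_abs sig g s : sig * sig = 1 -> parity sig g -> Rabs (g (Rabs s)) = Rabs (g s).
Proof.
  intros Hs P. unfold Rabs at 2. destruct Rcase_abs; auto.
  rewrite P, Rabs_sig; auto.
Qed.

Section Local.
Context (CK : R) (HCK : 1 <= CK).
Context (HK : forall i j a b, (i + j <= 3)%nat -> -1 <= a <= 1 -> -1 <= b <= 1 ->
  Rabs (bump i j a b) <= CK /\ Rabs (Psi i j a b) <= CK).
Context (l0 k0 al : R) (Hl0 : 0 < l0) (Hal : 0 < al < 1).
Context (l kap sig : R) (om : R -> R) (Hl : l0 <= l) (Hk : Rabs kap <= k0) (Hsig : sig * sig = 1).
Context (E : R -> R -> R) (J : jet) (HS : Sol l kap sig om E J).

(** With this radius all squares in use stay inside [[- 2 l, 2 l]], where the reflection laws are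
    available, for every [l >= l0]. *)
Definition rad := Rmin 1 l0 / 4.

Lemma rad_pos : 0 < rad <= 1/4 /\ 4 * rad <= l.
Proof.
  unfold rad. generalize (Rmin_l 1 l0) (Rmin_r 1 l0). intros.
  assert (0 < Rmin 1 l0) by (apply Rmin_glb_lt; lra). lra.
Qed.

Lemma cont_j0 z : cont1 (fun s => j0 J s z).
Proof. assert (H := gr_c _ _ _ (C2_0 _ (so_C2 _ _ _ _ _ _ HS))). ct. Qed.
Lemma cont_lap z : cont1 (fun s => lap J s z).
Proof. assert (H := cont2_lap _ (so_C2 _ _ _ _ _ _ HS)). ct. Qed.

Lemma lap_in s z M : - l <= s <= l -> Rabs (E s z) <= M ->
  Rabs (lap J s z) <= M + 2 * Rabs (j0 J s z).
Proof.
  intros Hs HM. assert (Q := so_eq _ _ _ _ _ _ HS s z Hs).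
  replace (lap J s z) with (E s z - 2 * (sech s * sech s) * j0 J s z) by lra.
  eapply Rle_trans; [apply Rabs_triang|]. rewrite Rabs_Ropp, Rabs_mult.
  rewrite (Rabs_pos_eq (2 * _)) by (generalize (sech_le1 s); lra).
  generalize (sech_le1 s) (Rabs_pos (j0 J s z)); intros. nra.
Qed.

Section L2.
Context (z Q M : R) (HQ : 0 < Q) (HM : 0 <= M).
Context (HI : RInt (fun s => j0 J s z * j0 J s z) 0 l <= Q * Q).
Context (HE : forall s, - l <= s <= l -> Rabs (E s z) <= M).

(** Beyond the boundary the value is the folded one plus a multiple of [rV], and the integral in
    [rV] is controlled by the square integral of the slice, hence by [Q]. *)
Lemma j0_fold s : - (l + 1) <= s <= l + 1 -> - (2 * l) <= s <= 2 * l ->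
  Rabs (j0 J s z) <= Rabs (j0 J (fold l s) z) + 4 * k0 * Xk k0 * Q.
Proof.
  intros Hs1 Hs2. assert (Hl' : 0 < l) by lra.
  assert (K0 := k0_pos _ _ Hk). assert (X1 := Xk_ge1 _ _ Hk).
  assert (W : forall s, 0 <= s <= 2 * l -> s <= l + 1 ->
     Rabs (j0 J s z) <= Rabs (j0 J (fold l s) z) + 4 * k0 * Xk k0 * Q).
  { clear s Hs1 Hs2; intros s Hs1 Hs2.
    assert (0 <= 4 * k0 * Xk k0 * Q) by (apply Rmult_le_pos; [|lra]; apply Rmult_le_pos; lra).
    destruct (Rle_dec s l).
    - rewrite fold_in, (Rabs_pos_eq s) by lra. lra.
    - rewrite fold_out by lra. rewrite (so_refl0 _ _ _ _ _ _ HS) by lra. unfold refl.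
      eapply Rle_trans; [apply Rabs_triang|]. replace (l - (s - l)) with (2 * l - s) by ring.
      apply Rplus_le_compat_l. rewrite !Rabs_mult, (Rabs_pos_eq 2) by lra.
      assert (V : Rabs (rV kap l (fun s => j0 J s z) (s - l)) <= Xk k0 * (0 + 2 * Q)).
      { apply (rV_L2 l kap k0 Hk (fun s => j0 J s z)); auto using cont_j0; try lra.
        intros u _. generalize (Rabs_pos (j0 J u z)); lra. }
      replace (4 * k0 * Xk k0 * Q) with (2 * k0 * (Xk k0 * (0 + 2 * Q))) by ring.
      apply Rmult_le_compat; auto using Rabs_pos; generalize (Rabs_pos kap); lra. }
  rewrite <- (parity_abs sig (fun s => j0 J s z) s Hsig (so_par0 _ _ _ _ _ _ HS z)).
  replace (fold l s) with (fold l (Rabs s)) by (unfold fold; rewrite Rabs_Rabsolu; auto).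
  apply W; [split; [apply Rabs_pos|]|]; apply Rabs_le; lra.
Qed.

Lemma lap_fold s : - (l + 1) <= s <= l + 1 -> - (2 * l) <= s <= 2 * l ->
  Rabs (lap J s z) <= 2 * Rabs (j0 J (fold l s) z) + (1 + 4 * k0 * Xk k0) * (M + Q).
Proof.
  intros Hs1 Hs2. assert (Hl' : 0 < l) by lra.
  assert (K0 := k0_pos _ _ Hk). assert (X1 := Xk_ge1 _ _ Hk).
  assert (KX : 0 <= k0 * Xk k0) by (apply Rmult_le_pos; lra).
  assert (W : forall s, 0 <= s <= 2 * l -> s <= l + 1 ->
     Rabs (lap J s z) <= 2 * Rabs (j0 J (fold l s) z) + (1 + 4 * k0 * Xk k0) * (M + Q)).
  { clear s Hs1 Hs2; intros s Hs1 Hs2.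
    destruct (Rle_dec s l).
    - rewrite fold_in, (Rabs_pos_eq s) by lra.
      generalize (lap_in s z M ltac:(lra) (HE s ltac:(lra))). intros; nra.
    - rewrite fold_out by lra. rewrite (so_reflL _ _ _ _ _ _ HS) by lra. unfold refl.
      eapply Rle_trans; [apply Rabs_triang|]. replace (l - (s - l)) with (2 * l - s) by ring.
      rewrite !Rabs_mult, (Rabs_pos_eq 2) by lra.
      assert (V : Rabs (rV kap l (fun s => lap J s z) (s - l)) <= Xk k0 * (M + 2 * Q)).
      { apply (rV_L2 l kap k0 Hk (fun s => j0 J s z)); auto using cont_j0, cont_lap; try lra.
        intros u Hu. apply lap_in; [lra|apply HE; lra]. }
      generalize (lap_in (2 * l - s) z M ltac:(lra) (HE (2 * l - s) ltac:(lra))).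
      assert (2 * Rabs kap * Rabs (rV kap l (fun s0 : R => lap J s0 z) (s - l)) <= 2 * k0 * (Xk k0 * (M + 2 * Q))).
      { apply Rmult_le_compat; auto using Rabs_pos; generalize (Rabs_pos kap); lra. }
      nra. }
  rewrite <- (parity_abs sig (fun s => lap J s z) s Hsig (so_parL _ _ _ _ _ _ HS z)).
  replace (fold l s) with (fold l (Rabs s)) by (unfold fold; rewrite Rabs_Rabsolu; auto).
  apply W; [split; [apply Rabs_pos|]|]; apply Rabs_le; lra.
Qed.
End L2.

Definition Csup := / Kmass * (2 * CK * (3 / sqrt rad + 8 * k0 * Xk k0) + 2 * CK * (8 + 8 * k0 * Xk k0)).

(** The square integral is known on every slice, so an average over a square loses only in the [s]
    direction, by [1 / sqrt u]. The factor [u] in front of the Laplacian term absorbs this loss for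
    all small scales. *)
Lemma sol_sup Q M x y : 0 < Q -> 0 <= M -> - l <= x <= l ->
  (forall z, y - rad <= z <= y + rad -> RInt (fun s => j0 J s z * j0 J s z) 0 l <= Q * Q) ->
  (forall s z, - l <= s <= l -> y - rad <= z <= y + rad -> Rabs (E s z) <= M) ->
  Rabs (j0 J x y) <= Csup * (Q + M).
Proof.
  intros HQ HM Hx HI HE. destruct rad_pos as [Hr1 Hr2].
  assert (K0 := k0_pos _ _ Hk). assert (X1 := Xk_ge1 _ _ Hk).
  assert (KX : 0 <= k0 * Xk k0) by (apply Rmult_le_pos; lra).
  assert (HJ := so_C2 _ _ _ _ _ _ HS).
  assert (Cf := cont1_fold l).
  assert (C0 : cont2 (j0 J)) by apply (C2_0 _ HJ).
  assert (CL := cont2_lap _ HJ).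
  assert (Y : forall t b, 0 < t <= rad -> -1 <= b <= 1 -> y - rad <= y + t * b <= y + rad).
  { intros t b Ht Hb. nra. }
  assert (Sx : forall t a, 0 < t <= rad -> -1 <= a <= 1 -> - (l + 1) <= x + t * a <= l + 1 /\ - (2 * l) <= x + t * a <= 2 * l).
  { intros t a Ht Ha. nra. }
  assert (NP : 0 < Kmass) by apply Kmass_pos.
  assert (B1 : Rabs (DI (bump 0 0) (j0 J) x y rad) <= 2 * (CK * ((3 / sqrt rad + 8 * k0 * Xk k0) * (Q + M)))).
  { apply DI_bound_L1; auto using cont2_K; [lra|intros; apply HK; auto; lia|].
    intros b Hb. specialize (Y rad b ltac:(lra) Hb). specialize (HI _ Y).
    eapply Rle_trans.
    - apply (RInt_mono _ (fun a => Rabs (j0 J (fold l (x + rad * a)) (y + rad * b)) + 4 * k0 * Xk k0 * Q));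
        [lra|ct|ct|].
      intros a Ha. destruct (Sx rad a ltac:(lra) Ha). apply j0_fold; auto.
    - rewrite RInt_plus', RInt_const' by ct.
      assert (F := fold_L1 (fun s => j0 J s (y + rad * b)) l x rad Q ltac:(lra) (cont_j0 _) HQ HI Hx ltac:(lra)).
      cbv beta in F.
      assert (0 < / sqrt rad) by (apply Rinv_0_lt_compat, sqrt_lt_R0; lra).
      unfold Rdiv in *. nra. }
  assert (B2 : forall u, 0 < u <= rad -> Rabs (u * DI (Psi 0 0) (lap J) x y u) <= 2 * CK * ((8 + 8 * k0 * Xk k0) * (Q + M))).
  { intros u Hu. rewrite Rabs_mult, (Rabs_pos_eq u) by lra.
    assert (Su : 0 < sqrt u) by (apply sqrt_lt_R0; lra).
    assert (Sq : sqrt u * sqrt u = u) by (apply sqrt_sqrt; lra).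
    assert (Su1 : sqrt u <= 1) by (rewrite <- sqrt_1; apply sqrt_le_1; lra).
    assert (B : Rabs (DI (Psi 0 0) (lap J) x y u) <= 2 * (CK * (6 * Q / sqrt u + 2 * ((1 + 4 * k0 * Xk k0) * (M + Q))))).
    { apply DI_bound_L1; auto using cont2_Psi; [lra|intros; apply HK; auto; lia|].
      intros b Hb. specialize (Y u b ltac:(lra) Hb). specialize (HI _ Y).
      eapply Rle_trans.
      - apply (RInt_mono _ (fun a => 2 * Rabs (j0 J (fold l (x + u * a)) (y + u * b)) + (1 + 4 * k0 * Xk k0) * (M + Q)));
          [lra|ct|ct|].
        intros a Ha. destruct (Sx u a ltac:(lra) Ha). apply lap_fold; auto.
      - rewrite RInt_plus', RInt_const', RInt_scal' by ct.
        assert (F := fold_L1 (fun s => j0 J s (y + u * b)) l x u Q ltac:(lra) (cont_j0 _) HQ HI Hx ltac:(lra)).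
        cbv beta in F. unfold Rdiv in *. lra. }
    apply Rle_trans with (u * (2 * (CK * (6 * Q / sqrt u + 2 * ((1 + 4 * k0 * Xk k0) * (M + Q)))))).
    { apply Rmult_le_compat_l; lra. }
    replace (u * (2 * (CK * (6 * Q / sqrt u + 2 * ((1 + 4 * k0 * Xk k0) * (M + Q))))))
      with (2 * CK * (6 * Q * (u / sqrt u) + u * (2 * ((1 + 4 * k0 * Xk k0) * (M + Q))))) by (field; lra).
    apply Rmult_le_compat_l; [lra|].
    replace (u / sqrt u) with (sqrt u) by (rewrite <- Sq at 2; field; lra).
    assert (0 <= (1 + 4 * k0 * Xk k0) * (M + Q)) by (apply Rmult_le_pos; lra).
    assert (u * (2 * ((1 + 4 * k0 * Xk k0) * (M + Q))) <= 2 * ((1 + 4 * k0 * Xk k0) * (M + Q))) by nra.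
    nra. }
  assert (F := sup_est J x y rad _ HJ ltac:(lra) B2).
  apply Rmult_le_reg_l with Kmass; auto.
  unfold Csup. rewrite <- !Rmult_assoc, Rinv_r, Rmult_1_l by lra.
  assert (0 <= CK * ((8 + 8 * k0 * Xk k0) * (Q + M))) by (repeat apply Rmult_le_pos; lra).
  nra.
Qed.

Definition CE := 1 + 2 * k0 * Xk k0.

Lemma CE_ge1 : 1 <= CE.
Proof.
  unfold CE. generalize (k0_pos _ _ Hk) (Xk_ge1 _ _ Hk); intros.
  assert (0 <= k0 * Xk k0) by (apply Rmult_le_pos; lra). lra.
Qed.

Lemma ext_sup g G s : cont1 g -> parity sig g ->
  (forall s, l <= s <= 2 * l -> g s = refl kap l g (s - l)) ->
  (forall s, - l <= s <= l -> Rabs (g s) <= G) ->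
  - (l + 4 * rad) <= s <= l + 4 * rad -> Rabs (g s) <= CE * G.
Proof.
  intros Hg P R HG Hs. destruct rad_pos as [Hr1 Hr2].
  rewrite <- (parity_abs sig g s Hsig P).
  assert (B : 0 <= Rabs s <= l + 4 * rad) by (split; [apply Rabs_pos | apply Rabs_le; lra]).
  assert (G0 : 0 <= G) by (eapply Rle_trans; [apply Rabs_pos | apply (HG 0); lra]).
  generalize CE_ge1; intros.
  destruct (Rle_dec (Rabs s) l).
  - eapply Rle_trans; [apply HG; lra|]. nra.
  - rewrite R by lra. apply (refl_sup l kap k0 Hk); auto; try lra. intros; apply HG; lra.
Qed.

Lemma j0_sup s z W : (forall s, - l <= s <= l -> Rabs (j0 J s z) <= W) ->
  - (l + 4 * rad) <= s <= l + 4 * rad -> Rabs (j0 J s z) <= CE * W.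
Proof.
  intros HW Hs. apply (ext_sup (fun s => j0 J s z)); auto using cont_j0.
  - apply (so_par0 _ _ _ _ _ _ HS).
  - intros; apply (so_refl0 _ _ _ _ _ _ HS); auto.
Qed.

Lemma lap_sup s z W M : (forall s, - l <= s <= l -> Rabs (j0 J s z) <= W) ->
  (forall s, - l <= s <= l -> Rabs (E s z) <= M) ->
  - (l + 4 * rad) <= s <= l + 4 * rad -> Rabs (lap J s z) <= CE * (M + 2 * W).
Proof.
  intros HW HM Hs. apply (ext_sup (fun s => lap J s z)); auto using cont_lap.
  - apply (so_parL _ _ _ _ _ _ HS).
  - intros; apply (so_reflL _ _ _ _ _ _ HS); auto.
  - intros u Hu. generalize (lap_in u z M Hu (HM u Hu)) (HW u Hu). lra.
Qed.

Definition Cgrad := / Kmass * (4 * CK * CE / rad + 8 * CK * CE).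

Lemma sol_grad i j W M x y : (i + j = 1)%nat -> - l <= x <= l ->
  (forall s z, - l <= s <= l -> y - rad <= z <= y + rad -> Rabs (j0 J s z) <= W) ->
  (forall s z, - l <= s <= l -> y - rad <= z <= y + rad -> Rabs (E s z) <= M) ->
  Rabs (jD J i j x y) <= Cgrad * (W + M).
Proof.
  intros Hij Hx HW HM. destruct rad_pos as [Hr1 Hr2]. assert (C1 := CE_ge1).
  assert (W0 : 0 <= W) by (eapply Rle_trans; [apply Rabs_pos | apply (HW x y); lra]).
  assert (M0 : 0 <= M) by (eapply Rle_trans; [apply Rabs_pos | apply (HM x y); lra]).
  assert (HJ := so_C2 _ _ _ _ _ _ HS).
  assert (G := grad_est CK HCK HK J i j x y rad (CE * W) (CE * (M + 2 * W)) HJ Hij ltac:(lra)).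
  assert (NP : 0 < Kmass) by apply Kmass_pos.
  apply Rmult_le_reg_l with Kmass; auto.
  unfold Cgrad. rewrite <- !Rmult_assoc, Rinv_r, Rmult_1_l by lra.
  eapply Rle_trans; [apply G|].
  - intros s z [Hs Hz]. apply j0_sup; try lra. intros; apply HW; lra.
  - intros s z [Hs Hz]. apply lap_sup; try lra; intros; [apply HW | apply HM]; lra.
  - assert (0 < / rad) by (apply Rinv_0_lt_compat; lra).
    assert (P : 0 <= CK * CE) by nra. unfold Rdiv.
    assert (0 <= CK * CE * / rad) by (apply Rmult_le_pos; lra).
    assert (4 * CK * (CE * W) * / rad <= 4 * (CK * CE * / rad) * (W + M)) by nra.
    assert (4 * CK * (CE * (M + 2 * W)) * rad <= 8 * (CK * CE) * (W + M)).
    { assert (0 <= CK * CE * (M + 2 * W)) by (apply Rmult_le_pos; lra). nra. }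
    nra.
Qed.

Section Holder.
Context (y R W L M : R) (H3 : 0 <= R) (M0 : 0 <= M) (L0 : 0 <= L).
Context (HW : forall s z, - l <= s <= l -> y - R <= z <= y + R -> Rabs (j0 J s z) <= W).
Context (HL1 : forall s z, - l <= s <= l -> y - R <= z <= y + R -> Rabs (j1 J s z) <= L).
Context (HL2 : forall s z, - l <= s <= l -> y - R <= z <= y + R -> Rabs (j2 J s z) <= L).
Context (HM : forall s z, - l <= s <= l -> y - R <= z <= y + R -> Rabs (E s z) <= M).
Context (HH : forall s z s' z' d, - l <= s <= l -> - l <= s' <= l ->
  y - R <= z <= y + R -> y - R <= z' <= y + R -> 0 < d <= rad ->
  Rabs (s' - s) <= d -> Rabs (z' - z) <= d -> Rabs (E s' z' - E s z) <= M * Rpower d al).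

Lemma W_pos : 0 <= W.
Proof.
  destruct rad_pos. eapply Rle_trans; [apply Rabs_pos | apply (HW 0 y); lra].
Qed.

Lemma j0_lip s z s' z' : - l <= s <= l -> - l <= s' <= l ->
  y - R <= z <= y + R -> y - R <= z' <= y + R ->
  Rabs (j0 J s' z' - j0 J s z) <= L * (Rabs (s' - s) + Rabs (z' - z)).
Proof.
  intros. assert (G := C2_0 _ (so_C2 _ _ _ _ _ _ HS)).
  assert (A : Rabs (j0 J s' z - j0 J s z) <= L * Rabs (s' - s)).
  { apply (lipschitz_MVT (fun s => j0 J s z) (fun s => j1 J s z)).
    - intros; apply (gr_d1 _ _ _ G).
    - intros u Hu. apply HL1; auto. unfold Rmin, Rmax in Hu. destruct (Rle_dec s s'); lra. }
  assert (B : Rabs (j0 J s' z' - j0 J s' z) <= L * Rabs (z' - z)).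
  { apply (lipschitz_MVT (fun z => j0 J s' z) (fun z => j2 J s' z)).
    - intros; apply (gr_d2 _ _ _ G).
    - intros u Hu. apply HL2; auto. unfold Rmin, Rmax in Hu. destruct (Rle_dec z z'); lra. }
  replace (j0 J s' z' - j0 J s z) with ((j0 J s' z' - j0 J s' z) + (j0 J s' z - j0 J s z)) by ring.
  eapply Rle_trans; [apply Rabs_triang|]. lra.
Qed.

Definition hol_in := M + 4 * L + 4 * W.
(** [hol_in] counts twice because a pair may straddle the boundary. The other terms belong to [rV]
    of the Laplacian, which is Lipschitz in its length [t] and inherits the Hölder modulus in
    [z]. *)
Definition hol_out := 2 * hol_in + 2 * k0 * ((k0 * Xk k0 + 1) * (M + 2 * W) + Xk k0 * hol_in).

Lemma lap_holder_in s z s' z' d : - l <= s <= l -> - l <= s' <= l ->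
  y - R <= z <= y + R -> y - R <= z' <= y + R -> 0 < d <= rad ->
  Rabs (s' - s) <= d -> Rabs (z' - z) <= d ->
  Rabs (lap J s' z' - lap J s z) <= hol_in * Rpower d al.
Proof.
  intros Hs Hs' Hz Hz' Hd Ds Dz. destruct rad_pos as [Hr1 Hr2]. assert (W0 := W_pos).
  assert (E1 := so_eq _ _ _ _ _ _ HS s z Hs). assert (E2 := so_eq _ _ _ _ _ _ HS s' z' Hs').
  replace (lap J s' z' - lap J s z) with ((E s' z' - E s z)
    - 2 * ((sech s' * sech s') * (j0 J s' z' - j0 J s z) + (sech s' * sech s' - sech s * sech s) * j0 J s z)) by lra.
  assert (A := HH s z s' z' d Hs Hs' Hz Hz' Hd Ds Dz).
  assert (B := j0_lip s z s' z' Hs Hs' Hz Hz'). assert (C := sech2_lip s s'). assert (D := HW s z Hs Hz).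
  assert (P : d <= Rpower d al) by (apply Rpower_ge_id; lra).
  assert (S1 := sech_le1 s').
  eapply Rle_trans; [apply Rabs_triang|]. rewrite Rabs_Ropp, Rabs_mult, (Rabs_pos_eq 2) by lra.
  assert (X1 : Rabs ((sech s' * sech s') * (j0 J s' z' - j0 J s z)) <= 2 * L * d).
  { rewrite Rabs_mult, (Rabs_pos_eq (sech s' * sech s')) by lra.
    assert (L * (Rabs (s' - s) + Rabs (z' - z)) <= L * (2 * d)) by (apply Rmult_le_compat_l; lra).
    generalize (Rabs_pos (j0 J s' z' - j0 J s z)); intros. nra. }
  assert (X2 : Rabs ((sech s' * sech s' - sech s * sech s) * j0 J s z) <= 2 * d * W).
  { rewrite Rabs_mult. apply Rmult_le_compat; auto using Rabs_pos; lra. }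
  assert (X3 := Rabs_triang ((sech s' * sech s') * (j0 J s' z' - j0 J s z)) ((sech s' * sech s' - sech s * sech s) * j0 J s z)).
  unfold hol_in. nra.
Qed.

Lemma lap_in_sup s z : - l <= s <= l -> y - R <= z <= y + R -> Rabs (lap J s z) <= M + 2 * W.
Proof.
  intros Hs Hz. generalize (lap_in s z M Hs (HM s z Hs Hz)) (HW s z Hs Hz). lra.
Qed.

Lemma lap_holder_pos s z s' z' d :
  0 <= s <= l + 4 * rad -> 0 <= s' <= l + 4 * rad ->
  y - R <= z <= y + R -> y - R <= z' <= y + R -> 0 < d <= rad ->
  Rabs (s' - s) <= d -> Rabs (z' - z) <= d ->
  Rabs (lap J s' z' - lap J s z) <= hol_out * Rpower d al.
Proof.
  intros Hs Hs' Hz Hz' Hd Ds Dz. destruct rad_pos as [Hr1 Hr2]. assert (W0 := W_pos).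
  assert (K0 := k0_pos _ _ Hk). assert (X1 := Xk_ge1 _ _ Hk).
  assert (KX : 0 <= k0 * Xk k0) by (apply Rmult_le_pos; lra).
  assert (H10 : 0 <= hol_in) by (unfold hol_in; lra).
  assert (P : d <= Rpower d al) by (apply Rpower_ge_id; lra).
  assert (P0 := Rpower_pos d al).
  set (T := 2 * k0 * ((k0 * Xk k0 + 1) * (M + 2 * W) + Xk k0 * hol_in)).
  assert (T0 : 0 <= T).
  { unfold T. apply Rmult_le_pos; [lra|]. apply Rplus_le_le_0_compat; apply Rmult_le_pos; lra. }
  assert (Out : forall s z s' z', l <= s <= l + 4 * rad -> l <= s' <= l + 4 * rad ->
     y - R <= z <= y + R -> y - R <= z' <= y + R -> Rabs (s' - s) <= d -> Rabs (z' - z) <= d ->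
     Rabs (lap J s' z' - lap J s z) <= (hol_in + T) * Rpower d al).
  { clear s z s' z' Hs Hs' Hz Hz' Ds Dz. intros s z s' z' Hs Hs' Hz Hz' Ds Dz.
    rewrite (so_reflL _ _ _ _ _ _ HS s z), (so_reflL _ _ _ _ _ _ HS s' z') by lra. unfold refl.
    set (t := s - l). set (t' := s' - l).
    assert (A1 : Rabs (lap J (l - t') z' - lap J (l - t) z) <= hol_in * Rpower d al).
    { apply lap_holder_in; unfold t, t'; try lra.
      replace (l - (s' - l) - (l - (s - l))) with (- (s' - s)) by ring. rewrite Rabs_Ropp; auto. }
    assert (A2 : Rabs (rV kap l (fun s => lap J s z) t' - rV kap l (fun s => lap J s z) t)
       <= (k0 * Xk k0 + 1) * (M + 2 * W) * Rabs (t' - t)).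
    { apply (rV_lip l kap k0 Hk); auto using cont_lap; unfold t, t'; try lra.
      intros u Hu Hu'. apply lap_in_sup; auto. split; [|lra].
      unfold Rmax in Hu'; destruct Rle_dec in Hu'; lra. }
    assert (A3 : Rabs (rV kap l (fun s => lap J s z') t' - rV kap l (fun s => lap J s z) t')
       <= Xk k0 * (hol_in * Rpower d al)).
    { replace (rV kap l (fun s => lap J s z') t' - rV kap l (fun s => lap J s z) t')
        with (rV kap l (fun s => lap J s z' + -1 * lap J s z) t').
      - assert (Ca := cont_lap z). assert (Cb := cont_lap z').
        apply (rV_sup l kap k0 Hk); [ct|unfold t'; lra|].
        intros u Hu. replace (lap J u z' + -1 * lap J u z) with (lap J u z' - lap J u z) by ring.
        apply lap_holder_in; auto; unfold t' in Hu; try lra.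
        rewrite Rminus_diag, Rabs_R0; lra.
      - assert (Ca := cont_lap z). assert (Cb := cont_lap z').
        rewrite rV_plus, rV_scal by ct. ring. }
    replace (lap J (l - t') z' + 2 * kap * rV kap l (fun s => lap J s z') t'
       - (lap J (l - t) z + 2 * kap * rV kap l (fun s => lap J s z) t))
     with ((lap J (l - t') z' - lap J (l - t) z) + 2 * kap *
       ((rV kap l (fun s => lap J s z') t' - rV kap l (fun s => lap J s z) t')
        + (rV kap l (fun s => lap J s z) t' - rV kap l (fun s => lap J s z) t))) by ring.
    eapply Rle_trans; [apply Rabs_triang|]. rewrite !Rabs_mult, (Rabs_pos_eq 2) by lra.
    assert (Dt : Rabs (t' - t) <= d) by (unfold t, t'; replace (s' - l - (s - l)) with (s' - s) by ring; auto).
    set (V1 := rV kap l (fun s => lap J s z') t' - rV kap l (fun s => lap J s z) t') in *.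
    set (V2 := rV kap l (fun s => lap J s z) t' - rV kap l (fun s => lap J s z) t) in *.
    assert (V12 : Rabs (V1 + V2) <= ((k0 * Xk k0 + 1) * (M + 2 * W) + Xk k0 * hol_in) * Rpower d al).
    { eapply Rle_trans; [apply Rabs_triang|].
      assert (0 <= (k0 * Xk k0 + 1) * (M + 2 * W)) by (apply Rmult_le_pos; lra). nra. }
    assert (2 * Rabs kap * Rabs (V1 + V2) <= T * Rpower d al).
    { unfold T. rewrite Rmult_assoc with (r1 := 2 * k0). apply Rmult_le_compat; auto using Rabs_pos; generalize (Rabs_pos kap); lra. }
    lra. }
  (* A pair on both sides of [s = l] is compared through the boundary point [(l, z)]. *)
  assert (Mix : forall s z s' z', 0 <= s <= l -> l <= s' <= l + 4 * rad ->
     y - R <= z <= y + R -> y - R <= z' <= y + R -> Rabs (s' - s) <= d -> Rabs (z' - z) <= d ->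
     Rabs (lap J s' z' - lap J s z) <= hol_out * Rpower d al).
  { clear s z s' z' Hs Hs' Hz Hz' Ds Dz. intros s z s' z' Hs Hs' Hz Hz' Ds Dz.
    apply Rabs_le_between in Ds.
    assert (A1 : Rabs (lap J l z - lap J s z) <= hol_in * Rpower d al).
    { apply lap_holder_in; try lra; try (apply Rabs_le; lra). }
    assert (A2 : Rabs (lap J s' z' - lap J l z) <= (hol_in + T) * Rpower d al).
    { apply Out; auto; try lra. apply Rabs_le; lra. }
    replace (lap J s' z' - lap J s z) with ((lap J s' z' - lap J l z) + (lap J l z - lap J s z)) by ring.
    eapply Rle_trans; [apply Rabs_triang|]. unfold hol_out. fold T. lra. }
  destruct (Rle_dec s l) as [A|A], (Rle_dec s' l) as [B|B].
  - eapply Rle_trans; [apply (lap_holder_in s z s' z' d); auto; lra|].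
    apply Rmult_le_compat_r; [lra|]. unfold hol_out; fold T; lra.
  - apply Mix; auto; lra.
  - rewrite Rabs_minus_sym. rewrite Rabs_minus_sym in Ds, Dz. apply Mix; auto; lra.
  - eapply Rle_trans; [apply (Out s z s' z'); auto; lra|].
    apply Rmult_le_compat_r; [lra|]. unfold hol_out; fold T; lra.
Qed.

Lemma lap_holder s z s' z' d :
  - (l + 4 * rad) <= s <= l + 4 * rad -> - (l + 4 * rad) <= s' <= l + 4 * rad ->
  y - R <= z <= y + R -> y - R <= z' <= y + R -> 0 < d <= rad ->
  Rabs (s' - s) <= d -> Rabs (z' - z) <= d ->
  Rabs (lap J s' z' - lap J s z) <= hol_out * Rpower d al.
Proof.
  intros Hs Hs' Hz Hz' Hd Ds Dz. destruct rad_pos as [Hr1 Hr2].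
  assert (W0 := W_pos). assert (P0 := Rpower_pos d al).
  assert (K0 := k0_pos _ _ Hk). assert (X1 := Xk_ge1 _ _ Hk).
  assert (KX : 0 <= k0 * Xk k0) by (apply Rmult_le_pos; lra).
  assert (H10 : 0 <= hol_in) by (unfold hol_in; lra).
  assert (H12 : hol_in <= hol_out).
  { unfold hol_out. assert (0 <= 2 * k0 * ((k0 * Xk k0 + 1) * (M + 2 * W) + Xk k0 * hol_in)); [|lra].
    apply Rmult_le_pos; [lra|]. apply Rplus_le_le_0_compat; apply Rmult_le_pos; lra. }
  assert (Ds' := Ds). apply Rabs_le_between in Ds'.
  (* Points on opposite sides of [s = 0] are at most [rad] apart in [s], hence both in the strip;
     two negative ones are mirrored. *)
  destruct (Rle_dec 0 s) as [A|A], (Rle_dec 0 s') as [B|B].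
  - apply lap_holder_pos; auto; lra.
  - eapply Rle_trans; [apply (lap_holder_in s z s' z' d); auto; lra|]. apply Rmult_le_compat_r; lra.
  - eapply Rle_trans; [apply (lap_holder_in s z s' z' d); auto; lra|]. apply Rmult_le_compat_r; lra.
  - assert (P := so_parL _ _ _ _ _ _ HS).
    assert (E1 := P z (- s)). assert (E2 := P z' (- s')). cbv beta in E1, E2.
    rewrite !Ropp_involutive in E1, E2. rewrite E1, E2, <- Rmult_minus_distr_l, Rabs_sig by auto.
    apply lap_holder_pos; auto; try lra.
    replace (- s' - - s) with (- (s' - s)) by ring. rewrite Rabs_Ropp; auto.
Qed.

Definition CD2 := / Kmass * (8 * CK * (/ al + / (1 - al) + 1) * (2 + / rad ^ 3)).

Lemma sol_D2 i j x z : (i + j = 2)%nat -> - l <= x <= l -> y - R + 2 * rad <= z <= y + R - 2 * rad ->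
  Rabs (jD J i j x z) <= CD2 * (hol_out + CE * W).
Proof.
  intros Hij Hx Hz. destruct rad_pos as [Hr1 Hr2]. assert (C1 := CE_ge1). assert (W0 := W_pos).
  assert (HJ := so_C2 _ _ _ _ _ _ HS).
  assert (NP : 0 < Kmass) by apply Kmass_pos.
  assert (HA : holder_at al (lap J) x z rad hol_out).
  { intros u s' z' Hu [Hs' Hz']. apply lap_holder; try lra; apply Rabs_le; lra. }
  assert (HP : 0 <= hol_out) by (eapply holder_at_pos; [|exact HA]; lra).
  assert (G := D2_est CK HCK HK al Hal J i j x z rad (CE * W) hol_out HJ Hij ltac:(lra)).
  apply Rmult_le_reg_l with Kmass; auto.
  unfold CD2. rewrite <- !Rmult_assoc, Rinv_r, Rmult_1_l by lra.
  eapply Rle_trans; [apply G; auto|].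
  - intros s u [Hs Hu]. apply j0_sup; [|lra]. intros; apply HW; lra.
  - assert (R1 : 0 < / rad) by (apply Rinv_0_lt_compat; lra).
    assert (1 <= / rad) by (rewrite <- Rinv_1 at 1; apply Rinv_le_contravar; lra).
    assert (RR : / rad ^ 2 <= / rad ^ 3) by (apply Rinv_le_contravar; [apply pow_lt; lra | simpl; nra]).
    assert (R3 : 0 < / rad ^ 3) by (apply Rinv_0_lt_compat, pow_lt; lra).
    assert (R2 : 0 < / rad ^ 2) by (apply Rinv_0_lt_compat, pow_lt; lra).
    assert (Ia : 0 < / al) by (apply Rinv_0_lt_compat; lra).
    assert (Ib : 0 < / (1 - al)) by (apply Rinv_0_lt_compat; lra).
    unfold Rdiv. set (w := CE * W). assert (0 <= w) by (unfold w; nra).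
    set (a := / al) in *. set (b := / (1 - al)) in *. set (c2 := / rad ^ 2) in *. set (c3 := / rad ^ 3) in *.
    assert (A1 : 4 * CK * w * c2 <= 4 * CK * ((1) * (2 + c3)) * (hol_out + w)).
    { assert (w * c2 <= (2 + c3) * (hol_out + w)) by nra. nra. }
    assert (A2 : 4 * CK * hol_out * a <= 4 * CK * (a * (2 + c3)) * (hol_out + w)).
    { assert (hol_out * a <= a * (2 + c3) * (hol_out + w)).
      { assert (hol_out <= (2 + c3) * (hol_out + w)) by nra. nra. } nra. }
    assert (0 <= CK * b * (2 + c3) * (hol_out + w)).
    { apply Rmult_le_pos; [|lra]. apply Rmult_le_pos; [|lra]. apply Rmult_le_pos; lra. }
    assert (0 <= CK * ((1) * (2 + c3)) * (hol_out + w)) by (apply Rmult_le_pos; [apply Rmult_le_pos; lra|lra]).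
    assert (0 <= CK * (a * (2 + c3)) * (hol_out + w)).
    { apply Rmult_le_pos; [|lra]. apply Rmult_le_pos; [lra|]. apply Rmult_le_pos; lra. }
    lra.
Qed.

Lemma sol_D2_holder i j x z x' z' d : (i + j = 2)%nat -> - l <= x <= l -> - l <= x' <= l ->
  y - R + 2 * rad <= z <= y + R - 2 * rad -> 0 < d <= rad ->
  Rabs (x' - x) <= d -> Rabs (z' - z) <= d ->
  Rabs (jD J i j x' z' - jD J i j x z) <= CD2 * (hol_out + CE * W) * Rpower d al.
Proof.
  intros Hij Hx Hx' Hz Hd Dx Dz. destruct rad_pos as [Hr1 Hr2]. assert (C1 := CE_ge1). assert (W0 := W_pos).
  assert (HJ := so_C2 _ _ _ _ _ _ HS).
  assert (NP : 0 < Kmass) by apply Kmass_pos.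
  assert (HA : forall s u, box x z rad s u -> holder_at al (lap J) s u rad hol_out).
  { intros s u [Hs Hu] v s' u' Hv [Hs' Hu']. apply lap_holder; try lra; apply Rabs_le; lra. }
  assert (HP : 0 <= hol_out) by (eapply holder_at_pos; [|apply (HA x z)]; [lra | split; lra]).
  assert (G := D2_holder CK HCK HK al Hal J i j x z x' z' rad (CE * W) hol_out d HJ Hij Hd ltac:(lra) Dx Dz).
  apply Rmult_le_reg_l with Kmass; auto.
  unfold CD2. rewrite <- !Rmult_assoc, Rinv_r, Rmult_1_l by lra.
  eapply Rle_trans; [apply G; auto|].
  - intros s u [Hs Hu]. apply j0_sup; [|lra]. intros; apply HW; lra.
  - assert (R3 : 0 < / rad ^ 3) by (apply Rinv_0_lt_compat, pow_lt; lra).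
    assert (Ia : 0 < / al) by (apply Rinv_0_lt_compat; lra).
    assert (Ib : 0 < / (1 - al)) by (apply Rinv_0_lt_compat; lra).
    apply Rmult_le_compat_r; [left; apply Rpower_pos|].
    unfold Rdiv. set (w := CE * W). assert (0 <= w) by (unfold w; nra).
    rewrite (Rmult_assoc (8 * CK * _)). apply Rmult_le_compat_l; [|nra].
    apply Rmult_le_pos; lra.
Qed.
End Holder.

Definition Wc := Csup.
Definition Lc := Cgrad * (Csup + 1).
Definition Dc := CD2 * (2 * (1 + 4 * Lc + 4 * Wc)
  + 2 * k0 * ((k0 * Xk k0 + 1) * (1 + 2 * Wc) + Xk k0 * (1 + 4 * Lc + 4 * Wc)) + CE * Wc).
Definition Cloc := Wc + Lc + Dc.

Lemma consts_pos : 0 <= Wc /\ 0 <= Lc /\ 0 <= Dc.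
Proof.
  destruct rad_pos as [Hr1 Hr2]. assert (C1 := CE_ge1).
  assert (K0 := k0_pos _ _ Hk). assert (X1 := Xk_ge1 _ _ Hk).
  assert (KX : 0 <= k0 * Xk k0) by (apply Rmult_le_pos; lra).
  assert (NP : 0 < / Kmass) by apply Rinv_0_lt_compat, Kmass_pos.
  assert (S1 : 0 < / sqrt rad) by (apply Rinv_0_lt_compat, sqrt_lt_R0; lra).
  assert (S2 : 0 < / rad) by (apply Rinv_0_lt_compat; lra).
  assert (S3 : 0 < / rad ^ 3) by (apply Rinv_0_lt_compat, pow_lt; lra).
  assert (Ia : 0 < / al) by (apply Rinv_0_lt_compat; lra).
  assert (Ib : 0 < / (1 - al)) by (apply Rinv_0_lt_compat; lra).
  assert (P1 : 0 <= Wc).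
  { unfold Wc, Csup, Rdiv. apply Rmult_le_pos; [lra|].
    apply Rplus_le_le_0_compat; apply Rmult_le_pos; lra. }
  assert (P2 : 0 <= Cgrad).
  { unfold Cgrad, Rdiv. apply Rmult_le_pos; [lra|].
    assert (0 <= CK * CE) by (apply Rmult_le_pos; lra).
    assert (0 <= CK * CE * / rad) by (apply Rmult_le_pos; lra). lra. }
  assert (P3 : 0 <= Lc) by (unfold Lc, Wc in *; apply Rmult_le_pos; lra).
  assert (P4 : 0 <= CD2).
  { unfold CD2. apply Rmult_le_pos; [lra|]. apply Rmult_le_pos; [|lra]. apply Rmult_le_pos; lra. }
  repeat split; auto. unfold Dc. apply Rmult_le_pos; auto.
  apply Rplus_le_le_0_compat; [apply Rplus_le_le_0_compat|apply Rmult_le_pos; lra]; [lra|].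
  apply Rmult_le_pos; [lra|]. apply Rplus_le_le_0_compat; apply Rmult_le_pos; lra.
Qed.

(** Each estimate uses squares around its point, so the window in [z] shrinks: half-width 3 for the
    data, 5/2 for the supremum, 2 for the gradient, 1 for the second derivatives. The gradient bound
    is what makes the zero order term [2 sech^2 w] Hölder. *)
Lemma sol_local y Q M : 0 < Q -> 0 <= M ->
  (forall z, y - 3 <= z <= y + 3 -> RInt (fun s => j0 J s z * j0 J s z) 0 l <= Q * Q) ->
  (forall s z, - l <= s <= l -> y - 3 <= z <= y + 3 -> Rabs (E s z) <= M) ->
  (forall s z s' z' d, - l <= s <= l -> - l <= s' <= l ->
     y - 3 <= z <= y + 3 -> y - 3 <= z' <= y + 3 -> 0 < d <= / 4 ->
     Rabs (s' - s) <= d -> Rabs (z' - z) <= d -> Rabs (E s' z' - E s z) <= M * Rpower d al) ->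
  (forall i j x z, (i + j <= 2)%nat -> - l <= x <= l -> y - 1 <= z <= y + 1 ->
     Rabs (jD J i j x z) <= Cloc * (Q + M)) /\
  (forall i j x z x' z' d, (i + j = 2)%nat -> - l <= x <= l -> - l <= x' <= l ->
     y - 1 <= z <= y + 1 -> 0 < d <= rad -> Rabs (x' - x) <= d -> Rabs (z' - z) <= d ->
     Rabs (jD J i j x' z' - jD J i j x z) <= Cloc * (Q + M) * Rpower d al).
Proof.
  intros HQ HM HI HE HH. destruct rad_pos as [Hr1 Hr2]. destruct consts_pos as [P1 [P2 P3]].
  set (S := Q + M). assert (S0 : 0 < S) by (unfold S; lra).
  assert (B0 : forall s z, - l <= s <= l -> y - (5/2) <= z <= y + 5/2 -> Rabs (j0 J s z) <= Wc * S).
  { intros s z Hs Hz. apply sol_sup; auto; intros; [apply HI | apply HE]; auto; lra. }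
  assert (B1 : forall i j s z, (i + j = 1)%nat -> - l <= s <= l -> y - 2 <= z <= y + 2 ->
     Rabs (jD J i j s z) <= Lc * S).
  { intros i j s z Hij Hs Hz. unfold Lc. replace (Cgrad * (Csup + 1) * S) with (Cgrad * (Wc * S + S)) by (unfold Wc; ring).
    apply sol_grad; auto.
    - intros; apply B0; auto; lra.
    - intros; eapply Rle_trans; [apply HE; auto; lra | unfold S; lra]. }
  assert (HE' : forall s z, - l <= s <= l -> y - 2 <= z <= y + 2 -> Rabs (E s z) <= S).
  { intros; eapply Rle_trans; [apply HE; auto; lra | unfold S; lra]. }
  assert (HH' : forall s z s' z' d, - l <= s <= l -> - l <= s' <= l ->
     y - 2 <= z <= y + 2 -> y - 2 <= z' <= y + 2 -> 0 < d <= rad ->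
     Rabs (s' - s) <= d -> Rabs (z' - z) <= d -> Rabs (E s' z' - E s z) <= S * Rpower d al).
  { intros. eapply Rle_trans; [apply (HH s z s' z' d); auto; lra|].
    apply Rmult_le_compat_r; [left; apply Rpower_pos | unfold S; lra]. }
  assert (EH : CD2 * (hol_out (Wc * S) (Lc * S) S + CE * (Wc * S)) = Dc * S).
  { unfold hol_out, hol_in, Dc. ring. }
  assert (D2 : forall i j x z, (i + j = 2)%nat -> - l <= x <= l -> y - 1 <= z <= y + 1 ->
     Rabs (jD J i j x z) <= Dc * S).
  { intros. rewrite <- EH. apply (sol_D2 y 2 (Wc * S) (Lc * S) S); auto; try lra; try nra.
    - intros; apply B0; auto; lra.
    - intros; apply (B1 1%nat 0%nat); auto.
    - intros; apply (B1 0%nat 1%nat); auto. }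
  split.
  - intros i j x z Hij Hx Hz. unfold Cloc.
    assert (A1 : 0 <= Wc * S) by (apply Rmult_le_pos; lra).
    assert (A2 : 0 <= Lc * S) by (apply Rmult_le_pos; lra).
    assert (A3 : 0 <= Dc * S) by (apply Rmult_le_pos; lra).
    assert (C : (i + j = 0 \/ i + j = 1 \/ i + j = 2)%nat) by lia.
    destruct C as [C|[C|C]].
    + assert (i = 0%nat) by lia. assert (j = 0%nat) by lia. subst. simpl.
      generalize (B0 x z Hx ltac:(lra)); lra.
    + generalize (B1 i j x z C Hx ltac:(lra)); lra.
    + generalize (D2 i j x z C Hx ltac:(lra)); lra.
  - intros i j x z x' z' d Hij Hx Hx' Hz Hd Dx Dz.
    apply Rle_trans with (Dc * S * Rpower d al).
    + rewrite <- EH. apply (sol_D2_holder y 2 (Wc * S) (Lc * S) S); auto; try lra; try nra.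
      * intros; apply B0; auto; lra.
      * intros; apply (B1 1%nat 0%nat); auto.
      * intros; apply (B1 0%nat 1%nat); auto.
    + apply Rmult_le_compat_r; [left; apply Rpower_pos|]. apply Rmult_le_compat_r; [lra|]. unfold Cloc; lra.
Qed.
End Local.

(** * Coercivity of the Jacobi operator *)

Lemma RInt_lin2 c1 f1 c2 f2 a b : cont1 f1 -> cont1 f2 ->
  RInt (fun x => c1 * f1 x + c2 * f2 x) a b = c1 * RInt f1 a b + c2 * RInt f2 a b.
Proof. intros. rewrite RInt_plus', !RInt_scal' by ct. auto. Qed.

Lemma lim_nonpos f d : 0 < d -> cont1 f -> (forall e, 0 < e < d -> f e <= 0) -> f 0 <= 0.
Proof.
  intros Hd Hf H. destruct (Rle_lt_dec (f 0) 0) as [|L]; auto. exfalso.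
  destruct (proj1 (filterlim_locally _ _) (Hf 0) (mkposreal _ L)) as [r Hr].
  set (e := Rmin d r / 2).
  assert (P : 0 < Rmin d r) by (apply Rmin_glb_lt; [auto | apply cond_pos]).
  generalize (Rmin_l d r) (Rmin_r d r); intros.
  assert (B : Rabs (f e - f 0) < f 0).
  { apply (Hr e). unfold ball; simpl; unfold AbsRing_ball, abs, minus, plus, opp; simpl.
    rewrite Ropp_0, Rplus_0_r, Rabs_pos_eq; unfold e; lra. }
  apply Rabs_lt_between in B. specialize (H e ltac:(unfold e; lra)). lra.
Qed.

Lemma tanh_0 : tanh 0 = 0.
Proof. rewrite tanh_def, sinh_0; ring. Qed.

Lemma tanh_pos s : 0 < s -> 0 < tanh s.
Proof.
  intros Hs. rewrite tanh_def. apply Rmult_lt_0_compat; [|apply sech_pos].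
  rewrite <- sinh_0. apply sinh_lt; auto.
Qed.

Section Energy1.
Context (l : R) (Hl : 0 < l) (w w1 w2 : R -> R).
Context (C0 : cont1 w) (C1 : cont1 w1) (C2 : cont1 w2).
Context (D0 : forall s, 0 < s < l -> is_derive w s (w1 s)).
Context (D1 : forall s, 0 < s < l -> is_derive w1 s (w2 s)).

Definition Lop (s : R) : R := w2 s + 2 * (sech s * sech s) * w s.

(** Darboux factorisation: [L - 1 = (d - tanh) (d + tanh)], and in the other order the product is
    the free operator [d^2 - 1]. With [y = (d + tanh) w], which vanishes at [l] by the Robin
    condition, the form is the integral of [w^2 - y^2]. Orthogonality to [sech] allows
    [w = (d - tanh) phi] with [phi] zero at both ends, and the gap is that of the Poincaré
    inequality for [phi]; note that [p] is [phi']. *)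
Lemma energy_even :
  w1 0 = 0 -> w1 l = - tanh l * w l -> RInt (fun s => w s * sech s) 0 l = 0 ->
  RInt (fun s => w s * Lop s) 0 l <= - / (4 * (l * l)) * RInt (fun s => w s * w s) 0 l.
Proof.
  intros B0 Bl Or.
  set (phi := fun s => cosh s * RInt (fun s => w s * sech s) 0 s).
  assert (Dp : forall s, is_derive phi s (w s + tanh s * phi s)).
  { intros s. unfold phi. eapply dr_eq.
    - apply (dr_mult cosh); [apply is_derive_cosh'|].
      apply (is_derive_RInt1 (fun s => w s * sech s)); ct.
    - simpl. rewrite tanh_def. generalize (cosh_sech s); intros Z.
      replace (cosh s * (w s * sech s)) with (w s * (cosh s * sech s)) by ring.
      rewrite Z. replace (sinh s * sech s * (cosh s * RInt (fun s0 => w s0 * sech s0) 0 s))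
        with (sinh s * RInt (fun s0 => w s0 * sech s0) 0 s * (cosh s * sech s)) by ring.
      rewrite Z. ring. }
  assert (Cp : cont1 phi) by (intros s; apply (ct_der _ _ _ (Dp s))).
  assert (P0 : phi 0 = 0) by (unfold phi; rewrite RInt_point; unfold zero; simpl; ring).
  assert (Pl : phi l = 0) by (unfold phi; rewrite Or; ring).
  set (y := fun s => w1 s + tanh s * w s).
  set (p := fun s => w s + tanh s * phi s).
  assert (Cy : cont1 y) by (unfold y; ct). assert (Cpp : cont1 p) by (unfold p; ct).
  set (I := fun f : R -> R => (RInt f 0 l : R)).
  assert (Ea : I (fun s => w s * Lop s) = I (fun s => w s * w s) - I (fun s => y s * y s)).
  { assert (F : I (fun s => w1 s * y s + w s * (w2 s + (sech s * sech s * w s + tanh s * w1 s))) = 0).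
    { unfold I. rewrite (RInt_FTC (fun s => w s * y s)); try lra.
      - unfold y. rewrite Bl, B0, tanh_0. ring.
      - intros s Hs. apply (dr_mult w y); auto. apply (dr_plus w1 (fun s => tanh s * w s)); auto.
        apply (dr_mult tanh w); auto. apply is_derive_tanh.
      - ct.
      - ct. }
    rewrite <- (Rplus_0_r (_ - _)), <- F. unfold I.
    rewrite <- RInt_minus', <- RInt_plus' by ct.
    apply RInt_ext'. intros s. unfold Lop, y. rewrite sech2_tanh2. ring. }
  assert (Eb : I (fun s => w s * w s) = - I (fun s => phi s * y s)).
  { assert (F : I (fun s => w1 s * phi s + w s * (w s + tanh s * phi s)) = 0).
    { unfold I. rewrite (RInt_FTC (fun s => w s * phi s)); try lra.
      - rewrite P0, Pl. lra.
      - intros s Hs. apply (dr_mult w phi); auto.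
      - ct.
      - ct. }
    cut (I (fun s => w s * w s) + I (fun s => phi s * y s) = 0); [lra|].
    rewrite <- F. unfold I. rewrite <- RInt_plus' by ct. apply RInt_ext'. intros s; unfold y; ring. }
  assert (Ec : I (fun s => w s * w s) = I (fun s => p s * p s) + I (fun s => phi s * phi s)).
  { assert (F : I (fun s => sech s * sech s * (phi s * phi s) + tanh s * ((w s + tanh s * phi s) * phi s + phi s * (w s + tanh s * phi s))) = 0).
    { unfold I. rewrite (RInt_FTC (fun s => tanh s * (phi s * phi s))); try lra.
      - rewrite P0, Pl. lra.
      - intros s Hs. apply (dr_mult tanh (fun s => phi s * phi s)); [apply is_derive_tanh|]. apply (dr_mult phi phi); auto.
      - ct.
      - ct. }
    rewrite <- (Rplus_0_r (I (fun s => w s * w s))), <- F. unfold I.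
    rewrite <- !RInt_plus' by ct. apply RInt_ext'. intros s; unfold p. rewrite sech2_tanh2. ring. }
  (* Poincaré's inequality: the derivative of [(s - l) phi^2] has integral zero, and completing the
     square leaves [phi'] only. *)
  assert (Ed : I (fun s => phi s * phi s) <= 4 * (l * l) * I (fun s => p s * p s)).
  { assert (F : I (fun s => 1 * (phi s * phi s) + (s - l) * ((w s + tanh s * phi s) * phi s + phi s * (w s + tanh s * phi s))) = 0).
    { unfold I. rewrite (RInt_FTC (fun s => (s - l) * (phi s * phi s))); try lra.
      - rewrite P0, Pl. lra.
      - intros s Hs. apply (dr_mult (fun s => s - l) (fun s => phi s * phi s)); [|apply (dr_mult phi phi); auto]. auto_derive; auto; ring.
      - ct.
      - ct. }
    assert (G : I (fun s => / 2 * (phi s * phi s) + - (2 * (l * l)) * (p s * p s)) <= 0).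
    { rewrite <- F. unfold I. apply RInt_mono; [lra|ct|ct|]. intros s Hs. fold (p s).
      assert (0 <= (phi s + 2 * ((s - l) * p s)) * (phi s + 2 * ((s - l) * p s))) by apply Rle_0_sqr.
      assert ((s - l) * (s - l) * (p s * p s) <= l * l * (p s * p s)).
      { apply Rmult_le_compat_r; [apply Rle_0_sqr | nra]. }
      nra. }
    unfold I in *. rewrite RInt_lin2 in G by ct. lra. }
  fold (I (fun s => w s * Lop s)). fold (I (fun s => w s * w s)).
  set (m := 1 + / (4 * (l * l))).
  assert (L4 : 0 < / (4 * (l * l))) by (apply Rinv_0_lt_compat; nra).
  assert (LL : / (4 * (l * l)) * (4 * (l * l)) = 1) by (field; lra).
  assert (A : m * I (fun s => phi s * phi s) <= I (fun s => w s * w s)).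
  { rewrite Ec. unfold m.
    assert (/ (4 * (l * l)) * I (fun s => phi s * phi s) <= / (4 * (l * l)) * (4 * (l * l) * I (fun s => p s * p s)))
      by (apply Rmult_le_compat_l; lra).
    rewrite <- (Rmult_assoc (/ (4 * (l * l)))), LL, Rmult_1_l in H. lra. }
  (* Young's inequality with weight [m]; by [A] its first term is at most half of the left side. *)
  assert (B : I (fun s => w s * w s) <= / 2 * m * I (fun s => phi s * phi s) + / (2 * m) * I (fun s => y s * y s)).
  { rewrite Eb. unfold I. rewrite <- RInt_lin2 by ct.
    replace (- RInt (fun s => phi s * y s) 0 l) with (RInt (fun s => (-1) * (phi s * y s)) 0 l)
      by (rewrite RInt_scal' by ct; lra).
    apply RInt_mono; [lra|ct|ct|]. intros s _.
    assert (Hm : 0 < m) by (unfold m; lra).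
    apply Rmult_le_reg_l with (2 * m); [lra|].
    replace (2 * m * (/ 2 * m * (phi s * phi s) + / (2 * m) * (y s * y s)))
      with ((m * phi s) * (m * phi s) + y s * y s) by (field; lra).
    generalize (Rle_0_sqr (m * phi s + y s)); unfold Rsqr; intros; lra. }
  rewrite Ea.
  assert (Hm : 0 < m) by (unfold m; lra).
  assert (m * I (fun s => w s * w s) <= I (fun s => y s * y s)).
  { assert (G : I (fun s => w s * w s) <= / 2 * I (fun s => w s * w s) + / (2 * m) * I (fun s => y s * y s)) by lra.
    apply (Rmult_le_compat_l (2 * m)) in G; [|lra].
    rewrite Rmult_plus_distr_l, <- (Rmult_assoc (2 * m) (/ (2 * m))), Rinv_r, Rmult_1_l in G by lra. lra. }
  unfold m in *. lra.
Qed.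

Section Odd.
Context (B0 : w 0 = 0) (Bl : w1 l * tanh l = w l * (sech l * sech l)).
Context (Or : RInt (fun s => w s * tanh s) 0 l = 0).

(** The Wronskian of [w] and [tanh]. Since [L tanh = 0] its derivative is [tanh * L w], and the
    Robin condition says that it vanishes at [l]. *)
Definition odd_defect s := w1 s * tanh s - w s * (sech s * sech s).
Definition orth_prim s := RInt (fun s => w s * tanh s) 0 s.

Lemma bb_derive s : 0 < s < l -> is_derive odd_defect s (tanh s * Lop s).
Proof.
  intros Hs. unfold odd_defect. eapply dr_eq.
  - apply dr_minus; apply dr_mult; auto; [apply is_derive_tanh|].
    apply (dr_mult sech sech); apply is_derive_sech.
  - unfold Lop. ring.
Qed.

Section Eps.
Context (e : R) (He : 0 < e < l).
(** The substitution [w = tanh * v] is singular at 0; the quotient is frozen below [e] so that all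
    integrands stay continuous on the line. *)
Definition coth_cut s := / tanh (Rmax e s).

Lemma it_cont : cont1 coth_cut.
Proof.
  intros s. unfold coth_cut. apply ct_inv.
  - assert (0 < Rmax e s) by (eapply Rlt_le_trans; [|apply Rmax_l]; lra).
    generalize (tanh_pos _ H); lra.
  - apply (ct_comp1 tanh); [|apply cont1_tanh].
    assert (M := cont1_Rmax0).
    apply continuous_ext with (fun s => e + Rmax 0 (s - e)).
    + assert (X : forall t : R, e + Rmax 0 (t - e) = Rmax e t); [|exact X].
      intros t. unfold Rmax; repeat destruct Rle_dec; lra.
    + ct.
Qed.

Lemma it_eq s : e <= s -> coth_cut s = / tanh s.
Proof. intros; unfold coth_cut; rewrite Rmax_right; auto. Qed.

Lemma it_derive s : e < s -> is_derive coth_cut s (- (sech s * sech s) * (coth_cut s * coth_cut s)).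
Proof.
  intros Hs. assert (T := tanh_pos s ltac:(lra)).
  apply (is_derive_ext_loc (fun s => / tanh s)).
  - assert (P : 0 < s - e) by lra. exists (mkposreal _ P). intros y Hy.
    apply ball_R, Rabs_lt_between in Hy; simpl in Hy. rewrite it_eq; auto; lra.
  - rewrite it_eq by lra. eapply dr_eq.
    + apply is_derive_inv; [apply is_derive_tanh | lra].
    + field. lra.
Qed.

(** For [v = w / tanh] one has [v' = odd_defect / tanh^2], so that the form equals minus the
    integral of [(odd_defect coth)^2], up to a term at [e]. Likewise the integral of
    [w^2 = v * (w tanh)] is paired with the primitive [orth_prim], which vanishes at [l] by
    orthogonality; a Poincaré inequality bounds [orth_prim coth] by [w], and Young's inequality
    closes the circle. *)
Lemma energy_odd_eps :
  let v := w e * coth_cut e in let th := orth_prim e * coth_cut e in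
  RInt (fun s => w s * Lop s) e l
  <= - / (4 * (l * l)) * RInt (fun s => w s * w s) e l
     + Rabs (v * odd_defect e) + (Rabs (v * orth_prim e) + th * th / (4 * l)) / (2 * (l * l)).
Proof.
  intros v th. assert (Ci := it_cont).
  assert (DP : forall s, is_derive orth_prim s (w s * tanh s)).
  { intros s. apply (is_derive_RInt1 (fun s => w s * tanh s)); ct. }
  assert (CP : cont1 orth_prim) by (intros s; apply (ct_der _ _ _ (DP s))).
  assert (Cb : cont1 odd_defect) by (unfold odd_defect; ct).
  assert (CL : cont1 Lop) by (unfold Lop; ct).
  assert (bl : odd_defect l = 0) by (unfold odd_defect; lra).
  assert (Pl : orth_prim l = 0) by exact Or.
  assert (Ti : forall s, e < s < l -> tanh s * coth_cut s = 1).
  { intros s Hs. rewrite it_eq by lra. apply Rinv_r. generalize (tanh_pos s ltac:(lra)); lra. }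
  assert (Dv : forall s, e < s < l -> is_derive (fun s => w s * coth_cut s) s (odd_defect s * (coth_cut s * coth_cut s))).
  { intros s Hs. eapply dr_eq.
    - apply (dr_mult w coth_cut); [apply D0; lra | apply it_derive; lra].
    - unfold odd_defect. replace (w1 s * coth_cut s) with (w1 s * coth_cut s * (tanh s * coth_cut s)) by (rewrite Ti by lra; ring). ring. }
  assert (Dth : forall s, e < s < l -> is_derive (fun s => orth_prim s * coth_cut s) s (w s - sech s * sech s * coth_cut s * (orth_prim s * coth_cut s))).
  { intros s Hs. eapply dr_eq.
    - apply (dr_mult orth_prim coth_cut); [apply DP | apply it_derive; lra].
    - replace (w s * tanh s * coth_cut s) with (w s * (tanh s * coth_cut s)) by ring. rewrite Ti by lra. ring. }
  pose (X := (RInt (fun s => (odd_defect s * coth_cut s) * (odd_defect s * coth_cut s)) e l : R)).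
  pose (Y := (RInt (fun s => (orth_prim s * coth_cut s) * (orth_prim s * coth_cut s)) e l : R)).
  pose (W := (RInt (fun s => w s * w s) e l : R)).
  assert (F1 : RInt (fun s => w s * Lop s) e l = - (v * odd_defect e) - X).
  { assert (F : RInt (fun s => odd_defect s * (coth_cut s * coth_cut s) * odd_defect s + (w s * coth_cut s) * (tanh s * Lop s)) e l = - (v * odd_defect e)).
    { rewrite (RInt_FTC (fun s => w s * coth_cut s * odd_defect s)); try lra.
      - rewrite bl. unfold v. lra.
      - intros s Hs. apply (dr_mult (fun s => w s * coth_cut s) odd_defect); [apply Dv; auto | apply bb_derive; lra].
      - ct.
      - ct. }
    unfold X. rewrite <- F, <- RInt_minus' by ct. apply RInt_ext. intros s Hs.
    rewrite Rmin_left, Rmax_right in Hs by lra.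
    transitivity (w s * Lop s * (tanh s * coth_cut s)); [rewrite Ti by lra; lra | lra]. }
  assert (F2 : W = - (v * orth_prim e) - RInt (fun s => (odd_defect s * coth_cut s) * (orth_prim s * coth_cut s)) e l).
  { assert (F : RInt (fun s => odd_defect s * (coth_cut s * coth_cut s) * orth_prim s + (w s * coth_cut s) * (w s * tanh s)) e l = - (v * orth_prim e)).
    { rewrite (RInt_FTC (fun s => w s * coth_cut s * orth_prim s)); try lra.
      - rewrite Pl. unfold v. lra.
      - intros s Hs. apply (dr_mult (fun s => w s * coth_cut s) orth_prim); [apply Dv; auto | apply DP].
      - ct.
      - ct. }
    unfold W. rewrite <- F, <- RInt_minus' by ct. apply RInt_ext. intros s Hs.
    rewrite Rmin_left, Rmax_right in Hs by lra.
    transitivity (w s * w s * (tanh s * coth_cut s)); [rewrite Ti by lra; lra | lra]. }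
  (* Poincaré again, with the weight [s - l]; the additional term [- sech^2 coth] in the derivative
     of [orth_prim coth] enters with the favourable sign on [s <= l]. *)
  assert (F3 : / 2 * Y + - (2 * (l * l)) * W <= l * (th * th)).
  { set (G := fun s => 1 * ((orth_prim s * coth_cut s) * (orth_prim s * coth_cut s)) + (s - l) *
        ((w s - sech s * sech s * coth_cut s * (orth_prim s * coth_cut s)) * (orth_prim s * coth_cut s)
         + (orth_prim s * coth_cut s) * (w s - sech s * sech s * coth_cut s * (orth_prim s * coth_cut s)))).
    assert (F : RInt G e l = (l - e) * (th * th)).
    { rewrite (RInt_FTC (fun s => (s - l) * ((orth_prim s * coth_cut s) * (orth_prim s * coth_cut s)))); try lra.
      - rewrite Pl. unfold th. lra.
      - intros s Hs. unfold G. apply (dr_mult (fun s => s - l) (fun s => (orth_prim s * coth_cut s) * (orth_prim s * coth_cut s))); [auto_derive; auto; ring|].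
        apply (dr_mult (fun s => orth_prim s * coth_cut s) (fun s => orth_prim s * coth_cut s)); apply Dth; auto.
      - ct.
      - unfold G; ct. }
    apply Rle_trans with ((l - e) * (th * th)); [|apply Rmult_le_compat_r; [apply Rle_0_sqr | lra]].
    rewrite <- F. unfold Y, W. rewrite <- RInt_lin2 by ct.
    apply RInt_mono; [lra|ct|unfold G; ct|]. intros s Hs. unfold G.
    set (T := orth_prim s * coth_cut s).
    assert (Hi : 0 <= coth_cut s).
    { unfold coth_cut. left; apply Rinv_0_lt_compat, tanh_pos. eapply Rlt_le_trans; [|apply Rmax_l]; lra. }
    assert (0 <= (T + 2 * ((s - l) * w s)) * (T + 2 * ((s - l) * w s))) by apply Rle_0_sqr.
    assert ((s - l) * (s - l) * (w s * w s) <= l * l * (w s * w s)).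
    { apply Rmult_le_compat_r; [apply Rle_0_sqr | nra]. }
    assert (0 <= (l - s) * (sech s * sech s * coth_cut s * (T * T))).
    { generalize (sech_le1 s); intros. apply Rmult_le_pos; [lra|].
      apply Rmult_le_pos; [apply Rmult_le_pos; lra | apply Rle_0_sqr]. }
    nra. }
  assert (L4 : 0 < / (4 * (l * l))) by (apply Rinv_0_lt_compat; nra).
  assert (F4 : - RInt (fun s => (odd_defect s * coth_cut s) * (orth_prim s * coth_cut s)) e l <= / (8 * (l * l)) * Y + 2 * (l * l) * X).
  { unfold X, Y. rewrite <- RInt_lin2 by ct.
    replace (- RInt (fun s => (odd_defect s * coth_cut s) * (orth_prim s * coth_cut s)) e l)
      with (RInt (fun s => (-1) * ((odd_defect s * coth_cut s) * (orth_prim s * coth_cut s))) e l) by (rewrite RInt_scal' by ct; lra).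
    apply RInt_mono; [lra|ct|ct|]. intros s _. set (T := orth_prim s * coth_cut s). set (b := odd_defect s * coth_cut s).
    apply Rmult_le_reg_l with (8 * (l * l)); [nra|].
    replace (8 * (l * l) * (/ (8 * (l * l)) * (T * T) + 2 * (l * l) * (b * b)))
      with (T * T + (4 * (l * l) * b) * (4 * (l * l) * b)) by (field; lra).
    generalize (Rle_0_sqr (T + 4 * (l * l) * b)); unfold Rsqr; intros; lra. }
  rewrite F1. change (RInt (fun s => w s * w s) e l) with W.
  assert (A1 := Rle_abs (- (v * odd_defect e))). rewrite Rabs_Ropp in A1.
  assert (A2 := Rle_abs (- (v * orth_prim e))). rewrite Rabs_Ropp in A2.
  set (v1 := Rabs (v * odd_defect e)) in *. set (v2 := Rabs (v * orth_prim e)) in *.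
  assert (G : / (4 * (l * l)) * W <= X + (v2 + th * th / (4 * l)) / (2 * (l * l))); [|lra].
  apply Rmult_le_reg_l with (4 * (l * l)); [nra|].
  replace (4 * (l * l) * (/ (4 * (l * l)) * W)) with W by (field; lra).
  replace (4 * (l * l) * (X + (v2 + th * th / (4 * l)) / (2 * (l * l))))
    with (4 * (l * l) * X + 2 * v2 + th * th / (2 * l)) by (field; lra).
  assert (F5 : / (8 * (l * l)) * Y <= / 2 * W + th * th / (4 * l)).
  { apply Rmult_le_reg_l with (4 * (l * l)); [nra|].
    replace (4 * (l * l) * (/ (8 * (l * l)) * Y)) with (/ 2 * Y) by (field; lra).
    replace (4 * (l * l) * (/ 2 * W + th * th / (4 * l))) with (2 * (l * l) * W + l * (th * th)) by (field; lra).
    lra. }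
  replace (th * th / (2 * l)) with (2 * (th * th / (4 * l))) by (field; lra).
  lra.
Qed.
End Eps.

(** The terms at [e] vanish in the limit: [w] and [odd_defect] are [O(e)] and [orth_prim] is
    [O(e^2)], while the quotient by [tanh] costs only [2 / e]. *)
Lemma energy_odd :
  RInt (fun s => w s * Lop s) 0 l <= - / (4 * (l * l)) * RInt (fun s => w s * w s) 0 l.
Proof.
  assert (CL : cont1 Lop) by (unfold Lop; ct).
  assert (Bd : exists L, 0 <= L /\ forall s, 0 <= s <= l -> Rabs (w1 s) <= L /\ Rabs (Lop s) <= L).
  { assert (Cc : forall f, cont1 f -> exists L, forall s, 0 <= s <= l -> Rabs (f s) <= L).
    { intros f Hf. destruct (continuity_ab_maj (fun s => Rabs (f s)) 0 l ltac:(lra)) as [m [Hm _]].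
      - intros c _. apply continuity_pt_filterlim. apply (ct_comp1 Rabs f); [apply Hf | apply cont1_Rabs].
      - exists (Rabs (f m)); auto. }
    destruct (Cc w1 C1) as [L1 H1], (Cc Lop CL) as [L2 H2].
    exists (Rmax 0 (Rmax L1 L2)). split; [apply Rmax_l|].
    intros s Hs. specialize (H1 s Hs); specialize (H2 s Hs).
    generalize (Rmax_l L1 L2) (Rmax_r L1 L2) (Rmax_r 0 (Rmax L1 L2)); lra. }
  destruct Bd as [L [HL Bd]].
  assert (Sm : exists d, 0 < d < l /\ forall s, 0 < s < d -> s / 2 <= tanh s).
  { assert (Cs : continuous (fun s => sech s * sech s) 0) by ct.
    assert (S0 : sech 0 * sech 0 = 1) by (rewrite sech2_tanh2, tanh_0; ring).
    assert (P : 0 < / 2) by lra.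
    destruct (proj1 (filterlim_locally _ _) Cs (mkposreal _ P)) as [r Hr].
    exists (Rmin l r / 2).
    assert (M : 0 < Rmin l r) by (apply Rmin_glb_lt; [auto | apply cond_pos]).
    generalize (Rmin_l l r) (Rmin_r l r); intros. split; [lra|].
    intros s Hs.
    destruct (MVT_gen tanh 0 s (fun s => sech s * sech s)) as [c [Hc Ec]].
    - intros; apply is_derive_tanh.
    - intros; apply continuity_pt_filterlim, cont1_tanh.
    - rewrite tanh_0 in Ec. rewrite Rmin_left, Rmax_right in Hc by lra.
      assert (B : Rabs (sech c * sech c - sech 0 * sech 0) < / 2).
      { apply (Hr c). unfold ball; simpl; unfold AbsRing_ball, abs, minus, plus, opp; simpl.
        rewrite Ropp_0, Rplus_0_r, Rabs_pos_eq; lra. }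
      rewrite S0 in B. apply Rabs_lt_between in B. nra. }
  destruct Sm as [d [Hd Sm]].
  assert (W0 : forall s, 0 <= s <= l -> Rabs (w s) <= L * s).
  { intros s Hs. destruct (Req_dec s 0) as [->|Hn]; [rewrite B0, Rabs_R0; lra|].
    destruct (MVT_gen w 0 s w1) as [c [Hc Ec]].
    - intros x Hx. rewrite Rmin_left, Rmax_right in Hx by lra. apply D0; lra.
    - intros; apply continuity_pt_filterlim, C0.
    - rewrite Rmin_left, Rmax_right in Hc by lra. rewrite B0, Rminus_0_r, Rminus_0_r in Ec. rewrite Ec, Rabs_mult, (Rabs_pos_eq s) by lra.
      apply Rmult_le_compat_r; [lra|]. apply Bd; lra. }
  assert (Bb : forall s, 0 < s <= l -> Rabs (odd_defect s) <= L * s).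
  { intros s Hs. assert (Cb : cont1 odd_defect) by (unfold odd_defect; ct).
    destruct (MVT_gen odd_defect 0 s (fun s => tanh s * Lop s)) as [c [Hc Ec]].
    - intros x Hx. rewrite Rmin_left, Rmax_right in Hx by lra. apply bb_derive; lra.
    - intros; apply continuity_pt_filterlim, Cb.
    - rewrite Rmin_left, Rmax_right in Hc by lra.
      assert (b0 : odd_defect 0 = 0) by (unfold odd_defect; rewrite B0, tanh_0; ring).
      rewrite b0, Rminus_0_r, Rminus_0_r in Ec. rewrite Ec, !Rabs_mult, (Rabs_pos_eq s) by lra.
      apply Rmult_le_compat_r; [lra|]. destruct (Bd c ltac:(lra)).
      generalize (tanh_le1 c) (Rabs_pos (tanh c)) (Rabs_pos (Lop c)). nra. }
  (* Any constant that dominates the error terms [T1] and [T4] divided by [e]; only its independence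
     of [e] matters. *)
  set (cst := 2 * L * L + (2 * L * L * l + 4 * L * L) * / (2 * (l * l)) * (1 + / (4 * l)) * (1 + l)).
  set (f := fun e => RInt (fun s => w s * Lop s) e l + / (4 * (l * l)) * RInt (fun s => w s * w s) e l - cst * e).
  assert (Cf : cont1 f).
  { assert (X : forall g, cont1 g -> cont1 (fun e => RInt g e l)).
    { intros g Hg e. apply (ct_der _ _ (- g e)). apply is_derive_ext with (fun e => - RInt g l e).
      - intros t. apply (opp_RInt_swap (V := R_CompleteNormedModule)), ex_RInt_cont1; auto.
      - apply dr_opp, is_derive_RInt1; auto. }
    assert (X1 := X _ (ltac:(ct) : cont1 (fun s => w s * Lop s))).
    assert (X2 := X _ (ltac:(ct) : cont1 (fun s => w s * w s))).
    unfold f; ct. }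
  assert (L2 : 0 < / (2 * (l * l))) by (apply Rinv_0_lt_compat; nra).
  assert (L4 : 0 < / (4 * l)) by (apply Rinv_0_lt_compat; nra).
  cut (f 0 <= 0); [unfold f; lra|].
  apply (lim_nonpos f (Rmin d 1)); auto; [apply Rmin_glb_lt; lra|].
  intros e He. generalize (Rmin_l d 1) (Rmin_r d 1); intros.
  assert (G := energy_odd_eps e ltac:(lra)). cbv zeta in G.
  assert (Te := Sm e ltac:(lra)). assert (Tp := tanh_pos e ltac:(lra)).
  assert (Ie : 0 < coth_cut e e /\ coth_cut e e * e <= 2).
  { rewrite it_eq by lra. split; [apply Rinv_0_lt_compat; auto|].
    apply Rmult_le_reg_l with (tanh e); auto. rewrite <- Rmult_assoc, Rinv_r by lra. lra. }
  set (i := coth_cut e e) in *.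
  assert (V : Rabs (w e * i) <= 2 * L).
  { rewrite Rabs_mult, (Rabs_pos_eq i) by lra. specialize (W0 e ltac:(lra)).
    apply Rle_trans with (L * e * i); [apply Rmult_le_compat_r; lra|]. nra. }
  assert (PH : Rabs (orth_prim e) <= e * (L * e)).
  { unfold orth_prim. replace (e * (L * e)) with ((e - 0) * (L * e)) by ring. apply RInt_bound; [lra|ct|].
    intros t Ht. rewrite Rabs_mult. specialize (W0 t ltac:(lra)).
    generalize (tanh_le1 t) (Rabs_pos (tanh t)) (Rabs_pos (w t)); intros.
    assert (L * t <= L * e) by (apply Rmult_le_compat_l; lra). nra. }
  assert (TH : Rabs (orth_prim e * i) <= 2 * L * e).
  { rewrite Rabs_mult, (Rabs_pos_eq i) by lra.
    apply Rle_trans with (e * (L * e) * i); [apply Rmult_le_compat_r; lra|].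
    replace (e * (L * e) * i) with (L * e * (i * e)) by ring.
    assert (0 <= L * e) by (apply Rmult_le_pos; lra). nra. }
  assert (T1 : Rabs (w e * i * odd_defect e) <= 2 * L * L * e).
  { rewrite Rabs_mult. specialize (Bb e ltac:(lra)).
    apply Rle_trans with (2 * L * (L * e)); [apply Rmult_le_compat; auto using Rabs_pos | lra]. }
  assert (T2 : Rabs (w e * i * orth_prim e) <= 2 * L * L * l * e).
  { rewrite Rabs_mult. apply Rle_trans with (2 * L * (e * (L * e))); [apply Rmult_le_compat; auto using Rabs_pos|].
    assert (0 <= L * L * e) by (apply Rmult_le_pos; nra). nra. }
  assert (T3 : orth_prim e * i * (orth_prim e * i) <= 4 * L * L * e).
  { replace (orth_prim e * i * (orth_prim e * i)) with (Rabs (orth_prim e * i) * Rabs (orth_prim e * i))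
      by (unfold Rabs; destruct Rcase_abs; ring).
    apply Rle_trans with (2 * L * e * (2 * L * e)); [apply Rmult_le_compat; auto using Rabs_pos|].
    assert (0 <= L * L * e) by (apply Rmult_le_pos; nra). nra. }
  unfold f. set (I1 := RInt (fun s => w s * Lop s) e l) in *. set (I2 := RInt (fun s => w s * w s) e l) in *.
  assert (T4 : (Rabs (w e * i * orth_prim e) + orth_prim e * i * (orth_prim e * i) / (4 * l)) / (2 * (l * l))
     <= (2 * L * L * l + 4 * L * L) * / (2 * (l * l)) * (1 + / (4 * l)) * (1 + l) * e).
  { unfold Rdiv. set (q := / (2 * (l * l))) in *. set (r := / (4 * l)) in *.
    assert (0 <= L * L) by nra. assert (0 <= L * L * e) by (apply Rmult_le_pos; lra).
    assert (0 <= L * L * e * l) by (apply Rmult_le_pos; lra).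
    assert (orth_prim e * i * (orth_prim e * i) * r <= 4 * L * L * e * r) by (apply Rmult_le_compat_r; lra).
    apply Rle_trans with ((2 * L * L * l * e + 4 * L * L * e * r) * q).
    - apply Rmult_le_compat_r; lra.
    - replace ((2 * L * L * l + 4 * L * L) * q * (1 + r) * (1 + l) * e)
        with (((2 * L * L * l + 4 * L * L) * e * (1 + r) * (1 + l)) * q) by ring.
      apply Rmult_le_compat_r; [lra|].
      set (A := L * L * e) in *. 
      replace ((2 * L * L * l + 4 * L * L) * e * (1 + r) * (1 + l)) with ((2 * (A * l) + 4 * A) * (1 + r) * (1 + l)) by (unfold A; ring).
      replace (2 * L * L * l * e + 4 * L * L * e * r) with (2 * (A * l) + 4 * (A * r)) by (unfold A; ring).
      assert (0 <= A * r) by (apply Rmult_le_pos; lra).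
      assert (0 <= A * l * r) by (apply Rmult_le_pos; lra).
      assert (0 <= A * l * l) by (apply Rmult_le_pos; lra).
      assert (0 <= A * l * l * r) by (apply Rmult_le_pos; lra).
      lra. }
  unfold cst. lra.
Qed.
End Odd.
End Energy1.

(** * Exponential decay of the squared norm *)

(** At a positive interior maximum the first derivative vanishes while the second is at least
    [c d > 0], so [d] would grow strictly just to the right of it. *)
Lemma compare_max (d d1 d2 : R -> R) Z c : 0 <= Z ->
  (forall z, is_derive d z (d1 z)) -> (forall z, is_derive d1 z (d2 z)) ->
  (forall z, - Z <= z <= Z -> c * d z <= d2 z) -> 0 < c ->
  d (- Z) <= 0 -> d Z <= 0 -> forall z, - Z <= z <= Z -> d z <= 0.
Proof.
  intros HZ D0 D1 Hc Hc0 Bl Br z Hz.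
  destruct (continuity_ab_maj d (- Z) Z ltac:(lra)) as [m [Hm1 Hm2]].
  { intros x _. apply continuity_pt_filterlim, (ct_der _ _ _ (D0 x)). }
  apply Rle_trans with (d m); [apply Hm1; auto|].
  destruct (Rle_lt_dec (d m) 0) as [|Hp]; auto. exfalso.
  assert (Hm : - Z < m < Z).
  { split; apply Rnot_le_lt; intros L.
    - replace m with (- Z) in Hp by lra. lra.
    - replace m with Z in Hp by lra. lra. }
  assert (Z1 : d1 m = 0).
  { assert (pr : derivable_pt d m) by (exists (d1 m); apply is_derive_Reals; auto).
    rewrite <- (deriv_maximum d (- Z) Z m pr); try lra.
    - symmetry. apply derive_pt_eq_0, is_derive_Reals; auto.
    - intros x H1 H2. apply Hm1; lra. }
  assert (P2 : 0 < d2 m).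
  { apply Rlt_le_trans with (c * d m); [apply Rmult_lt_0_compat; auto | apply Hc; lra]. }
  assert (A := proj1 (is_derive_Reals _ _ _) (D1 m)).
  destruct (A (d2 m) P2) as [r Hr].
  set (h := Rmin r (Z - m) / 2).
  assert (R0 : 0 < Rmin r (Z - m)) by (apply Rmin_glb_lt; [apply cond_pos | lra]).
  generalize (Rmin_l r (Z - m)) (Rmin_r r (Z - m)); intros Q1 Q2.
  destruct (MVT_gen d m (m + h) d1) as [x [Hx Ex]].
  - intros; apply D0.
  - intros; apply continuity_pt_filterlim, (ct_der _ _ _ (D0 x)).
  - rewrite Rmin_left, Rmax_right in Hx by (unfold h; lra).
    assert (Hd : d (m + h) <= d m) by (apply Hm1; unfold h; lra).
    destruct (Req_dec x m) as [->|Hn].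
    + (* the mean value point degenerates: use the next one *)
      assert (d (m + h) = d m) by (rewrite Z1 in Ex; lra).
      destruct (MVT_gen d (m + h / 2) (m + h) d1) as [x' [Hx' Ex']].
      * intros; apply D0.
      * intros; apply continuity_pt_filterlim, (ct_der _ _ _ (D0 x)).
      * rewrite Rmin_left, Rmax_right in Hx' by (unfold h; lra).
        assert (Hd' : d (m + h / 2) <= d m) by (apply Hm1; unfold h; lra).
        assert (P : 0 < d1 x').
        { specialize (Hr (x' - m) ltac:(unfold h in *; lra)).
          rewrite Rabs_pos_eq in Hr by (unfold h in *; lra).
          specialize (Hr ltac:(unfold h in *; lra)).
          replace (m + (x' - m)) with x' in Hr by ring. rewrite Z1, Rminus_0_r in Hr.
          apply Rabs_lt_between in Hr.
          assert (0 < d1 x' / (x' - m)) by lra.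
          replace (d1 x') with (d1 x' / (x' - m) * (x' - m)) by (field; unfold h in *; lra).
          apply Rmult_lt_0_compat; auto. unfold h in *; lra. }
        destruct (MVT_gen d m (m + h / 2) d1) as [u [Hu Eu]].
        -- intros; apply D0.
        -- intros; apply continuity_pt_filterlim, (ct_der _ _ _ (D0 x)).
        -- rewrite Rmin_left, Rmax_right in Hu by (unfold h; lra).
           assert (0 < d1 x' * (m + h - (m + h / 2))) by (apply Rmult_lt_0_compat; unfold h; lra).
           assert (P' : 0 <= d1 u).
           { destruct (Req_dec u m) as [->|Hn]; [lra|].
             specialize (Hr (u - m) ltac:(lra)).
             rewrite Rabs_pos_eq in Hr by lra.
             specialize (Hr ltac:(unfold h in *; lra)).
             replace (m + (u - m)) with u in Hr by ring. rewrite Z1, Rminus_0_r in Hr.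
             apply Rabs_lt_between in Hr.
             assert (0 < d1 u / (u - m)) by lra.
             replace (d1 u) with (d1 u / (u - m) * (u - m)) by (field; lra).
             left. apply Rmult_lt_0_compat; auto. lra. }
           assert (0 <= d1 u * (m + h / 2 - m)) by (apply Rmult_le_pos; unfold h; lra).
           lra.
    + assert (P : 0 < d1 x).
      { specialize (Hr (x - m) ltac:(lra)).
        rewrite Rabs_pos_eq in Hr by lra.
        specialize (Hr ltac:(unfold h in *; lra)).
        replace (m + (x - m)) with x in Hr by ring. rewrite Z1, Rminus_0_r in Hr.
        apply Rabs_lt_between in Hr.
        assert (0 < d1 x / (x - m)) by lra.
        replace (d1 x) with (d1 x / (x - m) * (x - m)) by (field; lra).
        apply Rmult_lt_0_compat; auto. lra. }
      assert (0 < d1 x * (m + h - m)) by (apply Rmult_lt_0_compat; unfold h; lra).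
      lra.
Qed.

(** A smooth substitute for [|z|], so that the barrier is twice differentiable at 0. *)
Definition rho z := sqrt (1 + z * z).

Lemma rho_pos z : 1 <= rho z /\ rho z * rho z = 1 + z * z.
Proof.
  unfold rho. assert (0 <= z * z) by apply Rle_0_sqr. split.
  - rewrite <- sqrt_1 at 1. apply sqrt_le_1; lra.
  - apply sqrt_sqrt; lra.
Qed.

Lemma rho_derive z : is_derive rho z (z / rho z).
Proof.
  destruct (rho_pos z) as [R1 R2]. unfold rho. assert (0 <= z * z) by apply Rle_0_sqr.
  auto_derive; [lra|]. change (sqrt (1 + z * z)) with (rho z). field. lra.
Qed.

Lemma rho_derive2 z : is_derive (fun z => z / rho z) z (/ (rho z * rho z * rho z)).
Proof.
  destruct (rho_pos z) as [R1 R2]. unfold Rdiv.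
  eapply dr_eq.
  - apply (dr_mult (fun z => z) (fun z => / rho z)); [apply dr_id|].
    apply is_derive_inv; [apply rho_derive | lra].
  - apply Rmult_eq_reg_r with (rho z * rho z * rho z); [|apply Rgt_not_eq; repeat apply Rmult_lt_0_compat; lra].
    rewrite Rinv_l by (apply Rgt_not_eq; repeat apply Rmult_lt_0_compat; lra).
    transitivity (rho z * rho z - z * z); [field; lra | lra].
Qed.

Section Decay.
Context (k : R) (Hk : 0 < k) (h h1 h2 : R -> R).
Context (D0 : forall z, is_derive h z (h1 z)) (D1 : forall z, is_derive h1 z (h2 z)).

(** On [|z| <= 9] one has [rho <= 10]; hence [1000 = 10^3] for [rho^3] and [exp (10 * k)] for
    [exp (k rho)]. *)
Definition decay_const (q0 : R) := 1000 * exp (10 * k) * q0 / (k * (k * k)).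

(* The supersolution [exp (- k rho)] absorbs a source on [|z| <= 9]
   because [rho'' = rho^-3 > 0]. *)
Lemma decay q0 q1 Bd Z (q : R -> R) : 0 <= q0 -> 0 <= q1 -> 0 <= Z -> 0 <= Bd ->
  (forall z, - Z <= z <= Z -> k * k * h z - / (k * k) * q z <= h2 z) ->
  (forall z, - Z <= z <= Z -> q z <= q0 + q1) ->
  (forall z, - Z <= z <= Z -> 9 < Rabs z -> q z <= q1) ->
  h (- Z) <= Bd -> h Z <= Bd ->
  forall z, - Z <= z <= Z ->
  h z <= decay_const q0 * exp (- k * rho z) + q1 / (k * k * (k * k)) + Bd * cosh (k * z) / cosh (k * Z).
Proof.
  intros Hq0 Hq1 HZ HB Hh Hqa Hqb Hl Hr z Hz.
  set (D := decay_const q0).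
  assert (Hkk : 0 < k * k) by nra.
  assert (HD : 0 <= D).
  { unfold D, decay_const, Rdiv. apply Rmult_le_pos; [|left; apply Rinv_0_lt_compat; nra].
    apply Rmult_le_pos; auto. generalize (exp_pos (10 * k)); lra. }
  assert (CZ := cosh_pos (k * Z)).
  assert (X := fun z => exp_pos (- k * rho z)).
  set (Q1 := q1 / (k * k * (k * k))).
  assert (HQ1 : k * k * Q1 = / (k * k) * q1) by (unfold Q1; field; lra).
  assert (HQ1' : 0 <= Q1) by (unfold Q1, Rdiv; apply Rmult_le_pos; [auto | left; apply Rinv_0_lt_compat; nra]).
  (* Three barriers are added: one for the source near 0, a constant for the uniform source [q1],
     and a multiple of [cosh] for the boundary values at [Z] and [- Z]. *)
  set (y := fun z => D * exp (- k * rho z) + Q1 + Bd / cosh (k * Z) * cosh (k * z)).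
  set (y1 := fun z => D * (- k * (z / rho z) * exp (- k * rho z)) + 0 + Bd / cosh (k * Z) * (k * sinh (k * z))).
  set (y2 := fun z => D * ((- k * (/ (rho z * rho z * rho z))) * exp (- k * rho z)
      + - k * (z / rho z) * (- k * (z / rho z) * exp (- k * rho z))) + 0
      + Bd / cosh (k * Z) * (k * (k * cosh (k * z)))).
  assert (De : forall z, is_derive (fun z => exp (- k * rho z)) z (- k * (z / rho z) * exp (- k * rho z))).
  { intros u. apply (dr_comp exp (fun z => - k * rho z)); [apply is_derive_exp|].
    apply dr_scal, rho_derive. }
  assert (Dc : forall z, is_derive (fun z => cosh (k * z)) z (k * sinh (k * z))).
  { intros u. apply (dr_comp cosh (fun z => k * z)); [apply is_derive_cosh'|auto_derive; auto; ring]. }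
  assert (Ds : forall z, is_derive (fun z => sinh (k * z)) z (k * cosh (k * z))).
  { intros u. apply (dr_comp sinh (fun z => k * z)); [apply is_derive_sinh'|auto_derive; auto; ring]. }
  assert (Dy : forall z, is_derive y z (y1 z)).
  { intros u. unfold y, y1. apply (dr_plus (fun z => D * exp (- k * rho z) + Q1)).
    - apply (dr_plus (fun z => D * exp (- k * rho z))); [apply dr_scal, De | apply dr_const].
    - apply dr_scal, Dc. }
  assert (Dy1 : forall z, is_derive y1 z (y2 z)).
  { intros u. unfold y1, y2.
    apply (dr_plus (fun z => D * (- k * (z / rho z) * exp (- k * rho z)) + 0)).
    - apply (dr_plus (fun z => D * (- k * (z / rho z) * exp (- k * rho z)))); [|apply dr_const].
      apply dr_scal. apply (dr_mult (fun z => - k * (z / rho z)) (fun z => exp (- k * rho z))); [|apply De].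
      apply dr_scal, rho_derive2.
    - apply dr_scal, dr_scal, Ds. }
  assert (Hy : forall z, - Z <= z <= Z -> y2 z <= k * k * y z - / (k * k) * q z).
  { intros u Hu. destruct (rho_pos u) as [R1 R2]. specialize (X u).
    unfold y2, y. set (ex := exp (- k * rho u)) in *.
    set (r3 := / (rho u * rho u * rho u)).
    assert (R3 : 0 < rho u * rho u * rho u) by (repeat apply Rmult_lt_0_compat; lra).
    assert (Pr3 : 0 < r3) by (unfold r3; apply Rinv_0_lt_compat; auto).
    assert (Z2 : (u / rho u) * (u / rho u) <= 1).
    { apply Rmult_le_reg_r with (rho u * rho u); [nra|].
      replace (u / rho u * (u / rho u) * (rho u * rho u)) with (u * u) by (field; lra). lra. }
    assert (Q : / (k * k) * q u <= D * (k * r3 * ex) + / (k * k) * q1).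
    { assert (Ik : 0 < / (k * k)) by (apply Rinv_0_lt_compat; auto).
      assert (P : 0 <= D * (k * r3 * ex)).
      { apply Rmult_le_pos; auto. apply Rmult_le_pos; [apply Rmult_le_pos|]; lra. }
      destruct (Rle_lt_dec (Rabs u) 9) as [S|S].
      - cut (/ (k * k) * q0 <= D * (k * r3 * ex)).
        { specialize (Hqa u Hu). intros.
          apply Rle_trans with (/ (k * k) * (q0 + q1)); [apply Rmult_le_compat_l; lra|lra]. }
        apply Rabs_le_between in S.
        assert (Rb : rho u <= 10) by nra.
        assert (E10 : exp (- 10 * k) <= ex) by (apply exp_le; nra).
        assert (R10 : / 1000 <= r3).
        { unfold r3. apply Rinv_le_contravar; auto.
          assert (rho u * rho u <= 100) by nra. nra. }
        apply Rle_trans with (D * (k * / 1000 * exp (- 10 * k))).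
        + right. unfold D, decay_const.
          assert (EE : exp (10 * k) * exp (- 10 * k) = 1).
          { rewrite <- exp_plus. replace (10 * k + - 10 * k) with 0 by ring. apply exp_0. }
          transitivity (/ (k * k) * q0 * (exp (10 * k) * exp (- 10 * k))); [rewrite EE; ring|].
          field. lra.
        + apply Rmult_le_compat_l; auto. generalize (exp_pos (- 10 * k)); intros.
          apply Rmult_le_compat; try nra.
      - specialize (Hqb u Hu S).
        assert (/ (k * k) * q u <= / (k * k) * q1) by (apply Rmult_le_compat_l; lra). lra. }
    assert (D * ex * (k * k) * (u / rho u * (u / rho u)) <= D * ex * (k * k) * 1).
    { apply Rmult_le_compat_l; auto. apply Rmult_le_pos; [apply Rmult_le_pos|]; lra. }
    lra. }
  assert (F : h z - y z <= 0).
  { apply (compare_max (fun z => h z - y z) (fun z => h1 z - y1 z) (fun z => h2 z - y2 z) Z (k * k)); auto.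
    - intros; apply dr_minus; auto.
    - intros; apply dr_minus; auto.
    - intros u Hu. specialize (Hh u Hu); specialize (Hy u Hu). lra.
    - unfold y. replace (k * - Z) with (- (k * Z)) by ring. rewrite cosh_neg || idtac.
      assert (Cn : cosh (- (k * Z)) = cosh (k * Z)) by (unfold cosh; rewrite Ropp_involutive; lra).
      rewrite ?Cn. replace (Bd / cosh (k * Z) * cosh (k * Z)) with Bd by (field; lra).
      generalize (Rmult_le_pos D _ HD (Rlt_le _ _ (X (- Z)))). lra.
    - unfold y. replace (Bd / cosh (k * Z) * cosh (k * Z)) with Bd by (field; lra).
      generalize (Rmult_le_pos D _ HD (Rlt_le _ _ (X Z))). lra. }
  unfold y, Rdiv in F. unfold Rdiv. lra.
Qed.
End Decay.

Lemma cosh_large k c : 0 < k -> exists Z, 0 <= Z /\ c <= cosh (k * Z).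
Proof.
  intros Hk. exists (2 * Rabs c / k). generalize (Rabs_pos c) (Rle_abs c); intros.
  split.
  - unfold Rdiv. apply Rmult_le_pos; [lra | left; apply Rinv_0_lt_compat; auto].
  - replace (k * (2 * Rabs c / k)) with (2 * Rabs c) by (field; lra).
    unfold cosh. generalize (exp_pos (- (2 * Rabs c))) (exp_ineq1_le (2 * Rabs c)); lra.
Qed.

Lemma cosh_mono x y : 0 <= x <= y -> cosh x <= cosh y.
Proof.
  intros H.
  destruct (MVT_gen cosh x y sinh) as [c [Hc Ec]].
  - intros; apply is_derive_cosh'.
  - intros; apply continuity_pt_filterlim, cont1_cosh.
  - rewrite Rmin_left, Rmax_right in Hc by lra.
    assert (Hs : 0 <= sinh c).
    { rewrite <- sinh_0. destruct (Req_dec c 0) as [->|]; [lra|]. left; apply sinh_lt. lra. }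
    nra.
Qed.

(** What the energy method uses, common to reflected approximations on the plane and to the
    difference of two solutions given on the strip only. In [s] no differentiability is recorded: it
    enters through the coercivity inequality [sd_coer]. *)
Record SD (l : R) (E w w1 w2 w11 w22 : R -> R -> R) : Prop := {
  sd_c : cont2 w; sd_c1 : cont2 w1; sd_c2 : cont2 w2; sd_c11 : cont2 w11; sd_c22 : cont2 w22;
  sd_cE : cont2 E;
  sd_d2 : forall s z, is_derive (fun z => w s z) z (w2 s z);
  sd_d22 : forall s z, is_derive (fun z => w2 s z) z (w22 s z);
  sd_eq : forall s z, 0 < s < l -> w11 s z + w22 s z + 2 * (sech s * sech s) * w s z = E s z;
  sd_coer : forall z, RInt (fun s => w s z * Lop (fun s => w s z) (fun s => w11 s z) s) 0 l
     <= - / (4 * (l * l)) * RInt (fun s => w s z * w s z) 0 l }.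

Section Energy2.
Context (l : R) (Hl : 0 < l) (E w w1 w2 w11 w22 : R -> R -> R) (HS : SD l E w w1 w2 w11 w22).

Definition hh z := RInt (fun s => w s z * w s z) 0 l.
Definition hh1 z := RInt (fun s => w2 s z * w s z + w s z * w2 s z) 0 l.
Definition hh2 z := RInt (fun s => w22 s z * w s z + w2 s z * w2 s z + (w2 s z * w2 s z + w s z * w22 s z)) 0 l.
Definition kk := / (2 * l).

Lemma kk_pos : 0 < kk.
Proof. unfold kk; apply Rinv_0_lt_compat; lra. Qed.
Lemma kk2 : kk * kk = / (4 * (l * l)).
Proof. unfold kk. field. lra. Qed.

Lemma hh_d z : is_derive hh z (hh1 z).
Proof.
  destruct HS. apply (is_derive_RInt_par (fun z s => w s z * w s z) (fun z s => w2 s z * w s z + w s z * w2 s z)).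
  - intros u s. apply (dr_mult (fun z => w s z) (fun z => w s z)); auto.
  - intros; ct.
  - ct.
Qed.

Lemma hh1_d z : is_derive hh1 z (hh2 z).
Proof.
  destruct HS. apply (is_derive_RInt_par (fun z s => w2 s z * w s z + w s z * w2 s z)
    (fun z s => w22 s z * w s z + w2 s z * w2 s z + (w2 s z * w2 s z + w s z * w22 s z))).
  - intros u s. apply (dr_plus (fun z => w2 s z * w s z) (fun z => w s z * w2 s z)).
    + apply (dr_mult (fun z => w2 s z) (fun z => w s z)); auto.
    + apply (dr_mult (fun z => w s z) (fun z => w2 s z)); auto.
  - intros; ct.
  - ct.
Qed.

(** [h''] is twice the integral of [w_z^2 + w w_zz] with [w_zz = E - L w]. Coercivity contributes
    [2 k^2 h], and Young's inequality spends half of it on the cross term with [E]. *)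
Lemma hh_ineq z : kk * kk * hh z - / (kk * kk) * RInt (fun s => E s z * E s z) 0 l <= hh2 z.
Proof.
  destruct HS as [Cw Cw1 Cw2 Cw11 Cw22 CE _ _ Heq Hc]. specialize (Hc z).
  assert (Kp : 0 < kk * kk) by (generalize kk_pos; nra).
  rewrite <- kk2 in Hc.
  assert (CL : cont1 (Lop (fun s => w s z) (fun s => w11 s z))) by (unfold Lop; ct).
  set (Lw := Lop (fun s => w s z) (fun s => w11 s z)) in *.
  apply Rle_trans with (RInt (fun s => - (kk * kk) * (w s z * w s z) + - / (kk * kk) * (E s z * E s z)) 0 l
     + RInt (fun s => -2 * (w s z * Lw s)) 0 l).
  - rewrite RInt_lin2, RInt_scal' by ct. unfold hh. lra.
  - rewrite <- RInt_plus' by ct. unfold hh2. apply RInt_le; [lra|apply ex_RInt_cont1; ct|apply ex_RInt_cont1; ct|].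
    intros s Hs. unfold Lw, Lop. specialize (Heq s z Hs).
    assert (EQ : w22 s z = E s z - (w11 s z + 2 * (sech s * sech s) * w s z)) by lra.
    rewrite EQ.
    assert (A : - (kk * kk) * (w s z * w s z) + - / (kk * kk) * (E s z * E s z) <= 2 * (w s z * E s z)).
    { apply Rmult_le_reg_l with (kk * kk); auto.
      replace (kk * kk * (- (kk * kk) * (w s z * w s z) + - / (kk * kk) * (E s z * E s z)))
        with (- ((kk * kk * w s z) * (kk * kk * w s z)) - E s z * E s z) by (field; apply Rgt_not_eq, kk_pos).
      generalize (Rle_0_sqr (kk * kk * w s z + E s z)); unfold Rsqr; intros; lra. }
    generalize (Rle_0_sqr (w2 s z)); unfold Rsqr; intros. lra.
Qed.

Lemma SD_decay q0 q1 Bd Z : 0 <= q0 -> 0 <= q1 -> 0 <= Z -> 0 <= Bd ->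
  (forall z, - Z <= z <= Z -> RInt (fun s => E s z * E s z) 0 l <= q0 + q1) ->
  (forall z, - Z <= z <= Z -> 9 < Rabs z -> RInt (fun s => E s z * E s z) 0 l <= q1) ->
  hh (- Z) <= Bd -> hh Z <= Bd ->
  forall z, - Z <= z <= Z ->
  hh z <= decay_const kk q0 * exp (- kk * rho z) + q1 / (kk * kk * (kk * kk)) + Bd * cosh (kk * z) / cosh (kk * Z).
Proof.
  intros. apply (decay kk kk_pos hh hh1 hh2 hh_d hh1_d q0 q1 Bd Z (fun z => RInt (fun s => E s z * E s z) 0 l)); auto.
  intros; apply hh_ineq.
Qed.

(** The bound [Bd] enters [SD_decay] with the factor [cosh (k z) / cosh (k Z)], which tends to 0 as
    [Z] grows; so any finite a priori bound improves to one by the source alone. *)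
Lemma SD_sup q1 Bd : 0 <= q1 ->
  (forall z, RInt (fun s => E s z * E s z) 0 l <= q1) -> (forall z, hh z <= Bd) ->
  forall z, hh z <= q1 / (kk * kk * (kk * kk)).
Proof.
  intros H0 Hq HB z.
  set (Q := q1 / (kk * kk * (kk * kk))).
  destruct (Rle_lt_dec (hh z) Q) as [|L]; auto. exfalso.
  set (B := Rmax 0 Bd).
  assert (B0 : 0 <= B) by apply Rmax_l. assert (B1 := Rmax_r 0 Bd). fold B in B1.
  (* Chosen so that the boundary contribution at [z] is strictly smaller than the excess [hh z - Q];
     the summand 1 takes care of [B = 0]. *)
  destruct (cosh_large kk (B * cosh (kk * z) / (hh z - Q) * 2 + 1) kk_pos) as [Z0 [HZ0 HZ1]].
  set (Z := Rmax Z0 (Rabs z)).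
  assert (Hz : - Z <= z <= Z) by (apply Rabs_le_between; apply Rmax_r).
  assert (Hm : cosh (kk * Z0) <= cosh (kk * Z)).
  { assert (D := kk_pos). apply cosh_mono. generalize (Rmax_l Z0 (Rabs z)). fold Z. intros.
    split; [apply Rmult_le_pos; lra | apply Rmult_le_compat_l; lra]. }
  assert (F := SD_decay 0 q1 B Z ltac:(lra) H0 ltac:(eapply Rle_trans; [exact HZ0 | apply Rmax_l]) B0
    ltac:(intros u _; specialize (Hq u); lra) ltac:(intros u _ _; apply Hq)
    ltac:(specialize (HB (- Z)); lra) ltac:(specialize (HB Z); lra) z Hz).
  fold Q in F. unfold decay_const in F.
  assert (C := cosh_pos (kk * Z)). assert (Cz := cosh_pos (kk * z)).
  assert (G : B * cosh (kk * z) / cosh (kk * Z) < hh z - Q).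
  { apply Rmult_lt_reg_r with (cosh (kk * Z)); auto.
    replace (B * cosh (kk * z) / cosh (kk * Z) * cosh (kk * Z)) with (B * cosh (kk * z)) by (field; lra).
    apply Rlt_le_trans with ((hh z - Q) * cosh (kk * Z0)); [|apply Rmult_le_compat_l; lra].
    apply Rlt_le_trans with ((hh z - Q) * (B * cosh (kk * z) / (hh z - Q) * 2 + 1)); [|apply Rmult_le_compat_l; lra].
    replace ((hh z - Q) * (B * cosh (kk * z) / (hh z - Q) * 2 + 1)) with (B * cosh (kk * z) * 2 + (hh z - Q)) by (field; lra).
    assert (0 <= B * cosh (kk * z)) by (apply Rmult_le_pos; lra). lra. }
  unfold Rdiv in F. rewrite !Rmult_0_r, !Rmult_0_l in F. unfold Rdiv in G. lra.
Qed.
End Energy2.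

(** * The Robin problem for a single Fourier mode *)

Lemma parity_mult a b f h : parity a f -> parity b h -> parity (a * b) (fun s => f s * h s).
Proof. intros Hf Hh s. rewrite Hf, Hh. ring. Qed.
Lemma parity_plus a f h : parity a f -> parity a h -> parity a (fun s => f s + h s).
Proof. intros Hf Hh s. rewrite Hf, Hh. ring. Qed.
Lemma parity_scal a c f : parity a f -> parity a (fun s => c * f s).
Proof. intros Hf s. rewrite Hf. ring. Qed.
Lemma parity_minus a f h : parity a f -> parity a h -> parity a (fun s => f s - h s).
Proof. intros Hf Hh s. rewrite Hf, Hh. ring. Qed.
Lemma parity_eq a b f : a = b -> parity a f -> parity b f.
Proof. intros <-; auto. Qed.

Lemma parity_RInt a f : cont1 f -> parity a f -> parity (- a) (fun s => RInt f 0 s).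
Proof.
  intros Hf P s.
  assert (E : RInt (fun t => f (0 - t)) 0 (- s) = - RInt f 0 s).
  { rewrite RInt_flip by auto. replace (0 - - s) with s by ring. replace (0 - 0) with 0 by ring.
    symmetry. apply (opp_RInt_swap (V := R_CompleteNormedModule)), ex_RInt_cont1; auto. }
  assert (E2 : RInt (fun t => f (0 - t)) 0 (- s) = a * RInt f 0 (- s)).
  { rewrite <- RInt_scal' by auto. apply RInt_ext'. intros t. rewrite <- P. f_equal; ring. }
  (* Stands in for [a^2 = 1], which is not assumed: parity applied twice. *)
  assert (aa : forall t, f t = a * a * f t).
  { intros t. rewrite <- (Ropp_involutive t) at 1. rewrite P, P. ring. }
  rewrite E in E2.
  assert (E3 : RInt f 0 (- s) = a * a * RInt f 0 (- s)).
  { rewrite <- RInt_scal' by auto. apply RInt_ext'; auto. }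
  rewrite E3, Rmult_assoc, <- E2. ring.
Qed.

Lemma cosh_even : parity 1 cosh.
Proof. intros s; unfold cosh; rewrite Ropp_involutive; lra. Qed.
Lemma sinh_odd : parity (-1) sinh.
Proof. intros s; unfold sinh; rewrite Ropp_involutive; lra. Qed.
Lemma sech_even : parity 1 sech.
Proof. intros s; unfold sech. rewrite cosh_even, !Rmult_1_l; auto. Qed.
Lemma tanh_odd : parity (-1) tanh.
Proof. intros s; rewrite !tanh_def, sinh_odd, sech_even. ring. Qed.

Section Mode.
Context (e2 : R) (ch sh : R -> R).
Context (Dch : forall s, is_derive ch s (e2 * sh s)) (Dsh : forall s, is_derive sh s (ch s)).
Context (Wr : forall s, ch s * ch s - e2 * (sh s * sh s) = 1).
Context (Ech : parity 1 ch) (Osh : parity (-1) sh).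
Context (g : R -> R) (Cg : cont1 g).

(** The hypotheses on [ch] and [sh] describe [cosh (eta s)] and [sinh (eta s) / eta], and also [1]
    and [s] for [eta = 0]. [mF] solves [F' - tanh F = g] with [F 0 = 0]; [mP] is the variation of
    constants solution of [P'' = e2 P + mF]. *)
Definition mF s := cosh s * RInt (fun t => g t * sech t) 0 s.
Definition mP s := sh s * RInt (fun t => ch t * mF t) 0 s - ch s * RInt (fun t => sh t * mF t) 0 s.
Definition mP1 s := ch s * RInt (fun t => ch t * mF t) 0 s - e2 * sh s * RInt (fun t => sh t * mF t) 0 s.

Lemma mF_d s : is_derive mF s (g s + tanh s * mF s).
Proof.
  unfold mF. eapply dr_eq.
  - apply (dr_mult cosh); [apply is_derive_cosh'|].
    apply (is_derive_RInt1 (fun s => g s * sech s)); ct.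
  - simpl. rewrite tanh_def. generalize (cosh_sech s); intros Z.
    replace (cosh s * (g s * sech s)) with (g s * (cosh s * sech s)) by ring.
    rewrite Z. replace (sinh s * sech s * (cosh s * RInt (fun s0 => g s0 * sech s0) 0 s))
      with (sinh s * RInt (fun s0 => g s0 * sech s0) 0 s * (cosh s * sech s)) by ring.
    rewrite Z. ring.
Qed.

Lemma mF_c : cont1 mF.
Proof. intros s; apply (ct_der _ _ _ (mF_d s)). Qed.
Lemma ch_c : cont1 ch.
Proof. intros s; apply (ct_der _ _ _ (Dch s)). Qed.
Lemma sh_c : cont1 sh.
Proof. intros s; apply (ct_der _ _ _ (Dsh s)). Qed.

Lemma mP_d s : is_derive mP s (mP1 s).
Proof.
  assert (CF := mF_c). assert (Cc := ch_c). assert (Cs := sh_c).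
  unfold mP, mP1. eapply dr_eq.
  - apply dr_minus.
    + apply (dr_mult sh); auto. apply (is_derive_RInt1 (fun t => ch t * mF t)); ct.
    + apply (dr_mult ch); auto. apply (is_derive_RInt1 (fun t => sh t * mF t)); ct.
  - simpl. ring.
Qed.

Lemma mP1_d s : is_derive mP1 s (e2 * mP s + mF s).
Proof.
  assert (CF := mF_c). assert (Cc := ch_c). assert (Cs := sh_c).
  unfold mP1, mP. eapply dr_eq.
  - apply dr_minus.
    + apply (dr_mult ch); auto. apply (is_derive_RInt1 (fun t => ch t * mF t)); ct.
    + apply (dr_mult (fun s => e2 * sh s)); [apply dr_scal; auto|].
      apply (is_derive_RInt1 (fun t => sh t * mF t)); ct.
  - simpl. generalize (Wr s); intros W. replace (mF s) with ((ch s * ch s - e2 * (sh s * sh s)) * mF s) at 3 by (rewrite W; ring).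
    ring.
Qed.

Section Hom.
(* [phi = mP + C hom], and [psi = phi' - tanh phi] solves the equation since
   [(L + 1) (d - tanh) = (d - tanh) d^2]. *)
Context (C : R) (hom hom1 : R -> R).
Context (Dh : forall s, is_derive hom s (hom1 s)) (Dh1 : forall s, is_derive hom1 s (e2 * hom s)).

Definition phi s := mP s + C * hom s.
Definition phi1 s := mP1 s + C * hom1 s.
Definition psi s := phi1 s - tanh s * phi s.
Definition psi1 s := e2 * phi s + mF s - sech s * sech s * phi s - tanh s * phi1 s.

Lemma phi_d s : is_derive phi s (phi1 s).
Proof. apply dr_plus; [apply mP_d | apply dr_scal; auto]. Qed.
Lemma phi1_d s : is_derive phi1 s (e2 * phi s + mF s).
Proof.
  eapply dr_eq; [apply dr_plus; [apply mP1_d | apply dr_scal; auto] | unfold phi; ring].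
Qed.
Lemma psi_d s : is_derive psi s (psi1 s).
Proof.
  unfold psi, psi1. eapply dr_eq.
  - apply dr_minus; [apply phi1_d|]. apply (dr_mult tanh phi); [apply is_derive_tanh | apply phi_d].
  - ring.
Qed.
Lemma psi1_d s : is_derive psi1 s (e2 * psi s + g s - 2 * (sech s * sech s) * psi s).
Proof.
  unfold psi1. eapply dr_eq.
  - apply dr_minus; [apply dr_minus; [apply dr_plus|]|].
    + apply dr_scal, phi_d.
    + apply mF_d.
    + apply (dr_mult (fun s => sech s * sech s) phi); [|apply phi_d].
      apply (dr_mult sech sech); apply is_derive_sech.
    + apply (dr_mult tanh phi1); [apply is_derive_tanh | apply phi1_d].
  - unfold psi. ring.
Qed.

Lemma psi_parity a : parity a g -> parity (- a) hom -> parity a psi.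
Proof.
  intros Pg Ph. assert (CF := mF_c). assert (Cc := ch_c). assert (Cs := sh_c).
  assert (PF : parity (- a) mF).
  { apply (parity_eq (1 * - (a * 1))); [ring|]. apply parity_mult; [apply cosh_even|].
    apply parity_RInt; [ct | apply parity_mult; auto; apply sech_even]. }
  assert (PP : parity (- a) mP).
  { apply parity_minus.
    - apply (parity_eq (-1 * - (1 * - a))); [ring|]. apply parity_mult; auto.
      apply parity_RInt; [ct | apply parity_mult; auto].
    - apply (parity_eq (1 * - (-1 * - a))); [ring|]. apply parity_mult; auto.
      apply parity_RInt; [ct | apply parity_mult; auto]. }
  assert (Pphi : parity (- a) phi) by (apply parity_plus; auto; apply parity_scal; auto).
  assert (Pphi1 : parity a phi1).
  { apply (parity_eq (- - a)); [ring|]. apply (parity_derive (- a) phi); auto. apply phi_d. }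
  apply parity_minus; auto. apply (parity_eq (-1 * - a)); [ring|].
  apply parity_mult; auto. apply tanh_odd.
Qed.
End Hom.
End Mode.

Definition mode_sol (l kap e2 sig : R) (om g psi psi1 : R -> R) : Prop :=
  (forall s, is_derive psi s (psi1 s)) /\
  (forall s, is_derive psi1 s (e2 * psi s + g s - 2 * (sech s * sech s) * psi s)) /\
  parity sig psi /\ psi1 l = kap * psi l /\ RInt (fun s => psi s * om s) 0 l = 0.

Lemma parity_odd_0 f : parity (-1) f -> f 0 = 0.
Proof. intros P. generalize (P 0). rewrite Ropp_0. lra. Qed.

Section ModeSolve.
Context (l : R) (Hl : 0 < l) (e2 : R) (ch sh : R -> R).
Context (Dch : forall s, is_derive ch s (e2 * sh s)) (Dsh : forall s, is_derive sh s (ch s)).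
Context (Wr : forall s, ch s * ch s - e2 * (sh s * sh s) = 1).
Context (Ech : parity 1 ch) (Osh : parity (-1) sh).
Context (g : R -> R) (Cg : cont1 g).

(** Since [(phi sech)' = psi sech], the single condition [phi l = 0] gives orthogonality of [psi];
    together with [mF l = 0], which is the orthogonality of [g], it gives the Robin condition as
    well. The homogeneous solution [sh] keeps [phi] odd and [psi] even. *)
Lemma mode_even : sh l <> 0 -> parity 1 g -> RInt (fun s => g s * sech s) 0 l = 0 ->
  exists psi psi1, mode_sol l (- tanh l) e2 1 sech g psi psi1.
Proof.
  intros Hsl Pg Or.
  set (C := - mP ch sh g l / sh l).
  exists (psi e2 ch sh g C sh ch), (psi1 e2 ch sh g C sh ch).
  assert (Fl : mF g l = 0) by (unfold mF; rewrite Or; ring).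
  assert (phl : phi ch sh g C sh l = 0) by (unfold phi, C; field; auto).
  assert (Dphi := phi_d e2 ch sh Dch Dsh g Cg C sh ch Dsh).
  assert (ph0 : phi ch sh g C sh 0 = 0).
  { unfold phi, mP. rewrite !RInt_point, (parity_odd_0 sh Osh). unfold zero; simpl. ring. }
  split; [|split; [|split; [|split]]].
  - intros s; apply (psi_d e2 ch sh Dch Dsh Wr g Cg C sh ch Dsh Dch).
  - intros s; apply (psi1_d e2 ch sh Dch Dsh Wr g Cg C sh ch Dsh Dch).
  - apply (psi_parity e2 ch sh Dch Dsh Ech Osh g Cg C sh ch Dsh); auto.
  - unfold psi1, psi. rewrite phl, Fl. ring.
  - assert (Cp : cont1 (phi ch sh g C sh)) by (intros s; apply (ct_der _ _ _ (Dphi s))).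
    assert (Cpsi : cont1 (psi e2 ch sh g C sh ch)).
    { intros s. apply (ct_der _ _ _ (psi_d e2 ch sh Dch Dsh Wr g Cg C sh ch Dsh Dch s)). }
    rewrite (RInt_FTC (fun s => phi ch sh g C sh s * sech s)); try lra.
    + rewrite phl, ph0. lra.
    + intros s _. eapply dr_eq.
      * apply (dr_mult (phi ch sh g C sh) sech); [apply Dphi | apply is_derive_sech].
      * unfold psi. ring.
    + ct.
    + ct.
Qed.

(** Green's formula against [tanh] shows that the Robin defect at [l] equals [e2] times the integral
    of [psi tanh]. For [e2 <> 0] one choice of [C] thus settles both conditions. For [e2 = 0] the
    Robin condition is automatic, and [C], which only adds a multiple of [tanh], is fixed by
    orthogonality. *)
Lemma mode_odd : ((e2 = 0 /\ forall s, ch s = 1) \/ e2 <> 0 /\ ch l * tanh l <> sh l) -> parity (-1) g ->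
  RInt (fun s => g s * tanh s) 0 l = 0 ->
  exists psi psi1, mode_sol l (sech l * sech l / tanh l) e2 (-1) tanh g psi psi1.
Proof.
  intros Hc Pg Or. assert (Tl := tanh_pos l Hl).
  assert (Gen : forall C,
    let p := psi e2 ch sh g C ch (fun s => e2 * sh s) in
    let p1 := psi1 e2 ch sh g C ch (fun s => e2 * sh s) in
    (forall s : R, is_derive p s (p1 s)) /\
    (forall s, is_derive p1 s (e2 * p s + g s - 2 * (sech s * sech s) * p s)) /\
    parity (-1) p /\
    p1 l * tanh l - p l * (sech l * sech l) = e2 * RInt (fun s => p s * tanh s) 0 l).
  { intros C p p1.
    assert (Dh1 : forall s, is_derive (fun s => e2 * sh s) s (e2 * ch s)) by (intros; apply dr_scal; auto).
    assert (D0 : forall s, is_derive p s (p1 s))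
      by (intros s; apply (psi_d e2 ch sh Dch Dsh Wr g Cg C ch _ Dch Dh1)).
    assert (D1 : forall s, is_derive p1 s (e2 * p s + g s - 2 * (sech s * sech s) * p s))
      by (intros s; apply (psi1_d e2 ch sh Dch Dsh Wr g Cg C ch _ Dch Dh1)).
    assert (P : parity (-1) p).
    { apply (psi_parity e2 ch sh Dch Dsh Ech Osh g Cg C ch _ Dch); auto. apply (parity_eq 1); [ring|auto]. }
    split; [auto|split; [auto|split; [auto|]]].
    assert (Cp : cont1 p) by (intros s; apply (ct_der _ _ _ (D0 s))).
    assert (Cp1 : cont1 p1) by (intros s; apply (ct_der _ _ _ (D1 s))).
    assert (F : RInt (fun s => e2 * (p s * tanh s) + 1 * (g s * tanh s)) 0 l
       = p1 l * tanh l - p l * (sech l * sech l)).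
    { rewrite (RInt_FTC (fun s => p1 s * tanh s - p s * (sech s * sech s))); try lra.
      - rewrite (parity_odd_0 p P), tanh_0. lra.
      - intros s _. eapply dr_eq.
        + apply dr_minus.
          * apply (dr_mult p1 tanh); [apply D1 | apply is_derive_tanh].
          * apply (dr_mult p (fun s => sech s * sech s)); [apply D0|].
            apply (dr_mult sech sech); apply is_derive_sech.
        + ring.
      - ct.
      - ct. }
    rewrite <- F, RInt_lin2, Or by ct. ring. }
  assert (Fin : forall C, RInt (fun s => psi e2 ch sh g C ch (fun s => e2 * sh s) s * tanh s) 0 l = 0 ->
    exists psi psi1, mode_sol l (sech l * sech l / tanh l) e2 (-1) tanh g psi psi1).
  { intros C HC. destruct (Gen C) as [G1 [G2 [G3 G4]]].
    eexists; eexists. split; [exact G1|]. split; [exact G2|]. split; [exact G3|]. split; [|exact HC].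
    rewrite HC in G4.
    apply Rmult_eq_reg_r with (tanh l); [|lra].
    replace (sech l * sech l / tanh l * psi e2 ch sh g C ch (fun s => e2 * sh s) l * tanh l)
      with (psi e2 ch sh g C ch (fun s => e2 * sh s) l * (sech l * sech l)) by (field; lra).
    lra. }
  assert (Cc := ch_c e2 ch sh Dch).
  destruct Hc as [[E0 E1]|[E0 Hn]].
  - set (p0 := psi e2 ch sh g 0 ch (fun s => e2 * sh s)).
    destruct (Gen 0) as [G1 _]. fold p0 in G1.
    assert (Cp : cont1 p0) by (intros s; apply (ct_der _ _ _ (G1 s))).
    set (T := RInt (fun s => tanh s * tanh s) 0 l).
    assert (HT : 0 < T).
    { apply RInt_gt_0; auto; intros; [|ct]. generalize (tanh_pos x ltac:(lra)); nra. }
    apply (Fin (RInt (fun s => p0 s * tanh s) 0 l / T)).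
    set (I := RInt (fun s => p0 s * tanh s) 0 l).
    rewrite (RInt_ext' _ (fun s => 1 * (p0 s * tanh s) + - (I / T) * (tanh s * tanh s))).
    + rewrite RInt_lin2 by ct. fold I. fold T. unfold Rdiv. rewrite Ropp_mult_distr_l_reverse.
      rewrite Rmult_assoc, Rinv_l by lra. lra.
    + intros s. unfold p0, psi, phi, phi1. rewrite E0, E1. ring.
  - set (A := tanh l * (e2 * mP ch sh g l + mF g l) - mP1 e2 ch sh g l).
    set (C := - A / (e2 * (ch l * tanh l - sh l))).
    assert (Hd : ch l * tanh l - sh l <> 0) by lra.
    apply (Fin C). destruct (Gen C) as [_ [_ [_ G4]]].
    apply Rmult_eq_reg_l with e2; auto. rewrite Rmult_0_r. unfold psi in *.
    rewrite <- G4.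
    transitivity (A + C * (e2 * (ch l * tanh l - sh l)));
      [|unfold C; field; auto].
    unfold psi1, phi1, phi, A. clearbody C. cbv beta. rewrite sech2_tanh2. ring.
Qed.
End ModeSolve.

(* [true] stands for the even part, [false] for the odd part. *)
Definition sigp (b : bool) : R := if b then 1 else -1.
Definition omp (b : bool) : R -> R := if b then sech else tanh.
Definition kapp (b : bool) (l : R) : R := if b then - tanh l else sech l * sech l / tanh l.

Lemma sigp2 b : sigp b * sigp b = 1.
Proof. destruct b; simpl; ring. Qed.
Lemma omp_cont b : cont1 (omp b).
Proof. destruct b; [apply cont1_sech | apply cont1_tanh]. Qed.

Lemma sinh_pos x : 0 < x -> 0 < sinh x.
Proof. intros. rewrite <- sinh_0. apply sinh_lt; auto. Qed.

(** The defect [q] vanishes at 0 and its derivative carries the sign of [eta^2 - 1] on the whole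
    half-line. *)
Lemma wronskian_nz l eta : 0 < l -> 0 < eta -> eta <> 1 ->
  cosh (eta * l) * tanh l <> sinh (eta * l) / eta.
Proof.
  intros Hl He H1 Heq.
  set (q := fun s => eta * (sinh s * cosh (eta * s)) - sinh (eta * s) * cosh s).
  assert (Dq : forall s, is_derive q s ((eta * eta - 1) * (sinh (eta * s) * sinh s))).
  { intros s. unfold q.
    assert (D1 : is_derive (fun s => cosh (eta * s)) s (eta * sinh (eta * s))).
    { apply (dr_comp cosh (fun s => eta * s)); [apply is_derive_cosh'|auto_derive; auto; ring]. }
    assert (D2 : is_derive (fun s => sinh (eta * s)) s (eta * cosh (eta * s))).
    { apply (dr_comp sinh (fun s => eta * s)); [apply is_derive_sinh'|auto_derive; auto; ring]. }
    eapply dr_eq.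
    - apply dr_minus.
      + apply dr_scal, (dr_mult sinh _ s _ _ (is_derive_sinh' s) D1).
      + apply (dr_mult _ cosh s _ _ D2 (is_derive_cosh' s)).
    - ring. }
  destruct (MVT_cor2 q (fun s => (eta * eta - 1) * (sinh (eta * s) * sinh s)) 0 l Hl) as [c [Ec Hc]].
  { intros; apply is_derive_Reals, Dq. }
  assert (q0 : q 0 = 0) by (unfold q; rewrite Rmult_0_r, sinh_0; ring).
  assert (ql : q l = 0).
  { unfold q. apply Rmult_eq_reg_r with (sech l); [|generalize (sech_pos l); lra].
    replace ((eta * (sinh l * cosh (eta * l)) - sinh (eta * l) * cosh l) * sech l)
      with (eta * (cosh (eta * l) * (sinh l * sech l)) - sinh (eta * l) * (cosh l * sech l)) by ring.
    rewrite <- tanh_def, Heq, cosh_sech. field. lra. }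
  rewrite q0, ql in Ec.
  assert (0 < sinh (eta * c) * sinh c).
  { apply Rmult_lt_0_compat; apply sinh_pos; [apply Rmult_lt_0_compat|]; lra. }
  assert (X : (eta * eta - 1) * (sinh (eta * c) * sinh c) * (l - 0) <> 0).
  { apply Rmult_integral_contrapositive_currified; [|lra].
    apply Rmult_integral_contrapositive_currified; [|lra].
    intros Z. assert (Z' : (eta - 1) * (eta + 1) = 0) by lra.
    destruct (Rmult_integral _ _ Z'); lra. }
  lra.
Qed.

Lemma mode_exists b l eta g : 0 < l -> 0 <= eta -> eta <> 1 -> cont1 g -> parity (sigp b) g ->
  RInt (fun s => g s * omp b s) 0 l = 0 ->
  exists psi psi1, mode_sol l (kapp b l) (eta * eta) (sigp b) (omp b) g psi psi1.
Proof.
  intros Hl He H1 Cg Pg Or.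
  destruct (Req_dec eta 0) as [->|Hn].
  - rewrite Rmult_0_l.
    assert (Dch : forall s : R, is_derive (fun _ : R => 1) s (0 * s)) by (intros; eapply dr_eq; [apply dr_const | ring]).
    assert (Dsh : forall s : R, is_derive (fun s : R => s) s 1) by (intros; apply dr_id).
    destruct b; simpl in *.
    + apply (mode_even l Hl 0 (fun _ => 1) (fun s => s)); auto; try lra; intros s; ring.
    + apply (mode_odd l Hl 0 (fun _ => 1) (fun s => s)); auto; intros s; ring.
  - set (ch := fun s => cosh (eta * s)). set (sh := fun s => sinh (eta * s) / eta).
    assert (Dch : forall s, is_derive ch s (eta * eta * sh s)).
    { intros s. unfold ch, sh. eapply dr_eq; [apply (dr_comp cosh (fun s => eta * s) s (sinh (eta * s)) eta); [apply is_derive_cosh'|auto_derive; auto; ring]|].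
      field; auto. }
    assert (Dsh : forall s, is_derive sh s (ch s)).
    { intros s. unfold ch, sh. apply (is_derive_ext (fun s => / eta * sinh (eta * s))); [intros; unfold Rdiv; apply Rmult_comm|].
      eapply dr_eq; [apply dr_scal, (dr_comp sinh (fun s => eta * s) s (cosh (eta * s)) eta); [apply is_derive_sinh'|auto_derive; auto; ring]|].
      field; auto. }
    assert (Wr : forall s, ch s * ch s - eta * eta * (sh s * sh s) = 1).
    { intros s. unfold ch, sh. rewrite <- (cosh2_sinh2 (eta * s)). field; auto. }
    assert (Ech : parity 1 ch).
    { intros s. unfold ch. replace (eta * - s) with (- (eta * s)) by ring. apply cosh_even. }
    assert (Osh : parity (-1) sh).
    { intros s. unfold sh. replace (eta * - s) with (- (eta * s)) by ring. rewrite sinh_odd. field; auto. }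
    assert (Hs : 0 < sinh (eta * l)) by (apply sinh_pos, Rmult_lt_0_compat; lra).
    destruct b; simpl in *.
    + apply (mode_even l Hl (eta * eta) ch sh); auto.
      unfold sh. apply Rgt_not_eq, Rdiv_lt_0_compat; lra.
    + apply (mode_odd l Hl (eta * eta) ch sh); auto.
      right. split; [nra|]. apply wronskian_nz; auto; lra.
Qed.

Lemma cont2_prod f t : cont1 f -> cont1 t -> cont2 (fun s z => f s * t z).
Proof. intros; ct. Qed.

Lemma grad_prod (f f1 t t1 : R -> R) :
  (forall s, is_derive f s (f1 s)) -> (forall z, is_derive t z (t1 z)) -> cont1 f1 -> cont1 t1 ->
  grad (fun s z => f s * t z) (fun s z => f1 s * t z) (fun s z => f s * t1 z).
Proof.
  intros Df Dt C1 T1.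
  assert (C0 : cont1 f) by (intros s; apply (ct_der _ _ _ (Df s))).
  assert (T0 : cont1 t) by (intros s; apply (ct_der _ _ _ (Dt s))).
  split; try (apply cont2_prod; auto).
  - intros s z. eapply dr_eq; [apply (dr_mult f (fun _ => t z)); [apply Df | apply dr_const] | ring].
  - intros s z. apply dr_scal, Dt.
Qed.

(** [tau'' = - eta^2 tau] cancels the term [eta^2 psi] of the mode equation. The reflection acts in
    [s] alone, so it commutes with the factor [tau z] and with the [z] derivatives. *)
Lemma mode_Sol l kap sig om eta g psi psi1 (tau tau1 : R -> R) :
  0 < l -> sig * sig = 1 -> cont1 g -> parity sig g -> cont1 om ->
  mode_sol l kap (eta * eta) sig om g psi psi1 ->
  (forall z, is_derive tau z (tau1 z)) -> (forall z, is_derive tau1 z (- (eta * eta) * tau z)) ->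
  (forall z, Rabs (tau z) <= 1) ->
  exists J, Sol l kap sig om (fun s z => g s * tau z) J.
Proof.
  intros Hl Hsig Cg Pg Com [D0 [D1 [P [BC Or]]]] T0 T1 TB.
  set (psi2 := fun s => eta * eta * psi s + g s - 2 * (sech s * sech s) * psi s).
  assert (Cp : cont1 psi) by (intros s; apply (ct_der _ _ _ (D0 s))).
  assert (C2 : cont1 psi2) by (unfold psi2; ct).
  assert (P2 : parity sig psi2).
  { intros s. unfold psi2. rewrite P, Pg, sech_even. ring. }
  assert (Ct : cont1 tau) by (intros s; apply (ct_der _ _ _ (T0 s))).
  assert (Ct1 : cont1 tau1) by (intros s; apply (ct_der _ _ _ (T1 s))).
  set (f := ext kap l sig psi). set (f1 := ext' kap l sig psi psi1). set (f2 := ext kap l sig psi2).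
  assert (Df : forall s, is_derive f s (f1 s)) by (intros; apply ext_derive; auto).
  assert (Df1 : forall s, is_derive f1 s (f2 s)) by (intros; apply (ext1_derive kap l sig Hl psi psi1 psi2 P D0 D1 C2 BC)).
  assert (Cf : cont1 f) by (apply ext2_cont; auto).
  assert (Cf2 : cont1 f2) by (apply ext2_cont; auto).
  assert (Cf1 : cont1 f1) by (intros s; apply (ct_der _ _ _ (Df1 s))).
  set (J := Jet (fun s z => f s * tau z) (fun s z => f1 s * tau z) (fun s z => f s * tau1 z)
    (fun s z => f2 s * tau z) (fun s z => f1 s * tau1 z) (fun s z => f s * (- (eta * eta) * tau z))).
  exists J. unfold J.
  assert (Pf : parity sig f) by (apply ext_parity; auto).
  assert (Pf2 : parity sig f2) by (apply ext_parity; auto).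
  split.
  - split; simpl; apply grad_prod; auto. ct.
  - intros z s; simpl. rewrite Pf; ring.
  - intros z s; unfold lap; simpl. rewrite Pf, Pf2; ring.
  - intros s z Hs; simpl.
    rewrite (refl_ext kap l _ (fun s => tau z * f s)) by (intros; lra).
    rewrite refl_scal by auto. unfold f at 1. rewrite (ext_self kap l sig Hl psi s P Hs). fold f. ring.
  - intros s z Hs; unfold lap; simpl.
    rewrite (refl_ext kap l _ (fun s => tau z * f2 s + - (eta * eta) * tau z * f s)) by (intros; lra).
    rewrite refl_plus, !refl_scal by ct.
    unfold f at 1, f2 at 1. rewrite (ext_self kap l sig Hl psi s P Hs), (ext_self kap l sig Hl psi2 s P2 Hs).
    fold f f2. ring.
  - intros s z Hs; unfold lap; simpl. unfold f, f2. rewrite !ext_in by auto. unfold psi2. ring.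
  - intros z; simpl. unfold f, f1, ext'.
    rewrite ext_in by (auto; lra). unfold ext3. rewrite glue_le by lra.
    rewrite glue_ge; [rewrite BC; ring| |lra].
    replace (- - l - l) with 0 by ring. rewrite refl1_0 by auto.
    rewrite (parity_derive sig psi psi1 D0 P). auto.
  - intros z; simpl.
    rewrite (RInt_ext (V := R_CompleteNormedModule) _ (fun s => tau z * (psi s * om s))).
    + rewrite RInt_scal' by ct. rewrite Or. apply Rmult_0_r.
    + intros s Hs. rewrite Rmin_left, Rmax_right in Hs by lra. unfold f. rewrite ext_in by (auto; lra).
      simpl. ring.
  - destruct (continuity_ab_maj (fun s => Rabs (psi s)) (- l) l ltac:(lra)) as [m [Hm _]].
    + intros c _. apply continuity_pt_filterlim. apply (ct_comp1 Rabs psi); [apply Cp | apply cont1_Rabs].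
    + exists (Rabs (psi m)). intros s z Hs. simpl. unfold f. rewrite ext_in by auto.
      rewrite Rabs_mult. specialize (Hm s Hs). specialize (TB z).
      generalize (Rabs_pos (psi s)) (Rabs_pos (tau z)). intros. nra.
Qed.

Definition jlin a (J : jet) b (J' : jet) : jet :=
  Jet (fun s z => a * j0 J s z + b * j0 J' s z) (fun s z => a * j1 J s z + b * j1 J' s z)
      (fun s z => a * j2 J s z + b * j2 J' s z) (fun s z => a * j11 J s z + b * j11 J' s z)
      (fun s z => a * j12 J s z + b * j12 J' s z) (fun s z => a * j22 J s z + b * j22 J' s z).

Lemma grad_lin a b g g1 g2 h h1 h2 : grad g g1 g2 -> grad h h1 h2 ->
  grad (fun s z => a * g s z + b * h s z) (fun s z => a * g1 s z + b * h1 s z)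
       (fun s z => a * g2 s z + b * h2 s z).
Proof.
  intros [] []. split; try ct.
  - intros. apply (dr_plus (fun s => a * g s z)); apply dr_scal; auto.
  - intros. apply (dr_plus (fun z => a * g s z)); apply dr_scal; auto.
Qed.

Lemma lap_lin a J b J' s z : lap (jlin a J b J') s z = a * lap J s z + b * lap J' s z.
Proof. unfold lap; simpl; ring. Qed.

Lemma Sol_lin l kap sig om E E' J J' a b : 0 < l -> cont1 om ->
  Sol l kap sig om E J -> Sol l kap sig om E' J' ->
  Sol l kap sig om (fun s z => a * E s z + b * E' s z) (jlin a J b J').
Proof.
  intros Hl Com S S'.
  assert (HJ := so_C2 _ _ _ _ _ _ S). assert (HJ' := so_C2 _ _ _ _ _ _ S').
  assert (c0 : forall z, cont1 (fun s => j0 J s z)) by (intros z; apply (cont_j0 _ _ _ _ _ _ S)).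
  assert (c0' : forall z, cont1 (fun s => j0 J' s z)) by (intros z; apply (cont_j0 _ _ _ _ _ _ S')).
  assert (cL : forall z, cont1 (fun s => lap J s z)) by (intros z; apply (cont_lap _ _ _ _ _ _ S)).
  assert (cL' : forall z, cont1 (fun s => lap J' s z)) by (intros z; apply (cont_lap _ _ _ _ _ _ S')).
  split.
  - destruct HJ, HJ'. split; simpl; apply grad_lin; auto.
  - intros z s; simpl.
    rewrite (so_par0 _ _ _ _ _ _ S z s), (so_par0 _ _ _ _ _ _ S' z s). ring.
  - intros z s; simpl. rewrite !lap_lin.
    rewrite (so_parL _ _ _ _ _ _ S z s), (so_parL _ _ _ _ _ _ S' z s). ring.
  - intros s z Hs; simpl.
    specialize (c0 z); specialize (c0' z).
    rewrite (so_refl0 _ _ _ _ _ _ S), (so_refl0 _ _ _ _ _ _ S') by auto.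
    rewrite (refl_plus kap l (fun s => a * j0 J s z) (fun s => b * j0 J' s z)) by ct.
    rewrite !refl_scal by auto. auto.
  - intros s z Hs; simpl. rewrite lap_lin.
    specialize (cL z); specialize (cL' z).
    rewrite (refl_ext kap l _ (fun s => a * lap J s z + b * lap J' s z)) by (intros; try apply lap_lin; lra).
    rewrite (so_reflL _ _ _ _ _ _ S), (so_reflL _ _ _ _ _ _ S') by auto.
    rewrite (refl_plus kap l (fun s => a * lap J s z) (fun s => b * lap J' s z)) by ct.
    rewrite !refl_scal by auto. auto.
  - intros s z Hs. rewrite lap_lin, <- (so_eq _ _ _ _ _ _ S), <- (so_eq _ _ _ _ _ _ S') by auto. simpl. ring.
  - intros z; simpl. rewrite (so_bc _ _ _ _ _ _ S), (so_bc _ _ _ _ _ _ S'). ring.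
  - intros z; simpl. specialize (c0 z); specialize (c0' z).
    rewrite (RInt_ext' _ (fun s => a * (j0 J s z * om s) + b * (j0 J' s z * om s))) by (intros; ring).
    rewrite RInt_lin2 by ct.
    rewrite (so_orth _ _ _ _ _ _ S), (so_orth _ _ _ _ _ _ S'). lra.
  - destruct (so_bdd _ _ _ _ _ _ S) as [B HB], (so_bdd _ _ _ _ _ _ S') as [B' HB'].
    exists (Rabs a * B + Rabs b * B'). intros s z Hs; simpl.
    eapply Rle_trans; [apply Rabs_triang|]. rewrite !Rabs_mult.
    apply Rplus_le_compat; apply Rmult_le_compat_l; auto using Rabs_pos.
Qed.

Lemma Sol_ext l kap sig om E E' J : (forall s z, - l <= s <= l -> E s z = E' s z) ->
  Sol l kap sig om E J -> Sol l kap sig om E' J.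
Proof. intros H []; split; auto. intros s z Hs. rewrite <- H; auto. Qed.

(** * Trigonometric approximation of the source *)

Section Trig.
Context (b : bool) (l theta : R) (Hl : 0 < l) (Ht : 0 <= theta) (Hn : forall j : nat, INR j * theta <> 1).
Context (E : R -> R -> R) (CE : cont2 E) (PE : forall z, parity (sigp b) (fun s => E s z)).
Context (OE : forall z, RInt (fun s => E s z * omp b s) 0 l = 0).

(** Parity and orthogonality hold on every slice, hence, by Fubini, for any weighted average over
    [z]: each Fourier coefficient is an admissible source of a mode problem. *)
Lemma Fourier_Sol (r : R -> R) (Cr : cont1 r) j (tau tau1 : R -> R) :
  (forall z, is_derive tau z (tau1 z)) ->
  (forall z, is_derive tau1 z (- ((INR j * theta) * (INR j * theta)) * tau z)) ->
  (forall z, Rabs (tau z) <= 1) ->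
  exists J, Sol l (kapp b l) (sigp b) (omp b)
    (fun s z => RInt (fun z' => r z' * E s z') (- (2 * PI)) (2 * PI) * tau z) J.
Proof.
  intros T0 T1 TB. assert (Co := omp_cont b).
  set (g := fun s => RInt (fun z' => r z' * E s z') (- (2 * PI)) (2 * PI)).
  assert (Cg : cont1 g).
  { intros s. apply (ct_RInt (fun s z' => r z' * E s z')). intros; ct. }
  assert (Pg : parity (sigp b) g).
  { intros s. unfold g. rewrite <- RInt_scal' by ct. apply RInt_ext'. intros z.
    rewrite (PE z s). ring. }
  assert (Og : RInt (fun s => g s * omp b s) 0 l = 0).
  { transitivity (RInt (fun s => RInt (fun z' => r z' * E s z' * omp b s) (- (2 * PI)) (2 * PI)) 0 l).
    - apply RInt_ext'. intros s. rewrite Rmult_comm. unfold g. rewrite <- RInt_scal' by ct.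
      apply RInt_ext'. intros; ring.
    - rewrite (RInt_Fubini (fun s z' => r z' * E s z' * omp b s)); [|ct|lra].
      rewrite (RInt_ext' _ (fun _ => 0)); [rewrite RInt_const'; lra|].
      intros z. rewrite (RInt_ext' _ (fun s => r z * (E s z * omp b s))) by (intros; ring).
      rewrite RInt_scal', OE by ct. lra. }
  destruct (mode_exists b l (INR j * theta) g Hl) as [psi [psi1 M]]; auto.
  { apply Rmult_le_pos; [apply pos_INR | auto]. }
  apply (mode_Sol l _ _ _ (INR j * theta) g psi psi1 tau tau1); auto. apply sigp2.
Qed.

Definition trig (L : list (R * nat)) (y : R) : R :=
  fold_right (fun p r => fst p * cos (INR (snd p) * theta * y) + r) 0 L.

Lemma trig_cont L : cont1 (trig L).
Proof. induction L as [|[c j] L IH]; unfold trig; simpl; intros y; [apply continuous_const|]. apply ct_plus; [ct|apply IH]. Qed.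

Definition conv (k : R -> R) (s z : R) := RInt (fun z' => k (z - z') * E s z') (- (2 * PI)) (2 * PI).

(** By the addition formula, convolution with [cos (e z)] is a sum of two separated sources, one
    with factor [cos (e z)] and one with [sin (e z)]. *)
Lemma trig_Sol L : exists J, Sol l (kapp b l) (sigp b) (omp b) (conv (trig L)) J.
Proof.
  assert (Co := omp_cont b).
  assert (Tc : forall j, let e := INR j * theta in
    (forall z, is_derive (fun z => cos (e * z)) z (- e * sin (e * z))) /\
    (forall z, is_derive (fun z => - e * sin (e * z)) z (- (e * e) * cos (e * z))) /\
    (forall z, is_derive (fun z => sin (e * z)) z (e * cos (e * z))) /\
    (forall z, is_derive (fun z => e * cos (e * z)) z (- (e * e) * sin (e * z)))).
  { intros j e. split; [|split; [|split]]; intros z; auto_derive; auto; ring. }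
  induction L as [|[c j] L [J IH]].
  - destruct (Tc 0%nat) as [T1 [T2 _]].
    destruct (Fourier_Sol (fun _ => 0) (fun x => continuous_const _ _) 0%nat _ _ T1 T2) as [J HJ].
    { intros z. apply Rabs_le, COS_bound. }
    exists (jlin 0 J 0 J). eapply Sol_ext; [|apply (Sol_lin _ _ _ _ _ _ _ _ 0 0 Hl Co HJ HJ)].
    intros s z _; simpl. unfold conv, trig; simpl. rewrite (RInt_ext' _ (fun _ => 0)) by (intros; ring).
    rewrite RInt_const'. lra.
  - destruct (Tc j) as [T1 [T2 [T3 T4]]].
    set (e := INR j * theta) in *.
    destruct (Fourier_Sol (fun z => cos (e * z)) ltac:(ct) j _ _ T1 T2) as [Jc HJc].
    { intros z. apply Rabs_le, COS_bound. }
    destruct (Fourier_Sol (fun z => sin (e * z)) ltac:(ct) j _ _ T3 T4) as [Js HJs].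
    { intros z. apply Rabs_le, SIN_bound. }
    exists (jlin 1 (jlin c Jc c Js) 1 J).
    eapply Sol_ext; [|apply Sol_lin; auto; [apply Sol_lin; eauto | exact IH]].
    intros s z _. cbv beta. unfold conv.
    assert (Ct := trig_cont L).
    rewrite (RInt_ext' (fun z' => trig ((c, j) :: L) (z - z') * E s z')
      (fun z' => (c * cos (e * z)) * (cos (e * z') * E s z') + (c * sin (e * z)) * (sin (e * z') * E s z') + trig L (z - z') * E s z')).
    + rewrite RInt_plus', RInt_lin2 by ct. ring.
    + intros z'. change (trig ((c, j) :: L) (z - z')) with (c * cos (e * (z - z')) + trig L (z - z')).
      rewrite Rmult_minus_distr_l, cos_minus. ring.
Qed.
End Trig.

(** * Trigonometric kernels that concentrate at 0 *)

Lemma trig_app th L L' y : trig th (L ++ L') y = trig th L y + trig th L' y.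
Proof. induction L as [|p L IH]; simpl; [unfold trig; simpl; ring|]. unfold trig in *; simpl. rewrite IH. ring. Qed.

Lemma trig_scal th c L : exists L', forall y, trig th L' y = c * trig th L y.
Proof.
  exists (map (fun p => (c * fst p, snd p)) L). intros y.
  induction L as [|p L IH]; unfold trig in *; simpl; [ring|]. rewrite IH. ring.
Qed.

Lemma trig_cos th L : exists L', forall y, trig th L' y = cos (th * y) * trig th L y.
Proof.
  induction L as [|[c j] L [L' IH]].
  - exists nil. intros y; unfold trig; simpl; ring.
  - destruct j as [|j].
    + exists ((c, 1%nat) :: L'). intros y. generalize (IH y). unfold trig; simpl. intros ->.
      rewrite !Rmult_0_l, cos_0. replace (1 * th * y) with (th * y) by ring. ring.
    + exists ((c / 2, S (S j)) :: (c / 2, j) :: L'). intros y. generalize (IH y). unfold trig.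
      cbn [fold_right fst snd]. intros ->. rewrite !S_INR.
      replace ((INR j + 1 + 1) * th * y) with ((INR j + 1) * th * y + th * y) by ring.
      replace (INR j * th * y) with ((INR j + 1) * th * y - th * y) by ring.
      rewrite cos_plus, cos_minus. field.
Qed.

(** The de la Vallée-Poussin kernel before normalisation, equal to [cos (th y / 2)^(2 n)]:
    nonnegative, a trigonometric polynomial, and concentrated at the multiples of the period. *)
Definition vp (th : R) (n : nat) (y : R) : R := ((1 + cos (th * y)) / 2) ^ n.

Lemma vp_trig th n : exists L, forall y, trig th L y = vp th n y.
Proof.
  induction n as [|n [L IH]].
  - exists ((1, 0%nat) :: nil). intros y; unfold trig, vp; simpl. rewrite !Rmult_0_l, cos_0. ring.
  - destruct (trig_cos th L) as [L1 H1]. destruct (trig_scal th (/ 2) (L ++ L1)) as [L2 H2].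
    exists L2. intros y. rewrite H2, trig_app, H1, IH. unfold vp; simpl. field.
Qed.

Lemma vp_cont th n : cont1 (vp th n).
Proof. unfold vp, Rdiv; ct. Qed.

Lemma vp_base th y : 0 <= (1 + cos (th * y)) / 2.
Proof. generalize (COS_bound (th * y)); lra. Qed.

Section Kernel.
Context (Z : R) (HZ : 0 < Z).
Let th := PI / Z.

Lemma th_Z : th * Z = PI.
Proof. unfold th; field; lra. Qed.

Lemma trig_period L y : trig th L (y + 2 * Z) = trig th L y.
Proof.
  induction L as [|[c j] L IH]; unfold trig in *; simpl; auto. rewrite IH. f_equal. f_equal.
  replace (INR j * th * (y + 2 * Z)) with (INR j * th * y + 2 * INR j * (th * Z)) by ring.
  rewrite th_Z. apply cos_period.
Qed.

Lemma trig_shift L x : RInt (trig th L) (x - Z) (x + Z) = RInt (trig th L) (- Z) Z.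
Proof.
  assert (C := trig_cont th L).
  set (G := fun x => RInt (trig th L) 0 (x + Z) - RInt (trig th L) 0 (x - Z)).
  assert (DG : forall x, is_derive G x 0).
  { intros u. unfold G. eapply dr_eq.
    - apply dr_minus.
      + apply (dr_comp (fun v => RInt (trig th L) 0 v) (fun x => x + Z) u (trig th L (u + Z)) 1);
          [apply is_derive_RInt1; auto | auto_derive; auto; ring].
      + apply (dr_comp (fun v => RInt (trig th L) 0 v) (fun x => x - Z) u (trig th L (u - Z)) 1);
          [apply is_derive_RInt1; auto | auto_derive; auto; ring].
    - replace (u + Z) with (u - Z + 2 * Z) by ring. rewrite trig_period. ring. }
  assert (EG : G x = G 0).
  { destruct (MVT_gen G 0 x (fun _ => 0)) as [c [_ Ec]]; [auto| |lra].
    intros u _; apply continuity_pt_filterlim, (ct_der G u 0 (DG u)). }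
  unfold G in EG. rewrite Rplus_0_l, Rminus_0_l in EG.
  assert (Ch : forall a b, RInt (trig th L) a b = RInt (trig th L) 0 b - RInt (trig th L) 0 a).
  { intros a b. rewrite <- (RInt_Chasles (trig th L) 0 a b) by (apply ex_RInt_cont1; auto).
    unfold plus; simpl. lra. }
  rewrite (Ch (x - Z)), (Ch (- Z)). exact EG.
Qed.

(** With [a] and [b] the base of the power at [d] and at [d / 2], the mass near 0 is at least
    [d b^n] and the tails are at most [2 Z a^n]; since [a < b], a large [n] makes their ratio
    small. *)
Lemma kernel_exists d e : 0 < d <= Z -> 0 < e ->
  exists L, (forall y, 0 <= trig th L y) /\ RInt (trig th L) (- Z) Z = 1 /\
    RInt (trig th L) (- Z) (- d) + RInt (trig th L) d Z <= e.
Proof.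
  intros Hd He.
  assert (Hth : 0 < th) by (apply Rdiv_lt_0_compat; [apply PI_RGT_0 | auto]).
  set (a := (1 + cos (th * d)) / 2). set (b := (1 + cos (th * (d / 2))) / 2).
  assert (TD : forall y, 0 <= y <= Z -> 0 <= th * y <= PI).
  { intros y Hy. rewrite <- th_Z. split; [apply Rmult_le_pos; lra | apply Rmult_le_compat_l; lra]. }
  assert (Hab : 0 <= a < b).
  { split; [apply vp_base|]. unfold a, b.
    assert (cos (th * d) < cos (th * (d / 2))); [|lra].
    destruct (TD d ltac:(lra)), (TD (d / 2) ltac:(lra)). apply cos_decreasing_1; auto. nra. }
  assert (Hr : Rabs (a / b) < 1).
  { rewrite Rabs_pos_eq by (apply Rmult_le_pos; [lra | left; apply Rinv_0_lt_compat; lra]).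
    apply Rmult_lt_reg_r with b; [lra|]. unfold Rdiv. rewrite Rmult_assoc, Rinv_l; lra. }
  assert (Hy0 : 0 < e * d / (2 * Z)) by (apply Rdiv_lt_0_compat; nra).
  destruct (pow_lt_1_zero (a / b) Hr _ Hy0) as [n Hn].
  specialize (Hn n (Nat.le_refl n)).
  assert (Cv := vp_cont th n).
  assert (V0 : forall y, 0 <= vp th n y) by (intros; apply pow_le, vp_base).
  set (I := RInt (vp th n) (- Z) Z).
  assert (Pb : 0 < b ^ n) by (apply pow_lt; lra).
  assert (vp_even : forall y, vp th n (Rabs y) = vp th n y).
  { intros y. unfold vp, Rabs. destruct Rcase_abs; auto.
    replace (th * - y) with (- (th * y)) by ring. rewrite cos_neg; auto. }
  assert (HI : d * b ^ n <= I).
  { apply Rle_trans with (RInt (vp th n) (- (d / 2)) (d / 2)).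
    - replace (d * b ^ n) with ((d / 2 - - (d / 2)) * b ^ n) by field. rewrite <- RInt_const'.
      apply RInt_mono; [lra|ct|auto|]. intros y Hy. rewrite <- vp_even. unfold vp, b.
      assert (Ry : 0 <= Rabs y <= d / 2) by (split; [apply Rabs_pos | apply Rabs_le; lra]).
      apply pow_incr. split; [apply vp_base|].
      assert (cos (th * (d / 2)) <= cos (th * Rabs y)); [|lra].
      destruct (TD (d / 2) ltac:(lra)), (TD (Rabs y) ltac:(lra)). apply cos_decr_1; auto. nra.
    - apply RInt_sub; auto; lra. }
  assert (Tail : forall u v, - Z <= u -> u <= v -> v <= Z -> (v <= - d \/ d <= u) -> RInt (vp th n) u v <= Z * a ^ n).
  { intros u v H1 H2 H3 H4.
    assert (Pa : 0 <= a ^ n) by (apply pow_le; lra).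
    apply Rle_trans with ((v - u) * a ^ n); [|apply Rmult_le_compat_r; auto; lra].
    rewrite <- RInt_const'. apply RInt_mono; [lra|auto|ct|]. intros y Hy. rewrite <- vp_even. unfold vp, a.
    assert (Ry : d <= Rabs y <= Z) by (unfold Rabs; destruct Rcase_abs; lra).
    apply pow_incr. split; [apply vp_base|].
    assert (cos (th * Rabs y) <= cos (th * d)); [|lra].
    destruct (TD d ltac:(lra)), (TD (Rabs y) ltac:(lra)). apply cos_decr_1; auto. nra. }
  assert (IP : 0 < I) by nra.
  destruct (vp_trig th n) as [L0 HL0]. destruct (trig_scal th (/ I) L0) as [L HL].
  assert (EL : forall y, trig th L y = / I * vp th n y) by (intros; rewrite HL, HL0; auto).
  assert (Ii : 0 < / I) by (apply Rinv_0_lt_compat; auto).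
  exists L. split; [|split].
  - intros y. rewrite EL. apply Rmult_le_pos; auto; lra.
  - rewrite (RInt_ext' _ _ _ _ EL), RInt_scal' by auto. fold I. apply Rinv_l. lra.
  - rewrite !(RInt_ext' _ _ _ _ EL), !RInt_scal' by auto.
    assert (T1 := Tail (- Z) (- d) ltac:(lra) ltac:(lra) ltac:(lra) ltac:(lra)).
    assert (T2 := Tail d Z ltac:(lra) ltac:(lra) ltac:(lra) ltac:(lra)).
    apply Rmult_le_reg_l with I; auto.
    rewrite <- Rmult_plus_distr_l, <- Rmult_assoc, Rinv_r, Rmult_1_l by lra.
    apply Rle_trans with (2 * Z * a ^ n); [lra|].
    assert (Hn' : a ^ n <= e * d / (2 * Z) * b ^ n).
    { apply Rabs_lt_between in Hn.
      replace (a ^ n) with ((a / b) ^ n * b ^ n).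
      - apply Rmult_le_compat_r; lra.
      - rewrite <- Rpow_mult_distr. f_equal. field. lra. }
    apply Rle_trans with (2 * Z * (e * d / (2 * Z) * b ^ n)); [apply Rmult_le_compat_l; lra|].
    replace (2 * Z * (e * d / (2 * Z) * b ^ n)) with (e * (d * b ^ n)) by (field; lra). nra.
Qed.

Section Average.
Context (L : list (R * nat)) (d e : R) (Hd : 0 < d <= Z) (He : 0 < e).
Context (K0 : forall y, 0 <= trig th L y) (K1 : RInt (trig th L) (- Z) Z = 1).
Context (Kt : RInt (trig th L) (- Z) (- d) + RInt (trig th L) d Z <= e).

Lemma average m B1 B2 : cont1 m -> 0 <= B1 -> 0 <= B2 ->
  (forall y, - d <= y <= d -> Rabs (m y) <= B1) -> (forall y, - Z <= y <= Z -> Rabs (m y) <= B2) ->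
  Rabs (RInt (fun y => trig th L y * m y) (- Z) Z) <= B1 + B2 * e.
Proof.
  intros Cm P1 P2 H1 H2. assert (Ck := trig_cont th L).
  assert (Pc : forall u v B, u <= v -> (forall y, u <= y <= v -> Rabs (m y) <= B) ->
    Rabs (RInt (fun y => trig th L y * m y) u v) <= B * RInt (trig th L) u v).
  { intros u v B Huv HB. eapply Rle_trans; [apply abs_RInt_le; [auto|apply ex_RInt_cont1; ct]|].
    rewrite <- RInt_scal' by auto. apply RInt_mono; [auto|ct|ct|]. intros y Hy.
    rewrite Rabs_mult, (Rabs_pos_eq (trig th L y)), Rmult_comm by auto.
    apply Rmult_le_compat_r; auto. }
  assert (CC : cont1 (fun y => trig th L y * m y)) by ct.
  rewrite <- (RInt_Chasles (fun y => trig th L y * m y) (- Z) (- d) Z) by (apply ex_RInt_cont1; auto).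
  rewrite <- (RInt_Chasles (fun y => trig th L y * m y) (- d) d Z) by (apply ex_RInt_cont1; auto).
  unfold plus; simpl.
  eapply Rle_trans; [apply Rabs_triang|]. 
  assert (T1 := Pc (- Z) (- d) B2 ltac:(lra) ltac:(intros; apply H2; lra)).
  assert (T3 := Pc d Z B2 ltac:(lra) ltac:(intros; apply H2; lra)).
  assert (T2 := Pc (- d) d B1 ltac:(lra) H1).
  assert (T4 : RInt (trig th L) (- d) d <= 1).
  { rewrite <- K1. apply RInt_sub; auto; lra. }
  assert (T5 := Rabs_triang (RInt (fun y => trig th L y * m y) (- d) d) (RInt (fun y => trig th L y * m y) d Z)).
  assert (B1 * RInt (trig th L) (- d) d <= B1 * 1) by (apply Rmult_le_compat_l; auto).
  assert (B2 * (RInt (trig th L) (- Z) (- d) + RInt (trig th L) d Z) <= B2 * e) by (apply Rmult_le_compat_l; auto).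
  lra.
Qed.

Context (E : R -> R -> R) (CE : cont2 E) (S0 : forall s z, 2 * PI <= Rabs z -> E s z = 0).
Context (HP : 2 * PI <= Z).

(** For these [z] the window [|y| <= Z] contains the support of [E s (z - y)] in [y]. Farther out
    the periodic copies of the kernel would enter. *)
Lemma conv_window s z : - (Z - 2 * PI) <= z <= Z - 2 * PI ->
  conv E (trig th L) s z = RInt (fun y => trig th L y * E s (z - y)) (- Z) Z.
Proof.
  intros Hz. assert (Ck := trig_cont th L). assert (PP := PI_RGT_0).
  set (f := fun y => trig th L y * E s (z - y)).
  assert (Cf : cont1 f) by (unfold f; ct).
  transitivity (RInt f (z - 2 * PI) (z + 2 * PI)).
  - replace (z + 2 * PI) with (z - - (2 * PI)) by ring. rewrite <- RInt_flip by auto.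
    apply RInt_ext'. intros y. unfold f. f_equal. f_equal. ring.
  - assert (Z0 : forall u v, u <= v -> (v <= z - 2 * PI \/ z + 2 * PI <= u) -> RInt f u v = 0).
    { intros u v Huv Ho. rewrite (RInt_ext (V := R_CompleteNormedModule) f (fun _ => 0)).
      - rewrite RInt_const'. lra.
      - intros y Hy. rewrite Rmin_left, Rmax_right in Hy by lra. unfold f.
        rewrite S0; [apply Rmult_0_r|]. unfold Rabs; destruct Rcase_abs; lra. }
    rewrite <- (RInt_Chasles f (- Z) (z - 2 * PI) Z), <- (RInt_Chasles f (z - 2 * PI) (z + 2 * PI) Z)
      by (apply ex_RInt_cont1; auto).
    unfold plus; simpl. rewrite (Z0 (- Z)), (Z0 (z + 2 * PI)) by lra. lra.
Qed.

(** Valid for all [z], also where the convolution is far from [E]: the kernel has mass 1 on any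
    window of length [2 Z], by periodicity. *)
Lemma conv_sup s z B : (forall z, Rabs (E s z) <= B) -> Rabs (conv E (trig th L) s z) <= B.
Proof.
  intros HB. assert (Ck := trig_cont th L). assert (PP := PI_RGT_0).
  assert (B0 : 0 <= B) by (eapply Rle_trans; [apply Rabs_pos | apply (HB 0)]).
  unfold conv. eapply Rle_trans; [apply abs_RInt_le; [lra|apply ex_RInt_cont1; ct]|].
  apply Rle_trans with (RInt (fun z' => B * trig th L (z - z')) (- (2 * PI)) (2 * PI)).
  - apply RInt_mono; [lra|ct|ct|]. intros y _.
    rewrite Rabs_mult, (Rabs_pos_eq (trig _ _ _)), Rmult_comm by auto. apply Rmult_le_compat_r; auto.
  - rewrite RInt_scal', RInt_flip by ct. rewrite <- (Rmult_1_r B) at 2. apply Rmult_le_compat_l; auto.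
    rewrite <- K1, <- (trig_shift L z). apply RInt_sub; auto; lra.
Qed.
End Average.
End Kernel.

Lemma tanh_mono x y : x <= y -> tanh x <= tanh y.
Proof.
  intros H.
  destruct (MVT_gen tanh x y (fun s => sech s * sech s)) as [c [_ Ec]].
  - intros; apply is_derive_tanh.
  - intros; apply continuity_pt_filterlim, cont1_tanh.
  - generalize (sech_le1 c). nra.
Qed.

Lemma kapp_bound b l0 l : 0 < l0 -> l0 <= l -> Rabs (kapp b l) <= 1 + / tanh l0.
Proof.
  intros H0 Hl. assert (T0 := tanh_pos l0 H0). assert (T := tanh_mono l0 l Hl).
  assert (I0 : 0 < / tanh l0) by (apply Rinv_0_lt_compat; auto).
  destruct b; simpl.
  - rewrite Rabs_Ropp. generalize (tanh_le1 l); lra.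
  - unfold Rdiv. assert (S := sech_le1 l).
    assert (/ tanh l <= / tanh l0) by (apply Rinv_le_contravar; lra).
    assert (0 < / tanh l) by (apply Rinv_0_lt_compat; lra).
    rewrite Rabs_pos_eq by (apply Rmult_le_pos; lra). nra.
Qed.

Lemma Sol_SD b l E J : 0 < l -> cont2 E -> Sol l (kapp b l) (sigp b) (omp b) E J ->
  SD l E (j0 J) (j1 J) (j2 J) (j11 J) (j22 J).
Proof.
  intros Hl CE S. assert (HJ := so_C2 _ _ _ _ _ _ S). destruct HJ as [[] [] []].
  split; auto.
  - intros s z Hs. rewrite <- (so_eq _ _ _ _ _ _ S) by lra. unfold lap. ring.
  - intros z.
    assert (D0 : forall s, is_derive (fun s => j0 J s z) s (j1 J s z)) by auto.
    assert (D1 : forall s, is_derive (fun s => j1 J s z) s (j11 J s z)) by auto.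
    assert (P0 := so_par0 _ _ _ _ _ _ S z).
    assert (P1 := parity_derive _ _ _ D0 P0).
    assert (Or := so_orth _ _ _ _ _ _ S z). assert (Bl := so_bc _ _ _ _ _ _ S z).
    destruct b; simpl in *.
    + apply energy_even with (w1 := fun s => j1 J s z); auto; try ct.
      apply (parity_odd_0 (fun s => j1 J s z)). apply (parity_eq (- 1)); [ring|auto].
    + apply energy_odd with (w1 := fun s => j1 J s z); auto; try ct.
      * apply (parity_odd_0 (fun s => j0 J s z)); auto.
      * rewrite Bl. field. generalize (tanh_pos l Hl); lra.
Qed.

Lemma hh_bound l w B z : 0 < l -> cont2 w -> (forall s, 0 <= s <= l -> Rabs (w s z) <= B) ->
  RInt (fun s => w s z * w s z) 0 l <= l * (B * B).
Proof.
  intros Hl Cw HB. replace (l * (B * B)) with ((l - 0) * (B * B)) by ring. rewrite <- RInt_const'.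
  apply RInt_mono; [lra|ct|ct|]. intros s Hs. specialize (HB s Hs).
  replace (w s z * w s z) with (Rabs (w s z) * Rabs (w s z)) by (unfold Rabs; destruct Rcase_abs; ring).
  generalize (Rabs_pos (w s z)); nra.
Qed.

(* The source is extended from the strip to the whole plane. *)
Record rhs (b : bool) (l al beta : R) (E : R -> R -> R) : Prop := {
  rh_c : cont2 E;
  rh_par : forall z, parity (sigp b) (fun s => E s z);
  rh_orth : forall z, RInt (fun s => E s z * omp b s) 0 l = 0;
  rh_supp : forall s z, 2 * PI <= Rabs z -> E s z = 0;
  rh_sup : forall s z, Rabs (E s z) <= beta;
  rh_holder : forall s z s' z' d, 0 < d <= / 4 -> Rabs (s' - s) <= d -> Rabs (z' - z) <= d ->
     Rabs (E s' z' - E s z) <= 2 * beta * Rpower d al }.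

(** [EN] resembles [E] only for [|z| <= INR n]; farther out nothing but the supremum bound is kept.
    For [|z| >= 9] within that range only the tails of the kernel meet the support of [E], so that
    supremum and Hölder constant are both small there. *)
Record approx (b : bool) (l al beta : R) (E : R -> R -> R) (n : nat) (e : R)
    (EN : R -> R -> R) (J : jet) : Prop := {
  ap_sol : Sol l (kapp b l) (sigp b) (omp b) EN J;
  ap_c : cont2 EN;
  ap_sup : forall s z, Rabs (EN s z) <= beta;
  ap_close : forall s z, Rabs z <= INR n -> Rabs (EN s z - E s z) <= beta * e;
  ap_holder : forall s z s' z' d, Rabs z <= INR n -> Rabs z' <= INR n -> 0 < d <= / 4 ->
     Rabs (s' - s) <= d -> Rabs (z' - z) <= d -> Rabs (EN s' z' - EN s z) <= 4 * beta * Rpower d al;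
  ap_far : forall s z, 9 <= Rabs z <= INR n -> Rabs (EN s z) <= beta * e;
  ap_far_holder : forall s z s' z' d, 9 <= Rabs z <= INR n -> 9 <= Rabs z' <= INR n -> 0 < d <= / 4 ->
     Rabs (s' - s) <= d -> Rabs (z' - z) <= d -> Rabs (EN s' z' - EN s z) <= beta * e * Rpower d al }.

Lemma approximant b l al beta E n e : 0 < l -> 0 < al < 1 -> 0 < e <= 1 -> rhs b l al beta E ->
  exists EN J, approx b l al beta E n e EN J.
Proof.
  intros Hl Hal He [Ec Ep Eo Es Eb Eh].
  assert (PP := PI_RGT_0). assert (P4 := PI_4). assert (P3 : 3 < PI) by (generalize PI2_3_2; unfold PI2; lra).
  assert (N0 := pos_INR n).
  set (Z := PI * (INR n + 8 + / 2)).
  assert (HZ : 0 < Z) by (unfold Z; apply Rmult_lt_0_compat; lra).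
  assert (ZN : INR n <= Z - 2 * PI) by (unfold Z; nra).
  (* Within distance [d] the source varies by at most [2 beta d^al <= beta e / 2]; the tails, of
     mass [e / 4], against [2 beta] give the other half of [beta e]. *)
  set (d := Rmin (/ 4) (Rpower (e / 4) (/ al))).
  assert (Hd : 0 < d <= / 4).
  { unfold d. split; [apply Rmin_glb_lt; [lra | apply Rpower_pos] | apply Rmin_l]. }
  assert (Hda : Rpower d al <= e / 4).
  { apply Rle_trans with (Rpower (Rpower (e / 4) (/ al)) al).
    - apply Rpower_le_base; [|lra]. split; [lra|apply Rmin_r].
    - rewrite Rpower_mult, Rinv_l, Rpower_1 by lra. lra. }
  assert (Hb : 0 <= beta) by (eapply Rle_trans; [apply Rabs_pos | apply (Eb 0 0)]).
  destruct (kernel_exists Z HZ d (e / 4) ltac:(unfold Z; nra) ltac:(lra)) as [L [K0 [K1 Kt]]].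
  set (th := PI / Z) in *.
  assert (Hth : th = / (INR n + 8 + / 2)) by (unfold th, Z; field; lra).
  (* The half-integer in [Z] keeps every frequency away from the resonance 1,
     where the Robin mode problem is not solvable. *)
  assert (Hn : forall j : nat, INR j * th <> 1).
  { intros j Hj. rewrite Hth in Hj.
    assert (X : 2 * INR j = 2 * INR n + 17).
    { apply (Rmult_eq_compat_r (2 * (INR n + 8 + / 2))) in Hj.
      replace (INR j * / (INR n + 8 + / 2) * (2 * (INR n + 8 + / 2))) with (2 * INR j) in Hj by (field; lra).
      lra. }
    replace 17 with (INR 17) in X by (simpl; ring). replace 2 with (INR 2) in X by reflexivity.
    rewrite <- !mult_INR, <- plus_INR in X. apply INR_eq in X. lia. }
  destruct (trig_Sol b l th Hl ltac:(rewrite Hth; left; apply Rinv_0_lt_compat; lra) Hn E Ec Ep Eo L) as [J HJ].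
  assert (Ck := trig_cont th L).
  exists (conv E (trig th L)), J.
  assert (W : forall s z, Rabs z <= INR n ->
     conv E (trig th L) s z = RInt (fun y => trig th L y * E s (z - y)) (- Z) Z).
  { intros s z Hz. apply Rabs_le_between in Hz. apply (conv_window Z); auto; unfold Z; nra. }
  assert (WD : forall s z s' z', Rabs z <= INR n -> Rabs z' <= INR n ->
     conv E (trig th L) s' z' - conv E (trig th L) s z
     = RInt (fun y => trig th L y * (E s' (z' - y) - E s (z - y))) (- Z) Z).
  { intros. rewrite !W by auto. rewrite <- RInt_minus' by ct. apply RInt_ext'. intros; ring. }
  assert (Av := average Z HZ L d (e / 4) ltac:(unfold Z; nra) K0 K1 Kt). fold th in Av.
  (* The distance 9 leaves room for the shift [d <= / 4] with the crude bound [PI <= 4]. *)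
  assert (Far : forall s z y, 9 <= Rabs z -> - d <= y <= d -> E s (z - y) = 0).
  { intros s z y Hz Hy. apply Es. destruct (Rle_dec 0 z).
    - rewrite Rabs_pos_eq in Hz by auto. rewrite Rabs_pos_eq by lra. nra.
    - rewrite Rabs_left in Hz by lra. rewrite Rabs_left by lra. nra. }
  assert (Pw : forall s z s' z' d y, 0 < d <= / 4 -> Rabs (s' - s) <= d -> Rabs (z' - z) <= d ->
     Rabs (E s' (z' - y) - E s (z - y)) <= 2 * beta * Rpower d al).
  { intros. apply Eh; auto. replace (z' - y - (z - y)) with (z' - z) by ring. auto. }
  split.
  - exact HJ.
  - intros p. apply (ct_RInt (fun (q : R * R) z' => trig th L (snd q - z') * E (fst q) z')). intros; ct.
  - intros s z. apply (conv_sup Z HZ L K0 K1); auto. unfold Z; nra.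
  - intros s z Hz. rewrite W by auto.
    replace (E s z) with (RInt (fun y => trig th L y * E s z) (- Z) Z).
    2:{ rewrite (RInt_ext' _ (fun y => E s z * trig th L y)) by (intros; ring).
        rewrite RInt_scal' by auto. fold th in K1. rewrite K1. apply Rmult_1_r. }
    rewrite <- RInt_minus' by ct.
    rewrite (RInt_ext' _ (fun y => trig th L y * (E s (z - y) - E s z))) by (intros; ring).
    eapply Rle_trans; [apply (Av _ (2 * beta * Rpower d al) (2 * beta)); [ct|generalize (Rpower_pos d al); nra|lra| |]|nra].
    + intros y Hy. apply Eh; auto. rewrite Rminus_diag, Rabs_R0; lra.
      replace (z - y - z) with (- y) by ring. rewrite Rabs_Ropp. apply Rabs_le; lra.
    + intros y Hy. eapply Rle_trans; [apply Rabs_triang|]. rewrite Rabs_Ropp.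
      generalize (Eb s (z - y)) (Eb s z); lra.
  - intros s z s' z' d' Hz Hz' Hd' Ds Dz. rewrite WD by auto.
    assert (Q := Rpower_pos d' al).
    assert (0 <= beta * Rpower d' al) by (apply Rmult_le_pos; lra).
    eapply Rle_trans; [apply (Av _ (2 * beta * Rpower d' al) (2 * beta * Rpower d' al)); [ct|lra|lra| |]|nra].
    + intros y Hy. apply Pw; auto.
    + intros y Hy. apply Pw; auto.
  - intros s z Hz. rewrite W by lra.
    eapply Rle_trans; [apply (Av _ 0 beta); [ct|lra|lra| |]|nra].
    + intros y Hy. rewrite Far by (auto; lra). rewrite Rabs_R0; lra.
    + intros y Hy. apply Eb.
  - intros s z s' z' d' Hz Hz' Hd' Ds Dz. rewrite WD by lra.
    assert (Q := Rpower_pos d' al).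
    assert (0 <= beta * Rpower d' al) by (apply Rmult_le_pos; lra).
    eapply Rle_trans; [apply (Av _ 0 (2 * beta * Rpower d' al)); [ct|lra|lra| |]|nra].
    + intros y Hy. rewrite !Far by (auto; lra). rewrite Rminus_diag, Rabs_R0; lra.
    + intros y Hy. apply Pw; auto.
Qed.

(** * Passage to the limit *)

Definition eps (n : nat) : R := / (INR n + 1).

Lemma eps_pos n : 0 < eps n <= 1.
Proof.
  unfold eps. generalize (pos_INR n); intros. split; [apply Rinv_0_lt_compat; lra|].
  apply Rle_trans with (/ 1); [apply Rinv_le_contravar; lra | rewrite Rinv_1; lra].
Qed.

Lemma eps_small c eta : 0 < eta -> exists N, forall n, (N <= n)%nat -> c * eps n <= eta.
Proof.
  intros He.
  destruct (INR_unbounded (Rabs c / eta)) as [N HN]. exists N. intros n Hn.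
  assert (INR N <= INR n) by (apply le_INR; auto). assert (P := pos_INR n).
  unfold eps. apply Rmult_le_reg_r with (INR n + 1); [lra|].
  rewrite Rmult_assoc, Rinv_l, Rmult_1_r by lra.
  apply Rle_trans with (Rabs c); [apply Rle_abs|].
  apply Rle_trans with (eta * (Rabs c / eta)); [right; field; lra|]. nra.
Qed.

Lemma cosh_eps k n : 0 < k -> / cosh (k * INR n) <= 2 / Rmin 1 k * eps n.
Proof.
  intros Hk. assert (P := pos_INR n). assert (M0 : 0 < Rmin 1 k) by (apply Rmin_glb_lt; lra).
  assert (M1 := Rmin_l 1 k). assert (M2 := Rmin_r 1 k).
  replace (2 / Rmin 1 k * eps n) with (/ (Rmin 1 k * (INR n + 1) / 2)) by (unfold eps; field; lra).
  apply Rinv_le_contravar; [unfold Rdiv; apply Rmult_lt_0_compat; [apply Rmult_lt_0_compat|]; lra|].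
  unfold cosh. generalize (exp_pos (- (k * INR n))) (exp_ineq1_le (k * INR n)); intros. nra.
Qed.

Lemma rho_lip y z : rho z >= rho y - Rabs (z - y).
Proof.
  assert (H : Rabs (rho z - rho y) <= 1 * Rabs (z - y)).
  { apply (lipschitz_MVT rho (fun z => z / rho z)).
    - intros; apply rho_derive.
    - intros x _. destruct (rho_pos x) as [R1 R2]. unfold Rdiv. rewrite Rabs_mult, Rabs_inv, (Rabs_pos_eq (rho x)) by lra.
      apply Rmult_le_reg_r with (rho x); [lra|]. rewrite Rmult_assoc, Rinv_l, Rmult_1_r, Rmult_1_l by lra.
      apply Rabs_le; split; nra. }
  apply Rabs_le_between in H. lra.
Qed.

(* Squared L^2 bound of the solution near height [y], and size of the source there. *)
Definition l2_decay (l beta y : R) : R := decay_const (kk l) (l * (beta * beta)) * exp (- kk l * (rho y - 3)).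
Definition src_sup (beta y : R) : R := if Rlt_dec (Rabs y) 12 then 4 * beta else 0.

Section Limit.
Context (CK : R) (HCK : 1 <= CK).
Context (HK : forall i j a b, (i + j <= 3)%nat -> -1 <= a <= 1 -> -1 <= b <= 1 ->
  Rabs (bump i j a b) <= CK /\ Rabs (Psi i j a b) <= CK).
Context (al : R) (Hal : 0 < al < 1) (b : bool) (l0 l beta : R) (Hl0 : 0 < l0) (Hl : l0 <= l).
Context (E : R -> R -> R) (HE : rhs b l al beta E).
Context (EN : nat -> R -> R -> R) (J : nat -> jet).
Context (HA : forall n, approx b l al beta E n (eps n) (EN n) (J n)).

Let k0 := 1 + / tanh l0.
Let Hlp : 0 < l := Rlt_le_trans _ _ _ Hl0 Hl.
Let k := kk l.

Lemma Hk0 : Rabs (kapp b l) <= k0.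
Proof. apply kapp_bound; auto. Qed.
Lemma beta_pos : 0 <= beta.
Proof. eapply Rle_trans; [apply Rabs_pos | apply (rh_sup _ _ _ _ _ HE 0 0)]. Qed.

Lemma Sol_hh_bdd E' J' : Sol l (kapp b l) (sigp b) (omp b) E' J' -> exists B, forall z, hh l (j0 J') z <= B.
Proof.
  intros S. destruct (so_bdd _ _ _ _ _ _ S) as [B HB]. exists (l * (B * B)). intros z.
  apply hh_bound; auto.
  - apply (C2_0 _ (so_C2 _ _ _ _ _ _ S)).
  - intros s Hs. apply HB; lra.
Qed.

Lemma Sol_hh_sup E' J' B : cont2 E' -> Sol l (kapp b l) (sigp b) (omp b) E' J' ->
  (forall s z, 0 <= s <= l -> Rabs (E' s z) <= B) ->
  forall z, hh l (j0 J') z <= l * (B * B) / (k * k * (k * k)).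
Proof.
  intros CE S HB z. destruct (Sol_hh_bdd _ _ S) as [Bd HBd].
  apply (SD_sup l Hlp E' _ _ _ _ _ (Sol_SD b l E' J' Hlp CE S) _ Bd); auto.
  - apply Rmult_le_pos; [lra | apply Rle_0_sqr].
  - intros u. apply hh_bound; auto.
Qed.

(** The bound [2 * beta] lets the lemma serve an approximation, with [q0 = l beta^2], and the
    difference of two, with [q0 = 0]. The boundary values at [INR n] and [- INR n] come from the
    global bound [Sol_hh_sup]. *)
Lemma Sol_hh_decay E' J' q0 e n z : cont2 E' -> Sol l (kapp b l) (sigp b) (omp b) E' J' ->
  0 <= q0 -> 0 < e <= 1 -> 
  (forall s z, 0 <= s <= l -> Rabs (E' s z) <= 2 * beta) ->
  (forall z, Rabs z <= INR n -> RInt (fun s => E' s z * E' s z) 0 l <= q0 + l * ((2 * beta * e) * (2 * beta * e))) ->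
  (forall z, 9 < Rabs z <= INR n -> RInt (fun s => E' s z * E' s z) 0 l <= l * ((2 * beta * e) * (2 * beta * e))) ->
  Rabs z <= INR n ->
  hh l (j0 J') z <= decay_const k q0 * exp (- k * rho z) + 4 * (l * (beta * beta) / (k * k * (k * k))) * e
     + 4 * (l * (beta * beta) / (k * k * (k * k))) * cosh (k * z) / cosh (k * INR n).
Proof.
  intros CE S Hq0 He HB H1 H2 Hz. assert (Kp := kk_pos l Hlp : 0 < k). assert (BP := beta_pos).
  set (HB4 := 4 * (l * (beta * beta) / (k * k * (k * k)))).
  assert (I4 : 0 < / (k * k * (k * k))) by (apply Rinv_0_lt_compat; repeat apply Rmult_lt_0_compat; auto).
  assert (P4 : 0 <= HB4).
  { unfold HB4, Rdiv. apply Rmult_le_pos; [lra|]. apply Rmult_le_pos; [|lra].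
    apply Rmult_le_pos; [lra | apply Rle_0_sqr]. }
  assert (Bd : forall z, hh l (j0 J') z <= HB4).
  { intros u. eapply Rle_trans; [apply (Sol_hh_sup E' J' (2 * beta)); auto|]. right. unfold HB4. field. lra. }
  assert (Q1 : 0 <= l * ((2 * beta * e) * (2 * beta * e))) by (apply Rmult_le_pos; [lra | apply Rle_0_sqr]).
  assert (F := SD_decay l Hlp E' _ _ _ _ _ (Sol_SD b l E' J' Hlp CE S) q0 _ HB4 (INR n) Hq0 Q1 (pos_INR n) P4).
  fold k in F.
  eapply Rle_trans; [apply F; auto|].
  - intros u Hu. apply H1. apply Rabs_le; lra.
  - intros u Hu Hu9. apply H2. split; auto. apply Rabs_le; lra.
  - apply Rabs_le_between in Hz; lra.
  - apply Rplus_le_compat_r, Rplus_le_compat_l. unfold HB4.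
    replace (l * (2 * beta * e * (2 * beta * e)) / (k * k * (k * k)))
      with (4 * (l * (beta * beta) / (k * k * (k * k))) * (e * e)) by (field; lra).
    fold HB4. apply Rmult_le_compat_l; auto. nra.
Qed.

Lemma cosh_abs x y : Rabs x <= y -> cosh x <= cosh y.
Proof.
  intros H. assert (E1 : cosh (Rabs x) = cosh x).
  { unfold Rabs; destruct Rcase_abs; auto. rewrite cosh_even. ring. }
  rewrite <- E1. apply cosh_mono. split; [apply Rabs_pos | auto].
Qed.

(** Gathers the error of the source inside [INR n] and the influence of the boundary values, both
    linear in [eps n] after [cosh_eps]. It depends on the height [y] but not on [n]. *)
Definition hc (y : R) : R := 4 * (l * (beta * beta) / (k * k * (k * k))) * (1 + cosh (k * (Rabs y + 3)) * (2 / Rmin 1 k)).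

Lemma hh_tail E' J' q0 n y z : cont2 E' -> Sol l (kapp b l) (sigp b) (omp b) E' J' ->
  0 <= q0 ->
  (forall s z, 0 <= s <= l -> Rabs (E' s z) <= 2 * beta) ->
  (forall z, Rabs z <= INR n -> RInt (fun s => E' s z * E' s z) 0 l <= q0 + l * ((2 * beta * eps n) * (2 * beta * eps n))) ->
  (forall z, 9 < Rabs z <= INR n -> RInt (fun s => E' s z * E' s z) 0 l <= l * ((2 * beta * eps n) * (2 * beta * eps n))) ->
  Rabs y + 3 <= INR n -> Rabs (z - y) <= 3 ->
  hh l (j0 J') z <= decay_const k q0 * exp (- k * (rho y - 3)) + hc y * eps n.
Proof.
  intros CE S Hq0 HB H1 H2 Hy Hz. assert (Kp := kk_pos l Hlp : 0 < k).
  assert (Az : Rabs z <= Rabs y + 3).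
  { replace z with (y + (z - y)) by ring. eapply Rle_trans; [apply Rabs_triang|]. lra. }
  assert (F := Sol_hh_decay E' J' q0 (eps n) n z CE S Hq0 (eps_pos n) HB H1 H2 ltac:(lra)).
  eapply Rle_trans; [exact F|]. set (HB4 := 4 * (l * (beta * beta) / (k * k * (k * k)))).
  assert (I4 : 0 < / (k * k * (k * k))) by (apply Rinv_0_lt_compat; repeat apply Rmult_lt_0_compat; auto).
  assert (P4 : 0 <= HB4).
  { unfold HB4, Rdiv. apply Rmult_le_pos; [lra|]. apply Rmult_le_pos; [|lra].
    apply Rmult_le_pos; [lra | apply Rle_0_sqr]. }
  assert (D0 : 0 <= decay_const k q0).
  { unfold decay_const, Rdiv. apply Rmult_le_pos; [|left; apply Rinv_0_lt_compat; repeat apply Rmult_lt_0_compat; auto].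
    apply Rmult_le_pos; auto. generalize (exp_pos (10 * k)); lra. }
  assert (R1 : decay_const k q0 * exp (- k * rho z) <= decay_const k q0 * exp (- k * (rho y - 3))).
  { apply Rmult_le_compat_l; auto. apply exp_le. generalize (rho_lip y z); nra. }
  assert (C1 : cosh (k * z) <= cosh (k * (Rabs y + 3))).
  { apply cosh_abs. rewrite Rabs_mult, (Rabs_pos_eq k) by lra. apply Rmult_le_compat_l; lra. }
  assert (C2 := cosh_eps k n Kp). assert (C3 := cosh_pos (k * z)).
  assert (C4 : 0 < / cosh (k * INR n)) by apply Rinv_0_lt_compat, cosh_pos.
  assert (C5 : cosh (k * z) * / cosh (k * INR n) <= cosh (k * (Rabs y + 3)) * (2 / Rmin 1 k * eps n)).
  { apply Rmult_le_compat; lra. }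
  unfold hc. fold HB4. unfold Rdiv at 1. rewrite (Rmult_assoc HB4 (cosh (k * z))).
  assert (HB4 * (cosh (k * z) * / cosh (k * INR n)) <= HB4 * (cosh (k * (Rabs y + 3)) * (2 / Rmin 1 k * eps n)))
    by (apply Rmult_le_compat_l; auto).
  lra.
Qed.

Lemma J_hh n y z : Rabs y + 3 <= INR n -> Rabs (z - y) <= 3 ->
  hh l (j0 (J n)) z <= l2_decay l beta y + hc y * eps n.
Proof.
  intros Hy Hz. assert (BP := beta_pos). destruct (HA n) as [S C Hs _ _ Hf _]. destruct (eps_pos n) as [e0 e1].
  apply (hh_tail (EN n)); auto.
  - apply Rmult_le_pos; [lra | apply Rle_0_sqr].
  - intros s u _. specialize (Hs s u). lra.
  - intros u Hu. eapply Rle_trans; [apply (hh_bound l (EN n) beta); auto|].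
    assert (0 <= l * (2 * beta * eps n * (2 * beta * eps n))) by (apply Rmult_le_pos; [lra | apply Rle_0_sqr]). lra.
  - intros u Hu. apply (hh_bound l (EN n)); auto. intros s _.
    specialize (Hf s u ltac:(lra)). assert (0 <= beta * eps n) by (apply Rmult_le_pos; lra). lra.
Qed.

Lemma src_sup_pos y : 0 <= src_sup beta y.
Proof. unfold src_sup. generalize beta_pos; destruct Rlt_dec; lra. Qed.
Lemma l2_decay_pos y : 0 <= l2_decay l beta y.
Proof.
  unfold l2_decay, decay_const, Rdiv. assert (Kp := kk_pos l Hlp).
  apply Rmult_le_pos; [|left; apply exp_pos].
  apply Rmult_le_pos; [|left; apply Rinv_0_lt_compat; repeat apply Rmult_lt_0_compat; auto].
  apply Rmult_le_pos; [generalize (exp_pos (10 * kk l)); lra|].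
  apply Rmult_le_pos; [lra | apply Rle_0_sqr].
Qed.

Let Cl := Cloc CK l0 k0 al.
Definition size y := sqrt (l2_decay l beta y) + src_sup beta y.

Lemma size_pos y : 0 <= size y.
Proof. unfold size. generalize (sqrt_pos (l2_decay l beta y)) (src_sup_pos y); lra. Qed.

Lemma Cl_pos : 0 <= Cl.
Proof.
  destruct (consts_pos CK HCK l0 k0 al Hl0 Hal l (kapp b l) Hl Hk0) as [P1 [P2 P3]].
  unfold Cl, Cloc. lra.
Qed.

Lemma J_local y eta : 0 < eta -> exists N0, forall n, (N0 <= n)%nat ->
  (forall i j x z, (i + j <= 2)%nat -> - l <= x <= l -> y - 1 <= z <= y + 1 ->
     Rabs (jD (J n) i j x z) <= Cl * (size y + eta)) /\
  (forall i j x z x' z' d, (i + j = 2)%nat -> - l <= x <= l -> - l <= x' <= l ->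
     y - 1 <= z <= y + 1 -> 0 < d <= rad l0 -> Rabs (x' - x) <= d -> Rabs (z' - z) <= d ->
     Rabs (jD (J n) i j x' z' - jD (J n) i j x z) <= Cl * (size y + eta) * Rpower d al).
Proof.
  intros He. assert (BP := beta_pos).
  destruct (eps_small (hc y) ((eta / 3) * (eta / 3)) ltac:(nra)) as [N1 H1].
  destruct (eps_small (1 + beta) (eta / 3) ltac:(lra)) as [N2 H2].
  destruct (INR_unbounded (Rabs y + 4)) as [N3 H3].
  exists (N1 + N2 + N3)%nat. intros n Hn.
  specialize (H1 n ltac:(lia)). specialize (H2 n ltac:(lia)).
  assert (Hny : Rabs y + 4 <= INR n).
  { apply Rle_trans with (INR N3); [lra | apply le_INR; lia]. }
  destruct (HA n) as [S C Hs _ Hh Hf Hfh]. destruct (eps_pos n) as [e0 e1].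
  (* [Q * Q] dominates [l2_decay + (eta / 3)^2], which bounds the slices since
     [hc y * eps n <= (eta / 3)^2]; the terms in [eps n] of [Q] and [M] together cost at most
     another [eta / 3]. *)
  set (Q := sqrt (l2_decay l beta y) + eta / 3 + eps n).
  set (M := src_sup beta y + beta * eps n).
  assert (Be : 0 <= beta * eps n) by (apply Rmult_le_pos; lra).
  assert (AP := l2_decay_pos y). assert (MP := src_sup_pos y). assert (SP := sqrt_pos (l2_decay l beta y)).
  assert (HQM : Q + M <= size y + eta) by (unfold Q, M, size; lra).
  assert (HQ : 0 < Q) by (unfold Q; lra).
  assert (HM : 0 <= M) by (unfold M; lra).
  assert (Zn : forall z, y - 3 <= z <= y + 3 -> Rabs z <= INR n /\ (~ Rabs y < 12 -> 9 <= Rabs z)).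
  { intros z Hz. split.
    - replace z with (y + (z - y)) by ring. eapply Rle_trans; [apply Rabs_triang|].
      assert (Rabs (z - y) <= 3) by (apply Rabs_le; lra). lra.
    - intros Hy. apply Rnot_lt_le in Hy.
      assert (Rabs (y - z) <= 3) by (apply Rabs_le; lra).
      assert (T := Rabs_triang z (y - z)). replace (z + (y - z)) with y in T by ring. lra. }
  destruct (sol_local CK HCK HK l0 k0 al Hl0 Hal l (kapp b l) (sigp b) (omp b) Hl Hk0 (sigp2 b) (EN n) (J n) S y Q M HQ HM) as [L1 L2].
  - intros z Hz. eapply Rle_trans.
    + apply (J_hh n y z); [lra | apply Rabs_le; lra].
    + unfold Q. set (a := sqrt (l2_decay l beta y)) in *.
      assert (Ha : a * a = l2_decay l beta y) by (unfold a; apply sqrt_sqrt; auto).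
      nra.
  - intros s z Hs' Hz. destruct (Zn z Hz) as [Z1 Z2]. unfold M, src_sup. destruct Rlt_dec.
    + specialize (Hs s z); lra.
    + rewrite Rplus_0_l. apply Hf. auto.
  - intros s z s' z' d Hs1 Hs2 Hz Hz' Hd Ds Dz.
    destruct (Zn z Hz) as [Z1 Z2]. destruct (Zn z' Hz') as [Z1' Z2'].
    assert (Pd := Rpower_pos d al).
    unfold M, src_sup. destruct Rlt_dec.
    + eapply Rle_trans; [apply (Hh s z s' z' d); auto|]. apply Rmult_le_compat_r; lra.
    + rewrite Rplus_0_l. apply Hfh; auto.
  - assert (CP := Cl_pos). split.
    + intros. eapply Rle_trans; [apply L1; auto|]. apply Rmult_le_compat_l; auto.
    + intros i j x z x' z' d A1 A2 A3 A4 A5 A6 A7. eapply Rle_trans; [apply (L2 i j x z x' z' d); auto|].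
      apply Rmult_le_compat_r; [left; apply Rpower_pos|]. apply Rmult_le_compat_l; auto.
Qed.

(** The difference of two approximations solves the same problem with a source of size [eps n] for
    [|z| <= INR n] and a bounded one beyond. With [q0 = 0] only terms that tend to 0 at fixed height
    remain, and [sol_sup] makes the convergence uniform in [x]. *)
Lemma J_cauchy y eta : 0 < eta -> exists N0, forall n m, (N0 <= n)%nat -> (n <= m)%nat ->
  forall x, - l <= x <= l -> Rabs (j0 (J n) x y - j0 (J m) x y) <= eta.
Proof.
  intros He. assert (BP := beta_pos).
  set (Cs := Csup CK l0 k0).
  assert (CsP : 0 <= Cs).
  { destruct (consts_pos CK HCK l0 k0 al Hl0 Hal l (kapp b l) Hl Hk0) as [P1 _]. exact P1. }
  set (e' := eta / (Cs + 1)).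
  assert (He' : 0 < e') by (apply Rdiv_lt_0_compat; lra).
  destruct (eps_small (hc y) ((e' / 3) * (e' / 3)) ltac:(nra)) as [N1 H1].
  destruct (eps_small (1 + 2 * beta) (e' / 3) ltac:(lra)) as [N2 H2].
  destruct (INR_unbounded (Rabs y + 4)) as [N3 H3].
  exists (N1 + N2 + N3)%nat. intros n m Hn Hm x Hx.
  specialize (H1 n ltac:(lia)). specialize (H2 n ltac:(lia)).
  assert (Hny : Rabs y + 4 <= INR n).
  { apply Rle_trans with (INR N3); [lra | apply le_INR; lia]. }
  assert (Hnm : INR n <= INR m) by (apply le_INR; auto).
  destruct (HA n) as [S C Hs Hc _ _ _]. destruct (HA m) as [S' C' Hs' Hc' _ _ _].
  destruct (eps_pos n) as [e0 e1].
  assert (Em : eps m <= eps n).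
  { unfold eps. apply Rinv_le_contravar; [generalize (pos_INR n); lra | lra]. }
  assert (SD := Sol_lin l (kapp b l) (sigp b) (omp b) _ _ _ _ 1 (-1) Hlp (omp_cont b) S S').
  set (ED := fun s z => 1 * EN n s z + -1 * EN m s z) in *.
  set (JD := jlin 1 (J n) (-1) (J m)) in *.
  assert (CD : cont2 ED) by (unfold ED; ct).
  assert (Bs : forall s z, Rabs (ED s z) <= 2 * beta).
  { intros s z. unfold ED. replace (1 * EN n s z + -1 * EN m s z) with (EN n s z - EN m s z) by ring.
    eapply Rle_trans; [apply Rabs_triang|]. rewrite Rabs_Ropp. generalize (Hs s z) (Hs' s z); lra. }
  assert (Bc : forall s z, Rabs z <= INR n -> Rabs (ED s z) <= 2 * beta * eps n).
  { intros s z Hz. unfold ED.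
    replace (1 * EN n s z + -1 * EN m s z) with ((EN n s z - E s z) - (EN m s z - E s z)) by ring.
    eapply Rle_trans; [apply Rabs_triang|]. rewrite Rabs_Ropp.
    generalize (Hc s z Hz) (Hc' s z ltac:(lra)). assert (beta * eps m <= beta * eps n) by (apply Rmult_le_compat_l; auto). lra. }
  assert (Be : 0 <= 2 * beta * eps n) by (apply Rmult_le_pos; lra).
  replace (j0 (J n) x y - j0 (J m) x y) with (j0 JD x y) by (simpl; ring).
  destruct (rad_pos l0 Hl0 l Hl) as [Hr1 Hr2].
  eapply Rle_trans.
  - apply (sol_sup CK HCK HK l0 k0 al Hl0 Hal l (kapp b l) (sigp b) (omp b) Hl Hk0 (sigp2 b) ED JD SD (e' / 3 + eps n) (2 * beta * eps n) x y); auto; try lra.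
    + intros z Hz. eapply Rle_trans.
      * apply (hh_tail ED JD 0 n y z CD SD (Rle_refl 0)); auto; try lra.
        -- intros u Hu. rewrite Rplus_0_l. apply (hh_bound l ED); auto.
        -- intros u Hu. apply (hh_bound l ED); auto. intros; apply Bc; lra.
        -- apply Rabs_le; lra.
      * unfold decay_const, Rdiv. rewrite Rmult_0_r, !Rmult_0_l, Rplus_0_l. nra.
    + intros s z _ Hz. apply Bc. replace z with (y + (z - y)) by ring.
      eapply Rle_trans; [apply Rabs_triang|]. assert (Rabs (z - y) <= 1) by (apply Rabs_le; lra). lra.
  - fold Cs. apply Rle_trans with (Cs * e'); [apply Rmult_le_compat_l; lra|].
    unfold e'. apply Rmult_le_reg_r with (Cs + 1); [lra|].
    replace (Cs * (eta / (Cs + 1)) * (Cs + 1)) with (Cs * eta) by (field; lra). nra.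
Qed.
End Limit.

(** * Limits of derivatives on the closed strip *)

Definition clamp (l s : R) : R := Rmax (- l) (Rmin l s).

Lemma clamp_in l s : 0 < l -> - l <= clamp l s <= l.
Proof. intros; unfold clamp, Rmax, Rmin; repeat destruct Rle_dec; lra. Qed.
Lemma clamp_id l s : - l <= s <= l -> clamp l s = s.
Proof. intros; unfold clamp, Rmax, Rmin; repeat destruct Rle_dec; lra. Qed.
Lemma clamp_lip l s t : 0 < l -> Rabs (clamp l s - clamp l t) <= Rabs (s - t).
Proof.
  intros; unfold clamp, Rmax, Rmin, Rabs; repeat destruct Rle_dec; repeat destruct Rcase_abs; lra.
Qed.

Lemma Rpower_small C al e : 0 < al -> 0 < e -> exists h, 0 < h /\
  forall t, 0 < t <= h -> C * Rpower t al <= e.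
Proof.
  intros Hal He. set (c := Rabs C + 1). assert (Hc : 0 < c) by (unfold c; generalize (Rabs_pos C); lra).
  assert (Hec : 0 < e / c) by (apply Rdiv_lt_0_compat; auto).
  exists (Rpower (e / c) (/ al)). split; [apply Rpower_pos|]. intros t Ht.
  assert (H : Rpower t al <= e / c).
  { apply Rle_trans with (Rpower (Rpower (e / c) (/ al)) al); [apply Rpower_le_base; lra|].
    rewrite Rpower_mult, Rinv_l, Rpower_1 by lra. lra. }
  assert (P := Rpower_pos t al).
  apply Rle_trans with (c * Rpower t al).
  - apply Rmult_le_compat_r; [lra|]. unfold c. generalize (Rle_abs C); lra.
  - apply Rle_trans with (c * (e / c)); [apply Rmult_le_compat_l; lra | right; field; lra].
Qed.

Lemma lim_seq_real u l : is_lim_seq u (Finite l) -> real (Lim_seq u) = l.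
Proof. intros H. rewrite (is_lim_seq_unique _ _ H). reflexivity. Qed.

Lemma ex_lim_real u : ex_finite_lim_seq u -> is_lim_seq u (real (Lim_seq u)).
Proof. intros [l H]. rewrite (lim_seq_real u l H). exact H. Qed.

Lemma lim_abs_le u (l B : R) N : is_lim_seq u l -> (forall n, (N <= n)%nat -> Rabs (u n) <= B) ->
  Rabs l <= B.
Proof.
  intros Hl Hb.
  assert (H := is_lim_seq_le_loc (fun n => Rabs (u n)) (fun _ => B) (Rabs l) B).
  simpl in H. apply H.
  - exists N. auto.
  - apply (is_lim_seq_abs u l Hl).
  - apply is_lim_seq_const.
Qed.

(** A Hölder bound uniform in [n] says that [g n x] differs from the difference quotient of [f n]
    with step [t] by at most [C t^al]. Convergence of [f n] at two points therefore makes [g n x] a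
    Cauchy sequence, and the Taylor estimate survives in the limit, on one side only at an
    endpoint. *)
Lemma lim_derive (f g : nat -> R -> R) (a b r C al : R) :
  a < b -> 0 < r -> 0 < al ->
  (exists N0, forall n, (N0 <= n)%nat -> forall x y, a <= x <= b -> a <= y <= b -> 0 < Rabs (y - x) <= r ->
     Rabs (g n y - g n x) <= C * Rpower (Rabs (y - x)) al) ->
  (forall n x, a <= x <= b -> is_derive (f n) x (g n x)) ->
  (forall x, a <= x <= b -> ex_finite_lim_seq (fun n => f n x)) ->
  forall x, a <= x <= b -> ex_finite_lim_seq (fun n => g n x) /\
   forall y, a <= y <= b -> 0 < Rabs (y - x) <= r ->
     Rabs (real (Lim_seq (fun n => f n y)) - real (Lim_seq (fun n => f n x))
       - real (Lim_seq (fun n => g n x)) * (y - x)) <= C * Rpower (Rabs (y - x)) al * Rabs (y - x).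
Proof.
  intros Hab Hr Hal [N0 Hg] Hd Hf x Hx.
  assert (T : forall n, (N0 <= n)%nat -> forall y, a <= y <= b -> 0 < Rabs (y - x) <= r ->
     Rabs (f n y - f n x - g n x * (y - x)) <= C * Rpower (Rabs (y - x)) al * Rabs (y - x)).
  { intros n Hn y Hy Hyx.
    assert (C0 : 0 <= C).
    { assert (A := Hg n Hn x y Hx Hy Hyx). assert (P := Rpower_pos (Rabs (y - x)) al).
      generalize (Rabs_pos (g n y - g n x)). intros. nra. }
    destruct (MVT_gen (f n) x y (g n)) as [c [Hc Ec]].
    - intros u Hu. apply Hd. unfold Rmin, Rmax in Hu; destruct Rle_dec in Hu; lra.
    - intros u Hu. apply continuity_pt_filterlim, (ct_der (f n) u (g n u)), Hd.
      unfold Rmin, Rmax in Hu; destruct Rle_dec in Hu; lra.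
    - rewrite Ec, <- Rmult_minus_distr_r, Rabs_mult. apply Rmult_le_compat_r; [apply Rabs_pos|].
      assert (Hcx : Rabs (c - x) <= Rabs (y - x)).
      { unfold Rmin, Rmax in Hc. unfold Rabs; repeat destruct Rcase_abs; destruct (Rle_dec x y); lra. }
      destruct (Req_dec c x) as [->|Hn'].
      + rewrite Rminus_diag, Rabs_R0. apply Rmult_le_pos; auto. left; apply Rpower_pos.
      + assert (Hp : 0 < Rabs (c - x)) by (apply Rabs_pos_lt; lra).
        eapply Rle_trans; [apply Hg; auto; [|lra]|].
        * unfold Rmin, Rmax in Hc; destruct Rle_dec in Hc; lra.
        * apply Rmult_le_compat_l; auto. apply Rpower_le_base; lra. }
  assert (G : ex_finite_lim_seq (fun n => g n x)).
  { apply ex_lim_seq_cauchy_corr. intros e. assert (He := cond_pos e).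
    destruct (Rpower_small (2 * C) al (e / 4) Hal ltac:(lra)) as [h [Hh Hsm]].
    (* Half the length guarantees that [x + t] or [x - t] lies in [[a, b]]. *)
    set (t := Rmin (Rmin h r) ((b - a) / 2)).
    assert (Ht : 0 < t) by (unfold t; repeat apply Rmin_glb_lt; lra).
    assert (Ht1 : t <= h) by (unfold t; eapply Rle_trans; [apply Rmin_l | apply Rmin_l]).
    assert (Ht2 : t <= r) by (unfold t; eapply Rle_trans; [apply Rmin_l | apply Rmin_r]).
    assert (Ht3 : t <= (b - a) / 2) by (unfold t; apply Rmin_r).
    assert (Y : exists y, a <= y <= b /\ Rabs (y - x) = t).
    { destruct (Rle_dec x ((a + b) / 2)).
      - exists (x + t). split; [lra|]. replace (x + t - x) with t by ring. apply Rabs_pos_eq; lra.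
      - exists (x - t). split; [lra|]. replace (x - t - x) with (- t) by ring. rewrite Rabs_Ropp. apply Rabs_pos_eq; lra. }
    destruct Y as [y [Hy Ey]].
    assert (Het : 0 < e / 4 * t) by nra.
    assert (Cf : forall u, a <= u <= b -> exists N, forall n m, (N <= n)%nat -> (N <= m)%nat -> Rabs (f n u - f m u) < e / 4 * t).
    { intros u Hu. destruct (proj1 (ex_lim_seq_cauchy_corr _) (Hf u Hu) (mkposreal _ Het)) as [N HN].
      exists N. auto. }
    destruct (Cf x Hx) as [N1 H1], (Cf y Hy) as [N2 H2].
    exists (N0 + N1 + N2)%nat. intros n m Hn Hm.
    assert (Tn := T n ltac:(lia) y Hy ltac:(lra)). assert (Tm := T m ltac:(lia) y Hy ltac:(lra)).
    specialize (H1 n m ltac:(lia) ltac:(lia)). specialize (H2 n m ltac:(lia) ltac:(lia)).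
    specialize (Hsm t ltac:(lra)). rewrite Ey in Tn, Tm.
    apply Rmult_lt_reg_r with t; auto. rewrite <- Ey at 1. rewrite <- Rabs_mult.
    replace ((g n x - g m x) * (y - x)) with
      ((f n y - f m y) - (f n x - f m x) - (f n y - f n x - g n x * (y - x)) + (f m y - f m x - g m x * (y - x))) by ring.
    set (A1 := f n y - f n x - g n x * (y - x)) in *. set (A2 := f m y - f m x - g m x * (y - x)) in *.
    assert (X1 := Rabs_triang ((f n y - f m y) - (f n x - f m x) - A1) A2).
    assert (X2 := Rabs_triang ((f n y - f m y) - (f n x - f m x)) (- A1)).
    assert (X3 := Rabs_triang (f n y - f m y) (- (f n x - f m x))).
    rewrite Rabs_Ropp in X2, X3. unfold Rminus in *. nra. }
  split; auto. intros y Hy Hyx.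
  apply (lim_abs_le (fun n => f n y - f n x - g n x * (y - x)) _ _ N0).
  - apply (is_lim_seq_minus' (fun n => f n y - f n x)).
    + apply (is_lim_seq_minus' (fun n => f n y)); apply ex_lim_real; auto.
    + apply (is_lim_seq_scal_r (fun n => g n x) (y - x) (real (Lim_seq (fun n => g n x)))).
      apply ex_lim_real; auto.
  - intros n Hn. apply T; auto.
Qed.

Lemma is_pd_intro l e W s z d C r al : 0 < al -> 0 < r ->
  (forall h, h <> 0 -> Rabs h <= r -> strip l (s + h * fst e, z + h * snd e) ->
    Rabs (W (s + h * fst e, z + h * snd e) - W (s, z) - d * h) <= C * Rpower (Rabs h) al * Rabs h) ->
  is_pd (strip l) e W (s, z) d.
Proof.
  intros Hal Hr H. unfold is_pd. cbv zeta. simpl fst; simpl snd.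
  apply filterlim_locally. intros eps'.
  destruct (Rpower_small C al (eps' / 2) Hal ltac:(generalize (cond_pos eps'); lra)) as [h0 [Hh0 Hs]].
  assert (Hm : 0 < Rmin h0 r) by (apply Rmin_glb_lt; lra).
  exists (mkposreal _ Hm). intros h Hh Hn HL. apply ball_R in Hh. simpl in Hh. rewrite Rminus_0_r in Hh.
  assert (Hh1 : Rabs h < h0) by (eapply Rlt_le_trans; [exact Hh | apply Rmin_l]).
  assert (Hh2 : Rabs h < r) by (eapply Rlt_le_trans; [exact Hh | apply Rmin_r]).
  assert (Hp : 0 < Rabs h) by (apply Rabs_pos_lt; auto).
  assert (A := H h Hn ltac:(lra) HL). specialize (Hs (Rabs h) ltac:(lra)).
  change (Rabs ((W (s + h * fst e, z + h * snd e) - W (s, z)) / h - d) < eps').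
  apply Rle_lt_trans with (C * Rpower (Rabs h) al); [|generalize (cond_pos eps'); lra].
  apply Rmult_le_reg_r with (Rabs h); auto. rewrite <- Rabs_mult.
  replace (((W (s + h * fst e, z + h * snd e) - W (s, z)) / h - d) * h)
    with (W (s + h * fst e, z + h * snd e) - W (s, z) - d * h) by (field; auto).
  exact A.
Qed.

Lemma jD_ds J i j s z : is_C2 J -> (i + j <= 1)%nat ->
  is_derive (fun s => jD J i j s z) s (jD J (S i) j s z).
Proof.
  intros [[] [] []] H. destruct i as [|[|i]], j as [|[|j]]; try lia; simpl; auto.
Qed.
Lemma jD_dz J i j s z : is_C2 J -> (i + j <= 1)%nat ->
  is_derive (fun z => jD J i j s z) z (jD J i (S j) s z).
Proof.
  intros [[] [] []] H. destruct i as [|[|i]], j as [|[|j]]; try lia; simpl; auto.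
Qed.

Lemma le_eps_lim (x a c : R) : 0 <= c -> (forall eta, 0 < eta -> x <= c * (a + eta)) -> x <= c * a.
Proof.
  intros Hc H. apply le_epsilon. intros e He.
  assert (P : 0 < e / (c + 1)) by (apply Rdiv_lt_0_compat; lra).
  eapply Rle_trans; [apply (H _ P)|]. rewrite Rmult_plus_distr_l. apply Rplus_le_compat_l.
  apply Rmult_le_reg_r with (c + 1); [lra|].
  replace (c * (e / (c + 1)) * (c + 1)) with (c * e) by (field; lra). nra.
Qed.

Section Limit2.
Context (CK : R) (HCK : 1 <= CK).
Context (HK : forall i j a b, (i + j <= 3)%nat -> -1 <= a <= 1 -> -1 <= b <= 1 ->
  Rabs (bump i j a b) <= CK /\ Rabs (Psi i j a b) <= CK).
Context (al : R) (Hal : 0 < al < 1) (b : bool) (l0 l beta : R) (Hl0 : 0 < l0) (Hl : l0 <= l).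
Context (E : R -> R -> R) (HE : rhs b l al beta E).
Context (EN : nat -> R -> R -> R) (J : nat -> jet).
Context (HA : forall n, approx b l al beta E n (eps n) (EN n) (J n)).

Let k0 := 1 + / tanh l0.
Let Hlp : 0 < l := Rlt_le_trans _ _ _ Hl0 Hl.
Let Cl := Cloc CK l0 k0 al.
Let Sol_n n := ap_sol _ _ _ _ _ _ _ _ _ (HA n).
Let C2n n := so_C2 _ _ _ _ _ _ (Sol_n n).

(** Meaningful on the strip; elsewhere [Lim_seq] and [real] supply some value. *)
Definition lim_jet (i j : nat) (s z : R) : R := real (Lim_seq (fun n => jD (J n) i j s z)).

Lemma ClP : 0 <= Cl.
Proof. apply (Cl_pos CK HCK al Hal b l0 l Hl0 Hl). Qed.

(** Order 2 has its Hölder bound from [J_local]. Lower orders are Lipschitz by the bounds one order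
    up, and [d <= d^al]; the factor 2 counts the two coordinate directions. *)
Lemma J_mod y eta : 0 < eta -> exists N0, forall n, (N0 <= n)%nat ->
  forall i j x z x' z' d, (i + j <= 2)%nat -> - l <= x <= l -> - l <= x' <= l ->
     y - 1 <= z <= y + 1 -> y - 1 <= z' <= y + 1 -> 0 < d <= rad l0 -> Rabs (x' - x) <= d -> Rabs (z' - z) <= d ->
     Rabs (jD (J n) i j x' z' - jD (J n) i j x z) <= 2 * Cl * (size l beta y + eta) * Rpower d al.
Proof.
  intros He. destruct (J_local CK HCK HK al Hal b l0 l beta Hl0 Hl E HE EN J HA y eta He) as [N0 H].
  fold k0 in H. fold Cl in H. exists N0. intros n Hn i j x z x' z' d Hij Hx Hx' Hz Hz' Hd Dx Dz.
  destruct (H n Hn) as [H1 H2]. destruct (rad_pos l0 Hl0 l Hl) as [Hr1 Hr2].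
  assert (CP := ClP). assert (SP : 0 <= size l beta y) by (apply (size_pos al b l beta E HE)).
  assert (P0 : 0 <= Cl * (size l beta y + eta)) by (apply Rmult_le_pos; lra).
  assert (Pd := Rpower_pos d al).
  destruct (Nat.eq_dec (i + j) 2) as [E2|E2].
  - eapply Rle_trans; [apply (H2 i j x z x' z' d); auto|]. apply Rmult_le_compat_r; lra.
  - assert (Hij1 : (i + j <= 1)%nat) by lia.
    assert (A1 : Rabs (jD (J n) i j x' z - jD (J n) i j x z) <= Cl * (size l beta y + eta) * Rabs (x' - x)).
    { apply (lipschitz_MVT (fun s => jD (J n) i j s z) (fun s => jD (J n) (S i) j s z)).
      - intros u _. apply jD_ds; auto.
      - intros u Hu. apply H1; auto; [lia|]. unfold Rmin, Rmax in Hu; destruct Rle_dec in Hu; lra. }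
    assert (A2 : Rabs (jD (J n) i j x' z' - jD (J n) i j x' z) <= Cl * (size l beta y + eta) * Rabs (z' - z)).
    { apply (lipschitz_MVT (fun z => jD (J n) i j x' z) (fun z => jD (J n) i (S j) x' z)).
      - intros u _. apply jD_dz; auto.
      - intros u Hu. apply H1; auto; [lia|]. unfold Rmin, Rmax in Hu; destruct Rle_dec in Hu; lra. }
    replace (jD (J n) i j x' z' - jD (J n) i j x z)
      with ((jD (J n) i j x' z' - jD (J n) i j x' z) + (jD (J n) i j x' z - jD (J n) i j x z)) by ring.
    assert (Dd : d <= Rpower d al) by (apply Rpower_ge_id; lra).
    eapply Rle_trans; [apply Rabs_triang|].
    set (c := Cl * (size l beta y + eta)) in *.
    assert (c * Rabs (x' - x) <= c * Rpower d al) by (apply Rmult_le_compat_l; lra).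
    assert (c * Rabs (z' - z) <= c * Rpower d al) by (apply Rmult_le_compat_l; lra).
    unfold c in *. lra.
Qed.

Definition convg i j := forall s z, - l <= s <= l -> ex_finite_lim_seq (fun n => jD (J n) i j s z).

Lemma step_s i j : (i + j <= 1)%nat -> convg i j ->
  convg (S i) j /\ forall s z, - l <= s <= l ->
    exists C, forall h, h <> 0 -> Rabs h <= rad l0 -> - l <= s + h <= l ->
      Rabs (lim_jet i j (s + h) z - lim_jet i j s z - lim_jet (S i) j s z * h) <= C * Rpower (Rabs h) al * Rabs h.
Proof.
  intros Hij Hc. destruct (rad_pos l0 Hl0 l Hl) as [Hr1 Hr2].
  assert (G : forall s z, - l <= s <= l -> ex_finite_lim_seq (fun n => jD (J n) (S i) j s z) /\
    exists C, forall h, h <> 0 -> Rabs h <= rad l0 -> - l <= s + h <= l ->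
      Rabs (lim_jet i j (s + h) z - lim_jet i j s z - lim_jet (S i) j s z * h) <= C * Rpower (Rabs h) al * Rabs h).
  { intros s z Hs.
    destruct (lim_derive (fun n s => jD (J n) i j s z) (fun n s => jD (J n) (S i) j s z)
      (- l) l (rad l0) (2 * Cl * (size l beta z + 1)) al ltac:(lra) ltac:(lra) ltac:(lra)) with (x := s) as [L1 L2]; auto.
    - destruct (J_mod z 1 ltac:(lra)) as [N0 H]. exists N0. intros n Hn x y Hx Hy Hxy.
      apply (H n Hn (S i) j); auto; try lia; try lra. rewrite Rminus_diag, Rabs_R0; lra.
    - intros; apply jD_ds; auto.
    - split; auto. exists (2 * Cl * (size l beta z + 1)). intros h Hh Hhr Hsh.
      replace (Rabs h) with (Rabs (s + h - s)) by (f_equal; ring).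
      replace (lim_jet (S i) j s z * h) with (lim_jet (S i) j s z * (s + h - s)) by (f_equal; ring).
      apply L2; auto. replace (s + h - s) with h by ring. split; auto. apply Rabs_pos_lt; auto. }
  split; [intros s z Hs | intros s z Hs]; apply (G s z Hs).
Qed.

Lemma step_z i j : (i + j <= 1)%nat -> convg i j ->
  convg i (S j) /\ forall s z, - l <= s <= l ->
    exists C, forall h, h <> 0 -> Rabs h <= rad l0 ->
      Rabs (lim_jet i j s (z + h) - lim_jet i j s z - lim_jet i (S j) s z * h) <= C * Rpower (Rabs h) al * Rabs h.
Proof.
  intros Hij Hc. destruct (rad_pos l0 Hl0 l Hl) as [Hr1 Hr2].
  assert (G : forall s z, - l <= s <= l -> ex_finite_lim_seq (fun n => jD (J n) i (S j) s z) /\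
    exists C, forall h, h <> 0 -> Rabs h <= rad l0 ->
      Rabs (lim_jet i j s (z + h) - lim_jet i j s z - lim_jet i (S j) s z * h) <= C * Rpower (Rabs h) al * Rabs h).
  { intros s z Hs.
    destruct (lim_derive (fun n z => jD (J n) i j s z) (fun n z => jD (J n) i (S j) s z)
      (z - 1) (z + 1) (rad l0) (2 * Cl * (size l beta z + 1)) al ltac:(lra) ltac:(lra) ltac:(lra)) with (x := z) as [L1 L2]; auto; try lra.
    - destruct (J_mod z 1 ltac:(lra)) as [N0 H]. exists N0. intros n Hn x y Hx Hy Hxy.
      apply (H n Hn i (S j)); auto; try lia; try lra. rewrite Rminus_diag, Rabs_R0; lra.
    - intros; apply jD_dz; auto.
    - split; auto. exists (2 * Cl * (size l beta z + 1)). intros h Hh Hhr.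
      replace (Rabs h) with (Rabs (z + h - z)) by (f_equal; ring).
      replace (lim_jet i (S j) s z * h) with (lim_jet i (S j) s z * (z + h - z)) by (f_equal; ring).
      apply Rabs_le_between in Hhr as Hh2.
      apply L2; auto; try lra. replace (z + h - z) with h by ring. split; auto. apply Rabs_pos_lt; auto. }
  split; [intros s z Hs | intros s z Hs]; apply (G s z Hs).
Qed.

Lemma convg_00 : convg 0 0.
Proof.
  intros s z Hs. apply ex_lim_seq_cauchy_corr. intros e.
  assert (He : 0 < e / 2) by (generalize (cond_pos e); lra).
  destruct (J_cauchy CK HCK HK al Hal b l0 l beta Hl0 Hl E HE EN J HA z (e / 2) He) as [N0 H].
  exists N0. intros n m Hn Hm. simpl.
  destruct (Nat.le_ge_cases n m) as [L|L].
  - generalize (H n m Hn L s Hs). lra.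
  - rewrite Rabs_minus_sym. generalize (H m n Hm L s Hs). lra.
Qed.

Lemma convg_all i j : (i + j <= 2)%nat -> convg i j.
Proof.
  intros Hij.
  destruct (step_s 0 0 ltac:(lia) convg_00) as [c10 _].
  destruct (step_z 0 0 ltac:(lia) convg_00) as [c01 _].
  destruct (step_s 1 0 ltac:(lia) c10) as [c20 _].
  destruct (step_s 0 1 ltac:(lia) c01) as [c11 _].
  destruct (step_z 0 1 ltac:(lia) c01) as [c02 _].
  destruct i as [|[|[|i]]], j as [|[|[|j]]]; try lia; auto. apply convg_00.
Qed.

Lemma U_lim i j s z : (i + j <= 2)%nat -> - l <= s <= l ->
  is_lim_seq (fun n => jD (J n) i j s z) (lim_jet i j s z).
Proof. intros. apply ex_lim_real, convg_all; auto. Qed.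

Lemma U_pd_s i j s z : (i + j <= 1)%nat -> - l <= s <= l ->
  is_pd (strip l) e_s (fun p => lim_jet i j (fst p) (snd p)) (s, z) (lim_jet (S i) j s z).
Proof.
  intros Hij Hs. destruct (rad_pos l0 Hl0 l Hl) as [Hr1 Hr2].
  destruct (proj2 (step_s i j Hij (convg_all i j ltac:(lia))) s z Hs) as [C HC].
  apply (is_pd_intro l e_s _ s z _ C (rad l0) al); try lra.
  intros h Hn Hh HL. unfold strip in HL. simpl in *. rewrite Rmult_1_r in *. rewrite Rmult_0_r, Rplus_0_r in *.
  apply HC; auto.
Qed.

Lemma U_pd_z i j s z : (i + j <= 1)%nat -> - l <= s <= l ->
  is_pd (strip l) e_z (fun p => lim_jet i j (fst p) (snd p)) (s, z) (lim_jet i (S j) s z).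
Proof.
  intros Hij Hs. destruct (rad_pos l0 Hl0 l Hl) as [Hr1 Hr2].
  destruct (proj2 (step_z i j Hij (convg_all i j ltac:(lia))) s z Hs) as [C HC].
  apply (is_pd_intro l e_z _ s z _ C (rad l0) al); try lra.
  intros h Hn Hh HL. simpl in *. rewrite Rmult_1_r in *. rewrite Rmult_0_r, Rplus_0_r in *.
  apply HC; auto.
Qed.

Lemma U_bound y i j x z : (i + j <= 2)%nat -> - l <= x <= l -> y - 1 <= z <= y + 1 ->
  Rabs (lim_jet i j x z) <= Cl * size l beta y.
Proof.
  intros Hij Hx Hz. apply le_eps_lim; [apply ClP|]. intros eta He.
  destruct (J_local CK HCK HK al Hal b l0 l beta Hl0 Hl E HE EN J HA y eta He) as [N0 H].
  apply (lim_abs_le _ _ _ N0 (U_lim i j x z Hij Hx)). intros n Hn. apply (proj1 (H n Hn)); auto.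
Qed.

Lemma U_holder y i j x z x' z' d : (i + j <= 2)%nat -> - l <= x <= l -> - l <= x' <= l ->
  y - 1 <= z <= y + 1 -> y - 1 <= z' <= y + 1 -> 0 < d <= rad l0 -> Rabs (x' - x) <= d -> Rabs (z' - z) <= d ->
  Rabs (lim_jet i j x' z' - lim_jet i j x z) <= 2 * Cl * Rpower d al * size l beta y.
Proof.
  intros Hij Hx Hx' Hz Hz' Hd Dx Dz. apply le_eps_lim.
  { assert (P := Rpower_pos d al). generalize ClP; intros. apply Rmult_le_pos; lra. }
  intros eta He.
  destruct (J_mod y eta He) as [N0 H].
  apply (lim_abs_le (fun n => jD (J n) i j x' z' - jD (J n) i j x z) _ _ N0).
  - apply is_lim_seq_minus'; apply U_lim; auto.
  - intros n Hn. eapply Rle_trans; [apply (H n Hn i j x z x' z' d); auto | right; ring].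
Qed.

Lemma U_pde s z : - l <= s <= l -> lim_jet 2 0 s z + lim_jet 0 2 s z + 2 * (sech s * sech s) * lim_jet 0 0 s z = E s z.
Proof.
  intros Hs.
  assert (L1 : is_lim_seq (fun n => EN n s z) (lim_jet 2 0 s z + lim_jet 0 2 s z + 2 * (sech s * sech s) * lim_jet 0 0 s z)).
  { apply is_lim_seq_ext with (fun n => jD (J n) 2 0 s z + jD (J n) 0 2 s z + 2 * (sech s * sech s) * jD (J n) 0 0 s z).
    - intros n. rewrite <- (so_eq _ _ _ _ _ _ (Sol_n n)) by auto. reflexivity.
    - apply (is_lim_seq_plus' (fun n => jD (J n) 2 0 s z + jD (J n) 0 2 s z)).
      + apply is_lim_seq_plus'; apply U_lim; auto; lia.
      + apply (is_lim_seq_scal_l (fun n => jD (J n) 0 0 s z) _ (lim_jet 0 0 s z)). apply U_lim; auto; lia. }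
  assert (L2 : is_lim_seq (fun n => EN n s z) (E s z)).
  { apply is_lim_seq_spec. intros e. 
    destruct (eps_small (Rabs beta) (e / 2) ltac:(generalize (cond_pos e); lra)) as [N1 H1].
    destruct (INR_unbounded (Rabs z)) as [N2 H2]. exists (N1 + N2)%nat. intros n Hn.
    assert (Hz : Rabs z <= INR n) by (apply Rle_trans with (INR N2); [lra | apply le_INR; lia]).
    eapply Rle_lt_trans; [apply (ap_close _ _ _ _ _ _ _ _ _ (HA n)); auto|].
    specialize (H1 n ltac:(lia)). destruct (eps_pos n).
    assert (beta * eps n <= Rabs beta * eps n) by (apply Rmult_le_compat_r; [lra | apply Rle_abs]).
    generalize (cond_pos e). lra. }
  apply is_lim_seq_unique in L1. apply is_lim_seq_unique in L2. rewrite L1 in L2. inversion L2. auto.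
Qed.

Lemma U_bc z : lim_jet 1 0 l z = kapp b l * lim_jet 0 0 l z.
Proof.
  assert (Hll : - l <= l <= l) by lra.
  assert (L1 := U_lim 1 0 l z ltac:(lia) Hll).
  assert (L2 := is_lim_seq_scal_l _ (kapp b l) _ (U_lim 0 0 l z ltac:(lia) Hll)).
  apply is_lim_seq_ext with (v := fun n => kapp b l * jD (J n) 0 0 l z) in L1.
  - apply is_lim_seq_unique in L1. apply is_lim_seq_unique in L2. rewrite L1 in L2. inversion L2. auto.
  - intros n. apply (so_bc _ _ _ _ _ _ (Sol_n n)).
Qed.

Lemma U_parity z : parity (sigp b) (fun s => lim_jet 0 0 s z).
Proof.
  intros s. unfold lim_jet.
  rewrite (Lim_seq_ext (fun n => jD (J n) 0 0 (- s) z) (fun n => sigp b * jD (J n) 0 0 s z)).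
  - rewrite Lim_seq_scal_l.
    (* Parity is claimed for every [s], also off the strip, where the limit may be infinite:
       opposite infinities both have real value 0. *)
    destruct (Lim_seq (fun n => jD (J n) 0 0 s z)) as [r| |], b; simpl;
      repeat (destruct Rle_dec || destruct Rle_lt_or_eq_dec); simpl; lra.
  - intros n. apply (so_par0 _ _ _ _ _ _ (Sol_n n) z s).
Qed.

Lemma U_clamp_cont z : cont1 (fun s => lim_jet 0 0 (clamp l s) z).
Proof.
  intros s. apply filterlim_locally. intros e. destruct (rad_pos l0 Hl0 l Hl) as [Hr1 Hr2].
  destruct (Rpower_small (2 * Cl * size l beta z) al (e / 2) ltac:(lra) ltac:(generalize (cond_pos e); lra)) as [h [Hh Hs]].
  assert (Hm : 0 < Rmin h (rad l0)) by (apply Rmin_glb_lt; lra).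
  exists (mkposreal _ Hm). intros t Ht. apply ball_R in Ht. simpl in Ht.
  change (Rabs (lim_jet 0 0 (clamp l t) z - lim_jet 0 0 (clamp l s) z) < e).
  assert (M1 := Rmin_l h (rad l0)). assert (M2 := Rmin_r h (rad l0)).
  destruct (Req_dec t s) as [->|Hn]; [rewrite Rminus_diag, Rabs_R0; apply cond_pos|].
  assert (Hp : 0 < Rabs (t - s)) by (apply Rabs_pos_lt; lra).
  eapply Rle_lt_trans.
  - apply (U_holder z 0 0 (clamp l s) z (clamp l t) z (Rabs (t - s))); try lra; try lia; try (apply clamp_in; lra).
    + apply clamp_lip; lra.
    + rewrite Rminus_diag, Rabs_R0; lra.
  - specialize (Hs (Rabs (t - s)) ltac:(lra)). generalize (cond_pos e). lra.
Qed.

Lemma U_orth z : RInt (fun s => lim_jet 0 0 (clamp l s) z * omp b s) 0 l = 0.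
Proof.
  assert (CU := U_clamp_cont z). assert (Co := omp_cont b).
  assert (Ob : forall s, Rabs (omp b s) <= 1).
  { intros s. destruct b; simpl; [|apply tanh_le1]. generalize (sech_le1 s) (sech_pos s); intros.
    rewrite Rabs_pos_eq by lra. nra. }
  cut (forall e, 0 < e -> Rabs (RInt (fun s => lim_jet 0 0 (clamp l s) z * omp b s) 0 l) <= l * e).
  { intros H. set (I := RInt _ 0 l) in *.
    destruct (Req_dec I 0) as [|Hn]; auto. exfalso.
    assert (P : 0 < Rabs I) by (apply Rabs_pos_lt; auto).
    assert (Q : 0 < Rabs I / (2 * l)) by (apply Rdiv_lt_0_compat; lra).
    specialize (H _ Q). replace (l * (Rabs I / (2 * l))) with (Rabs I / 2) in H by (field; lra). lra. }
  intros e He.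
  destruct (J_cauchy CK HCK HK al Hal b l0 l beta Hl0 Hl E HE EN J HA z e He) as [N0 H].
  assert (B : forall s, 0 <= s <= l -> Rabs (j0 (J N0) s z - lim_jet 0 0 s z) <= e).
  { intros s Hs. apply (lim_abs_le (fun n => j0 (J N0) s z - j0 (J n) s z) _ _ N0).
    - apply is_lim_seq_minus'; [apply is_lim_seq_const | apply (U_lim 0 0); [lia | lra]].
    - intros n Hn. apply H; auto. lra. }
  assert (c0 : cont1 (fun s => j0 (J N0) s z)) by apply (cont_j0 _ _ _ _ _ _ (Sol_n N0)).
  replace (RInt (fun s => lim_jet 0 0 (clamp l s) z * omp b s) 0 l)
    with (RInt (fun s => lim_jet 0 0 (clamp l s) z * omp b s - j0 (J N0) s z * omp b s) 0 l).
  2:{ rewrite RInt_minus' by ct. rewrite (so_orth _ _ _ _ _ _ (Sol_n N0)). lra. }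
  replace l with (l - 0) at 2 by ring. apply RInt_bound; [lra|ct|].
  intros s Hs. rewrite <- Rmult_minus_distr_r, Rabs_mult, clamp_id by lra.
  rewrite Rabs_minus_sym. specialize (B s Hs). specialize (Ob s).
  generalize (Rabs_pos (omp b s)) (Rabs_pos (j0 (J N0) s z - lim_jet 0 0 s z)). nra.
Qed.
End Limit2.

(** * Localized norms and directional derivatives on the strip *)

Lemma dist2_ge p q : Rabs (fst p - fst q) <= dist2 p q /\ Rabs (snd p - snd q) <= dist2 p q.
Proof.
  unfold dist2. assert (S : forall x, Rabs x = sqrt (x ^ 2)).
  { intros x. rewrite <- (sqrt_Rsqr_abs x). f_equal. unfold Rsqr; ring. }
  split; rewrite S; apply sqrt_le_1_alt.
  - generalize (pow2_ge_0 (snd p - snd q)); lra.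
  - generalize (pow2_ge_0 (fst p - fst q)); lra.
Qed.

Lemma dist2_le p q d : Rabs (fst p - fst q) <= d -> Rabs (snd p - snd q) <= d -> dist2 p q <= 2 * d.
Proof.
  intros H1 H2. assert (0 <= d) by (eapply Rle_trans; [apply Rabs_pos | exact H1]).
  unfold dist2. rewrite <- (sqrt_Rsqr (2 * d)) by lra. apply sqrt_le_1_alt. unfold Rsqr.
  apply Rabs_le_between in H1; apply Rabs_le_between in H2. nra.
Qed.

Lemma dist2_pos p q : p <> q -> 0 < dist2 p q.
Proof.
  intros H. destruct (dist2_ge p q) as [D1 D2].
  destruct (Req_dec (fst p) (fst q)) as [E1|E1].
  - destruct (Req_dec (snd p) (snd q)) as [E2|E2].
    + exfalso. apply H. destruct p, q; simpl in *; subst; auto.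
    + eapply Rlt_le_trans; [|exact D2]. apply Rabs_pos_lt; lra.
  - eapply Rlt_le_trans; [|exact D1]. apply Rabs_pos_lt; lra.
Qed.

Lemma dist2_refl p : dist2 p p = 0.
Proof. unfold dist2. rewrite !Rminus_diag. replace (0 ^ 2 + 0 ^ 2) with 0 by ring. apply sqrt_0. Qed.

Section Norms.
Context (L : R * R -> Prop) (al : R) (p : R * R) (Lp : L p).
Context (Lq : L (fst p, snd p + / 2)).
Let W q := L q /\ dist2 p q < 1.

Lemma sup_abs_le f c : Rbar_le (sup_abs W f) (Finite c) <-> (forall q, W q -> Rabs (f q) <= c).
Proof.
  unfold sup_abs. destruct (Lub_Rbar_correct (fun x => exists p, W p /\ x = Rabs (f p))) as [H1 H2].
  split.
  - intros H q Hq. assert (A := H1 (Rabs (f q)) (ex_intro _ q (conj Hq eq_refl))).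
    apply (Rbar_le_trans _ _ _ A H).
  - intros H. apply H2. intros x [q [Hq ->]]. apply H; auto.
Qed.

Lemma Wp : W p.
Proof. split; auto. rewrite dist2_refl; lra. Qed.

Lemma sup_abs_pos f : Rbar_le (Finite 0) (sup_abs W f).
Proof.
  unfold sup_abs. destruct (Lub_Rbar_correct (fun x => exists p, W p /\ x = Rabs (f p))) as [H1 _].
  apply Rbar_le_trans with (Finite (Rabs (f p))); [apply Rabs_pos|].
  apply H1. exists p; split; auto. apply Wp.
Qed.

Lemma holder_seminorm_le f c : Rbar_le (holder_seminorm W al f) (Finite c) <->
  (forall q q', W q -> W q' -> q <> q' -> Rabs (f q - f q') <= c * Rpower (dist2 q q') al).
Proof.
  unfold holder_seminorm.
  destruct (Lub_Rbar_correct (fun x => exists p q, W p /\ W q /\ p <> q /\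
                       x = Rabs (f p - f q) / Rpower (dist2 p q) al)) as [H1 H2].
  split.
  - intros H q q' Hq Hq' Hn.
    assert (A := H1 _ (ex_intro _ q (ex_intro _ q' (conj Hq (conj Hq' (conj Hn eq_refl)))))).
    assert (B := Rbar_le_trans _ _ _ A H). simpl in B.
    assert (P := Rpower_pos (dist2 q q') al).
    apply (Rmult_le_compat_r (Rpower (dist2 q q') al)) in B; [|lra].
    replace (Rabs (f q - f q') / Rpower (dist2 q q') al * Rpower (dist2 q q') al)
      with (Rabs (f q - f q')) in B by (field; lra). exact B.
  - intros H. apply H2. intros x [q [q' [Hq [Hq' [Hn ->]]]]]. simpl.
    assert (P := Rpower_pos (dist2 q q') al).
    apply Rmult_le_reg_r with (Rpower (dist2 q q') al); auto.
    replace (Rabs (f q - f q') / Rpower (dist2 q q') al * Rpower (dist2 q q') al)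
      with (Rabs (f q - f q')) by (field; lra). auto.
Qed.

Lemma holder_seminorm_pos f : Rbar_le (Finite 0) (holder_seminorm W al f).
Proof.
  unfold holder_seminorm.
  destruct (Lub_Rbar_correct (fun x => exists p q, W p /\ W q /\ p <> q /\
                       x = Rabs (f p - f q) / Rpower (dist2 p q) al)) as [H1 _].
  (* A second point of the disk, since the least upper bound of an empty set of quotients would be
     minus infinity. *)
  set (q := (fst p, snd p + / 2)).
  apply Rbar_le_trans with (Finite (Rabs (f p - f q) / Rpower (dist2 p q) al)).
  - simpl. apply Rmult_le_pos; [apply Rabs_pos | left; apply Rinv_0_lt_compat, Rpower_pos].
  - apply H1. exists p, q. split; [apply Wp|]. split; [|split; auto].
    + split; auto. unfold dist2, q; simpl.
      replace ((fst p - fst p) * ((fst p - fst p) * 1) +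
        (snd p - (snd p + / 2)) * ((snd p - (snd p + / 2)) * 1)) with (/ 4) by field.
      rewrite <- sqrt_1. apply sqrt_lt_1; lra.
    + intros E. assert (X : snd p = snd p + / 2) by (rewrite E at 1; reflexivity). lra.
Qed.

Lemma Rbar_plus_pos a b : Rbar_le (Finite 0) a -> Rbar_le (Finite 0) b -> Rbar_le (Finite 0) (Rbar_plus a b).
Proof. intros Ha Hb. replace (Finite 0) with (Rbar_plus (Finite 0) (Finite 0)) by (simpl; f_equal; ring). apply Rbar_plus_le_compat; auto. Qed.

Lemma Rbar_plus_le_parts a b c : Rbar_le (Finite 0) a -> Rbar_le (Finite 0) b ->
  Rbar_le (Rbar_plus a b) (Finite c) -> Rbar_le a (Finite c) /\ Rbar_le b (Finite c).
Proof. destruct a, b; simpl; try tauto; lra. Qed.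

Lemma Rbar_plus_le_fin a b x y : Rbar_le a (Finite x) -> Rbar_le b (Finite y) ->
  Rbar_le (Rbar_plus a b) (Finite (x + y)).
Proof. intros Ha Hb. apply (Rbar_plus_le_compat a (Finite x) b (Finite y)); auto. Qed.

Lemma Rbar_sum_le {T} (F : T -> Rbar) c (l : list T) :
  (forall x, In x l -> Rbar_le (F x) (Finite c)) ->
  Rbar_le (Rbar_sum (map F l)) (Finite (INR (length l) * c)).
Proof.
  induction l as [|x l IH]; intros H.
  - simpl. rewrite Rmult_0_l. apply Rle_refl.
  - change (length (x :: l)) with (S (length l)). rewrite S_INR.
    replace ((INR (length l) + 1) * c) with (c + INR (length l) * c) by ring.
    apply (Rbar_plus_le_fin (F x)); [apply H; simpl; auto | apply IH; intros; apply H; simpl; auto].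
Qed.

Lemma Rbar_sum_pos {T} (F : T -> Rbar) (l : list T) :
  (forall x, Rbar_le (Finite 0) (F x)) -> Rbar_le (Finite 0) (Rbar_sum (map F l)).
Proof.
  induction l as [|x l IH]; intros H; simpl; [apply Rle_refl|].
  apply Rbar_plus_pos; auto.
Qed.

Lemma norm_pos k f : Rbar_le (Finite 0) (holder_norm_at L k al f p).
Proof.
  apply Rbar_plus_pos; apply Rbar_sum_pos; intros; [apply sup_abs_pos | apply holder_seminorm_pos].
Qed.

Lemma norm0_parts f c : Rbar_le (holder_norm_at L 0 al f p) (Finite c) ->
  (forall q, W q -> Rabs (f q) <= c) /\
  (forall q q', W q -> W q' -> q <> q' -> Rabs (f q - f q') <= c * Rpower (dist2 q q') al).
Proof.
  unfold holder_norm_at. cbn [seq flat_map multi_indices map app Rbar_sum fold_right Nat.sub].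
  intros H. fold W in H. unfold pd_multi in H. simpl Nat.iter in H.
  assert (H' : Rbar_le (Rbar_plus (sup_abs W f) (holder_seminorm W al f)) (Finite c)).
  { rewrite !Rbar_plus_0_r in H. exact H. }
  destruct (Rbar_plus_le_parts _ _ _ (sup_abs_pos f) (holder_seminorm_pos f) H') as [A B].
  split; [apply sup_abs_le | apply holder_seminorm_le]; auto.
Qed.

Lemma norm2_le f c :
  (forall i j, (i + j <= 2)%nat -> forall q, W q -> Rabs (pd_multi L (i, j) f q) <= c) ->
  (forall i j, (i + j = 2)%nat -> forall q q', W q -> W q' -> q <> q' ->
     Rabs (pd_multi L (i, j) f q - pd_multi L (i, j) f q') <= c * Rpower (dist2 q q') al) ->
  Rbar_le (holder_norm_at L 2 al f p) (Finite (9 * c)).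
Proof.
  intros HS HH. unfold holder_norm_at. fold W.
  replace (9 * c) with (INR 6 * c + INR 3 * c) by (simpl; ring).
  apply Rbar_plus_le_fin.
  - apply (Rbar_sum_le (fun g => sup_abs W (pd_multi L g f)) c (flat_map multi_indices (seq 0 3))).
    intros [i j] Hin. apply sup_abs_le. apply HS.
    simpl in Hin. repeat destruct Hin as [Hin|Hin]; try (inversion Hin; subst; simpl; lia).
  - apply (Rbar_sum_le (fun g => holder_seminorm W al (pd_multi L g f)) c (multi_indices 2)).
    intros [i j] Hin. apply holder_seminorm_le. apply HH.
    simpl in Hin. repeat destruct Hin as [Hin|Hin]; try (inversion Hin; subst; simpl; lia).
Qed.

Lemma norm_finite k f c : Rbar_le (holder_norm_at L k al f p) (Finite c) ->
  is_finite (holder_norm_at L k al f p).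
Proof.
  intros H. generalize (norm_pos k f). destruct (holder_norm_at L k al f p); simpl in *; try tauto.
  intros; reflexivity.
Qed.
End Norms.

Lemma strip_shift l p t : strip l p -> strip l (fst p, snd p + t).
Proof. unfold strip; auto. Qed.

Lemma Rpower_double d al : 0 < d -> 0 < al < 1 -> Rpower (2 * d) al <= 2 * Rpower d al.
Proof.
  intros Hd Ha. rewrite <- Rpower_mult_distr by lra. apply Rmult_le_compat_r; [left; apply Rpower_pos|].
  rewrite <- (Rpower_1 2) at 2 by lra. apply Rle_Rpower; lra.
Qed.

(** * The source extended to the plane and split by parity *)

Section Source.
Context (al l beta : R) (Hal : 0 < al < 1) (Hl : 0 < l) (E : R * R -> R).
Context (HS : forall p, strip l p -> 2 * PI < Rabs (snd p) -> E p = 0).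
Context (HN : forall p, strip l p -> Rbar_le (holder_norm_at (strip l) 0 al E p) (Finite beta)).
Context (HO : orthogonality l E).

Lemma E_sup p : strip l p -> Rabs (E p) <= beta.
Proof.
  intros Hp. destruct (norm0_parts (strip l) al p Hp (strip_shift l p _ Hp) E beta (HN p Hp)) as [A _].
  apply A. split; auto. rewrite dist2_refl; lra.
Qed.

(** The localized norm compares points at distance less than 1: for [d <= / 4] the two points are at
    most [2 d <= 1/2] apart, so both lie in one disk, and [(2 d)^al <= 2 d^al] produces the factor
    2. *)
Lemma E_holder s z s' z' d : - l <= s <= l -> - l <= s' <= l -> 0 < d <= / 4 ->
  Rabs (s' - s) <= d -> Rabs (z' - z) <= d -> Rabs (E (s', z') - E (s, z)) <= 2 * beta * Rpower d al.
Proof.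
  intros Hs Hs' Hd Ds Dz.
  assert (Hp : strip l (s', z')) by exact Hs'. assert (Hq : strip l (s, z)) by exact Hs.
  assert (Bp : 0 <= beta) by (eapply Rle_trans; [apply Rabs_pos | apply (E_sup _ Hp)]).
  assert (Pd := Rpower_pos d al).
  destruct (classic ((s', z') = (s, z))) as [Eq|Hn].
  - rewrite Eq, Rminus_diag, Rabs_R0. apply Rmult_le_pos; lra.
  - destruct (norm0_parts (strip l) al _ Hp (strip_shift l _ _ Hp) E beta (HN _ Hp)) as [_ B].
    assert (D2 : dist2 (s', z') (s, z) <= 2 * d) by (apply dist2_le; auto).
    assert (D0 := dist2_pos _ _ Hn).
    eapply Rle_trans; [apply B; auto|].
    + split; auto. rewrite dist2_refl; lra.
    + split; auto. lra.
    + rewrite (Rmult_comm 2), Rmult_assoc. apply Rmult_le_compat_l; auto.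
      apply Rle_trans with (Rpower (2 * d) al); [apply Rpower_le_base; lra|]. apply Rpower_double; lra.
Qed.

(** Constant continuation in [s] across the boundary, which preserves the supremum and the Hölder
    modulus and commutes with the mirror image in [s]. *)
Definition Ec (s z : R) : R := E (clamp l s, z).
Definition Eb (b : bool) (s z : R) : R := / 2 * (Ec s z + sigp b * Ec (- s) z).

Lemma clamp_opp s : clamp l (- s) = - clamp l s.
Proof. unfold clamp, Rmax, Rmin; repeat destruct Rle_dec; lra. Qed.

Lemma cont2_holder f c : (forall s z s' z' d, 0 < d <= / 4 -> Rabs (s' - s) <= d -> Rabs (z' - z) <= d ->
  Rabs (f s' z' - f s z) <= c * Rpower d al) -> cont2 f.
Proof.
  intros H [s z]. apply filterlim_locally. intros e.
  destruct (Rpower_small c al (e / 2) ltac:(lra) ltac:(generalize (cond_pos e); lra)) as [h [Hh Hs]].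
  set (d := Rmin h (/ 4)).
  assert (Hd : 0 < d) by (unfold d; apply Rmin_glb_lt; lra).
  assert (M1 := Rmin_l h (/ 4)). assert (M2 := Rmin_r h (/ 4)). fold d in M1, M2.
  exists (mkposreal _ Hd). intros [s' z'] [B1 B2]. apply ball_R in B1. apply ball_R in B2. simpl in *.
  change (Rabs (f s' z' - f s z) < e).
  eapply Rle_lt_trans; [apply (H s z s' z' d); lra|].
  specialize (Hs d ltac:(lra)). generalize (cond_pos e); lra.
Qed.

Lemma Ec_holder s z s' z' d : 0 < d <= / 4 -> Rabs (s' - s) <= d -> Rabs (z' - z) <= d ->
  Rabs (Ec s' z' - Ec s z) <= 2 * beta * Rpower d al.
Proof.
  intros. apply E_holder; [apply clamp_in; auto | apply clamp_in; auto | auto | | auto]. eapply Rle_trans; [apply clamp_lip|]; auto.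
Qed.

Lemma Ec_cont : cont2 Ec.
Proof. apply (cont2_holder Ec (2 * beta)). intros; apply Ec_holder; auto. Qed.

Lemma Rabs_half x y : forall M, Rabs x <= M -> Rabs y <= M -> Rabs (/ 2 * (x + y)) <= M.
Proof. intros M Hx Hy. apply Rabs_le_between in Hx; apply Rabs_le_between in Hy. apply Rabs_le; lra. Qed.

Lemma omp_par b : parity (sigp b) (omp b).
Proof. destruct b; [apply sech_even | apply tanh_odd]. Qed.

Lemma orth_omp b f : orthogonality l f -> forall z, is_RInt (fun s => f (s, z) * omp b s) (- l) l 0.
Proof. intros H z. destruct (H z), b; auto. Qed.

Lemma half_orth b (f : R -> R) : cont1 f -> RInt (fun s => f s * omp b s) (- l) l = 0 ->
  RInt (fun s => / 2 * (f s + sigp b * f (- s)) * omp b s) 0 l = 0.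
Proof.
  intros Cf Hf. assert (Co := omp_cont b). assert (P := omp_par b).
  assert (E1 : RInt (fun s => f (- s) * omp b (- s)) 0 l = RInt (fun s => f s * omp b s) (- l) 0).
  { transitivity (RInt (fun t => (fun s => f s * omp b s) (0 - t)) 0 l).
    - apply RInt_ext'. intros s. replace (0 - s) with (- s) by ring. auto.
    - rewrite (RInt_flip (fun s => f s * omp b s)) by ct. f_equal; ring. }
  rewrite (RInt_ext' _ (fun s => / 2 * (f s * omp b s) + / 2 * (f (- s) * omp b (- s)))).
  - rewrite RInt_lin2, E1 by ct.
    rewrite <- (RInt_Chasles (fun s => f s * omp b s) (- l) 0 l) in Hf by (apply ex_RInt_cont1; ct).
    unfold plus in Hf; simpl in Hf. lra.
  - intros s. rewrite (P s). ring.
Qed.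

Lemma Ec_orth b z : RInt (fun s => Ec s z * omp b s) (- l) l = 0.
Proof.
  apply is_RInt_unique. apply (is_RInt_ext (fun s => E (s, z) * omp b s)); [|apply orth_omp; auto].
  intros s Hs. rewrite Rmin_left, Rmax_right in Hs by lra. unfold Ec. rewrite clamp_id by lra. auto.
Qed.

(** On the lines [|z| = 2 PI], left open by the hypothesis on the support, the value is a limit from
    outside by Hölder continuity. *)
Lemma Ec_supp s z : 2 * PI <= Rabs z -> Ec s z = 0.
Proof.
  intros [Hz|Hz]; [apply HS; auto; apply clamp_in; auto|].
  destruct (Req_dec (Ec s z) 0) as [|Hn]; auto. exfalso.
  assert (P : 0 < Rabs (Ec s z) / 2) by (generalize (Rabs_pos_lt _ Hn); lra).
  destruct (Rpower_small (2 * beta) al (Rabs (Ec s z) / 2) ltac:(lra) P) as [h [Hh Hsm]].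
  set (t := Rmin h (/ 4)).
  assert (Ht : 0 < t) by (unfold t; apply Rmin_glb_lt; lra).
  assert (T1 := Rmin_l h (/ 4)). assert (T2 := Rmin_r h (/ 4)). fold t in T1, T2.
  set (z' := if Rle_dec 0 z then z + t else z - t).
  assert (Z0 : Ec s z' = 0).
  { apply HS; [apply clamp_in; auto|]. simpl. unfold z'. destruct Rle_dec.
    - rewrite Rabs_pos_eq in Hz by auto. rewrite Rabs_pos_eq by lra. lra.
    - rewrite Rabs_left in Hz by lra. rewrite Rabs_left by lra. lra. }
  assert (A := Ec_holder s z' s z t ltac:(lra) ltac:(rewrite Rminus_diag, Rabs_R0; lra)).
  rewrite Z0, Rminus_0_r in A. specialize (Hsm t ltac:(lra)).
  assert (B : Rabs (z - z') <= t).
  { unfold z'. destruct Rle_dec; [replace (z - (z + t)) with (- t) by ring; rewrite Rabs_Ropp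
                                 | replace (z - (z - t)) with t by ring]; rewrite Rabs_pos_eq; lra. }
  specialize (A B). lra.
Qed.

Lemma Eb_rhs b : rhs b l al beta (Eb b).
Proof.
  assert (Cc := Ec_cont). assert (B0 : forall s z, Rabs (Ec s z) <= beta).
  { intros. apply E_sup, clamp_in; auto. }
  split.
  - unfold Eb; ct.
  - intros z s. unfold Eb. rewrite Ropp_involutive.
    generalize (sigp2 b); intros Q. 
    replace (sigp b * (/ 2 * (Ec s z + sigp b * Ec (- s) z)))
      with (/ 2 * (sigp b * Ec s z + (sigp b * sigp b) * Ec (- s) z)) by ring. rewrite Q. ring.
  - intros z. unfold Eb. apply (half_orth b (fun s => Ec s z)); [ct | apply Ec_orth].
  - intros s z Hz. unfold Eb. rewrite !Ec_supp by auto. ring.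
  - intros s z. unfold Eb. apply Rabs_half; auto. rewrite Rabs_sig; auto. apply sigp2.
  - intros s z s' z' d Hd Ds Dz. unfold Eb.
    replace (/ 2 * (Ec s' z' + sigp b * Ec (- s') z') - / 2 * (Ec s z + sigp b * Ec (- s) z))
      with (/ 2 * ((Ec s' z' - Ec s z) + sigp b * (Ec (- s') z' - Ec (- s) z))) by ring.
    apply Rabs_half; [apply Ec_holder; auto|].
    rewrite Rabs_sig by apply sigp2. apply Ec_holder; auto.
    replace (- s' - - s) with (- (s' - s)) by ring. rewrite Rabs_Ropp; auto.
Qed.

Lemma Eb_sum s z : - l <= s <= l -> Eb true s z + Eb false s z = E (s, z).
Proof. intros Hs. unfold Eb, Ec, sigp. rewrite (clamp_id l s) by auto. lra. Qed.
End Source.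

Lemma is_pd_eps L e f p d : is_pd L e f p d <->
  (forall eps, 0 < eps -> exists del, 0 < del /\ forall h, h <> 0 -> Rabs h < del ->
     L (fst p + h * fst e, snd p + h * snd e) ->
     Rabs ((f (fst p + h * fst e, snd p + h * snd e) - f p) / h - d) < eps).
Proof.
  unfold is_pd. split.
  - intros H eps He.
    destruct (H (ball d (mkposreal _ He)) (locally_ball _ _)) as [del Hd]. exists del. split; [apply cond_pos|].
    intros h Hn Hh HL. apply (Hd h); auto. change (Rabs (h - 0) < del). rewrite Rminus_0_r; auto.
  - intros H. apply filterlim_locally. intros eps. destruct (H eps (cond_pos eps)) as [del [Hd Hh]].
    exists (mkposreal _ Hd). intros h B Hn HL. apply ball_R in B. rewrite Rminus_0_r in B.
    apply (Hh h Hn B HL).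
Qed.

Lemma is_pd_ext L e f g p d : (forall q, L q -> f q = g q) -> L p -> is_pd L e f p d -> is_pd L e g p d.
Proof.
  intros H Hp. rewrite !is_pd_eps. intros Hf eps He. destruct (Hf eps He) as [del [Hd Hh]].
  exists del; split; auto. intros h Hn Hl HL. rewrite <- !H by auto. auto.
Qed.

Lemma is_pd_lin L e f g p c d d' a : is_pd L e f p d -> is_pd L e g p d' ->
  is_pd L e (fun q => a * (f q + c * g q)) p (a * (d + c * d')).
Proof.
  rewrite !is_pd_eps. intros Hf Hg eps He.
  set (m := 1 + Rabs a * (1 + Rabs c)).
  assert (Hm : 0 < m) by (unfold m; generalize (Rabs_pos a), (Rabs_pos c); nra).
  assert (Hem : 0 < eps / m) by (apply Rdiv_lt_0_compat; auto).
  destruct (Hf _ Hem) as [d1 [P1 Q1]]. destruct (Hg _ Hem) as [d2 [P2 Q2]].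
  exists (Rmin d1 d2). split; [apply Rmin_glb_lt; auto|]. intros h Hn Hh HL.
  specialize (Q1 h Hn (Rlt_le_trans _ _ _ Hh (Rmin_l _ _)) HL).
  specialize (Q2 h Hn (Rlt_le_trans _ _ _ Hh (Rmin_r _ _)) HL).
  set (x := (f (fst p + h * fst e, snd p + h * snd e) - f p) / h - d) in *.
  set (y := (g (fst p + h * fst e, snd p + h * snd e) - g p) / h - d') in *.
  match goal with |- Rabs ?t < _ => replace t with (a * (x + c * y)) end.
  2:{ unfold x, y. field; auto. }
  rewrite Rabs_mult. apply Rle_lt_trans with (Rabs a * (1 + Rabs c) * (eps / m)).
  - rewrite Rmult_assoc. apply Rmult_le_compat_l; [apply Rabs_pos|].
    eapply Rle_trans; [apply Rabs_triang|]. rewrite Rabs_mult.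
    generalize (Rabs_pos c); intros. nra.
  - replace eps with (m * (eps / m)) at 2 by (field; lra). apply Rmult_lt_compat_r; auto. unfold m; lra.
Qed.

Definition mir (p : R * R) : R * R := (- fst p, snd p).

Lemma strip_mir l p : strip l p -> strip l (mir p).
Proof. unfold strip, mir; simpl; lra. Qed.

Lemma is_pd_mir_s l f p d : is_pd (strip l) e_s f (mir p) d -> is_pd (strip l) e_s (fun q => f (mir q)) p (- d).
Proof.
  rewrite !is_pd_eps. intros H eps He. destruct (H eps He) as [del [Hd Hh]]. exists del; split; auto.
  intros h Hn Hl HL.
  specialize (Hh (- h) ltac:(lra) ltac:(rewrite Rabs_Ropp; auto)).
  assert (Eq : (fst (mir p) + - h * fst e_s, snd (mir p) + - h * snd e_s)
    = mir (fst p + h * fst e_s, snd p + h * snd e_s)).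
  { unfold mir, e_s; simpl. f_equal; ring. }
  rewrite Eq in Hh. specialize (Hh (strip_mir _ _ HL)).
  match type of Hh with Rabs ?t < _ => replace t with (- ((f (mir (fst p + h * fst e_s, snd p + h * snd e_s)) - f (mir p)) / h - - d)) in Hh by (field; auto) end.
  rewrite Rabs_Ropp in Hh. exact Hh.
Qed.

Lemma is_pd_mir_z l f p d : is_pd (strip l) e_z f (mir p) d -> is_pd (strip l) e_z (fun q => f (mir q)) p d.
Proof.
  rewrite !is_pd_eps. intros H eps He. destruct (H eps He) as [del [Hd Hh]]. exists del; split; auto.
  intros h Hn Hl HL.
  assert (Eq : (fst (mir p) + h * fst e_z, snd (mir p) + h * snd e_z)
    = mir (fst p + h * fst e_z, snd p + h * snd e_z)).
  { unfold mir, e_z; simpl. f_equal; ring. }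
  specialize (Hh h Hn Hl). rewrite Eq in Hh. exact (Hh (strip_mir _ _ HL)).
Qed.

(** [iota] returns the limit as soon as the limit is unique, that is, as soon as the filter is
    proper: from any point of the strip there are arbitrarily small admissible [h], of a suitable
    sign at the boundary. *)
Lemma pd_eq l e f p d : 0 < l -> e = e_s \/ e = e_z -> strip l p ->
  is_pd (strip l) e f p d -> pd (strip l) e f p = d.
Proof.
  intros Hl He Hp H. unfold pd.
  assert (FF : ProperFilter' (within (fun h => strip l (fst p + h * fst e, snd p + h * snd e)) (locally' 0))).
  { constructor; [|apply within_filter; apply locally'_filter].
    intros [del Hd].
    set (t := Rmin (del / 2) l). assert (T1 := Rmin_l (del / 2) l). assert (T2 := Rmin_r (del / 2) l). fold t in T1, T2.
    assert (Tp : 0 < t) by (unfold t; apply Rmin_glb_lt; auto; generalize (cond_pos del); lra).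
    assert (Q : exists h, h <> 0 /\ Rabs h <= t /\ strip l (fst p + h * fst e, snd p + h * snd e)).
    { unfold strip in *. destruct He as [-> | ->]; simpl.
      - destruct (Rle_dec (fst p) 0).
        + exists t. rewrite Rabs_pos_eq; lra.
        + exists (- t). rewrite Rabs_Ropp, Rabs_pos_eq; lra.
      - exists t. rewrite Rabs_pos_eq; lra. }
    destruct Q as [h [Hn [Hh HL]]]. apply (Hd h); auto. change (Rabs (h - 0) < del). rewrite Rminus_0_r.
    generalize (cond_pos del); lra. }
  apply (iota_filterlim_locally (F := within (fun h => strip l (fst p + h * fst e, snd p + h * snd e)) (locally' 0))
     (fun h => (f (fst p + h * fst e, snd p + h * snd e) - f p) / h) d).
  exact H.
Qed.

Lemma pd_spec l e f p : 0 < l -> e = e_s \/ e = e_z -> strip l p ->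
  (exists d, is_pd (strip l) e f p d) -> is_pd (strip l) e f p (pd (strip l) e f p).
Proof. intros Hl He Hp [d Hd]. rewrite (pd_eq l e f p d Hl He Hp Hd). exact Hd. Qed.

Lemma is_pd_derive_s l f s z d : 0 < l -> - l < s < l -> is_pd (strip l) e_s f (s, z) d ->
  is_derive (fun t => f (clamp l t, z)) s d.
Proof.
  intros Hl Hs. rewrite is_pd_eps. intros H. apply is_derive_Reals. intros eps He.
  destruct (H eps He) as [del [Hd Hh]].
  assert (Hm : 0 < Rmin del (Rmin (l - s) (l + s))) by (repeat apply Rmin_glb_lt; lra).
  exists (mkposreal _ Hm). intros h Hn Hlt. simpl in Hlt.
  assert (M1 := Rmin_l del (Rmin (l - s) (l + s))). assert (M2 := Rmin_r del (Rmin (l - s) (l + s))).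
  assert (M3 := Rmin_l (l - s) (l + s)). assert (M4 := Rmin_r (l - s) (l + s)).
  assert (B : - l <= s + h <= l) by (assert (Hx := Rabs_le_between h (Rabs h)); destruct Hx as [Hx _]; specialize (Hx (Rle_refl _)); lra).
  rewrite (clamp_id l (s + h)), (clamp_id l s) by lra.
  assert (Q : (fst (s, z) + h * fst e_s, snd (s, z) + h * snd e_s) = (s + h, z)) by (simpl; f_equal; ring).
  specialize (Hh h Hn ltac:(lra)). rewrite Q in Hh. apply Hh. exact B.
Qed.

Lemma is_pd_derive_z l f s z d : strip l (s, z) -> is_pd (strip l) e_z f (s, z) d ->
  is_derive (fun t => f (s, t)) z d.
Proof.
  intros Hs. rewrite is_pd_eps. intros H. apply is_derive_Reals. intros eps He.
  destruct (H eps He) as [del [Hd Hh]]. exists (mkposreal _ Hd). intros h Hn Hlt.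
  assert (Q : (fst (s, z) + h * fst e_z, snd (s, z) + h * snd e_z) = (s, z + h)) by (simpl; f_equal; ring).
  specialize (Hh h Hn Hlt). rewrite Q in Hh. apply Hh. exact Hs.
Qed.

Lemma continuous_on_eps (L : R * R -> Prop) (f : R * R -> R) : continuous_on L f <-> forall p, L p -> forall eps, 0 < eps ->
  exists del, 0 < del /\ forall q, L q -> Rabs (fst q - fst p) < del -> Rabs (snd q - snd p) < del ->
    Rabs (f q - f p) < eps.
Proof.
  split.
  - intros H p Hp eps He. 
    destruct (H p Hp (ball (f p) (mkposreal _ He)) (locally_ball _ _)) as [del Hd]. exists del; split; [apply cond_pos|]. intros q Hq H1 H2.
    apply (Hd q); auto. split; apply ball_R; auto.
  - intros H p Hp. apply filterlim_locally. intros eps. destruct (H p Hp eps (cond_pos eps)) as [del [Hd Hh]].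
    exists (mkposreal _ Hd). intros q [H1 H2] Hq. apply ball_R in H1. apply ball_R in H2.
    apply (Hh q Hq H1 H2).
Qed.

Lemma continuous_on_clamp l (f : R * R -> R) : 0 < l -> continuous_on (strip l) f -> cont2 (fun s z => f (clamp l s, z)).
Proof.
  intros Hl. rewrite continuous_on_eps. intros H [s z]. apply filterlim_locally. intros eps.
  destruct (H (clamp l s, z) (clamp_in l s Hl) eps (cond_pos eps)) as [del [Hd Hh]].
  exists (mkposreal _ Hd). intros [s' z'] [B1 B2]. apply ball_R in B1. apply ball_R in B2. simpl in *.
  apply (Hh (clamp l s', z')); simpl; auto; [apply clamp_in; auto|].
  eapply Rle_lt_trans; [apply clamp_lip; auto | auto].
Qed.

Lemma continuous_on_ext (L : R * R -> Prop) (f g : R * R -> R) : (forall q, L q -> f q = g q) -> continuous_on L f -> continuous_on L g.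
Proof.
  rewrite !continuous_on_eps. intros E H p Hp eps He. destruct (H p Hp eps He) as [del [Hd Hh]].
  exists del; split; auto. intros q Hq. rewrite <- !E by auto. auto.
Qed.

Lemma continuous_on_lin (L : R * R -> Prop) (f g : R * R -> R) a c : continuous_on L f -> continuous_on L g ->
  continuous_on L (fun q => a * (f q + c * g q)).
Proof.
  rewrite !continuous_on_eps. intros Hf Hg p Hp eps He.
  set (m := 1 + Rabs a * (1 + Rabs c)).
  assert (Hm : 0 < m) by (unfold m; generalize (Rabs_pos a), (Rabs_pos c); nra).
  assert (Hem : 0 < eps / m) by (apply Rdiv_lt_0_compat; auto).
  destruct (Hf p Hp _ Hem) as [d1 [P1 Q1]]. destruct (Hg p Hp _ Hem) as [d2 [P2 Q2]].
  exists (Rmin d1 d2). split; [apply Rmin_glb_lt; auto|]. intros q Hq H1 H2.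
  assert (M1 := Rmin_l d1 d2). assert (M2 := Rmin_r d1 d2).
  specialize (Q1 q Hq ltac:(lra) ltac:(lra)). specialize (Q2 q Hq ltac:(lra) ltac:(lra)).
  replace (a * (f q + c * g q) - a * (f p + c * g p)) with (a * ((f q - f p) + c * (g q - g p))) by ring.
  rewrite Rabs_mult. apply Rle_lt_trans with (Rabs a * (1 + Rabs c) * (eps / m)).
  - rewrite Rmult_assoc. apply Rmult_le_compat_l; [apply Rabs_pos|].
    eapply Rle_trans; [apply Rabs_triang|]. rewrite Rabs_mult.
    generalize (Rabs_pos c); intros. nra.
  - replace eps with (m * (eps / m)) at 2 by (field; lra). apply Rmult_lt_compat_r; auto. unfold m; lra.
Qed.

Lemma continuous_on_mir l (f : R * R -> R) : continuous_on (strip l) f -> continuous_on (strip l) (fun q => f (mir q)).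
Proof.
  rewrite !continuous_on_eps. intros H p Hp eps He. destruct (H _ (strip_mir _ _ Hp) eps He) as [del [Hd Hh]].
  exists del; split; auto. intros q Hq H1 H2. apply Hh; [apply strip_mir; auto | | auto].
  unfold mir; simpl. replace (- fst q - - fst p) with (- (fst q - fst p)) by ring. rewrite Rabs_Ropp; auto.
Qed.

(** * The polynomial weight and the power of the width *)

Definition wt (xi y : R) : R := Rpower (1 / (1 + Rabs y)) xi.

Lemma wt_base y : 0 < 1 / (1 + Rabs y) <= 1.
Proof.
  assert (P := Rabs_pos y). split; [apply Rdiv_lt_0_compat; lra|].
  apply Rmult_le_reg_r with (1 + Rabs y); [lra|]. field_simplify; lra.
Qed.

Lemma Rpower_5_2 l : 0 < l -> Rpower l (5 / 2) * Rpower l (5 / 2) = l ^ 5.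
Proof.
  intros Hl. rewrite <- Rpower_plus. replace (5 / 2 + 5 / 2) with (INR 5) by (simpl; lra).
  apply Rpower_pow; auto.
Qed.

(** The factor [k^-3 = 8 l^3] turns 1000 into 8000 and, with the [l] from the slice of the source,
    gives [l^4]; the fifth power is the price of trading the exponential for [1 / (1 + |y|)]. In the
    exponent, 13 is 10 from [decay_const] plus 3 from the window in [z]. *)
Lemma l2_decay_le l0 l beta y : 0 < l0 -> l0 <= l ->
  l2_decay l beta y <= 8000 * exp (13 * / (2 * l0)) * (2 + / l0) * (l ^ 5 * (beta * beta)) * (1 / (1 + Rabs y)).
Proof.
  intros Hl0 Hl. unfold l2_decay, decay_const. assert (Hlp : 0 < l) by lra.
  assert (Yp := Rabs_pos y). assert (I0 : 0 < / l0) by (apply Rinv_0_lt_compat; auto).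
  assert (Hk : 0 < kk l) by (apply kk_pos; auto).
  assert (Hk0 : kk l <= / (2 * l0)) by (apply Rinv_le_contravar; lra).
  assert (Er : kk l * (2 * l) = 1) by (unfold kk; field; lra).
  assert (Hrho : Rabs y <= rho y).
  { unfold rho. rewrite <- (sqrt_Rsqr_abs y). apply sqrt_le_1_alt. unfold Rsqr; lra. }
  assert (E1 : exp (10 * kk l) * exp (- kk l * (rho y - 3)) <= exp (13 * / (2 * l0)) * exp (- (kk l * Rabs y))).
  { rewrite <- !exp_plus. apply exp_le. nra. }
  assert (E2 : exp (- (kk l * Rabs y)) <= (1 + 2 * l) * (1 / (1 + Rabs y))).
  { assert (X := exp_ineq1_le (kk l * Rabs y)). assert (P := exp_pos (kk l * Rabs y)).
    assert (1 <= exp (kk l * Rabs y)) by nra.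
    assert (Rabs y <= 2 * l * exp (kk l * Rabs y)).
    { replace (Rabs y) with (2 * l * (kk l * Rabs y)) at 1.
      - apply Rmult_le_compat_l; lra.
      - transitivity (kk l * (2 * l) * Rabs y); [ring | rewrite Er; ring]. }
    rewrite exp_Ropp. apply Rmult_le_reg_r with (exp (kk l * Rabs y) * (1 + Rabs y)); [nra|].
    field_simplify; nra. }
  assert (E3 : 1 + 2 * l <= (2 + / l0) * l).
  { assert (1 <= / l0 * l); [|lra]. apply Rmult_le_reg_l with l0; auto.
    rewrite <- Rmult_assoc, Rinv_r by lra. lra. }
  assert (W := wt_base y).
  assert (C1 : kk l * (kk l * kk l) = / (8 * (l * (l * l)))) by (unfold kk; field; lra).
  rewrite C1.
  replace (1000 * exp (10 * kk l) * (l * (beta * beta)) / / (8 * (l * (l * l))) * exp (- kk l * (rho y - 3)))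
    with (8000 * (l ^ 4 * (beta * beta)) * (exp (10 * kk l) * exp (- kk l * (rho y - 3)))) by (field; lra).
  assert (Q : 0 <= l ^ 4 * (beta * beta)) by (apply Rmult_le_pos; [apply pow_le; lra | nra]).
  assert (E0 := exp_pos (13 * / (2 * l0))).
  apply Rle_trans with (8000 * (l ^ 4 * (beta * beta)) * (exp (13 * / (2 * l0)) * ((2 + / l0) * l * (1 / (1 + Rabs y))))).
  - apply Rmult_le_compat_l; [lra|]. eapply Rle_trans; [exact E1|].
    apply Rmult_le_compat_l; [lra|]. eapply Rle_trans; [exact E2|].
    apply Rmult_le_compat_r; lra.
  - right. ring.
Qed.

(** [size] contains the square root of the bound on slices, so that [2 xi <= 1] is the condition
    under which the weight absorbs [1 / (1 + |y|)]. The constant 52 is [4 * 13]: [src_sup] is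
    [4 * beta] for [|y| < 12], where the weight is at least [1/13]. *)
Lemma size_le l0 xi : 0 < l0 -> 0 < xi < 1 / 2 -> exists C, 0 < C /\
  forall l beta y, l0 <= l -> 0 <= beta ->
    size l beta y <= C * (Rpower l (5 / 2) * beta * wt xi y).
Proof.
  intros Hl0 Hxi. set (A := 8000 * exp (13 * / (2 * l0)) * (2 + / l0)).
  assert (I0 : 0 < / l0) by (apply Rinv_0_lt_compat; auto).
  assert (HA : 0 < A).
  { unfold A. assert (E0 := exp_pos (13 * / (2 * l0))). nra. }
  assert (P0 := Rpower_pos l0 (5 / 2)). assert (S0 := sqrt_lt_R0 A HA).
  assert (D0 : 0 < 52 / Rpower l0 (5 / 2)) by (apply Rdiv_lt_0_compat; lra).
  exists (sqrt A + 52 / Rpower l0 (5 / 2)). split; [lra|]. intros l beta y Hl Hb.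
  assert (Pl := Rpower_pos l (5 / 2)). assert (Pm : Rpower l0 (5 / 2) <= Rpower l (5 / 2)) by (apply Rpower_le_base; lra).
  assert (W := wt_base y). assert (Wp : 0 < wt xi y) by apply Rpower_pos.
  assert (W1 : 1 / (1 + Rabs y) <= wt xi y) by (apply Rpower_ge_id; lra).
  assert (W2 : 1 / (1 + Rabs y) <= wt xi y * wt xi y).
  { unfold wt. rewrite <- Rpower_plus. apply Rpower_ge_id; lra. }
  unfold size. rewrite Rmult_plus_distr_r. apply Rplus_le_compat.
  - set (T := Rpower l (5 / 2) * beta * wt xi y).
    assert (HT : 0 <= T) by (unfold T; repeat apply Rmult_le_pos; lra).
    rewrite <- (sqrt_Rsqr (sqrt A * T)) by (apply Rmult_le_pos; lra).
    apply sqrt_le_1_alt. eapply Rle_trans; [apply (l2_decay_le l0); auto|]. fold A. unfold Rsqr.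
    replace (sqrt A * T * (sqrt A * T)) with ((sqrt A * sqrt A) * (T * T)) by ring.
    rewrite sqrt_def by lra. unfold T.
    replace (Rpower l (5 / 2) * beta * wt xi y * (Rpower l (5 / 2) * beta * wt xi y))
      with ((Rpower l (5 / 2) * Rpower l (5 / 2)) * (beta * beta) * (wt xi y * wt xi y)) by ring.
    rewrite Rpower_5_2, !Rmult_assoc by lra. apply Rmult_le_compat_l; [lra|].
    rewrite <- !Rmult_assoc. rewrite !Rmult_assoc.
    apply Rmult_le_compat_l; [apply pow_le; lra|]. apply Rmult_le_compat_l; [lra|].
    apply Rmult_le_compat_l; lra.
  - unfold src_sup. destruct Rlt_dec as [Hy|Hy].
    + assert (Yp := Rabs_pos y).
      assert (V : / 13 <= wt xi y).
      { eapply Rle_trans; [|exact W1]. unfold Rdiv. rewrite Rmult_1_l. apply Rinv_le_contravar; lra. }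
      assert (V2 : 1 <= Rpower l (5 / 2) / Rpower l0 (5 / 2)).
      { apply Rmult_le_reg_r with (Rpower l0 (5 / 2)); auto. field_simplify; lra. }
      replace (52 / Rpower l0 (5 / 2) * (Rpower l (5 / 2) * beta * wt xi y))
        with (4 * beta * (13 * wt xi y * (Rpower l (5 / 2) / Rpower l0 (5 / 2)))) by (field; lra).
      rewrite <- (Rmult_1_r (4 * beta)) at 1. apply Rmult_le_compat_l; [lra|]. nra.
    + repeat apply Rmult_le_pos; lra.
Qed.

(** * Existence *)

(** All that is kept of the limit for one parity. [W i j] stands for the derivative of order [i] in
    [s] and [j] in [z], linked by one-sided derivatives relative to the strip. *)
Record piece (b : bool) (l l0 al beta Cl : R) (E : R -> R -> R) (W : nat -> nat -> R -> R -> R) : Prop := {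
  pc_s : forall i j s z, (i + j <= 1)%nat -> - l <= s <= l ->
    is_pd (strip l) e_s (fun p => W i j (fst p) (snd p)) (s, z) (W (S i) j s z);
  pc_z : forall i j s z, (i + j <= 1)%nat -> - l <= s <= l ->
    is_pd (strip l) e_z (fun p => W i j (fst p) (snd p)) (s, z) (W i (S j) s z);
  pc_bound : forall y i j x z, (i + j <= 2)%nat -> - l <= x <= l -> y - 1 <= z <= y + 1 ->
    Rabs (W i j x z) <= Cl * size l beta y;
  pc_holder : forall y i j x z x' z' d, (i + j <= 2)%nat -> - l <= x <= l -> - l <= x' <= l ->
    y - 1 <= z <= y + 1 -> y - 1 <= z' <= y + 1 -> 0 < d <= rad l0 ->
    Rabs (x' - x) <= d -> Rabs (z' - z) <= d ->
    Rabs (W i j x' z' - W i j x z) <= 2 * Cl * Rpower d al * size l beta y;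
  pc_pde : forall s z, - l <= s <= l ->
    W 2%nat 0%nat s z + W 0%nat 2%nat s z + 2 * (sech s * sech s) * W 0%nat 0%nat s z = E s z;
  pc_bc : forall z, W 1%nat 0%nat l z = kapp b l * W 0%nat 0%nat l z;
  pc_par : forall z, parity (sigp b) (fun s => W 0%nat 0%nat s z);
  pc_cont : forall z, cont1 (fun s => W 0%nat 0%nat (clamp l s) z);
  pc_orth : forall z, RInt (fun s => W 0%nat 0%nat (clamp l s) z * omp b s) 0 l = 0 }.

Lemma piece_exists al l0 : 0 < al < 1 -> 0 < l0 -> exists Cl, 0 <= Cl /\
  forall b l beta E, l0 <= l -> rhs b l al beta E ->
  exists W, piece b l l0 al beta Cl E W.
Proof.
  intros Hal Hl0. destruct kernels_bounded as [CK [HCK HK]].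
  (* [1 + / tanh l0] bounds the Robin coefficients of both parities for all [l >= l0], so the
     constant precedes the choice of [b], [l], [beta] and [E]. *)
  exists (Cloc CK l0 (1 + / tanh l0) al). split.
  { apply (Cl_pos CK HCK al Hal true l0 l0 Hl0 (Rle_refl _)). }
  intros b l beta E Hl HE.
  assert (X : forall n, { c : (R -> R -> R) * jet | approx b l al beta E n (eps n) (fst c) (snd c) }).
  { intros n. apply constructive_indefinite_description.
    destruct (approximant b l al beta E n (eps n) ltac:(lra) Hal) as [EN [J HJ]]; auto.
    - split; [apply eps_pos|]. unfold eps. rewrite <- Rinv_1. apply Rinv_le_contravar; [lra|].
      generalize (pos_INR n); lra.
    - exists (EN, J); exact HJ. }
  set (EN n := fst (proj1_sig (X n))). set (J n := snd (proj1_sig (X n))).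
  assert (HA : forall n, approx b l al beta E n (eps n) (EN n) (J n)) by (intros n; exact (proj2_sig (X n))).
  exists (lim_jet J). split.
  - intros; apply (U_pd_s CK HCK HK al Hal b l0 l beta Hl0 Hl E HE EN J HA); auto.
  - intros; apply (U_pd_z CK HCK HK al Hal b l0 l beta Hl0 Hl E HE EN J HA); auto.
  - intros; apply (U_bound CK HCK HK al Hal b l0 l beta Hl0 Hl E HE EN J HA); auto.
  - intros; eapply (U_holder CK HCK HK al Hal b l0 l beta Hl0 Hl E HE EN J HA); eauto.
  - intros; apply (U_pde CK HCK HK al Hal b l0 l beta Hl0 Hl E HE EN J HA); auto.
  - intros; apply (U_bc CK HCK HK al Hal b l0 l beta Hl0 Hl E HE EN J HA); auto.
  - intros; apply (U_parity al b l beta E HE EN J HA); auto.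
  - intros; apply (U_clamp_cont CK HCK HK al Hal b l0 l beta Hl0 Hl E HE EN J HA); auto.
  - intros; apply (U_orth CK HCK HK al Hal b l0 l beta Hl0 Hl E HE EN J HA); auto.
Qed.

Lemma Derive_tanh l : Derive tanh l = sech l * sech l.
Proof. apply is_derive_unique. apply is_derive_tanh. Qed.
Lemma Derive_sech l : Derive sech l = - (tanh l * sech l).
Proof. apply is_derive_unique. eapply dr_eq; [apply is_derive_sech|]. ring. Qed.

Section Assembly.
Context (l l0 al beta Cl : R) (E : R * R -> R) (EP : bool -> R -> R -> R) (W : bool -> nat -> nat -> R -> R -> R).
Context (Hal : 0 < al < 1) (Hl0 : 0 < l0) (Hl : l0 <= l) (HCl : 0 <= Cl).
Context (HEP : forall s z, - l <= s <= l -> EP true s z + EP false s z = E (s, z)).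
Context (HW : forall b, piece b l l0 al beta Cl (EP b) (W b)).
Let Hlp : 0 < l := Rlt_le_trans _ _ _ Hl0 Hl.

Definition Wb (b : bool) (i j : nat) (p : R * R) : R := W b i j (fst p) (snd p).
Definition Wt (i j : nat) (p : R * R) : R := Wb true i j p + Wb false i j p.

Lemma Wt_lin i j p : Wt i j p = 1 * (Wb true i j p + 1 * Wb false i j p).
Proof. unfold Wt; ring. Qed.

Lemma Wt_pd_s i j p : (i + j <= 1)%nat -> strip l p -> is_pd (strip l) e_s (Wt i j) p (Wt (S i) j p).
Proof.
  intros Hij Hp. rewrite Wt_lin.
  apply (is_pd_ext _ _ (fun q => 1 * (Wb true i j q + 1 * Wb false i j q))); auto.
  { intros; symmetry; apply Wt_lin. }
  destruct p as [s z]. apply is_pd_lin; [apply (pc_s _ _ _ _ _ _ _ _ (HW true)) | apply (pc_s _ _ _ _ _ _ _ _ (HW false))]; auto.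
Qed.

Lemma Wt_pd_z i j p : (i + j <= 1)%nat -> strip l p -> is_pd (strip l) e_z (Wt i j) p (Wt i (S j) p).
Proof.
  intros Hij Hp. rewrite Wt_lin.
  apply (is_pd_ext _ _ (fun q => 1 * (Wb true i j q + 1 * Wb false i j q))); auto.
  { intros; symmetry; apply Wt_lin. }
  destruct p as [s z]. apply is_pd_lin; [apply (pc_z _ _ _ _ _ _ _ _ (HW true)) | apply (pc_z _ _ _ _ _ _ _ _ (HW false))]; auto.
Qed.

Lemma Wt_bound i j p q : (i + j <= 2)%nat -> strip l q -> dist2 p q < 1 ->
  Rabs (Wt i j q) <= 2 * Cl * size l beta (snd p).
Proof.
  intros Hij Hq Hd. destruct (dist2_ge p q) as [_ D]. assert (D' : Rabs (snd p - snd q) <= 1) by lra.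
  apply Rabs_le_between in D'.
  assert (A := pc_bound _ _ _ _ _ _ _ _ (HW true) (snd p) i j (fst q) (snd q) Hij Hq ltac:(lra)).
  assert (B := pc_bound _ _ _ _ _ _ _ _ (HW false) (snd p) i j (fst q) (snd q) Hij Hq ltac:(lra)).
  unfold Wt, Wb. eapply Rle_trans; [apply Rabs_triang|]. lra.
Qed.

Lemma Wt_holder_loc y i j p q d : (i + j <= 2)%nat -> strip l p -> strip l q ->
  y - 1 <= snd p <= y + 1 -> y - 1 <= snd q <= y + 1 -> 0 < d <= rad l0 ->
  Rabs (fst q - fst p) <= d -> Rabs (snd q - snd p) <= d ->
  Rabs (Wt i j q - Wt i j p) <= 4 * Cl * size l beta y * Rpower d al.
Proof.
  intros Hij Hp Hq Yp Yq Hd H1 H2.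
  assert (A := pc_holder _ _ _ _ _ _ _ _ (HW true) y i j _ _ _ _ d Hij Hp Hq Yp Yq Hd H1 H2).
  assert (B := pc_holder _ _ _ _ _ _ _ _ (HW false) y i j _ _ _ _ d Hij Hp Hq Yp Yq Hd H1 H2).
  unfold Wt, Wb.
  match goal with |- Rabs (?a + ?b - (?c + ?e)) <= _ => replace (a + b - (c + e)) with ((a - c) + (b - e)) by ring end.
  eapply Rle_trans; [apply Rabs_triang|]. lra.
Qed.

Lemma Wt_continuous i j : (i + j <= 2)%nat -> continuous_on (strip l) (Wt i j).
Proof.
  intros Hij. apply continuous_on_eps. intros p Hp e He.
  destruct (rad_pos l0 Hl0 l Hl) as [Hr1 Hr2].
  destruct (Rpower_small (4 * Cl * size l beta (snd p)) al (e / 2) ltac:(lra) ltac:(lra)) as [h [Hh Hs]].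
  set (d := Rmin h (rad l0)).
  assert (Hd : 0 < d) by (unfold d; apply Rmin_glb_lt; lra).
  assert (M1 := Rmin_l h (rad l0)). assert (M2 := Rmin_r h (rad l0)). fold d in M1, M2.
  exists d; split; auto. intros q Hq H1 H2.
  assert (H3 := H2). apply Rabs_lt_between in H3.
  eapply Rle_lt_trans; [apply (Wt_holder_loc (snd p) i j p q d); auto; lra|].
  specialize (Hs d ltac:(lra)). lra.
Qed.

(** Iterated [pd] agrees with the [Wt i j] on the strip only, so the induction runs over all
    functions with that restriction. *)
Lemma Wt_Ck k : forall i j f, (i + j + k <= 2)%nat -> (forall p, strip l p -> Wt i j p = f p) -> Ck_on (strip l) k f.
Proof.
  induction k as [|k IH]; intros i j f Hij Hf; (split; [apply (continuous_on_ext _ (Wt i j)); auto; apply Wt_continuous; lia|]); auto.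
  assert (Ds : forall p, strip l p -> is_pd (strip l) e_s f p (Wt (S i) j p)).
  { intros p Hp. apply (is_pd_ext _ _ (Wt i j)); auto. apply Wt_pd_s; auto; lia. }
  assert (Dz : forall p, strip l p -> is_pd (strip l) e_z f p (Wt i (S j) p)).
  { intros p Hp. apply (is_pd_ext _ _ (Wt i j)); auto. apply Wt_pd_z; auto; lia. }
  intros e [-> | ->]; split.
  - intros p Hp. eexists; apply Ds; auto.
  - apply (IH (S i) j); [lia|]. intros p Hp. symmetry. apply pd_eq; auto.
  - intros p Hp. eexists; apply Dz; auto.
  - apply (IH i (S j)); [lia|]. intros p Hp. symmetry. apply pd_eq; auto.
Qed.

Lemma Wt_multi i j p : (i + j <= 2)%nat -> strip l p -> pd_multi (strip l) (i, j) (Wt 0 0) p = Wt i j p.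
Proof.
  intros Hij. revert p.
  assert (Z : forall n, (n <= 2)%nat -> forall p, strip l p -> Nat.iter n (pd (strip l) e_z) (Wt 0 0) p = Wt 0 n p).
  { induction n as [|n IH]; intros Hn p Hp; [reflexivity|]. simpl. apply pd_eq; auto.
    apply (is_pd_ext _ _ (Wt 0 n)); auto.
    - intros; symmetry; apply IH; auto; lia.
    - apply Wt_pd_z; auto; lia. }
  unfold pd_multi; cbn [fst snd].
  induction i as [|i IH]; intros p Hp; [apply Z; auto; lia|]. simpl. apply pd_eq; auto.
  apply (is_pd_ext _ _ (Wt i j)); auto.
  - intros; symmetry; apply IH; auto; lia.
  - apply Wt_pd_s; auto; lia.
Qed.

(** Pairs closer than [rad l0] are handled by the Hölder bound; for the others the supremum bound
    suffices, at the cost of [rad^(-al)]. The factor 9 counts six suprema and three seminorms. *)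
Lemma Wt_norm p : strip l p -> Rbar_le (holder_norm_at (strip l) 2 al (Wt 0 0) p)
  (Finite (9 * ((4 + 4 / Rpower (rad l0) al) * Cl * size l beta (snd p)))).
Proof.
  intros Hp. destruct (rad_pos l0 Hl0 l Hl) as [Hr1 Hr2].
  assert (Pr := Rpower_pos (rad l0) al).
  assert (D0 : 0 < 4 / Rpower (rad l0) al) by (apply Rdiv_lt_0_compat; lra).
  assert (S0 : 0 <= Cl * size l beta (snd p)).
  { assert (A := pc_bound _ _ _ _ _ _ _ _ (HW true) (snd p) 0%nat 0%nat (fst p) (snd p) ltac:(lia) Hp ltac:(lra)).
    eapply Rle_trans; [apply Rabs_pos | exact A]. }
  apply norm2_le.
  - intros i j Hij q [Hq Hd]. rewrite Wt_multi by auto. eapply Rle_trans; [apply (Wt_bound i j p); auto|]. nra.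
  - intros i j Hij q q' [Hq Hd] [Hq' Hd'] Hn. rewrite !Wt_multi by (auto; lia).
    assert (Pd := dist2_pos _ _ Hn). assert (Pw := Rpower_pos (dist2 q q') al).
    destruct (Rle_dec (dist2 q q') (rad l0)) as [Hle|Hgt].
    + destruct (dist2_ge q q') as [A1 A2]. destruct (dist2_ge p q) as [_ B1]. destruct (dist2_ge p q') as [_ B2].
      assert (B1' : Rabs (snd p - snd q) <= 1) by lra. assert (B2' : Rabs (snd p - snd q') <= 1) by lra.
      apply Rabs_le_between in B1'. apply Rabs_le_between in B2'.
      eapply Rle_trans; [apply (Wt_holder_loc (snd p) i j q' q (dist2 q q')); auto; try lra; lia|].
      apply Rmult_le_compat_r; [lra|]. nra.
    + assert (A1 := Wt_bound i j p q ltac:(lia) Hq Hd). assert (A2 := Wt_bound i j p q' ltac:(lia) Hq' Hd').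
      assert (M : Rpower (rad l0) al <= Rpower (dist2 q q') al) by (apply Rpower_le_base; lra).
      apply Rle_trans with (4 * (Cl * size l beta (snd p))).
      * unfold Rminus. eapply Rle_trans; [apply Rabs_triang|]. rewrite Rabs_Ropp. lra.
      * apply Rle_trans with (4 / Rpower (rad l0) al * (Cl * size l beta (snd p)) * Rpower (dist2 q q') al).
        -- replace (4 / Rpower (rad l0) al * (Cl * size l beta (snd p)) * Rpower (dist2 q q') al)
             with (4 * (Cl * size l beta (snd p)) * (Rpower (dist2 q q') al / Rpower (rad l0) al)) by (field; lra).
           rewrite <- (Rmult_1_r (4 * (Cl * size l beta (snd p)))) at 1. apply Rmult_le_compat_l; [lra|].
           apply Rmult_le_reg_r with (Rpower (rad l0) al); auto. field_simplify; lra.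
        -- apply Rmult_le_compat_r; [lra|]. nra.
Qed.

Lemma Wt_pde : solves_pde l E (Wt 0 0).
Proof.
  intros p Hp. rewrite !Wt_multi by (auto; lia). destruct p as [s z]. cbn [fst].
  rewrite <- (HEP s z Hp).
  rewrite <- (pc_pde _ _ _ _ _ _ _ _ (HW true) s z Hp), <- (pc_pde _ _ _ _ _ _ _ _ (HW false) s z Hp).
  unfold Wt, Wb; cbn [fst snd]. ring.
Qed.

Lemma even_part_Wt p : even_part (Wt 0 0) p = Wb true 0 0 p.
Proof.
  unfold even_part, Wt, Wb; cbn [fst snd].
  rewrite (pc_par _ _ _ _ _ _ _ _ (HW true) (snd p) (fst p)), (pc_par _ _ _ _ _ _ _ _ (HW false) (snd p) (fst p)).
  unfold sigp. lra.
Qed.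
Lemma odd_part_Wt p : odd_part (Wt 0 0) p = Wb false 0 0 p.
Proof.
  unfold odd_part, Wt, Wb; cbn [fst snd].
  rewrite (pc_par _ _ _ _ _ _ _ _ (HW true) (snd p) (fst p)), (pc_par _ _ _ _ _ _ _ _ (HW false) (snd p) (fst p)).
  unfold sigp. lra.
Qed.

Lemma Wt_odd : boundary_odd l (Wt 0 0).
Proof.
  intros z. assert (Hp : strip l (l, z)) by (unfold strip; simpl; lra).
  rewrite odd_part_Wt. rewrite (pd_eq l e_s _ (l, z) (W false 1%nat 0%nat l z)); auto.
  - rewrite Derive_tanh, (pc_bc _ _ _ _ _ _ _ _ (HW false)). unfold Wb, kapp; cbn [fst snd].
    generalize (tanh_pos l Hlp); intros. field. lra.
  - apply (is_pd_ext _ _ (Wb false 0 0)); auto.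
    + intros; symmetry; apply odd_part_Wt.
    + apply (pc_s _ _ _ _ _ _ _ _ (HW false)); auto.
Qed.
Lemma Wt_even : boundary_even l (Wt 0 0).
Proof.
  intros z. assert (Hp : strip l (l, z)) by (unfold strip; simpl; lra).
  rewrite even_part_Wt. rewrite (pd_eq l e_s _ (l, z) (W true 1%nat 0%nat l z)); auto.
  - rewrite Derive_sech, (pc_bc _ _ _ _ _ _ _ _ (HW true)). unfold Wb, kapp; cbn [fst snd]. ring.
  - apply (is_pd_ext _ _ (Wb true 0 0)); auto.
    + intros; symmetry; apply even_part_Wt.
    + apply (pc_s _ _ _ _ _ _ _ _ (HW true)); auto.
Qed.

Lemma RInt_parity f c : cont1 f -> parity c f -> RInt f (- l) l = (1 + c) * RInt f 0 l.
Proof.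
  intros Cf Pf. rewrite <- (RInt_Chasles f (- l) 0 l) by (apply ex_RInt_cont1; auto).
  replace (RInt f (- l) 0) with (c * RInt f 0 l).
  - unfold plus; simpl. lra.
  - rewrite <- RInt_scal' by auto.
    transitivity (RInt (fun t => f (0 - t)) 0 l).
    + apply RInt_ext'. intros s. rewrite <- Pf. f_equal; ring.
    + rewrite (RInt_flip f) by auto. f_equal; ring.
Qed.

Lemma parity_clamp b z : parity (sigp b) (fun s => W b 0%nat 0%nat (clamp l s) z).
Proof. intros s. rewrite clamp_opp by auto. apply (pc_par _ _ _ _ _ _ _ _ (HW b)). Qed.

(** For different parities the integrand is odd; for equal ones it is even, and the integral is
    twice that over [[0, l]]. *)
Lemma Wb_orth b b' z : RInt (fun s => W b 0%nat 0%nat (clamp l s) z * omp b' s) (- l) l = 0.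
Proof.
  assert (Co := omp_cont b'). assert (Cw := pc_cont _ _ _ _ _ _ _ _ (HW b) z).
  rewrite (RInt_parity _ (sigp b * sigp b')); [| ct | apply parity_mult; [apply parity_clamp | apply omp_par]].
  destruct (Bool.bool_dec b b') as [->|Hn].
  - rewrite (pc_orth _ _ _ _ _ _ _ _ (HW b') z). apply Rmult_0_r.
  - replace (1 + sigp b * sigp b') with 0; [apply Rmult_0_l|]. destruct b, b'; try tauto; unfold sigp; lra.
Qed.

Lemma Wt_orth : orthogonality l (Wt 0 0).
Proof.
  assert (X : forall b' z, is_RInt (fun s => Wt 0 0 (s, z) * omp b' s) (- l) l 0).
  { intros b' z. assert (Co := omp_cont b').
    assert (C1 := pc_cont _ _ _ _ _ _ _ _ (HW true) z). assert (C2 := pc_cont _ _ _ _ _ _ _ _ (HW false) z).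
    apply (is_RInt_ext (fun s => plus (W true 0%nat 0%nat (clamp l s) z * omp b' s) (W false 0%nat 0%nat (clamp l s) z * omp b' s))).
    - intros s Hs. rewrite Rmin_left, Rmax_right in Hs by lra. rewrite clamp_id by lra.
      unfold Wt, Wb, plus; simpl. ring.
    - replace 0 with (plus 0 0) by (unfold plus; simpl; ring).
      apply (is_RInt_plus (V := R_NormedModule)).
      + rewrite <- (Wb_orth true b' z). apply (RInt_correct (V := R_CompleteNormedModule)), ex_RInt_cont1; ct.
      + rewrite <- (Wb_orth false b' z). apply (RInt_correct (V := R_CompleteNormedModule)), ex_RInt_cont1; ct. }
  intros z. split; [apply (X true) | apply (X false)].
Qed.

Lemma Wt_solution : is_solution l al E (Wt 0 0).
Proof.
  split; [split|split; [|split; [|split]]].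
  - apply (Wt_Ck 2 0 0); auto.
  - intros p Hp. eapply norm_finite; [exact Hp | apply strip_shift; auto | apply Wt_norm; auto].
  - apply Wt_pde.
  - apply Wt_orth.
  - apply Wt_odd.
  - apply Wt_even.
Qed.
End Assembly.

(** * Uniqueness *)

Record reg (l : R) (f fs fz fss fzz : R * R -> R) : Prop := {
  rg_c : continuous_on (strip l) f;
  rg_cs : continuous_on (strip l) fs;
  rg_cz : continuous_on (strip l) fz;
  rg_css : continuous_on (strip l) fss;
  rg_czz : continuous_on (strip l) fzz;
  rg_s : forall p, strip l p -> is_pd (strip l) e_s f p (fs p);
  rg_z : forall p, strip l p -> is_pd (strip l) e_z f p (fz p);
  rg_ss : forall p, strip l p -> is_pd (strip l) e_s fs p (fss p);
  rg_zz : forall p, strip l p -> is_pd (strip l) e_z fz p (fzz p) }.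

Lemma Ck_continuous (L : R * R -> Prop) k f : Ck_on L k f -> continuous_on L f.
Proof. destruct k; intros [H _]; exact H. Qed.

Lemma reg_Ck l f : 0 < l -> Ck_on (strip l) 2 f ->
  reg l f (pd (strip l) e_s f) (pd (strip l) e_z f)
    (pd (strip l) e_s (pd (strip l) e_s f)) (pd (strip l) e_z (pd (strip l) e_z f)).
Proof.
  intros Hl [C0 H]. destruct (H e_s (or_introl eq_refl)) as [D1 [C1 H1]].
  destruct (H e_z (or_intror eq_refl)) as [D2 [C2 H2]].
  destruct (H1 e_s (or_introl eq_refl)) as [D3 C3]. destruct (H2 e_z (or_intror eq_refl)) as [D4 C4].
  split; auto; try (eapply Ck_continuous; eauto); intros p Hp; apply pd_spec; auto.
Qed.

Lemma reg_lin l f fs fz fss fzz g gs gz gss gzz a c : reg l f fs fz fss fzz -> reg l g gs gz gss gzz ->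
  reg l (fun p => a * (f p + c * g p)) (fun p => a * (fs p + c * gs p)) (fun p => a * (fz p + c * gz p))
    (fun p => a * (fss p + c * gss p)) (fun p => a * (fzz p + c * gzz p)).
Proof.
  intros [] []. split; try (apply continuous_on_lin; auto); intros p Hp; apply is_pd_lin; auto.
Qed.

Lemma is_pd_opp L e f p d : is_pd L e f p d -> is_pd L e (fun q => - f q) p (- d).
Proof.
  rewrite !is_pd_eps. intros H eps He. destruct (H eps He) as [del [Hd Hh]]. exists del; split; auto.
  intros h Hn Hl HL. specialize (Hh h Hn Hl HL).
  match type of Hh with Rabs ?t < _ => match goal with |- Rabs ?u < _ => replace u with (- t) by (field; auto) end end.
  rewrite Rabs_Ropp; auto.
Qed.

Lemma continuous_on_opp (L : R * R -> Prop) (f : R * R -> R) : continuous_on L f -> continuous_on L (fun q => - f q).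
Proof.
  intros H. apply (continuous_on_ext L (fun q => - 1 * (f q + 0 * f q))); [intros; ring|].
  apply continuous_on_lin; auto.
Qed.

Lemma reg_mir l f fs fz fss fzz : reg l f fs fz fss fzz ->
  reg l (fun p => f (mir p)) (fun p => - fs (mir p)) (fun p => fz (mir p)) (fun p => fss (mir p)) (fun p => fzz (mir p)).
Proof.
  intros []. split.
  - apply continuous_on_mir; auto.
  - apply continuous_on_opp, continuous_on_mir; auto.
  - apply continuous_on_mir; auto.
  - apply continuous_on_mir; auto.
  - apply continuous_on_mir; auto.
  - intros p Hp. apply is_pd_mir_s. apply rg_s0, strip_mir; auto.
  - intros p Hp. apply is_pd_mir_z. apply rg_z0, strip_mir; auto.
  - intros p Hp. replace (fss (mir p)) with (- - fss (mir p)) by ring.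
    apply is_pd_opp. apply is_pd_mir_s. apply rg_ss0, strip_mir; auto.
  - intros p Hp. apply is_pd_mir_z. apply rg_zz0, strip_mir; auto.
Qed.

Definition part (b : bool) (f : R * R -> R) (p : R * R) : R := / 2 * (f p + sigp b * f (mir p)).
(** The derivative in [s] of [part b f]: differentiation across the mirror reverses the sign. *)
Definition part_s (b : bool) (f : R * R -> R) (p : R * R) : R := / 2 * (f p + sigp b * - f (mir p)).

Lemma reg_part b l f fs fz fss fzz : reg l f fs fz fss fzz ->
  reg l (part b f) (part_s b fs) (part b fz) (part b fss) (part b fzz).
Proof. intros H. apply (reg_lin l _ _ _ _ _ _ _ _ _ _ (/ 2) (sigp b) H (reg_mir _ _ _ _ _ _ H)). Qed.

Lemma mir_0 z : mir (0, z) = (0, z).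
Proof. unfold mir; simpl. rewrite Ropp_0; auto. Qed.
Lemma even_part_part f p : even_part f p = part true f p.
Proof. unfold even_part, part, sigp, mir. lra. Qed.
Lemma odd_part_part f p : odd_part f p = part false f p.
Proof. unfold odd_part, part, sigp, mir. lra. Qed.

Lemma boundary_part l f fs fz fss fzz b : 0 < l -> reg l f fs fz fss fzz ->
  boundary_odd l f -> boundary_even l f ->
  forall z, part_s b fs (l, z) = kapp b l * part b f (l, z).
Proof.
  intros Hl Hr Ho He z. assert (Hp : strip l (l, z)) by (unfold strip; simpl; lra).
  assert (T := tanh_pos l Hl). assert (S := sech_pos l).
  assert (D := rg_s _ _ _ _ _ _ (reg_part b _ _ _ _ _ _ Hr) (l, z) Hp).
  destruct b; unfold kapp.
  - specialize (He z). rewrite even_part_part in He.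
    rewrite (pd_eq l e_s _ (l, z) (part_s true fs (l, z))), Derive_sech in He; auto.
    + apply Rmult_eq_reg_r with (sech l); lra.
    + apply (is_pd_ext _ _ (part true f)); auto. intros; symmetry; apply even_part_part.
  - specialize (Ho z). rewrite odd_part_part in Ho.
    rewrite (pd_eq l e_s _ (l, z) (part_s false fs (l, z))), Derive_tanh in Ho; auto.
    + apply Rmult_eq_reg_r with (tanh l); [|lra].
      replace (sech l * sech l / tanh l * part false f (l, z) * tanh l)
        with (part false f (l, z) * (sech l * sech l)) by (field; lra). lra.
    + apply (is_pd_ext _ _ (part false f)); auto. intros; symmetry; apply odd_part_part.
Qed.

Lemma RInt_sq_0 l f : 0 < l -> cont1 f -> RInt (fun s => f s * f s) 0 l = 0 ->
  forall s, 0 <= s <= l -> f s = 0.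
Proof.
  intros Hl Cf H s Hs. destruct (Req_dec (f s) 0) as [|Hn]; auto. exfalso.
  assert (P : 0 < Rabs (f s)) by (apply Rabs_pos_lt; auto).
  destruct (proj1 (filterlim_locally f (f s)) (Cf s) (mkposreal _ P)) as [del Hd].
  set (d := Rmin (del / 2) l).
  assert (M1 := Rmin_l (del / 2) l). assert (M2 := Rmin_r (del / 2) l). fold d in M1, M2.
  assert (Pd : 0 < d) by (unfold d; apply Rmin_glb_lt; auto; generalize (cond_pos del); lra).
  set (a := Rmax 0 (s - d / 2)). set (b := Rmin l (s + d / 2)).
  assert (Ha : 0 <= a /\ a < b /\ b <= l /\ s - d / 2 <= a /\ b <= s + d / 2).
  { unfold a, b, Rmax, Rmin; repeat destruct Rle_dec; lra. }
  assert (C2 : cont1 (fun s => f s * f s)) by ct.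
  assert (Q : 0 < RInt (fun s => f s * f s) a b).
  { apply RInt_gt_0; [lra| |].
    - intros x Hx. assert (Bx : Rabs (f x - f s) < Rabs (f s)).
      { apply (Hd x). change (Rabs (x - s) < del). apply Rabs_lt_between. generalize (cond_pos del); lra. }
      destruct (Req_dec (f x) 0) as [E0|E0]; [|nra].
      rewrite E0, Rminus_0_l, Rabs_Ropp in Bx. lra.
    - intros; apply C2. }
  assert (X : RInt (fun s => f s * f s) a b <= RInt (fun s => f s * f s) 0 l).
  { apply RInt_sub; auto; try lra. intros; nra. }
  lra.
Qed.

Section Uniqueness.
Context (l al : R) (E u v : R * R -> R) (Hl : 0 < l).
Context (Hu : is_solution l al E u) (Hv : is_solution l al E v).
Context (Bu : bounded_on (strip l) u) (Bv : bounded_on (strip l) v).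

Let ps := pd (strip l) e_s.
Let pz := pd (strip l) e_z.
(** Written as an instance of the combination in [is_pd_lin] and [reg_lin], so that these apply
    without rewriting. *)
Definition dif (f g : R * R -> R) (p : R * R) : R := 1 * (f p + -1 * g p).
Definition cl (f : R * R -> R) (s z : R) : R := f (clamp l s, z).

Lemma dif_reg : reg l (dif v u) (dif (ps v) (ps u)) (dif (pz v) (pz u)) (dif (ps (ps v)) (ps (ps u))) (dif (pz (pz v)) (pz (pz u))).
Proof.
  destruct Hu as [[Cu _] _]. destruct Hv as [[Cv _] _].
  apply (reg_lin l _ _ _ _ _ _ _ _ _ _ 1 (-1)); apply reg_Ck; auto.
Qed.

Lemma dif_pde p : strip l p ->
  dif (ps (ps v)) (ps (ps u)) p + dif (pz (pz v)) (pz (pz u)) p + 2 * (sech (fst p) * sech (fst p)) * dif v u p = 0.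
Proof.
  intros Hp. destruct Hu as [_ [Pu _]]. destruct Hv as [_ [Pv _]].
  specialize (Pu p Hp). specialize (Pv p Hp).
  change (ps (ps u) p + pz (pz u) p + 2 * sech (fst p) ^ 2 * u p = E p) in Pu.
  change (ps (ps v) p + pz (pz v) p + 2 * sech (fst p) ^ 2 * v p = E p) in Pv.
  unfold dif. lra.
Qed.

Lemma part_pde b p : strip l p ->
  part b (dif (ps (ps v)) (ps (ps u))) p + part b (dif (pz (pz v)) (pz (pz u))) p
    + 2 * (sech (fst p) * sech (fst p)) * part b (dif v u) p = 0.
Proof.
  intros Hp. assert (A := dif_pde p Hp). assert (B := dif_pde _ (strip_mir _ _ Hp)).
  unfold part. unfold mir in B at 3 4; cbn [fst] in B. rewrite sech_even in B.
  replace (1 * sech (fst p)) with (sech (fst p)) in B by ring.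
  match goal with |- ?x = 0 => transitivity (/ 2 * (0 + sigp b * 0)); [rewrite <- A at 1; rewrite <- B; ring | ring] end.
Qed.

Lemma dif_orth b z : RInt (fun s => cl (dif v u) s z * omp b s) (- l) l = 0.
Proof.
  destruct Hu as [_ [_ [Ou _]]]. destruct Hv as [_ [_ [Ov _]]].
  apply is_RInt_unique.
  apply (is_RInt_ext (fun s => minus (v (s, z) * omp b s) (u (s, z) * omp b s))).
  - intros s Hs. rewrite Rmin_left, Rmax_right in Hs by lra. unfold cl. rewrite clamp_id by lra.
    unfold dif, minus, plus, opp; simpl. ring.
  - replace 0 with (minus 0 0) by (unfold minus, plus, opp; simpl; ring).
    apply (is_RInt_minus (V := R_NormedModule)); apply orth_omp; auto.
Qed.

Lemma cl_cont f : continuous_on (strip l) f -> cont2 (cl f).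
Proof. apply continuous_on_clamp; auto. Qed.

Lemma cont2_1 (f : R -> R -> R) z : cont2 f -> cont1 (fun s => f s z).
Proof. intros H. ct. Qed.

Lemma part_clamp b f s z : cl (part b f) s z = / 2 * (cl f s z + sigp b * cl f (- s) z).
Proof. unfold cl, part, mir; cbn [fst snd]. rewrite clamp_opp by auto. auto. Qed.

Lemma part_orth b z : RInt (fun s => cl (part b (dif v u)) s z * omp b s) 0 l = 0.
Proof.
  rewrite (RInt_ext' _ (fun s => / 2 * (cl (dif v u) s z + sigp b * cl (dif v u) (- s) z) * omp b s)).
  - apply (half_orth l b (fun s => cl (dif v u) s z)); [|apply dif_orth].
    apply cont2_1, cl_cont, (rg_c _ _ _ _ _ _ dif_reg).
  - intros s. rewrite part_clamp; auto.
Qed.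

Lemma part_bc b z : part_s b (dif (ps v) (ps u)) (l, z) = kapp b l * part b (dif v u) (l, z).
Proof.
  destruct Hu as [[Cu _] [_ [_ [O1 E1]]]]. destruct Hv as [[Cv _] [_ [_ [O2 E2]]]].
  assert (A := boundary_part l _ _ _ _ _ b Hl (reg_Ck l u Hl Cu) O1 E1 z).
  assert (B := boundary_part l _ _ _ _ _ b Hl (reg_Ck l v Hl Cv) O2 E2 z).
  fold ps in A, B. unfold part, part_s, dif in *. lra.
Qed.

(** The clamped functions are continuous on the plane, but in [s] they satisfy the equation and the
    derivative relations only inside the strip, which is why the energy inequalities ask for
    derivatives on the open interval alone. *)
Lemma part_SD b : SD l (fun _ _ => 0) (cl (part b (dif v u))) (cl (part_s b (dif (ps v) (ps u))))
  (cl (part b (dif (pz v) (pz u)))) (cl (part b (dif (ps (ps v)) (ps (ps u))))) (cl (part b (dif (pz (pz v)) (pz (pz u))))).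
Proof.
  destruct (reg_part b _ _ _ _ _ _ dif_reg) as [c cs cz css czz ds dz dss dzz].
  split; try (apply cl_cont; auto).
  - ct.
  - intros s z. apply (is_pd_derive_z l); [apply clamp_in; auto | apply dz, clamp_in; auto].
  - intros s z. apply (is_pd_derive_z l); [apply clamp_in; auto | apply dzz, clamp_in; auto].
  - intros s z Hs. unfold cl. rewrite clamp_id by lra. apply (part_pde b (s, z)). unfold strip; simpl; lra.
  - intros z.
    assert (D1 : forall s, 0 < s < l -> is_derive (fun s => cl (part b (dif v u)) s z) s (cl (part_s b (dif (ps v) (ps u))) s z)).
    { intros s Hs. unfold cl at 2. rewrite clamp_id by lra.
      apply is_pd_derive_s; [auto | lra | apply ds; unfold strip; simpl; lra]. }
    assert (D2 : forall s, 0 < s < l -> is_derive (fun s => cl (part_s b (dif (ps v) (ps u))) s z) s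
      (cl (part b (dif (ps (ps v)) (ps (ps u)))) s z)).
    { intros s Hs. unfold cl at 2. rewrite clamp_id by lra.
      apply is_pd_derive_s; [auto | lra | apply dss; unfold strip; simpl; lra]. }
    assert (Cw := cont2_1 _ z (cl_cont _ c)). assert (Cs := cont2_1 _ z (cl_cont _ cs)).
    assert (Css := cont2_1 _ z (cl_cont _ css)).
    assert (O := part_orth b z). assert (BC := part_bc b z).
    assert (K0 : forall f, cl f 0 z = f (0, z)) by (intros; unfold cl; rewrite clamp_id by lra; auto).
    assert (Kl : forall f, cl f l z = f (l, z)) by (intros; unfold cl; rewrite clamp_id by lra; auto).
    destruct b.
    + apply (energy_even l Hl _ (fun s => cl (part_s true (dif (ps v) (ps u))) s z)); auto.
      * rewrite K0. unfold part_s. rewrite mir_0. unfold sigp. lra.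
      * rewrite !Kl. exact BC.
    + apply (energy_odd l Hl _ (fun s => cl (part_s false (dif (ps v) (ps u))) s z)); auto.
      * rewrite K0. unfold part. rewrite mir_0. unfold sigp. lra.
      * rewrite !Kl, BC. unfold kapp. generalize (tanh_pos l Hl); intros. field. lra.
Qed.

Lemma part_0 b s z : 0 <= s <= l -> part b (dif v u) (s, z) = 0.
Proof.
  intros Hs. assert (HS := part_SD b). set (w := cl (part b (dif v u))) in *.
  assert (Cw : cont2 w) by apply HS.
  destruct Bu as [M1 H1]. destruct Bv as [M2 H2].
  assert (Bw : forall s z, Rabs (w s z) <= M2 + M1).
  { intros s' z'. unfold w. rewrite part_clamp. apply Rabs_half; [|rewrite Rabs_sig by apply sigp2];
      unfold cl, dif; [set (q := (clamp l s', z')) | set (q := (clamp l (- s'), z'))];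
      assert (Hq : strip l q) by (apply clamp_in; auto);
      replace (1 * (v q + -1 * u q)) with (v q - u q) by ring;
      unfold Rminus; (eapply Rle_trans; [apply Rabs_triang|]); rewrite Rabs_Ropp;
      generalize (H1 q Hq), (H2 q Hq); lra. }
  assert (Z : RInt (fun s => w s z * w s z) 0 l <= 0).
  { assert (A := SD_sup l Hl _ _ _ _ _ _ HS 0 (l * ((M2 + M1) * (M2 + M1))) (Rle_refl 0)).
    assert (A' : hh l w z <= 0 / (kk l * kk l * (kk l * kk l))).
    { apply A.
      - intros z'. rewrite (RInt_ext' _ (fun _ => 0)) by (intros; ring). rewrite RInt_const'. lra.
      - intros z'. apply hh_bound; auto. }
    unfold Rdiv in A'. rewrite Rmult_0_l in A'. exact A'. }
  assert (P : 0 <= RInt (fun s => w s z * w s z) 0 l).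
  { apply RInt_nonneg; [lra | ct | intros; nra]. }
  assert (F := RInt_sq_0 l (fun s => w s z) Hl ltac:(ct) (Rle_antisym _ _ Z P) s Hs).
  unfold w, cl in F. rewrite clamp_id in F by lra. exact F.
Qed.

Lemma solution_unique p : strip l p -> v p = u p.
Proof.
  intros Hp. destruct p as [s z].
  assert (X : forall b, part b (dif v u) (s, z) = 0).
  { intros b. destruct (Rle_dec 0 s); [apply part_0; unfold strip in Hp; simpl in Hp; lra|].
    assert (Q : part b (dif v u) (- s, z) = 0) by (apply part_0; unfold strip in Hp; simpl in Hp; lra).
    unfold part, mir in *; cbn [fst snd] in *. rewrite Ropp_involutive in Q. generalize (sigp2 b); intros S2.
    transitivity (sigp b * (/ 2 * (dif v u (- s, z) + sigp b * dif v u (s, z)))); [|rewrite Q; ring].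
    replace (sigp b * (/ 2 * (dif v u (- s, z) + sigp b * dif v u (s, z))))
      with (/ 2 * (sigp b * sigp b * dif v u (s, z) + sigp b * dif v u (- s, z))) by ring.
    rewrite S2. ring. }
  assert (X1 := X true). assert (X2 := X false). unfold part, sigp, dif in X1, X2. lra.
Qed.
End Uniqueness.

Theorem theorem1 :
  forall (alpha xi l0 : R),
    0 < alpha < 1 -> 0 < xi < 1 / 2 -> 0 < l0 ->
  exists C : R,
  forall (l beta : R) (E : R * R -> R),
    l0 <= l ->
    locally_Cka (strip l) 0 alpha E ->
    (forall p, strip l p -> 2 * PI < Rabs (snd p) -> E p = 0) ->
    (forall p, strip l p ->
       Rbar_le (holder_norm_at (strip l) 0 alpha E p) (Finite beta)) ->
    orthogonality l E ->
  exists u : R * R -> R,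
    is_solution l alpha E u /\
    (forall p, strip l p ->
       Rbar_le (holder_norm_at (strip l) 2 alpha u p)
         (Finite (C * Rpower l (5 / 2) * beta
                  * Rpower (1 / (1 + Rabs (snd p))) xi))) /\
    (forall v : R * R -> R,
       is_solution l alpha E v -> bounded_on (strip l) v ->
       forall p, strip l p -> v p = u p).
Proof.
  intros al xi l0 Hal Hxi Hl0.
  destruct (piece_exists al l0 Hal Hl0) as [Cl [HCl Hpiece]].
  destruct (size_le l0 xi Hl0 Hxi) as [Cz [HCz Hsize]].
  set (Ch := 9 * ((4 + 4 / Rpower (rad l0) al) * Cl)).
  exists (Ch * Cz). intros l beta E Hl _ HS HN HO.
  assert (Hlp : 0 < l) by lra.
  assert (HR := Eb_rhs al l beta Hal Hlp E HS HN HO).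
  destruct (Hpiece true l beta _ Hl (HR true)) as [Wp HWp].
  destruct (Hpiece false l beta _ Hl (HR false)) as [Wm HWm].
  set (W := fun b : bool => if b then Wp else Wm).
  assert (HW : forall b, piece b l l0 al beta Cl (Eb l E b) (W b)) by (intros [|]; auto).
  (* The sign of [beta] is not a hypothesis: it bounds [|E (0, 0)|]. *)
  assert (Hb : 0 <= beta).
  { eapply Rle_trans; [apply Rabs_pos | apply (E_sup al l beta E HN (0, 0))]. unfold strip; simpl; lra. }
  assert (Pl := Rpower_pos l (5 / 2)).
  assert (HCh : 0 <= Ch).
  { assert (0 < 4 / Rpower (rad l0) al) by (apply Rdiv_lt_0_compat; [lra | apply Rpower_pos]).
    unfold Ch. apply Rmult_le_pos; [lra|]. apply Rmult_le_pos; lra. }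
  assert (Hsol : is_solution l al E (Wt W 0 0)).
  { apply (Wt_solution l l0 al beta Cl E (Eb l E)); auto. intros; apply Eb_sum; auto. }
  exists (Wt W 0 0). split; [exact Hsol | split].
  - intros p Hp. eapply Rbar_le_trans; [apply (Wt_norm l l0 al beta Cl (Eb l E) W Hal Hl0 Hl HW p Hp)|].
    assert (X := Hsize l beta (snd p) Hl Hb). unfold wt in X. simpl.
    replace (9 * ((4 + 4 / Rpower (rad l0) al) * Cl * size l beta (snd p))) with (Ch * size l beta (snd p))
      by (unfold Ch; ring).
    eapply Rle_trans; [apply Rmult_le_compat_l; [exact HCh | exact X]|]. right; ring.
  - intros v Hv Bv p Hp. apply (solution_unique l al E (Wt W 0 0) v Hlp Hsol Hv); auto.
    (* The constructed solution is itself bounded, as the uniqueness argument demands of both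
       solutions; the final factor 1 bounds the weight. *)
    exists (2 * Cl * (Cz * (Rpower l (5 / 2) * beta * 1))). intros q Hq.
    eapply Rle_trans; [apply (Wt_bound l l0 al beta Cl (Eb l E) W HW 0 0 q q); auto; rewrite dist2_refl; lra|].
    apply Rmult_le_compat_l; [lra|]. eapply Rle_trans; [apply Hsize; auto|].
    apply Rmult_le_compat_l; [lra|]. apply Rmult_le_compat_l; [apply Rmult_le_pos; lra|].
    apply Rpower_le_1; [apply wt_base | lra].
Qed.
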